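(* Let $n\ge1$, $\alpha\in(0,1)$, and let $B_r=B_r(0)\subset\mathbb{R}^n$. Let $F:S^{n\times n}\to\mathbb{R}$ be a smooth function for which there are coefficient functions $a^{ij,kl}$ on $S^{n\times n}$ with $$\frac{\partial F}{\partial u_{ij}}(M)=a^{pq,ij}(M)\,M_{pq}\qquad\text{for all }M\in S^{n\times n},\ 1\le i,j\le n.$$ Suppose $u\in C^{2,\alpha}(B_1)$ is a critical point of the functional $\int_{B_1}F(D^2u)\,dx$ with respect to compactly supported variations, and let $U=D^2u(B_1)\subseteq S^{n\times n}$ be the range of $D^2u$. Suppose that there is $\Lambda>0$ with $a^{ij,kl}(M)\xi_{ij}\xi_{kl}\ge\Lambda|\xi|^2$ for all $M\in U$ and $\xi\in S^{n\times n}$, and that $F$ is uniformly convex or uniformly concave on $U$. Then $u\in C^\infty(B_r)$ for all $r<1$.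
   Context: $S^{n\times n}$ is the space of real symmetric $n\times n$ matrices; repeated indices are summed from $1$ to $n$; subscripts on $u,\eta$ denote partial derivatives. $\partial F/\partial u_{ij}$ denotes the components, symmetric in $i,j$, of the derivative of $F$, so that $DF(M)[\xi]=\frac{\partial F}{\partial u_{ij}}(M)\xi_{ij}$ for $\xi\in S^{n\times n}$. ''Critical point with respect to compactly supported variations'' means that the first variation vanishes, i.e. $\int_{B_1}\frac{\partial F}{\partial u_{ij}}(D^2u)\,\eta_{ij}\,dx=0$ for all $\eta\in C_0^\infty(B_1)$. $F$ is uniformly convex on $U$ if there is $\lambda>0$ such that $D^2F(M)[\xi,\xi]\ge\lambda|\xi|^2$ for all $M\in U$, $\xi\in S^{n\times n}$, where $D^2F(M)$ is the second derivative of $F$ at $M$; $F$ is uniformly concave on $U$ if $-F$ is uniformly convex on $U$. *)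

(* Defs.v *)
From mathcomp Require Import all_boot all_order all_algebra.
From mathcomp Require Import all_classical all_reals all_analysis.
Set Implicit Arguments.
Unset Strict Implicit.
Unset Printing Implicit Defensive.
Import Order.TTheory GRing.Theory Num.Theory.
Import numFieldNormedType.Exports.
Local Open Scope classical_set_scope.
Local Open Scope ring_scope.

Section IteratedDerivatives.
Context {R : realType} {V : normedModType R}.

Definition iter_derive (f : V -> R) (vs : seq V) : V -> R :=
  foldr (fun v g => 'D_v g) f vs.

(* f is C^k on A, where derivatives are taken along the directions in E.
   With A open and E the coordinate vectors this is the usual class C^k(A);
   with A = E a linear subspace W, it only involves the values of f on W and
   says that the restriction of f to W is C^k. *)
Definition Ck_along (E A : set V) (k : nat) (f : V -> R) : Prop :=
  forall vs : seq V, (size vs <= k)%N -> (forall v, v \in vs -> E v) ->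
    {within A, continuous (iter_derive f vs)} /\
    ((size vs < k)%N ->
       forall x v, A x -> E v -> derivable (iter_derive f vs) x v).

Definition smooth_along (E A : set V) (f : V -> R) : Prop :=
  forall k, Ck_along E A k f.

End IteratedDerivatives.

Section EuclideanSpace.
Context {R : realType} {n : nat}.
Implicit Types (u eta : 'rV[R]_n -> R) (x y : 'rV[R]_n).

(* The library's norm on matrices is the sup norm; balls and Hölder quotients
   use the Euclidean one. *)
Definition enorm x : R := Num.sqrt (\sum_i x 0 i ^+ 2).

Definition eball (r : R) : set 'rV[R]_n := [set x | enorm x < r].

Definition coord (i : 'I_n) : 'rV[R]_n := delta_mx 0 i.

Definition Ck_on (A : set 'rV[R]_n) (k : nat) u : Prop :=
  Ck_along (range coord) A k u.

Definition smooth_on (A : set 'rV[R]_n) u : Prop :=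
  smooth_along (range coord) A u.

Definition partial2 u (i j : 'I_n) : 'rV[R]_n -> R :=
  'D_(coord j) ('D_(coord i) u).

Definition hess u x : 'M[R]_n := \matrix_(i, j) partial2 u i j x.

(* The class C^{2,alpha}(B_1) of the open ball: second derivatives are Hölder
   continuous on each smaller ball. *)
Definition C2holder_unit_ball (alpha : R) u : Prop :=
  Ck_on (eball 1) 2 u /\
  forall r : R, r < 1 -> exists C : R, forall i j x y,
    eball r x -> eball r y ->
    `|partial2 u i j x - partial2 u i j y| <= C * enorm (x - y) `^ alpha.

(* C_0^oo(A), extended by zero to the whole space. *)
Definition test_function (A : set 'rV[R]_n) eta : Prop :=
  [/\ smooth_on setT eta, compact (closure [set x | eta x != 0])
    & closure [set x | eta x != 0] `<=` A].

End EuclideanSpace.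

(* Lebesgue integral over R^n as an iterated integral (Fubini); it is only
   applied below to bounded measurable functions of bounded support. *)
Fixpoint integral_Rn {R : realType} (n : nat) : ('rV[R]_n -> R) -> R :=
  match n with
  | 0 => fun f => f 0
  | m.+1 => fun f =>
      Rintegral (@lebesgue_measure R) setT (fun t : R =>
        integral_Rn (fun y : 'rV[R]_m => f (row_mx (t%:M : 'rV[R]_1) y)))
  end.

Definition integral_on {R : realType} {n : nat} (A : set 'rV[R]_n)
    (f : 'rV[R]_n -> R) : R :=
  integral_Rn (fun x => \1_A x * f x).

Section SymmetricMatrices.
Context {R : realType} {n : nat}.
(* A function on symmetric matrices is a function on all of 'M[R]_n of which
   only the values at symmetric matrices are ever used. *)
Implicit Types (F : 'M[R]_n -> R) (M xi : 'M[R]_n) (U : set 'M[R]_n).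

Definition symm : set 'M[R]_n := [set M | M^T = M].

Definition smooth_symm F : Prop := smooth_along symm symm F.

Definition symm_unit (i j : 'I_n) : 'M[R]_n :=
  2^-1 *: (delta_mx i j + delta_mx j i).

(* dF/du_ij, symmetric in i, j: since xi = sum_ij xi_ij symm_unit i j for xi
   symmetric, these are the coefficients for which
   DF(M)[xi] = sum_ij dF/du_ij(M) xi_ij. *)
Definition dsymm F (i j : 'I_n) : 'M[R]_n -> R := 'D_(symm_unit i j) F.

Definition frob2 xi : R := \sum_i \sum_j xi i j ^+ 2.

Definition uniformly_convex U F : Prop :=
  exists2 lambda : R, 0 < lambda &
    forall M xi, U M -> symm xi -> lambda * frob2 xi <= 'D_xi ('D_xi F) M.

Definition uniformly_concave U F : Prop := uniformly_convex U (\- F).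

Definition critical_point F (u : 'rV[R]_n -> R) : Prop :=
  forall eta, test_function (eball 1) eta ->
    integral_on (eball 1)
      (fun x => \sum_i \sum_j dsymm F i j (hess u x) * partial2 eta i j x) = 0.

End SymmetricMatrices.

(* Main.v *)
Require Import Defs.
From mathcomp Require Import all_boot all_order all_algebra.
From mathcomp Require Import all_classical all_reals all_analysis.
From mathcomp Require Import ring lra zify.
Set Implicit Arguments.
Unset Strict Implicit.
Unset Printing Implicit Defensive.
Import Order.TTheory GRing.Theory Num.Theory.
Import numFieldNormedType.Exports.
Local Open Scope classical_set_scope.
Local Open Scope ring_scope.

(* The second derivatives of F at D^2u are elliptic coefficients on account of the
   uniform convexity (or concavity) of F alone.  A difference quotient of u solves
   the linear double-divergence equation
     int a_ij,pq (D^2 v)_pq eta_ij = 0,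
   where a is the average of D^2F along the segment between D^2u(x) and
   D^2u(x + t e_k).  It is elliptic near any point because D^2u is continuous, and
   it is Hoelder continuous uniformly in t.  An interior Schauder estimate for such
   equations bounds the C^(2,alpha) norm of the difference quotients, hence u is
   C^(3,alpha); the derivatives of u then solve linear equations whose coefficients
   are functions of D^2u, and the argument is iterated.

   The Schauder estimate is obtained by a blow-up argument from a Liouville
   theorem: an entire weak solution of a constant coefficient equation whose second
   derivatives are globally alpha-Hoelder is a quadratic polynomial.  By the
   Caccioppoli inequality, applied repeatedly to second differences, iterated
   differences of high order vanish; they can be unwound because the second
   derivatives have sublinear differences.  Integration by parts is replaced by
   translation invariance of the integral and by limits of difference quotients. *)

(** * Directional derivatives *)

(** Three choices shape the development. Derivatives are carried as explicit data ([C1on], [C2on])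
    and not computed by ['D]: the functions that occur are limits, rescalings and difference
    quotients, whose derivatives are known by construction. Weak equations are tested against C^2
    functions, because the energy estimate uses a cutoff times the solution itself; mollification
    shows that smooth test functions give the same equations. Limits are taken along one ultrafilter
    on the integers for which every bounded sequence converges, so that uncountably many values
    converge at once and no subsequence is extracted. The Schauder estimate is a priori: its
    constant ignores the size of the Hoelder seminorm of the second derivatives, but finiteness of
    that seminorm is assumed. This is why it is applied to difference quotients, where finiteness is
    free for each increment t, and not directly to derivatives. An inhomogeneous flux is allowed in
    the linear theory since differentiating an equation produces one from the derivatives of its
    coefficients. *)

Section EpsilonDelta.
Context {R : realType} {V W : normedModType R}.
Implicit Types (f : V -> W) (x y : V).

Lemma continuous_atP f x : {for x, continuous f} <->
  forall e : R, 0 < e -> exists2 d : R, 0 < d & forall y, `|y - x| < d -> `|f y - f x| < e.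
Proof.
split=> [/cvgrPdist_lt cf e e0|H].
  have /nbhs_ballP [d /= d0 Hd] := cf e e0; exists d => // y yx; rewrite distrC.
  by apply: Hd; rewrite -ball_normE /= distrC.
apply/cvgrPdist_lt => e e0; have [d d0 Hd] := H e e0.
apply/nbhs_ballP; exists d => //= y; rewrite -ball_normE /= distrC => yx.
by rewrite distrC; exact: Hd.
Qed.

End EpsilonDelta.

Section DirectionalDerivatives.
Context {R : realType} {V : normedModType R}.
Implicit Types (f : V -> R) (x y v : V).

Lemma is_derive_line f x v (s d : R) :
  is_derive (s *: v + x) v f d -> is_derive s (1 : R) (fun t => f (t *: v + x)) d.
Proof.
move=> [fd fE].
have E : (fun h : R => h^-1 *: (((fun t => f (t *: v + x)) \o shift s) (h *: (1 : R)) - f (s *: v + x)))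
       = (fun h : R => h^-1 *: ((f \o shift (s *: v + x)) (h *: v) - f (s *: v + x))).
  by apply/funext => h /=; rewrite [_%:A]mulr1 scalerDl addrA.
by split; [rewrite /derivable E | rewrite /derive E].
Qed.

Lemma is_derive_dirZ f x v (k d : R) :
  is_derive x v f d -> is_derive x (k *: v) f (k * d).
Proof.
have [->|k0] := eqVneq k 0.
  by move=> _; rewrite scale0r mul0r; exact: is_derive0.
move=> df.
have : is_derive (0 : R) (1 : R) (fun t => f (t *: v + x)) d.
  by apply: is_derive_line; rewrite scale0r add0r.
move=> H.
have H2 : is_derive (0 : R) (1 : R) ((fun t => f (t *: v + x)) \o (fun t => k * t)) (k * d).
  have ? : is_derive ((fun t : R => k * t) 0) 1 (fun t => f (t *: v + x)) d by rewrite mulr0.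
  rewrite mulrC; apply: is_derive1_comp.
  by apply: is_derive_eq; rewrite [_ *: _]mulr1.
case: H2 => D E; split.
  apply/derivable1P; rewrite (_ : (fun _ => _) = (fun t => f (t *: v + x)) \o (fun t => k * t)) //.
  by apply/funext => t /=; rewrite scalerA mulrC.
rewrite -E /derive; set g1 := fun h : R => _; set g2 := fun h : R => _.
suff -> : g1 = g2 by [].
apply/funext => h; rewrite /g1 /g2 /=.
by rewrite addr0 mulr0 scale0r add0r [_%:A]mulr1 scalerA [k * h]mulrC.
Qed.

Lemma mvt_line f x v (df : R -> R) :
  (forall s : R, 0 <= s <= 1 -> is_derive (s *: v + x) v f (df s)) ->
  exists2 s : R, 0 <= s <= 1 & f (v + x) - f x = df s.
Proof.
move=> H.
have H1 (s : R) : 0 <= s <= 1 -> is_derive s (1 : R) (fun t => f (t *: v + x)) (df s).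
  by move=> s01; apply: is_derive_line; exact: H.
have [||c] := @MVT R (fun t => f (t *: v + x)) df 0 1 ltr01.
- by move=> s; rewrite in_itv /= => /andP[s0 s1]; apply: H1; rewrite !ltW.
- apply: derivable_within_continuous => s; rewrite in_itv /= => s01.
  by have [] := H1 _ s01.
rewrite in_itv /= => /andP[c0 c1]; rewrite scale1r scale0r add0r subr0 mulr1 => E.
by exists c => //; rewrite !ltW.
Qed.

(** The mean value theorem is used twice: along [a] for the increment of [f] in direction [b], then
    along [b] for [fa]. The left side is symmetric in [a] and [b], on which [schwarz] rests;
    [interpolation] reads the identity as a bound on a second derivative by values of the
    function. *)
Lemma second_difference f (fa fab : V -> R) x (a b : V) (k : R) :
  (forall s t : R, 0 <= s <= 1 -> 0 <= t <= 1 ->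
     is_derive ((s * k) *: a + (t * k) *: b + x) a f (fa ((s * k) *: a + (t * k) *: b + x)) /\
     is_derive ((s * k) *: a + (t * k) *: b + x) b fa (fab ((s * k) *: a + (t * k) *: b + x))) ->
  exists s t : R, [/\ 0 <= s <= 1, 0 <= t <= 1 &
   f (k *: a + k *: b + x) - f (k *: a + x) - (f (k *: b + x) - f x)
     = k ^+ 2 * fab ((s * k) *: a + (t * k) *: b + x)].
Proof.
move=> H.
have I0 : (0 : R) <= (0 : R) <= (1 : R) by rewrite lexx ler01.
have I1 : (0 : R) <= (1 : R) <= (1 : R) by rewrite lexx ler01.
pose g y := f (y + k *: b) - f y.
have sh y w d h : is_derive (y + w) h f d -> is_derive y h (fun z => f (z + w)) d.
  move=> [D E].
  have EE : (fun t : R => t^-1 *: (((fun z => f (z + w)) \o shift y) (t *: h) - f (y + w)))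
     = (fun t : R => t^-1 *: ((f \o shift (y + w)) (t *: h) - f (y + w))).
    by apply/funext => t /=; rewrite addrA.
  by split; [rewrite /derivable EE|rewrite /derive EE].
have [s s01 E1] : exists2 s : R, 0 <= s <= 1 & g (k *: a + x) - g x =
    k * (fa (s *: (k *: a) + x + k *: b) - fa (s *: (k *: a) + x)).
  apply: (@mvt_line g x (k *: a)) => s s01; apply: is_derive_dirZ.
  rewrite /g; apply: is_deriveB.
    apply: sh; rewrite addrAC scalerA.
    by have [+ _] := H s 1 s01 I1; rewrite mul1r.
  by have [+ _] := H s 0 s01 I0; rewrite mul0r scale0r addr0 scalerA.
have [t t01 E2] : exists2 t : R, 0 <= t <= 1 &
    fa (k *: b + (s *: (k *: a) + x)) - fa (s *: (k *: a) + x) =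
    k * fab (t *: (k *: b) + (s *: (k *: a) + x)).
  apply: mvt_line => t t01; apply: is_derive_dirZ.
  have [_] := H s t s01 t01.
  by rewrite !scalerA -addrA addrCA.
exists s, t; split => //.
rewrite [_ + k *: b]addrC E2 in E1.
rewrite expr2 -mulrA -!scalerA -[X in fab X]addrA [X in fab X]addrCA -E1 /g.
rewrite [k *: a + x + k *: b]addrAC [x + k *: b]addrC; ring.
Qed.

(** The same parallelogram difference equals k^2 times a value of [fab] and k^2 times a value of
    [fba] at points near [x]; continuity at [x] then compares the two functions there. *)
Lemma schwarz f (fa fb fab fba : V -> R) x (a b : V) :
  (\forall y \near x, is_derive y a f (fa y) /\ is_derive y b fa (fab y)) ->
  (\forall y \near x, is_derive y b f (fb y) /\ is_derive y a fb (fba y)) ->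
  {for x, continuous fab} -> {for x, continuous fba} -> fab x = fba x.
Proof.
move=> Hab Hba cab cba.
apply/eqP; rewrite -subr_eq0 -normr_le0; apply/ler_addgt0Pr => /= e e0; rewrite add0r.
have e2 : 0 < e / 2 by rewrite divr_gt0.
move: cab cba => /cvgrPdist_lt /(_ _ e2) cab /cvgrPdist_lt /(_ _ e2) cba.
have [r /= r0 Hr] := (nbhs_ballP _ _).1 (filterI (filterI Hab Hba) (filterI cab cba)).
(* Small enough for every point of the parallelogram with sides k a and k b to lie in the ball of
   radius [r]. *)
pose k := r / (2 * (`|a| + `|b| + 1)).
have N0 : 0 < `|a| + `|b| + 1 by rewrite ltr_wpDl ?addr_ge0.
have k0 : 0 < k by rewrite divr_gt0 // mulr_gt0.
have inb (s t : R) : 0 <= s <= 1 -> 0 <= t <= 1 -> ball x r ((s * k) *: a + (t * k) *: b + x).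
  move=> /andP[s0 s1] /andP[t0 t1].
  rewrite -ball_normE /= opprD addrCA subrr addr0 normrN.
  apply: (le_lt_trans (ler_normD _ _)).
  have nsk (w : R) : 0 <= w -> `|w * k| = w * k by move=> w0; rewrite ger0_norm // mulr_ge0 // ltW.
  rewrite [`|_ *: a|]normrZ [`|_ *: b|]normrZ !nsk //.
  have A : s * k * `|a| <= k * `|a| by rewrite -mulrA ler_piMl // mulr_ge0 // ltW.
  have B : t * k * `|b| <= k * `|b| by rewrite -mulrA ler_piMl // mulr_ge0 // ltW.
  apply: (le_lt_trans (lerD A B)); rewrite -mulrDr /k.
  rewrite mulrAC ltr_pdivrMr ?mulr_gt0 // ltr_pM2l //.
  have := normr_ge0 a; have := normr_ge0 b; lra.
have [s [t [s01 t01 E1]]] := @second_difference f fa fab x a b k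
   (fun s t hs ht => (Hr _ (inb s t hs ht)).1.1).
have inb' (s' t' : R) : 0 <= s' <= 1 -> 0 <= t' <= 1 -> ball x r ((s' * k) *: b + (t' * k) *: a + x).
  by move=> hs ht; rewrite [X in X + x]addrC; apply: inb.
have [s' [t' [s01' t01' E2]]] := @second_difference f fb fba x b a k
   (fun s t hs ht => (Hr _ (inb' s t hs ht)).1.2).
have := (Hr _ (inb _ _ s01 t01)).2.1; have := (Hr _ (inb' _ _ s01' t01')).2.2.
set y := _ + x; set z := _ + x => /= Hz Hy.
have E3 : fab z = fba y.
  have k2 : k ^+ 2 != 0 by rewrite expf_neq0 // gt_eqF.
  apply: (mulfI k2); rewrite -E1 -E2 [k *: b + k *: a]addrC; ring.
have -> : fab x - fba x = (fab x - fab z) + (fba y - fba x) by rewrite E3; ring.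
rewrite (splitr e); apply: (le_trans (ler_normD _ _)); rewrite lerD ?ltW //.
by rewrite distrC.
Qed.

End DirectionalDerivatives.

(* Finite coordinates shared by the coordinate vectors of R^n and the matrix
   units: both have sup-norm bounds with constant 1. *)
Record frame {R : realType} {V : normedModType R} {T : finType}
    (e : T -> V) (c : T -> V -> R) : Prop := Frame {
  frame_sum : forall h, h = \sum_p c p h *: e p;
  frame_le : forall p h, `|c p h| <= `|h|;
  frame_norm : forall p, `|e p| <= 1;
  frame_linear : forall p k u v, c p (k *: u + v) = k * c p u + c p v }.

Lemma frame_coord {R : realType} {n : nat} :
  frame (@Defs.coord R n) (fun i (x : 'rV[R]_n) => x 0 i).
Proof.
split.
- by move=> h; rewrite [LHS]row_sum_delta.
- move=> i h; rewrite [leRHS]/Num.Def.normr /= mx_normrE.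
  exact: (le_bigmax _ (fun ij : 'I_1 * 'I_n => `|h ij.1 ij.2|) (0, i)).
- move=> i; rewrite /Num.Def.normr /= mx_normrE; apply/bigmax_leP; split => // -[a b] _ /=.
  by rewrite mxE; case: eqP; case: eqP; rewrite ?normr1 ?normr0.
- by move=> i k u v; rewrite !mxE.
Qed.

Lemma frame_delta {R : realType} {m n : nat} :
  frame (fun p : 'I_m * 'I_n => delta_mx p.1 p.2 : 'M[R]_(m, n))
        (fun p (x : 'M[R]_(m, n)) => x p.1 p.2).
Proof.
split.
- by move=> h; rewrite [LHS]matrix_sum_delta pair_big.
- move=> p h; rewrite [leRHS]/Num.Def.normr /= mx_normrE.
  exact: (le_bigmax _ (fun ij : 'I_m * 'I_n => `|h ij.1 ij.2|) p).
- move=> i; rewrite /Num.Def.normr /= mx_normrE; apply/bigmax_leP; split => // -[a b] _ /=.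
  by rewrite mxE; case: eqP; case: eqP; rewrite ?normr1 ?normr0.
- by move=> i k u v; rewrite !mxE.
Qed.

Section Frames.
Context {R : realType} {V : normedModType R} {T : finType}.
Context {e : T -> V} {c : T -> V -> R} (fr : frame e c).
Implicit Types (f : V -> R) (x y v h : V).

Lemma frame0 p : c p 0 = 0.
Proof.
have := frame_linear fr p 1 0 0; rewrite scale1r addr0 mul1r => H.
by apply: (addrI (c p 0)); rewrite addr0 -H.
Qed.

Lemma frameZ p k v : c p (k *: v) = k * c p v.
Proof. by rewrite -[k *: v]addr0 (frame_linear fr) frame0 addr0. Qed.

Lemma frameD p u v : c p (u + v) = c p u + c p v.
Proof. by rewrite -[u]scale1r (frame_linear fr) mul1r scale1r. Qed.

Lemma frameB p u v : c p (u - v) = c p u - c p v.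
Proof. by rewrite -scaleN1r frameD frameZ mulN1r. Qed.

(** Go from [x] to [y] along one frame vector at a time and use the mean value theorem on each leg,
    where the partial derivatives stay close to their values at [x]. *)
Lemma frame_diff f (f1 : T -> V -> R) x :
  (\forall y \near x, forall p, is_derive y (e p) f (f1 p y)) ->
  (forall p, {for x, continuous (f1 p)}) ->
  forall eps : R, 0 < eps ->
  \forall y \near x, `|f y - f x - \sum_p f1 p x * c p (y - x)| <= eps * `|y - x|.
Proof.
move=> df cf eps eps0.
(* Each leg has length at most |h|, so a path of at most [#|T|] legs stays in the ball of radius [r]
   once |h| < r / N; dividing [eps] by [N] pays for the sum of the errors. *)
pose N : R := #|T|.+1%:R.
have N0 : 0 < N by rewrite ltr0n.
have e2 : 0 < eps / N by rewrite divr_gt0.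
have ncf : \forall y \near x, forall p, `|f1 p x - f1 p y| < eps / N.
  apply: filter_forall => p; have /cvgrPdist_lt := cf p; exact.
have [r /= r0 Hr] := (nbhs_ballP _ _).1 (filterI df ncf).
apply/nbhs_ballP; exists (r / N); first by rewrite /= divr_gt0.
move=> y; rewrite -ball_normE /= distrC => yx.
set h := y - x in yx *.
have yE : y = h + x by rewrite /h subrK.
have key (s : seq T) : (size s <= #|T|)%N ->
    `|\sum_(p <- s) c p h *: e p| <= (size s)%:R * `|h| /\
    `|f (\sum_(p <- s) c p h *: e p + x) - f x - \sum_(p <- s) f1 p x * c p h|
      <= (size s)%:R * (eps / N * `|h|).
  elim: s => [_|p s IH /= ss].
    by rewrite !big_nil add0r subrr subr0 !normr0 !mul0r; split.
  have [I1 I2] := IH (ltnW ss).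
  rewrite !big_cons [(size (p :: s))%:R](_ : _ = (size s)%:R + 1); last by rewrite natr1.
  set w := \sum_(j <- s) _ in I1 I2 *.
  have ce : `|c p h *: e p| <= `|h|.
    rewrite normrZ -[leRHS]mulr1; apply: ler_pM => //; [exact: frame_le fr _ _|exact: frame_norm fr _].
  have wlt (t : R) : 0 <= t <= 1 -> ball x r (t *: (c p h *: e p) + (w + x)).
    move=> /andP[t0 t1]; rewrite -ball_normE /= distrC addrA addrK.
    apply: (le_lt_trans (ler_normD _ _)).
    have : `|t *: (c p h *: e p)| <= `|h|.
      rewrite normrZ (ger0_norm t0) -[leRHS]mul1r; exact: ler_pM.
    move=> /lerD /(_ I1) /le_lt_trans; apply.
    rewrite -{1}[`|h|]mul1r -mulrDl nat1r.
    move: yx; rewrite ltr_pdivlMr // mulrC; apply: le_lt_trans.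
    by rewrite ler_wpM2r // /N ler_nat ltnS ltnW.
  split.
    rewrite mulrDl mul1r addrC; apply: (le_trans (ler_normD _ _)); exact: lerD.
  have [t t01 E] : exists2 t : R, 0 <= t <= 1 &
     f (c p h *: e p + (w + x)) - f (w + x) = c p h * f1 p (t *: (c p h *: e p) + (w + x)).
    apply: mvt_line => t t01; apply: is_derive_dirZ.
    by have [/(_ p)] := Hr _ (wlt _ t01).
  rewrite -[X in f (X) - _ - _]addrA.
  have -> : f (c p h *: e p + (w + x)) - f x - (f1 p x * c p h + \sum_(j <- s) f1 j x * c j h)
    = (f (w + x) - f x - \sum_(j <- s) f1 j x * c j h)
      + c p h * (f1 p (t *: (c p h *: e p) + (w + x)) - f1 p x).
    rewrite mulrBr -E; ring.
  apply: (le_trans (ler_normD _ _)); rewrite [leRHS]mulrDl mul1r; apply: lerD => //.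
  rewrite normrM mulrC; apply: ler_pM => //; last exact: frame_le fr _ _.
  by rewrite distrC; have [_ /(_ p) /ltW] := Hr _ (wlt _ t01).
have ss : (size (enum T) <= #|T|)%N by rewrite cardT.
have [_] := key _ ss; rewrite -cardT !big_enum -(frame_sum fr h) -yE => /le_trans; apply.
rewrite mulrA; apply: ler_wpM2r => //.
rewrite mulrCA -[leRHS]mulr1; apply: ler_wpM2l; first exact: ltW.
by rewrite ler_pdivrMr // mul1r /N ler_nat.
Qed.

Lemma frame_continuous f (f1 : T -> V -> R) x :
  (\forall y \near x, forall p, is_derive y (e p) f (f1 p y)) ->
  (forall p, {for x, continuous (f1 p)}) -> {for x, continuous f}.
Proof.
move=> df cf; apply/cvgrPdist_le => /= eps eps0.
pose L : R := \sum_p `|f1 p x|.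
have L0 : 0 <= L by rewrite sumr_ge0.
have D := frame_diff df cf ltr01.
have yx : \forall y \near x, `|y - x| <= eps / (L + 1).
  by apply/nbhs_ballP; exists (eps / (L + 1)); rewrite /= ?divr_gt0 ?ltr_wpDl // => y;
     rewrite -ball_normE /= distrC => /ltW.
near=> y.
have H1 : `|f y - f x - \sum_p f1 p x * c p (y - x)| <= 1 * `|y - x| by near: y.
have H2 : `|y - x| <= eps / (L + 1) by near: y.
have H3 : `|\sum_p f1 p x * c p (y - x)| <= L * `|y - x|.
  rewrite mulr_suml; apply: (le_trans (ler_norm_sum _ _ _)); apply: ler_sum => p _.
  rewrite normrM; apply: ler_wpM2l => //; exact: frame_le fr _ _.
rewrite distrC -[f y - f x](subrK (\sum_p f1 p x * c p (y - x))).
apply: (le_trans (ler_normD _ _)); apply: (le_trans (lerD H1 H3)).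
rewrite -mulrDl addrC mulrC -ler_pdivlMr //; exact: ltr_wpDl.
Unshelve. all: by end_near. Qed.

(** The expansion of [frame_diff] at [g s] is divided by the increment of the parameter. It serves
    for lines and for curves of matrices. *)
Lemma frame_curve f (f1 : T -> V -> R) (g : R -> V) (s : R) (v : V) :
  (\forall y \near g s, forall p, is_derive y (e p) f (f1 p y)) ->
  (forall p, {for g s, continuous (f1 p)}) ->
  is_derive s (1 : R) g v ->
  is_derive s (1 : R) (f \o g) (\sum_p f1 p (g s) * c p v).
Proof.
move=> df cf dg.
have gc : {for s, continuous g}.
  by apply/differentiable_continuous/derivable1_diffP; case: dg.
have qv : (fun h : R => h^-1 *: (g (h + s) - g s)) h @[h --> 0^'] --> v.
  have [D E] := dg; rewrite -E /derive.
  have : (fun h : R => h^-1 *: ((g \o shift s) (h *: (1 : R)) - g s))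
       = (fun h : R => h^-1 *: (g (h + s) - g s)).
    by apply/funext => h /=; rewrite [_%:A]mulr1.
  by move=> EE; move: D; rewrite /derivable EE.
pose L : R := \sum_p `|f1 p (g s)|.
have L0 : 0 <= L by rewrite sumr_ge0.
suff Q : (fun h : R => h^-1 *: (f (g (h + s)) - f (g s))) h @[h --> 0^'] -->
     \sum_p f1 p (g s) * c p v.
  have EE : (fun h : R => h^-1 *: ((f \o g \o shift s) (h *: (1 : R)) - (f \o g) s))
       = (fun h : R => h^-1 *: (f (g (h + s)) - f (g s))).
    by apply/funext => h /=; rewrite [_%:A]mulr1.
  by split; [rewrite /derivable EE; apply/cvg_ex; eexists; exact: Q | rewrite /derive EE; exact: cvg_lim Q].
apply/cvgrPdist_le => /= eps eps0.
(* [C] collects two errors: [L] for replacing [v] by the difference quotient of the curve, and a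
   bound on the norm of that quotient for the first-order expansion. *)
pose C : R := L + 1 + `|v| + 1.
have C0 : 0 < C by rewrite /C; have := normr_ge0 v; lra.
have d0 : 0 < eps / C by rewrite divr_gt0.
pose d := Num.min (eps / C) 1.
have dd0 : 0 < d by rewrite lt_min d0 ltr01.
have D := frame_diff df cf dd0.
have sh : (fun h : R => h + s) @ (0 : R)^' --> 0 + s.
  by apply: cvgD; [exact: cvg_within | exact: cvg_cst].
rewrite add0r in sh.
have gs : g (h + s) @[h --> (0 : R)^'] --> g s by apply: (cvg_comp _ _ sh); exact: gc.
have D' := gs _ D.
have /cvgrPdist_le /(_ d dd0) qv' := qv.
near=> h.
have h0 : h != 0 by near: h; exact: nbhs_dnbhs_neq.
have H1 : `|f (g (h + s)) - f (g s) - \sum_p f1 p (g s) * c p (g (h + s) - g s)| <= d * `|g (h + s) - g s|.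
  by near: h.
have H2 : `|v - h^-1 *: (g (h + s) - g s)| <= d by near: h.
set q := h^-1 *: (g (h + s) - g s) in H2.
have gq : g (h + s) - g s = h *: q by rewrite scalerA divff // scale1r.
clearbody q.
have H3 : `|\sum_p f1 p (g s) * c p (v - q)| <= L * d.
  rewrite mulr_suml; apply: (le_trans (ler_norm_sum _ _ _)); apply: ler_sum => p _.
  rewrite normrM; apply: ler_wpM2l => //; apply: le_trans H2; exact: frame_le fr _ _.
have H4 : `|h^-1 *: (f (g (h + s)) - f (g s)) - \sum_p f1 p (g s) * c p q| <= d * `|q|.
  have -> : \sum_p f1 p (g s) * c p q = h^-1 *: \sum_p f1 p (g s) * c p (g (h + s) - g s).
    rewrite gq scaler_sumr; apply: eq_bigr => p _; rewrite frameZ.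
    by rewrite /GRing.scale /= [RHS]mulrCA mulKf.
  rewrite -scalerBr normrZ normfV ler_pdivrMl ?normr_gt0 //.
  by apply: (le_trans H1); rewrite gq normrZ mulrCA.
have H5 : `|q| <= `|v| + d.
  rewrite -[q](subKr v); apply: (le_trans (ler_normB _ _)); exact: lerD.
have -> : \sum_p f1 p (g s) * c p v - h^-1 *: (f (g (h + s)) - f (g s)) =
   \sum_p f1 p (g s) * c p (v - q) - (h^-1 *: (f (g (h + s)) - f (g s)) - \sum_p f1 p (g s) * c p q).
  under [X in _ = X - _]eq_bigr do rewrite frameB mulrBr.
  by rewrite sumrB; ring.
apply: (le_trans (ler_normB _ _)); apply: (le_trans (lerD H3 H4)).
have d1 : d <= 1 by rewrite ge_min lexx orbT.
have dC : d <= eps / C by rewrite ge_min lexx.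
have : L * d + d * `|q| <= d * C.
  by rewrite mulrC -mulrDr; apply: ler_wpM2l; [exact: ltW|rewrite /C; lra].
move=> /le_trans; apply.
by rewrite -ler_pdivlMr.
Unshelve. all: by end_near. Qed.

Lemma frame_is_derive f (f1 : T -> V -> R) x v :
  (\forall y \near x, forall p, is_derive y (e p) f (f1 p y)) ->
  (forall p, {for x, continuous (f1 p)}) ->
  is_derive x v f (\sum_p f1 p x * c p v).
Proof.
move=> df cf.
have dg : is_derive (0 : R) (1 : R) (fun t : R => t *: v + x) v.
  rewrite -[X in is_derive _ _ _ X]addr0; apply: is_deriveD.
  have H : is_derive (0 : R) (1 : R) ( *:%R^~ v : R -> V) (1 *: v).
    have dd : differentiable ( *:%R^~ v : R -> V) (0 : R) by [].
    by split; [exact: diff_derivable | rewrite deriveE // diff_val].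
  by rewrite scale1r in H.
have E0 : 0 *: v + x = x by rewrite scale0r add0r.
have := @frame_curve f f1 (fun t : R => t *: v + x) 0 v.
rewrite E0 => /(_ df cf dg) [D E]; split; first by apply/derivable1P.
have EE : (fun h : R => h^-1 *: (((f \o (fun t : R => t *: v + x)) \o shift 0) (h *: (1 : R)) - (f \o (fun t : R => t *: v + x)) 0))
  = (fun h : R => h^-1 *: ((f \o shift x) (h *: v) - f x)).
  by apply/funext => h; rewrite /= addr0 scale0r add0r [_%:A]mulr1.
by rewrite -E /derive EE.
Qed.

End Frames.

(** * Integrals of compactly supported continuous functions *)

(** Vanishing outside a norm ball stands for compact support, which is the same for row vectors and
    makes shifts and dilations immediate. *)
Definition Cc {R : realType} {V : normedModType R} (f : V -> R) : Prop :=
  continuous f /\ exists M, forall x, M < `|x| -> f x = 0.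

Section IntegralLine.
Context {R : realType}.
Implicit Types (f g P : R -> R).
Notation mu := (@lebesgue_measure R).
Notation J f := (Rintegral mu setT f).

Lemma Cc_integrable f : Cc f -> mu.-integrable setT (EFin \o f).
Proof.
move=> [cf [M fM]].
have -> : EFin \o f = EFin \o (f \_ `[- M, M]).
  apply/funext => x /=; rewrite patchE; case: ifPn => // /negP xM.
  rewrite fM //; rewrite ltNge; apply/negP => xM'; apply: xM.
  by rewrite inE /= in_itv /= -ler_norml.
rewrite -restrict_EFin -integrable_mkcond //.
apply: continuous_compact_integrable; first exact: segment_compact.
exact: continuous_subspaceT.
Qed.

Lemma mvt1 P f : (forall x : R, is_derive x (1 : R) P (f x)) ->
  forall a b : R, exists2 s : R, 0 <= s <= 1 & P b - P a = (b - a) * f (s * (b - a) + a).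
Proof.
move=> dP a b.
have H (s : R) : 0 <= s <= 1 ->
    is_derive (s *: (b - a) + a) (b - a) P ((b - a) * f (s * (b - a) + a)).
  move=> _; have E : b - a = (b - a) *: (1 : R) by rewrite [RHS]mulr1.
  by rewrite [X in is_derive _ X]E; apply: is_derive_dirZ; exact: dP.
by have [s s01 E] := mvt_line H; exists s => //; rewrite -E subrK.
Qed.

Lemma derive_zero_const (Q : R -> R) : (forall x : R, is_derive x (1 : R) Q 0) ->
  forall a b, Q a = Q b.
Proof.
move=> dQ a b; have [s _ E] := mvt1 (f := fun=> 0) dQ b a.
by move: E; rewrite mulr0 => /eqP; rewrite subr_eq0 => /eqP.
Qed.

Lemma is_derive_integralNy f (x : R) : Cc f ->
  is_derive x (1 : R) (fun x => Rintegral mu `]-oo, x]%classic f) (f x).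
Proof.
move=> Cf; have x1 : x < x + 1 by rewrite ltrDl.
have [||D E] := @continuous_FTC1 R f -oo%O x (x + 1) x1 _ _ (Cf.1 x).
- apply: (@integrableS _ _ _ _ setT) => //; exact: Cc_integrable.
- by rewrite /Order.lt /=.
- by rewrite derive1E in E; exact: DeriveDef D E.
Qed.

Lemma antiderivative f : Cc f -> exists P, forall x : R, is_derive x (1 : R) P (f x).
Proof. by move=> Cf; eexists => x; exact: is_derive_integralNy. Qed.

(** Any antiderivative computes the integral; translation and dilation below are then changes of
    variable in an antiderivative, not in the measure. *)
Lemma integral_antiderivative f P (M a b : R) : Cc f -> (forall x, M < `|x| -> f x = 0) ->
  (forall x : R, is_derive x (1 : R) P (f x)) -> a <= - M -> M <= b -> J f = P b - P a.
Proof.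
move=> Cf fM dP aM Mb.
pose P0 x := Rintegral mu `]-oo, x]%classic f.
have dP0 (x : R) : is_derive x (1 : R) P0 (f x) by exact: is_derive_integralNy.
have E : P b - P0 b = P a - P0 a.
  apply: (@derive_zero_const (P \- P0)) => x.
  by rewrite -(subrr (f x)); apply: is_deriveB.
(* On the half-line up to [a] only the point [- M] is not covered by [fM]; there [f] vanishes as a
   limit from the left. *)
have E0 : P0 a = 0.
  rewrite /P0 Rintegral_mkcond (_ : f \_ _ = cst 0).
    by rewrite Rintegral_cst // mul0r.
  apply/funext => x; rewrite patchE; case: ifPn => //; rewrite inE /= in_itv /= => xa.
  have [xM|Mx] := eqVneq x (- M); last first.
    apply: fM; rewrite ltr_normr; apply/orP; right; rewrite ltrNr lt_neqAle Mx.
    exact: le_trans aM.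
  have cx : f y @[y --> x^'-] --> f x by apply: cvg_at_left_filter; exact: Cf.1.
  have c0 : f y @[y --> x^'-] --> (0 : R).
    apply: cvg_near_cst; near=> y; apply: fM.
    have yx : y < x by near: y; exact: nbhs_left_lt.
    by rewrite ltr_normr ltrNr -xM yx orbT.
  exact: (cvg_unique _ cx c0).
have E1 : J f = P0 b.
  rewrite /P0 [RHS]Rintegral_mkcond; congr (Rintegral _ _ _).
  apply/funext => x; rewrite patchE; case: ifPn => //; rewrite notin_setE /= in_itv /= => /negP.
  rewrite -ltNge => bx; apply: fM; rewrite ltr_normr (le_lt_trans Mb bx) //.
by rewrite E1 -[LHS]subr0 -E0; move: E; lra.
Unshelve. all: by end_near. Qed.

Lemma Cc_bound f : Cc f -> exists2 M : R, 0 < M & forall x, M < `|x| -> f x = 0.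
Proof.
move=> [_ [M fM]]; exists (`|M| + 1); first exact: ltr_wpDl.
move=> x Mx; apply: fM; apply: le_lt_trans Mx; rewrite (le_trans (ler_norm M)) // lerDl //.
Qed.

Lemma integral1_linear (k : R) f g : Cc f -> Cc g ->
  J (fun x => k * f x + g x) = k * J f + J g.
Proof.
move=> /Cc_integrable If /Cc_integrable Ig.
rewrite RintegralD //; first by rewrite RintegralZl.
have -> : EFin \o (fun x => k * f x) = (fun x => k%:E * (EFin \o f) x)%E.
  by apply/funext => x /=; rewrite EFinM.
exact: integrableZl.
Qed.

Lemma integral1_le f g : Cc f -> Cc g -> (forall x, f x <= g x) -> J f <= J g.
Proof. by move=> /Cc_integrable If /Cc_integrable Ig fg; apply: le_Rintegral. Qed.

Lemma integral1_shift f h : Cc f -> J (fun x => f (x + h)) = J f.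
Proof.
move=> Cf; have [P dP] := antiderivative Cf.
have [M M0 fM] := Cc_bound Cf.
pose N : R := M + `|h|.
have fN x : N < `|x| -> f x = 0.
  by move=> Nx; apply: fM; apply: le_lt_trans Nx; rewrite lerDl.
have fN' x : N < `|x| -> f (x + h) = 0.
  move=> Nx; apply: fM; move: Nx; rewrite /N.
  have := ler_normB (x + h) h; rewrite addrK; lra.
have Cf' : Cc (fun x => f (x + h)).
  split; last by exists N.
  move=> x; apply: (@continuous_comp _ _ _ (fun x => x + h)); last exact: Cf.1.
  by apply: cvgD; [exact: cvg_id|exact: cvg_cst].
have dP' x : is_derive x (1 : R) (fun x => P (x + h)) (f (x + h)).
  have := @is_derive_line R R P h 1 x (f (x + h)).
  have E : (fun t : R => P (t *: (1 : R) + h)) = (fun t : R => P (t + h)).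
    by apply/funext => t; rewrite [_ *: _]mulr1.
  by rewrite E [_ *: _]mulr1; apply; exact: dP.
have h1 := ler_norm h; have h2 := ler_norm (- h); rewrite normrN in h2.
rewrite (@integral_antiderivative _ _ N (- N - `|h|) (N + `|h|) Cf' fN' dP'); [|lra|lra].
by rewrite (@integral_antiderivative _ _ M (- N - `|h| + h) (N + `|h| + h) Cf fM dP) // /N; lra.
Qed.

Lemma integral1_dilate f (k : R) : 0 < k -> Cc f -> k * J (fun x => f (k * x)) = J f.
Proof.
move=> k0 Cf; have [P dP] := antiderivative Cf.
have [M M0 fM] := Cc_bound Cf.
have fM' x : M / k < `|x| -> f (k * x) = 0.
  by rewrite ltr_pdivrMr // => Mx; apply: fM; rewrite normrM (gtr0_norm k0) mulrC.
have Cf' : Cc (fun x => f (k * x)).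
  split; last by exists (M / k).
  move=> x; apply: (@continuous_comp _ _ _ (fun x => k * x)); last exact: Cf.1.
  by apply: cvgM; [exact: cvg_cst|exact: cvg_id].
have dP' x : is_derive x (1 : R) (fun x => k^-1 * P (k * x)) (f (k * x)).
  have H : is_derive x (1 : R) (P \o (fun x => k * x)) (f (k * x) * k).
    have ? : is_derive ((fun x => k * x) x) 1 P (f (k * x)) by exact: dP.
    apply: is_derive1_comp.
    by apply: is_derive_eq; rewrite [_ *: _]mulr1.
  by apply: is_derive_eq; rewrite /GRing.scale /= mulrC mulfK // gt_eqF.
rewrite (@integral_antiderivative _ _ (M / k) (- (M / k)) (M / k) Cf' fM' dP') //.
rewrite (@integral_antiderivative _ _ M (- M) M Cf fM dP) //.
by rewrite mulrBr !mulVKf ?gt_eqF // mulrN [k * (M / k)]mulrC divfK // gt_eqF.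
Qed.

(** An antiderivative is nondecreasing, and it grows strictly on [x0, x0 + d/2], where [f] stays
    positive. *)
Lemma integral1_gt0 f x0 : Cc f -> (forall x, 0 <= f x) -> 0 < f x0 -> 0 < J f.
Proof.
move=> Cf f0 fx0.
have f2 : 0 < f x0 / 2 by rewrite divr_gt0.
have /cvgrPdist_lt /(_ _ f2) /nbhs_ballP [d /= d0 Hd] := Cf.1 x0.
have [P dP] := antiderivative Cf.
have [M M0 fM] := Cc_bound Cf.
have inc x y : x <= y -> P x <= P y.
  move=> xy; have [s _ E] := mvt1 dP x y.
  by rewrite -subr_ge0 E mulr_ge0 // subr_ge0.
pose b : R := M + `|x0| + d.
rewrite (@integral_antiderivative _ _ M (- b) b Cf fM dP); last 2 first.
- by rewrite /b; have := normr_ge0 x0; lra.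
- by rewrite /b; have := normr_ge0 x0; lra.
have h1 := ler_norm x0; have h2 := ler_norm (- x0); rewrite normrN in h2.
have i1 : P (- b) <= P x0 by apply: inc; rewrite /b; lra.
have i2 : P (d / 2 + x0) <= P b by apply: inc; rewrite /b; lra.
have [s /andP[s0 s1] E] := mvt1 dP x0 (d / 2 + x0).
rewrite addrK in E.
have dd : 0 < d / 2 by rewrite divr_gt0.
have : 0 < d / 2 * f (s * (d / 2) + x0).
  rewrite mulr_gt0 //.
  have /Hd : ball x0 d (s * (d / 2) + x0).
    rewrite -ball_normE /= opprD addrCA subrr addr0 normrN ger0_norm; last by rewrite mulr_ge0 // ltW.
    have : s * (d / 2) <= d / 2 by rewrite ler_piMl // ltW.
    by lra.
  by move=> /= /(le_lt_trans (ler_norm _)); lra.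
by lra.
Qed.

End IntegralLine.

(** Only [x] is confined to [K]; [y] may leave it, as needed for functions on an open set that are
    shifted off a compact support. The near-covering form of compactness is applied with the radius
    as parameter, tending to 0 from above. *)
Lemma compact_unif_cont {R : realType} {V : normedModType R} (K : set V) (f : V -> R) :
  compact K -> (forall x, K x -> {for x, continuous f}) ->
  forall e : R, 0 < e -> exists2 d : R, 0 < d &
    forall x y, K x -> `|y - x| < d -> `|f y - f x| < e.
Proof.
move=> /compact_near_coveringP cK cf e e0.
have := cK R (0 : R)^'+ (fun d x => forall y, `|y - x| < d -> `|f y - f x| < e) _.
case.
  move=> x Kx; have e2 : 0 < e / 2 by rewrite divr_gt0.
  have /cvgrPdist_lt /(_ _ e2) /nbhs_ballP [r /= r0 Hr] := cf x Kx.
  have r2 : 0 < r / 2 by rewrite divr_gt0.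
  exists (ball x (r / 2), [set d | d < r / 2]).
    split => /=; first exact: nbhsx_ballx.
    exact: nbhs_right_lt.
  move=> [z d] [/= xz dr] y yz.
  have xy : ball x r y.
    move: xz; rewrite -!ball_normE /= => xz.
    have -> : x - y = (x - z) - (y - z) by rewrite opprB addrA subrK.
    apply: (le_lt_trans (ler_normB _ _)); lra.
  have xz' : ball x r z by apply: le_ball xz; lra.
  move: (Hr _ xy) (Hr _ xz') => /= H1 H2.
  have -> : f y - f z = (f x - f z) - (f x - f y) by ring.
  by apply: (le_lt_trans (ler_normB _ _)); lra.
move=> d0 /= d00 Hd.
exists (d0 / 2); first by rewrite divr_gt0.
move=> x y Kx; apply: (Hd (d0 / 2)) => //=; last by rewrite divr_gt0.
by rewrite sub0r normrN gtr0_norm ?divr_gt0 //; move: d00 => /=; lra.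
Qed.

Section Rows.
Context {R : realType} {n : nat}.
Implicit Types x y : 'rV[R]_n.

Lemma coord_norm_le x i : `|x 0 i| <= `|x|.
Proof. exact: (frame_le frame_coord). Qed.

Lemma row_norm_le x (r : R) : 0 <= r -> (forall i, `|x 0 i| <= r) -> `|x| <= r.
Proof.
move=> r0 xr; rewrite /Num.Def.normr /= mx_normrE; apply/bigmax_leP; split => // -[a b] _ /=.
by rewrite ord1.
Qed.

Lemma compact_cube (r : R) : compact [set x : 'rV[R]_n | `|x| <= r].
Proof.
apply: bounded_closed_compact.
  exists r; split; first exact: num_real.
  by move=> M rM x /= xr; apply: le_trans xr _; exact: ltW.
rewrite (_ : mkset _ = (fun x : 'rV[R]_n => `|x|) @^-1` [set t | t <= r]) //.
by apply: closed_comp; [move=> x _; exact: norm_continuous | exact: closed_le].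
Qed.

Lemma Cc_unif (f : 'rV[R]_n -> R) : Cc f ->
  forall e : R, 0 < e -> exists2 d : R, 0 < d & forall x y, `|y - x| < d -> `|f y - f x| < e.
Proof.
move=> [cf [M fM]] e e0.
have [d d0 Hd] := compact_unif_cont (@compact_cube (M + 1)) (fun x _ => cf x) e0.
exists (Num.min d 1); first by rewrite lt_min d0 ltr01.
move=> x y; rewrite lt_min => /andP[yd y1].
have [xM|xM] := leP `|x| (M + 1); first exact: Hd.
have xM' : M < `|x| by lra.
suff yM : M < `|y| by rewrite !fM ?subrr ?normr0.
have := ler_normB y (y - x); rewrite subKr; lra.
Qed.

(** Piecewise linear and merely continuous: it serves as a weight in integrals and is never
    differentiated. *)
Definition cutoff (M : R) x : R := Num.max 0 (Num.min 1 (M + 1 - `|x|)).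

Lemma Cc_cutoff M : Cc (cutoff M).
Proof.
split; last first.
  by exists (M + 1) => x Mx; apply: max_l; rewrite ge_min subr_le0 (ltW Mx) orbT.
move=> x; apply: (@continuous_max _ _ (fun=> 0) (fun x => Num.min 1 (M + 1 - `|x|))).
  exact: (@cst_continuous _ _ _ x).
apply: (@continuous_min _ _ (fun=> 1) (fun x => M + 1 - `|x|)); first exact: (@cst_continuous _ _ _ x).
apply: (@continuousB _ _ _ (fun=> M + 1) (fun x => `|x|)); first exact: (@cst_continuous _ _ _ x).
exact: norm_continuous.
Qed.

Lemma cutoff_ge0 M x : 0 <= cutoff M x.
Proof. by rewrite le_max lexx. Qed.

Lemma cutoff1 M x : `|x| <= M -> cutoff M x = 1.
Proof.
move=> xM; rewrite /cutoff min_l; first by rewrite max_r.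
by rewrite lerBrDr addrC lerD2r.
Qed.

Lemma cutoff_le1 M x : cutoff M x <= 1.
Proof. by rewrite ge_max ler01 ge_min lexx. Qed.

Lemma cutoff_out M x : M + 1 < `|x| -> cutoff M x = 0.
Proof. by move=> Mx; apply: max_l; rewrite ge_min subr_le0 (ltW Mx) orbT. Qed.

End Rows.

Section CcClosure.
Context {R : realType} {V : normedModType R}.
Implicit Types (f g : V -> R).

Lemma Cc_linear (k : R) f g : Cc f -> Cc g -> Cc (fun x => k * f x + g x).
Proof.
move=> [cf [M fM]] [cg [N gN]]; split.
  by move=> x; apply: cvgD; [apply: cvgM; [exact: cvg_cst|exact: cf]|exact: cg].
by exists (Num.max M N) => x; rewrite gt_max => /andP[/fM -> /gN ->]; rewrite mulr0 addr0.
Qed.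

Lemma Cc_mul f g : continuous f -> Cc g -> Cc (fun x => f x * g x).
Proof.
move=> cf [cg [N gN]]; split; first by move=> x; apply: cvgM; [exact: cf|exact: cg].
by exists N => x /gN ->; rewrite mulr0.
Qed.

Lemma Cc0 : Cc (fun _ : V => 0 : R).
Proof. by split; [exact: cst_continuous | exists 0]. Qed.

Lemma CcZ (k : R) f : Cc f -> Cc (fun x => k * f x).
Proof. by apply: Cc_mul; exact: cst_continuous. Qed.

Lemma CcD f g : Cc f -> Cc g -> Cc (fun x => f x + g x).
Proof.
move=> Cf Cg; have := Cc_linear 1 Cf Cg.
by congr (Cc _); apply/funext => x; rewrite mul1r.
Qed.

Lemma Cc_sum (I : finType) (f : I -> V -> R) : (forall i, Cc (f i)) -> Cc (fun x => \sum_i f i x).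
Proof.
move=> Cf; have -> : (fun x => \sum_i f i x) = \sum_i f i by apply/funext => x; rewrite fct_sumE.
elim/big_ind: _ => [||i _]; [exact: Cc0|exact: CcD|exact: Cf].
Qed.

Lemma Cc_norm f : Cc f -> Cc (fun x => `|f x|).
Proof.
move=> [cf [M fM]]; split; last by exists M => x /fM ->; rewrite normr0.
by move=> x; apply: (@continuous_comp _ _ _ f); [exact: cf|exact: norm_continuous].
Qed.

Lemma Cc_bound_ge f (N : R) : Cc f -> exists2 M : R, N <= M & forall x, M < `|x| -> f x = 0.
Proof.
move=> [_ [M fM]]; exists (Num.max N M); first by rewrite le_max lexx.
by move=> x; rewrite gt_max => /andP[_ /fM].
Qed.

Lemma Cc_shift f h : Cc f -> Cc (fun x => f (x + h)).
Proof.
move=> Cf; have [M _ fM] := Cc_bound_ge 0 Cf; split.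
  move=> x; apply: (@continuous_comp _ _ _ (fun x => x + h)); last exact: Cf.1.
  by apply: cvgD; [exact: cvg_id|exact: cvg_cst].
exists (M + `|h|) => x xM; apply: fM.
by have := ler_normB (x + h) h; rewrite addrK; lra.
Qed.

Lemma Cc_dilate f (k : R) : 0 < k -> Cc f -> Cc (fun x => f (k *: x)).
Proof.
move=> k0 Cf; have [M _ fM] := Cc_bound_ge 0 Cf; split.
  move=> x; apply: (@continuous_comp _ _ _ (fun x => k *: x)); last exact: Cf.1.
  exact: scaler_continuous.
exists (M / k) => x xM; apply: fM.
by rewrite normrZ gtr0_norm // mulrC -ltr_pdivrMr.
Qed.

End CcClosure.

(** Everything used about [integral_Rn]. Each law passes from the sections to the iterated integral
    one variable at a time, so neither a product measure nor an exchange of integrations enters. *)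
Record integral_laws {R : realType} (n : nat) : Prop := IntegralLaws {
  law_linear : forall (k : R) (f g : 'rV[R]_n -> R), Cc f -> Cc g ->
    integral_Rn (fun x => k * f x + g x) = k * integral_Rn f + integral_Rn g;
  law_le : forall f g : 'rV[R]_n -> R, Cc f -> Cc g -> (forall x, f x <= g x) ->
    integral_Rn f <= integral_Rn g;
  law_shift : forall (f : 'rV[R]_n -> R) h, Cc f ->
    integral_Rn (fun x => f (x + h)) = integral_Rn f;
  law_dilate : forall (f : 'rV[R]_n -> R) k, 0 < k -> Cc f ->
    k ^+ n * integral_Rn (fun x => f (k *: x)) = integral_Rn f;
  law_gt0 : forall (f : 'rV[R]_n -> R) x0, Cc f -> (forall x, 0 <= f x) -> 0 < f x0 ->
    0 < integral_Rn f }.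

Lemma law_zero {R : realType} {n : nat} : @integral_laws R n ->
  integral_Rn (fun _ : 'rV[R]_n => 0 : R) = 0.
Proof.
move=> L; have := law_linear L (-1) Cc0 Cc0.
rewrite (_ : (fun _ : 'rV[R]_n => -1 * 0 + 0) = (fun=> 0)); last by apply/funext => x; rewrite mulr0 addr0.
by rewrite mulN1r addNr.
Qed.

(** * Induction on the dimension for iterated integrals *)

Section IntegralInduction.
Context {R : realType} {m : nat} (IH : @integral_laws R m).
Notation I := (@integral_Rn R m).
Notation rm t y := (row_mx (t%:M : 'rV[R]_1) y : 'rV[R]_(1 + m)).
Implicit Types (t s : R) (y z : 'rV[R]_m) (f g : 'rV[R]_m.+1 -> R).

(** The constant is the integral of a cutoff equal to 1 on the cube of radius [M], hence common to
    all functions supported there. *)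
Lemma integral_bound (M : R) : exists2 C : R, 0 <= C & forall (g : 'rV[R]_m -> R) (s : R),
  Cc g -> (forall x, M < `|x| -> g x = 0) -> (forall x, `|g x| <= s) -> `|I g| <= C * s.
Proof.
have I0 := law_zero IH.
have IZ (k : R) (g : 'rV[R]_m -> R) : Cc g -> I (fun x => k * g x) = k * I g.
  move=> Cg; have := law_linear IH k Cg Cc0; rewrite I0 addr0 => <-.
  by congr (integral_Rn _); apply/funext => x; rewrite addr0.
exists (I (cutoff M)).
  rewrite -I0; apply: (law_le IH); [exact: Cc0|exact: Cc_cutoff|exact: cutoff_ge0].
move=> g s Cg gM gs.
have key x : `|g x| <= s * cutoff M x.
  have [xM|xM] := leP `|x| M; first by rewrite cutoff1 // mulr1.
  rewrite gM // normr0 mulr_ge0 ?cutoff_ge0 //.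
  by apply: le_trans (gs x); exact: normr_ge0.
have Cs := CcZ s (Cc_cutoff M).
rewrite mulrC -IZ; last exact: Cc_cutoff.
rewrite ler_norml -mulN1r -IZ //; apply/andP; split.
  apply: (law_le IH) => // [|x]; first exact: CcZ.
  by rewrite mulN1r lerNl; apply: le_trans (key x); rewrite -normrN; exact: ler_norm.
by apply: (law_le IH) => // x; apply: le_trans (key x); exact: ler_norm.
Qed.

Lemma rowN0 t y : (rm t y) 0 (lshift m 0) = t.
Proof. by rewrite row_mxEl mxE eqxx mulr1n. Qed.

Lemma rowB t s y z : rm t y - rm s z = rm (t - s) (y - z).
Proof. by rewrite opp_row_mx add_row_mx -raddfB. Qed.

Lemma rowD t s y z : rm t y + rm s z = rm (t + s) (y + z).
Proof. by rewrite add_row_mx -raddfD. Qed.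

Lemma rowE (x : 'rV[R]_(1 + m)) : x = rm (x 0 0) (rsubmx x).
Proof.
rewrite -[LHS]hsubmxK; congr row_mx; apply/rowP => i; rewrite !mxE ord1 eqxx mulr1n.
by congr (x _ _); apply/val_inj.
Qed.

Lemma row_norm1 t y : `|t| <= `|rm t y|.
Proof. by rewrite -{1}(rowN0 t y); exact: coord_norm_le. Qed.

Lemma row_norm2 t y : `|y| <= `|rm t y|.
Proof.
apply: row_norm_le => // i; have := coord_norm_le (rm t y) (rshift 1 i).
by rewrite row_mxEr.
Qed.

Lemma row_normD t y : `|rm t y| <= `|t| + `|y|.
Proof.
apply: row_norm_le; first exact: addr_ge0.
move=> i; case: (split_ordP i) => j ->; rewrite ?row_mxEl ?row_mxEr.
  by rewrite mxE ord1 eqxx mulr1n lerDl.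
by apply: le_trans (coord_norm_le _ _) _; rewrite lerDr.
Qed.

Lemma Cc_section f t : Cc f -> Cc (fun y => f (rm t y)).
Proof.
move=> Cf; split.
  move=> y; apply/continuous_atP => e e0.
  have [d d0 Hd] := Cc_unif Cf e0; exists d => // z yz.
  apply: Hd; rewrite rowB subrr; apply: le_lt_trans (row_normD _ _) _.
  by rewrite normr0 add0r.
have [_ [M fM]] := Cf; exists M => y My; apply: fM; apply: lt_le_trans My _.
exact: row_norm2.
Qed.

(** [f] is uniformly continuous and all its sections vanish outside one cube, so [integral_bound]
    turns uniform closeness of sections into closeness of their integrals. This keeps the outer
    integrand in [Cc]. *)
Lemma Cc_slice f : Cc f -> Cc (fun t : R => I (fun y => f (rm t y))).
Proof.
move=> Cf; have [_ [M fM]] := Cf.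
have secM t y : M < `|y| -> f (rm t y) = 0.
  by move=> My; apply: fM; apply: lt_le_trans My _; exact: row_norm2.
have IB t s : I (fun y => f (rm t y)) - I (fun y => f (rm s y)) = I (fun y => f (rm t y) - f (rm s y)).
  have := law_linear IH (-1) (Cc_section s Cf) (Cc_section t Cf).
  rewrite mulN1r addrC => <-; congr (integral_Rn _).
  by apply/funext => y; rewrite mulN1r addrC.
have CB t s : Cc (fun y => f (rm t y) - f (rm s y)).
  have := Cc_linear (-1) (Cc_section s Cf) (Cc_section t Cf).
  by congr (Cc _); apply/funext => y; rewrite mulN1r addrC.
have [C C0 HC] := integral_bound M.
split.
  move=> t; apply/continuous_atP => e' e'0.
  have e0 : 0 < e' / 2 by rewrite divr_gt0.
  set e := e' / 2 in e0.
  have e1 : 0 < e / (C + 1) by rewrite divr_gt0 // ltr_wpDl.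
  have [d d0 Hd] := Cc_unif Cf e1.
  exists d => // s ts; suff : `|I (fun y => f (rm s y)) - I (fun y => f (rm t y))| <= e.
    by rewrite /e; lra.
  rewrite IB; apply: (le_trans (HC _ (e / (C + 1)) (CB s t) _ _)).
  - by move=> y My; rewrite !secM // subrr.
  - move=> y; apply: ltW; apply: Hd; rewrite rowB subrr; apply: le_lt_trans (row_normD _ _) _.
    by rewrite normr0 addr0.
  - by rewrite mulrA ler_pdivrMr ?ltr_wpDl // mulrC ler_pM2l // lerDl.
exists M => t Mt; rewrite (_ : (fun y => _) = (fun=> 0)).
  apply/eqP; rewrite -normr_le0.
  have := HC (fun=> 0) 0 Cc0; rewrite mulr0; apply => // x; by rewrite normr0.
apply/funext => y; apply: fM; apply: lt_le_trans Mt _; exact: row_norm1.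
Qed.

Lemma integral_laws_step : @integral_laws R m.+1.
Proof.
split.
- move=> k f g Cf Cg /=.
  rewrite -integral1_linear; [|exact: Cc_slice|exact: Cc_slice].
  congr (Rintegral _ _ _); apply/funext => t.
  by rewrite -(law_linear IH) //; exact: Cc_section.
- move=> f g Cf Cg fg /=; apply: integral1_le; [exact: Cc_slice|exact: Cc_slice|].
  by move=> t; apply: (law_le IH); [exact: Cc_section|exact: Cc_section|].
- move=> f h Cf /=; rewrite -[RHS](integral1_shift (h 0 0)); last exact: Cc_slice.
  congr (Rintegral _ _ _); apply/funext => t.
  rewrite -[RHS](law_shift IH (rsubmx (h : 'rV_(1 + m)))); last exact: Cc_section.
  congr (integral_Rn _); apply/funext => y; congr (f _).
  by have := rowE h; set a := h 0 0; set b := rsubmx (h : 'rV_(1 + m)) => ->; exact: rowD.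
- move=> f k k0 Cf /=; rewrite -[RHS](integral1_dilate k0); last exact: Cc_slice.
  rewrite exprS -mulrA; congr (_ * _).
  have Cf' : Cc (fun t : R => I (fun y => f (k *: rm t y))).
    exact: (Cc_slice (Cc_dilate k0 Cf)).
  have := integral1_linear (k ^+ m) Cf' Cc0.
  rewrite Rintegral_cst // mul0r addr0 => <-.
  congr (Rintegral _ _ _); apply/funext => t; rewrite addr0.
  rewrite -[RHS](law_dilate IH k0); last exact: Cc_section.
  congr (_ * integral_Rn _); apply/funext => y; congr (f _).
  by rewrite scale_row_mx scale_scalar_mx.
- move=> f x0 Cf f0 fx0 /=.
  have I0 := law_zero IH.
  apply: (@integral1_gt0 _ _ (x0 0 0)); first exact: Cc_slice.
    by move=> t; rewrite -I0; apply: (law_le IH); [exact: Cc0|exact: Cc_section|].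
  apply: (law_gt0 IH (x0 := rsubmx (x0 : 'rV_(1 + m)))); [exact: Cc_section|by []|].
  by rewrite -rowE.
Qed.

End IntegralInduction.

Lemma integral_laws_all {R : realType} n : @integral_laws R n.
Proof.
elim: n => [|n IH]; last exact: integral_laws_step.
have E0 (x : 'rV[R]_0) : x = 0 by apply/rowP => -[].
split => /=.
- by [].
- by move=> f g _ _; apply.
- by move=> f h _; rewrite [_ + h]E0.
- by move=> f k _ _; rewrite expr0 mul1r scaler0.
- by move=> f x0 _ _; rewrite [x0]E0.
Qed.

Section ContinuityAt.
Context {R : realType} {V : normedModType R}.
Implicit Types (f g : V -> R) (x : V).

Lemma cont_cst (k : R) x : {for x, continuous (fun _ : V => k)}.
Proof. exact: (@cst_continuous _ _ k x). Qed.

Lemma contD f g x : {for x, continuous f} -> {for x, continuous g} ->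
  {for x, continuous (fun x => f x + g x)}.
Proof. exact: continuousD. Qed.

Lemma contM f g x : {for x, continuous f} -> {for x, continuous g} ->
  {for x, continuous (fun x => f x * g x)}.
Proof. exact: continuousM. Qed.

Lemma contB f g x : {for x, continuous f} -> {for x, continuous g} ->
  {for x, continuous (fun x => f x - g x)}.
Proof. exact: continuousB. Qed.

Lemma cont_sum (T : finType) (f : T -> V -> R) x : (forall i, {for x, continuous (f i)}) ->
  {for x, continuous (fun x => \sum_i f i x)}.
Proof.
move=> cf; have -> : (fun x => \sum_i f i x) = \sum_i f i by apply/funext => y; rewrite fct_sumE.
elim/big_ind: _ => [|g h cg ch|i _]; [exact: cont_cst|exact: contD|exact: cf].
Qed.

Lemma cont_affine f (k : R) (a x : V) : {for k *: x + a, continuous f} ->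
  {for x, continuous (fun x => f (k *: x + a))}.
Proof.
move=> cf; apply: (@continuous_comp _ _ _ (fun x => k *: x + a) f) => //.
apply: (@continuousD _ _ _ (fun x => k *: x) (fun=> a)); last exact: (@cst_continuous _ _ a x).
exact: scaler_continuous.
Qed.

Lemma is_derive_quotient f x v (d : R) :
  (forall eps : R, 0 < eps -> exists2 r : R, 0 < r & forall t, t != 0 -> `|t| < r ->
    `|t^-1 * (f (t *: v + x) - f x) - d| <= eps) -> is_derive x v f d.
Proof.
move=> H; have Q : (fun h : R => h^-1 *: ((f \o shift x) (h *: v) - f x)) h @[h --> (0 : R)^'] --> d.
  apply/cvgrPdist_le => eps eps0; have [r r0 Hr] := H _ eps0.
  near=> t; rewrite distrC; apply: Hr; first by near: t; exact: nbhs_dnbhs_neq.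
  by near: t; exact: dnbhs0_lt.
by split; [apply/cvg_ex; exists d; exact: Q|exact: cvg_lim Q].
Unshelve. all: by end_near. Qed.

Lemma quotient_derive f x v (d : R) : is_derive x v f d ->
  forall eps : R, 0 < eps -> exists2 r : R, 0 < r & forall t, t != 0 -> `|t| < r ->
    `|t^-1 * (f (t *: v + x) - f x) - d| <= eps.
Proof.
move=> [D <-] eps eps0; move/cvgrPdist_le : D => /(_ _ eps0) /nbhs_ballP [r /= r0 Hr].
exists r => // t t0 tr; rewrite distrC; apply: Hr => //=.
by rewrite -ball_normE /= sub0r normrN.
Qed.

End ContinuityAt.

Section Integral.
Context {R : realType} {n : nat}.
Implicit Types (f g : 'rV[R]_n -> R).
Notation I := (@integral_Rn R n).

Lemma int0 : I (fun=> 0) = 0.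
Proof. exact: law_zero (integral_laws_all n). Qed.

Lemma intZ (k : R) f : Cc f -> I (fun x => k * f x) = k * I f.
Proof.
move=> Cf; have := law_linear (integral_laws_all n) k Cf Cc0; rewrite int0 addr0 => <-.
by congr (integral_Rn _); apply/funext => x; rewrite addr0.
Qed.

Lemma intD f g : Cc f -> Cc g -> I (fun x => f x + g x) = I f + I g.
Proof.
move=> Cf Cg; have := law_linear (integral_laws_all n) 1 Cf Cg; rewrite mul1r => <-.
by congr (integral_Rn _); apply/funext => x; rewrite mul1r.
Qed.

Lemma intB f g : Cc f -> Cc g -> I (fun x => f x - g x) = I f - I g.
Proof.
move=> Cf Cg; rewrite -[X in _ - X]mul1r -mulNr -intZ // -intD //; last exact: CcZ.
by congr (integral_Rn _); apply/funext => x; rewrite mulN1r.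
Qed.

Lemma int_le f g : Cc f -> Cc g -> (forall x, f x <= g x) -> I f <= I g.
Proof. exact: (law_le (integral_laws_all n)). Qed.

Lemma int_ge0 f : Cc f -> (forall x, 0 <= f x) -> 0 <= I f.
Proof. by move=> Cf f0; rewrite -int0; apply: int_le => //; exact: Cc0. Qed.

Lemma int_shift f h : Cc f -> I (fun x => f (x + h)) = I f.
Proof. exact: (law_shift (integral_laws_all n)). Qed.

Lemma int_dilate f (k : R) : 0 < k -> Cc f -> k ^+ n * I (fun x => f (k *: x)) = I f.
Proof. exact: (law_dilate (integral_laws_all n)). Qed.

Lemma int_gt0 f x0 : Cc f -> (forall x, 0 <= f x) -> 0 < f x0 -> 0 < I f.
Proof. exact: (law_gt0 (integral_laws_all n)). Qed.

Lemma int_norm f g : Cc f -> Cc g -> (forall x, `|f x| <= g x) -> `|I f| <= I g.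
Proof.
move=> Cf Cg fg; rewrite ler_norml -mulN1r -intZ //; apply/andP; split.
  apply: int_le => // [|x]; first exact: CcZ.
  by rewrite mulN1r lerNl; apply: le_trans (fg x); rewrite -normrN; exact: ler_norm.
by apply: int_le => // x; apply: le_trans (fg x); exact: ler_norm.
Qed.

Lemma int_sum (T : finType) (f : T -> 'rV[R]_n -> R) : (forall i, Cc (f i)) ->
  I (fun x => \sum_i f i x) = \sum_i I (f i).
Proof.
move=> Cf; have H (s : seq T) : Cc (fun x => \sum_(i <- s) f i x) /\
    I (fun x => \sum_(i <- s) f i x) = \sum_(i <- s) I (f i).
  elim: s => [|i s [IC IE]].
    rewrite (_ : (fun=> _) = fun=> 0); last by apply/funext => x; rewrite big_nil.
    by rewrite big_nil int0; split => //; exact: Cc0.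
  rewrite (_ : (fun=> _) = fun x => f i x + \sum_(j <- s) f j x); last first.
    by apply/funext => x; rewrite big_cons.
  by rewrite big_cons -IE intD //; split => //; exact: CcD.
exact: (H (index_enum T)).2.
Qed.

Lemma CcB f g : Cc f -> Cc g -> Cc (fun x => f x - g x).
Proof.
move=> Cf Cg; have := Cc_linear (-1) Cg Cf.
by congr (Cc _); apply/funext => x; rewrite mulN1r addrC.
Qed.

End Integral.

(** * Twice differentiable functions and weak solutions *)

Section ClassicalData.
Context {R : realType} {n : nat}.
Notation V := 'rV[R]_n.
Notation e i := (@Defs.coord R n i).
Implicit Types (f g : V -> R) (fd gd : 'I_n -> V -> R) (fdd gdd : 'I_n -> 'I_n -> V -> R).
Implicit Types (O : set V) (x y h : V).

Definition C1on O f fd : Prop :=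
  (forall x, O x -> forall i, is_derive x (e i) f (fd i x)) /\
  (forall x, O x -> forall i, {for x, continuous (fd i)}).

Definition C2on O f fd fdd : Prop :=
  (forall x, O x -> forall i, is_derive x (e i) f (fd i x)) /\
  (forall i, C1on O (fd i) (fdd i)).

Definition vanish_off O f : Prop :=
  exists K : set V, [/\ compact K, K `<=` O & forall x, ~ K x -> f x = 0].

Definition test O f fd fdd : Prop := C2on setT f fd fdd /\ vanish_off O f.

(** The double divergence of [c] vanishes weakly in [O]. Values of [c] off [O] do not matter, since
    the second derivatives of a test function vanish there; so [c] may be continuous on [O]
    alone. *)
Definition solves O (c : 'I_n -> 'I_n -> V -> R) : Prop :=
  forall f fd fdd, test O f fd fdd ->
    integral_Rn (fun x => \sum_i \sum_j c i j x * fdd i j x) = 0.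

Lemma C1on_near O f fd x : open O -> C1on O f fd -> O x ->
  \forall y \near x, forall i, is_derive y (e i) f (fd i y).
Proof.
move=> oO [df _] Ox; have : \forall y \near x, O y by exact: open_nbhs_nbhs.
by apply: filterS => y /df.
Qed.

Lemma C1on_continuous O f fd x : open O -> C1on O f fd -> O x -> {for x, continuous f}.
Proof.
move=> oO Cf Ox; apply: (frame_continuous frame_coord (f1 := fd)).
  exact: C1on_near Cf Ox.
by move=> i; exact: Cf.2.
Qed.

Lemma C1on_derive O f fd x h : open O -> C1on O f fd -> O x ->
  is_derive x h f (\sum_i fd i x * h 0 i).
Proof.
move=> oO Cf Ox; apply: (frame_is_derive frame_coord (f1 := fd)).
  exact: C1on_near Cf Ox.
by move=> i; exact: Cf.2.
Qed.

Lemma C2on_C1on O f fd fdd : open O -> C2on O f fd fdd -> C1on O f fd.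
Proof.
move=> oO [df Cf1]; split => // x Ox i; exact: C1on_continuous (Cf1 i) Ox.
Qed.

Lemma C2on_derive2 O f fd fdd x i j : C2on O f fd fdd -> O x ->
  is_derive x (e j) (fd i) (fdd i j x).
Proof. by move=> [_ Cf] Ox; exact: (Cf i).1. Qed.

Lemma C2on_sym O f fd fdd x i j : open O -> C2on O f fd fdd -> O x -> fdd i j x = fdd j i x.
Proof.
move=> oO [df Cf] Ox; have nO : \forall y \near x, O y by exact: open_nbhs_nbhs.
apply: (@schwarz R V f (fd i) (fd j) (fdd i j) (fdd j i) x (e i) (e j)).
- by apply: filterS nO => y Oy; split; [exact: df|exact: (Cf i).1].
- by apply: filterS nO => y Oy; split; [exact: df|exact: (Cf j).1].
- exact: (Cf i).2.
- exact: (Cf j).2.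
Qed.

Lemma C1on_sub O O' f fd : O' `<=` O -> C1on O f fd -> C1on O' f fd.
Proof. by move=> OO [df cf]; split => x /OO; [exact: df|exact: cf]. Qed.

Lemma C2on_sub O O' f fd fdd : O' `<=` O -> C2on O f fd fdd -> C2on O' f fd fdd.
Proof. by move=> OO [df Cf]; split => [x /OO|i]; [exact: df|exact: C1on_sub (Cf i)]. Qed.

Lemma C1onD O (k : R) f fd g gd : C1on O f fd -> C1on O g gd ->
  C1on O (fun x => k * f x + g x) (fun i x => k * fd i x + gd i x).
Proof.
move=> [df cf] [dg cg]; split=> x Ox i.
  apply: is_deriveD (dg _ Ox i).
  exact: (is_deriveZ _ (df _ Ox i)).
by apply: contD; [apply: contM; [exact: cont_cst|exact: cf]|exact: cg].
Qed.

Lemma C2onD O (k : R) f fd fdd g gd gdd : C2on O f fd fdd -> C2on O g gd gdd ->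
  C2on O (fun x => k * f x + g x) (fun i x => k * fd i x + gd i x)
    (fun i j x => k * fdd i j x + gdd i j x).
Proof.
move=> [df cf] [dg cg]; split=> [x Ox i|i]; last exact: C1onD.
by apply: is_deriveD (dg _ Ox i); exact: (is_deriveZ _ (df _ Ox i)).
Qed.

Lemma C1onM O f fd g gd : open O -> C1on O f fd -> C1on O g gd ->
  C1on O (fun x => f x * g x) (fun i x => fd i x * g x + f x * gd i x).
Proof.
move=> oO Cf Cg; have [df cf] := Cf; have [dg cg] := Cg; split=> x Ox i.
  have D := is_deriveM (df _ Ox i) (dg _ Ox i).
  apply: is_derive_eq; rewrite /GRing.scale /=; ring.
apply: contD; apply: contM; [exact: cf|exact: (C1on_continuous oO Cg)|
  exact: (C1on_continuous oO Cf)|exact: cg].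
Qed.

Lemma C2onM O f fd fdd g gd gdd : open O -> C2on O f fd fdd -> C2on O g gd gdd ->
  C2on O (fun x => f x * g x) (fun i x => fd i x * g x + f x * gd i x)
   (fun i j x => fdd i j x * g x + fd i x * gd j x + (fd j x * gd i x + f x * gdd i j x)).
Proof.
move=> oO Cf Cg; have Cf' := C2on_C1on oO Cf; have Cg' := C2on_C1on oO Cg.
split=> [x Ox i|i]; first exact: (C1onM oO Cf' Cg').1.
have := C1onD 1 (C1onM oO (Cf.2 i) Cg') (C1onM oO Cf' (Cg.2 i)).
congr (C1on _ _ _); first by apply/funext => x; rewrite mul1r.
by apply/funext => j; apply/funext => x; rewrite mul1r.
Qed.

Lemma is_derive_affine f x v (k d : R) a : is_derive (k *: x + a) v f d ->
  is_derive x v (fun y => f (k *: y + a)) (k * d).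
Proof.
move=> /(is_derive_dirZ k) df.
have : is_derive (0 : R) (1 : R) (fun t => f (t *: (k *: v) + (k *: x + a))) (k * d).
  by apply: is_derive_line; rewrite scale0r add0r.
have E : (fun t : R => f (t *: (k *: v) + (k *: x + a))) = (fun t : R => f (k *: (t *: v + x) + a)).
  by apply/funext => t; rewrite scalerDr addrA !scalerA mulrC.
rewrite E => -[D E']; split; first by apply/derivable1P.
rewrite -E' /derive.
have EE : (fun h : R => h^-1 *: (((fun t : R => f (k *: (t *: v + x) + a)) \o shift 0) (h *: (1 : R)) - f (k *: (0 *: v + x) + a)))
  = (fun h : R => h^-1 *: (((fun y => f (k *: y + a)) \o shift x) (h *: v) - f (k *: x + a))).
  by apply/funext => h; rewrite /= addr0 scale0r add0r [_%:A]mulr1.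
by rewrite EE.
Qed.

Lemma C1on_affine O f fd (k : R) a : C1on O f fd ->
  C1on [set x | O (k *: x + a)] (fun x => f (k *: x + a)) (fun i x => k * fd i (k *: x + a)).
Proof.
move=> [df cf]; split=> x /= Ox i; first exact: is_derive_affine (df _ Ox i).
by apply: contM; [exact: cont_cst|apply: cont_affine; exact: cf].
Qed.

Lemma C2on_affine O f fd fdd (k : R) a : C2on O f fd fdd ->
  C2on [set x | O (k *: x + a)] (fun x => f (k *: x + a)) (fun i x => k * fd i (k *: x + a))
    (fun i j x => k ^+ 2 * fdd i j (k *: x + a)).
Proof.
move=> [df cf]; split=> [x /= Ox i|i]; first exact: is_derive_affine (df _ Ox i).
have [d2 c2] := C1on_affine k a (cf i); split=> x Ox j.
  rewrite expr2 -mulrA; exact: (is_deriveZ _ (d2 _ Ox j)).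
by apply: contM; [exact: cont_cst|apply: cont_affine; exact: (cf i).2].
Qed.

Lemma is_derive_off (K : set V) f x v d : compact K -> (forall x, ~ K x -> f x = 0) ->
  ~ K x -> is_derive x v f d -> d = 0.
Proof.
move=> cK fK Kx [_ <-].
have near0 : \forall y \near x, f y = cst 0 y.
  have : open (~` K) by apply: closed_openC; apply: compact_closed cK; exact: norm_hausdorff.
  by move=> oK; have : \forall y \near x, (~` K) y by [exact: open_nbhs_nbhs]; apply: filterS => y /fK.
by rewrite (near_eq_derive _ near0) derive_cst.
Qed.

Lemma test_support O f fd fdd : test O f fd fdd ->
  exists K : set V, [/\ compact K, K `<=` O, forall x, ~ K x -> f x = 0,
    forall x i, ~ K x -> fd i x = 0 & forall x i j, ~ K x -> fdd i j x = 0].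
Proof.
move=> [[df Cf] [K [cK KO fK]]]; exists K.
have f1K x i : ~ K x -> fd i x = 0 by move=> Kx; exact: is_derive_off fK Kx (df x I i).
split=> // x i j Kx.
apply: (@is_derive_off K (fd i) x (e j)) => //; first by move=> y; exact: f1K.
by exact: (Cf i).1.
Qed.

Lemma Cc_vanish f : continuous f -> vanish_off setT f -> Cc f.
Proof.
move=> cf [K [/compact_bounded [M [_ KM]] _ fK]]; split => //.
exists (M + 1) => x Mx; apply: fK => Kx.
by have := KM (M + 1) _ x Kx; rewrite ltrDl ltr01 => /(_ isT) /=; rewrite leNgt Mx.
Qed.

Lemma vanish_off_sub O O' f : O `<=` O' -> vanish_off O f -> vanish_off O' f.
Proof. by move=> OO [K [? KO ?]]; exists K; split => //; exact: subset_trans OO. Qed.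

Lemma test_sub O O' f fd fdd : O `<=` O' -> test O f fd fdd -> test O' f fd fdd.
Proof. by move=> OO [? /(vanish_off_sub OO)]. Qed.

Lemma solves_sub O O' c : O `<=` O' -> solves O' c -> solves O c.
Proof. by move=> OO sc f fd fdd /(test_sub OO); exact: sc. Qed.

(** At a point outside [O] the complement of the support [K] is a neighbourhood on which the product
    is 0, so a jump of [c] at the boundary of [O] is harmless. *)
Lemma Cc_cut O (c g : V -> R) : open O -> (forall x, O x -> {for x, continuous c}) ->
  continuous g -> vanish_off O g -> Cc (fun x => c x * g x).
Proof.
move=> oO cc cg [K [cK KO gK]].
have KT : vanish_off setT (fun x => c x * g x).
  by exists K; split => // x /gK ->; rewrite mulr0.
apply: Cc_vanish KT => x.
have [Ox|Ox] := pselect (O x); first by apply: contM; [exact: cc|exact: cg].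
have oK : open (~` K) by apply: closed_openC; apply: compact_closed cK; exact: norm_hausdorff.
have Kx : (~` K) x by move=> /KO.
have near0 : \forall y \near x, 0 = c y * g y.
  have : \forall y \near x, (~` K) y by exact: open_nbhs_nbhs.
  by apply: filterS => y /gK ->; rewrite mulr0.
rewrite /continuous_at gK // mulr0.
by apply: cvg_trans (near_eq_cvg near0) _; exact: cvg_cst.
Qed.

Lemma test_vanish2 O f fd fdd i j : test O f fd fdd -> vanish_off O (fdd i j).
Proof. by move=> /test_support [K [? ? _ _ fK]]; exists K; split => // x; exact: fK. Qed.

Lemma test_continuous2 O f fd fdd i j : test O f fd fdd -> continuous (fdd i j).
Proof. by move=> [[_ Cf] _] x; exact: (Cf i).2. Qed.

Lemma Cc_test2 O f fd fdd i j : test O f fd fdd -> Cc (fdd i j).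
Proof.
move=> tf; apply: Cc_vanish; first exact: test_continuous2 tf.
exact: vanish_off_sub (test_vanish2 i j tf).
Qed.

Lemma Cc_pairing O (c : 'I_n -> 'I_n -> V -> R) f fd fdd i j : open O -> (forall x, O x -> {for x, continuous (c i j)}) ->
  test O f fd fdd -> Cc (fun x => c i j x * fdd i j x).
Proof.
move=> oO cc tf; apply: (Cc_cut oO) => //; [exact: test_continuous2 tf|exact: test_vanish2 tf].
Qed.

(** The quotient is a value of [fd i] at a point within |t| of [x], and [fd i] is uniformly
    continuous because it is compactly supported. *)
Lemma uniform_quotient f fd : C1on setT f fd -> (forall i, Cc (fd i)) -> forall i (eps : R), 0 < eps ->
  exists2 d : R, 0 < d & forall t x, t != 0 -> `|t| < d ->
    `|t^-1 * (f (t *: e i + x) - f x) - fd i x| <= eps.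
Proof.
move=> [df _] C1 i eps eps0.
have [d d0 Hd] := Cc_unif (C1 i) eps0.
exists d => // t x t0 td.
have [s /andP[s0 s1] E] : exists2 s : R, 0 <= s <= 1 &
    f (t *: e i + x) - f x = t * fd i (s *: (t *: e i) + x).
  by apply: mvt_line => s _; apply: is_derive_dirZ; exact: df.
rewrite E mulKf //; apply/ltW/Hd; rewrite addrK; apply: le_lt_trans td.
rewrite !normrZ (ger0_norm s0) -[leRHS]mul1r; apply: ler_pM => //.
by rewrite -[leRHS]mulr1; apply: ler_wpM2l => //; exact: (frame_norm frame_coord).
Qed.

(** The difference quotient of [f] has integral 0 by translation invariance, and it converges to
    [fd i] uniformly on a fixed cube. *)
Lemma int_derive f fd i : C1on setT f fd -> Cc f -> (forall i, Cc (fd i)) -> integral_Rn (fd i) = 0.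
Proof.
move=> Cf cf cf1; apply/eqP; rewrite -normr_le0; apply/ler_addgt0Pr => /= eps eps0; rewrite add0r.
have [M _ fM] := Cc_bound_ge 0 cf.
have [M1 _ f1M] := Cc_bound_ge M (cf1 i).
(* The increment [t] is at most 1, so all quotients vanish outside the cube of radius [N]. *)
pose N : R := Num.max M M1 + 1.
have [C C0 HC] := integral_bound (integral_laws_all n) N.
have e1 : 0 < eps / (C + 1) by rewrite divr_gt0 // ltr_wpDl.
have [d d0 Hd] := uniform_quotient Cf cf1 i e1.
pose t : R := Num.min (d / 2) 1.
have t0 : 0 < t by rewrite lt_min ltr01 divr_gt0.
have td : `|t| < d by rewrite gtr0_norm // gt_min; apply/orP; left; lra.
have Cs : Cc (fun x => f (t *: e i + x)).
  by have := Cc_shift (t *: e i) cf; congr (Cc _); apply/funext => x; rewrite addrC.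
have Cq : Cc (fun x => t^-1 * (f (t *: e i + x) - f x)) by apply: CcZ; exact: CcB.
have E : integral_Rn (fun x => t^-1 * (f (t *: e i + x) - f x)) = 0.
  rewrite intZ; last exact: CcB.
  rewrite intB // -[X in _ - X](int_shift (t *: e i) cf).
  rewrite (_ : (fun x => f (x + _)) = (fun x => f (t *: e i + x))); last by apply/funext => x; rewrite addrC.
  by rewrite subrr mulr0.
have -> : `|integral_Rn (fd i)| = `|integral_Rn (fun x => t^-1 * (f (t *: e i + x) - f x) - fd i x)|.
  by rewrite intB // E sub0r normrN.
apply: le_trans (HC _ (eps / (C + 1)) (CcB Cq (cf1 i)) _ _) _.
- move=> x Nx; rewrite f1M; last first.
    by apply: le_lt_trans Nx; rewrite /N (le_trans (_ : _ <= Num.max M M1)) ?le_max ?lexx ?orbT // lerDl.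
  rewrite !fM ?subrr ?mulr0 ?subrr //.
    by apply: le_lt_trans Nx; rewrite /N (le_trans (_ : _ <= Num.max M M1)) ?le_max ?lexx ?orbT // lerDl.
  have := ler_normB (t *: e i + x) (t *: e i); rewrite addrC addKr => H.
  have : `|t *: e i| <= 1.
    rewrite normrZ -[leRHS]mulr1; apply: ler_pM => //; last exact: (frame_norm frame_coord).
    by rewrite gtr0_norm // ge_min lexx orbT.
  have : M <= Num.max M M1 by rewrite le_max lexx.
  move: H Nx; rewrite /N; lra.
- by move=> x; apply: Hd => //; rewrite gt_eqF.
- by rewrite mulrA ler_pdivrMr ?ltr_wpDl // mulrC ler_pM2l // lerDl.
Qed.

End ClassicalData.

(** * Classes C^k along a set of directions *)

Section CkAlong.
Context {R : realType} {V : normedModType R}.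
Implicit Types (f g : V -> R) (E A : set V) (k : nat).

(** [iter_derive] applies the last vector of the list first, so the list is split at its end: one
    derivative is taken, and the remaining vectors act on it. *)
Lemma Ck_along_rec E A k f : Ck_along E A k.+1 f <->
  [/\ {within A, continuous f}, forall x v, A x -> E v -> derivable f x v
    & forall v, E v -> Ck_along E A k ('D_v f)].
Proof.
split=> [H|[cf df Hf]].
  split.
  - by have [] := H [::] isT (fun v => ltac:(by [])).
  - by move=> x v Ax Ev; have [_ /(_ isT)] := H [::] isT (fun v => ltac:(by [])); exact.
  - move=> v Ev vs svs Evs.
    have [||H1 H2] := H (rcons vs v).
    + by rewrite size_rcons.
    + by move=> w; rewrite mem_rcons inE => /orP[/eqP ->|/Evs].
    + by move: H1 H2; rewrite /iter_derive foldr_rcons size_rcons ltnS.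
elim/last_ind => [|vs v _] svs Evs; first by split => // _ x v Ax Ev; exact: df.
have Ev : E v by apply: Evs; rewrite mem_rcons inE eqxx.
rewrite size_rcons ltnS in svs.
have Evs' w : w \in vs -> E w by move=> wvs; apply: Evs; rewrite mem_rcons inE wvs orbT.
have [H1 H2] := Hf v Ev vs svs Evs'.
by split; rewrite /iter_derive foldr_rcons // size_rcons ltnS.
Qed.

Lemma Ck_along0 E A f : Ck_along E A 0 f <-> {within A, continuous f}.
Proof.
split=> [H|cf]; first by have [] := H [::] isT (fun v => ltac:(by [])).
by move=> [|v vs].
Qed.

Lemma within_openP A f : open A -> {within A, continuous f} <-> (forall x, A x -> {for x, continuous f}).
Proof.
move=> oA; rewrite continuous_open_subspace //; split => H x; last by rewrite inE => /H.
by move=> Ax; apply: H; rewrite inE.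
Qed.

Lemma Ck_along_ext E A k f g : open A -> (forall x, A x -> f x = g x) ->
  Ck_along E A k f -> Ck_along E A k g.
Proof.
move=> oA; elim: k f g => [|k IH] f g fg.
  move=> /Ck_along0 /(within_openP _ oA) cf; apply/Ck_along0/(within_openP _ oA) => x Ax.
  have near_fg : \forall y \near x, f y = g y.
    by have : \forall y \near x, A y by [exact: open_nbhs_nbhs]; apply: filterS => y /fg.
  rewrite /prop_for /continuous_at -(fg x Ax); apply: cvg_trans (near_eq_cvg near_fg) _; exact: cf.
have near_fg x : A x -> \forall y \near x, f y = g y.
  by move=> Ax; have : \forall y \near x, A y by [exact: open_nbhs_nbhs]; apply: filterS => y /fg.
move=> /Ck_along_rec [cf df Hf]; apply/Ck_along_rec; split.
- apply/(within_openP _ oA) => x Ax; have {}cf := (within_openP _ oA).1 cf x Ax.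
  rewrite /prop_for /continuous_at -(fg x Ax); apply: cvg_trans (near_eq_cvg (near_fg _ Ax)) _; exact: cf.
- by move=> x v Ax Ev; apply: near_eq_derivable (near_fg _ Ax) _; exact: df.
- move=> v Ev; apply: IH (Hf v Ev) => x Ax; exact: near_eq_derive (near_fg _ Ax).
Qed.

Lemma Ck_along_linear E k (c : R) f g :
  Ck_along E setT k f -> Ck_along E setT k g -> Ck_along E setT k (fun x => c * f x + g x).
Proof.
elim: k f g => [|k IH] f g.
  move=> /Ck_along0 /(within_openP _ openT) cf /Ck_along0 /(within_openP _ openT) cg.
  apply/Ck_along0/(within_openP _ openT) => x _.
  by apply: contD; [apply: contM; [exact: cont_cst|exact: cf]|exact: cg].
move=> /Ck_along_rec [/(within_openP _ openT) cf df Hf] /Ck_along_rec [/(within_openP _ openT) cg dg Hg].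
have D x v : E v -> is_derive x v (fun x => c * f x + g x) (c * 'D_v f x + 'D_v g x).
  move=> Ev; apply: is_deriveD; last exact/derivableP/dg.
  by apply: (is_deriveZ c); exact/derivableP/df.
apply/Ck_along_rec; split.
- apply/(within_openP _ openT) => x _.
  by apply: contD; [apply: contM; [exact: cont_cst|exact: cf]|exact: cg].
- by move=> x v _ Ev; have [] := D x v Ev.
- move=> v Ev; rewrite (_ : 'D_v _ = fun x => c * 'D_v f x + 'D_v g x); first by apply: IH; [exact: Hf|exact: Hg].
  by apply/funext => x; have [_ ->] := D x v Ev.
Qed.

Lemma Ck_along_dilate E k (c : R) f :
  Ck_along E setT k f -> Ck_along E setT k (fun x => f (c *: x)).
Proof.
have cD g x : {for c *: x, continuous g} -> {for x, continuous (fun x : V => g (c *: x) : R)}.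
  by move=> cg; apply: (@continuous_comp _ _ _ (fun x => c *: x) g) => //; exact: scaler_continuous.
elim: k f => [|k IH] f.
  move=> /Ck_along0 /(within_openP _ openT) cf.
  by apply/Ck_along0/(within_openP _ openT) => x _; apply: cD; exact: cf.
move=> Ckf; have [/(within_openP _ openT) cf df Hf] := (Ck_along_rec _ _ _ _).1 Ckf.
have D x v : E v -> is_derive x v (fun x => f (c *: x)) (c * 'D_v f (c *: x)).
  move=> Ev; have /(is_derive_dirZ c) H : is_derive (c *: x) v f ('D_v f (c *: x)) by exact/derivableP/df.
  apply: is_derive_quotient => eps eps0; have [r r0 Hr] := quotient_derive H eps0.
  exists r => // t t0 tr; by have := Hr t t0 tr; rewrite scalerDr !scalerA [c * t]mulrC.
apply/Ck_along_rec; split.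
- by apply/(within_openP _ openT) => x _; apply: cD; exact: cf.
- by move=> x v _ Ev; have [] := D x v Ev.
(* The factor [c] is written as (c - 1) + 1 to fit the shape of [Ck_along_linear]. *)
- move=> v Ev; rewrite (_ : 'D_v _ = fun x => (c - 1) * ('D_v f) (c *: x) + ('D_v f) (c *: x)).
    by have H := IH _ (Hf v Ev); exact: (@Ck_along_linear E k (c - 1) (fun x => ('D_v f) (c *: x)) (fun x => ('D_v f) (c *: x)) H H).
  by apply/funext => x; have [_ ->] := D x v Ev; rewrite mulrBl mul1r subrK.
Qed.

End CkAlong.

(** * Mollification of test functions *)

Section FlatFunction.
Context {R : realType}.
Implicit Types (p : {poly R}) (t : R).

(* p(1/t) exp(-1/t) on the positive half-line: the class is stable under differentiation *)
Definition flat p t : R := if 0 < t then p.[t^-1] * expR (- t^-1) else 0.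

(** The derivative of p(1/t) exp(-1/t) is t^-2 (p(1/t) - p'(1/t)) exp(-1/t). *)
Definition flat_step p : {poly R} := 'X^2 * (p - p^`()).

(** Raise y/k <= exp(y/k) to the power k; this is the origin of the constant k^k. *)
Lemma expR_ge_pow k (y : R) : 0 <= y -> y ^+ k <= (k ^ k)%:R * expR y.
Proof.
move=> y0; case: k => [|k]; first by rewrite expr0 mul1r -expR0 ler_expR.
have k0 : 0 < k.+1%:R :> R by rewrite ltr0n.
have H : y / k.+1%:R <= expR (y / k.+1%:R).
  by apply: le_trans (expR_ge1Dx _); rewrite lerDr.
have : (y / k.+1%:R) ^+ k.+1 <= expR (y / k.+1%:R) ^+ k.+1.
  by apply: lerXn2r => //; rewrite nnegrE ?expR_ge0 // divr_ge0 // ltW.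
rewrite -expRM_natl [k.+1%:R * _]mulrC divfK ?gt_eqF // expr_div_n ler_pdivrMr ?exprn_gt0 //.
by rewrite natrX mulrC.
Qed.

Lemma poly_exp_bound p : exists2 C : R, 0 <= C & forall y, 0 <= y -> `|p.[y]| <= C * expR y.
Proof.
exists (\sum_(i < size p) `|p`_i| * (i ^ i)%:R).
  by apply: sumr_ge0 => i _; rewrite mulr_ge0.
move=> y y0; rewrite horner_coef mulr_suml; apply: le_trans (ler_norm_sum _ _ _) _.
apply: ler_sum => i _; rewrite normrM -mulrA ler_wpM2l // ger0_norm ?exprn_ge0 //.
exact: expR_ge_pow.
Qed.

(** The exponential bound is applied to X^2 p at 1/t. The quadratic bound is what gives flat
    functions the derivative 0 at the origin. *)
Lemma flat_quadratic p : exists2 C : R, 0 <= C & forall t, `|flat p t| <= C * t ^+ 2.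
Proof.
have [C C0 HC] := poly_exp_bound ('X^2 * p).
exists C => // t; rewrite /flat; case: ifPn => [t0|_]; last by rewrite normr0 mulr_ge0 // sqr_ge0.
have tv : 0 <= t^-1 by rewrite invr_ge0 ltW.
have := HC _ tv; rewrite hornerM hornerXn normrM ger0_norm ?exprn_ge0 // normrM => H.
rewrite (gtr0_norm (expR_gt0 _)) expRN ler_pdivrMr ?expR_gt0 //.
rewrite mulrAC -ler_pdivrMr ?exprn_gt0 // mulrC -exprVn //.
Qed.

Lemma is_derive_flat p t : is_derive t (1 : R) (flat p) (flat (flat_step p) t).
Proof.
have [t0|t0|t0] := ltgtP 0 t.
- have E : \forall y \near t, (horner p \o (fun y => y^-1)) y * (expR \o (fun y => - y^-1)) y = flat p y.
    near=> y; rewrite /flat ifT //; near: y; exact: lt_nbhsr.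
  apply: near_eq_is_derive E _.
  have tn : t != 0 by rewrite gt_eqF.
  have Dv : is_derive t (1 : R) (fun y : R => y^-1) (- t ^- 2).
    have := @is_deriveV R id t 1 1 tn (is_derive_id _ _).
    by move=> H; apply: is_derive_eq; rewrite /GRing.scale /= mulr1.
  have DN : is_derive t (1 : R) (fun y : R => - y^-1) (t ^- 2).
    by apply: is_derive_eq; rewrite opprK.
  have D1 : is_derive t (1 : R) (horner p \o (fun y => y^-1)) (p^`().[t^-1] * (- t ^- 2)).
    by apply: is_derive1_comp.
  have D2 : is_derive t (1 : R) (expR \o (fun y => - y^-1)) (expR (- t^-1) * t ^- 2).
    by apply: is_derive1_comp.
  have D := is_deriveM D1 D2.
  apply: is_derive_eq; rewrite /flat t0 /flat_step hornerM hornerXn hornerD hornerN /GRing.scale /=.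
  by rewrite exprVn; ring.
- have E : \forall y \near t, (fun=> 0) y = flat p y.
    near=> y; rewrite /flat ifF //; apply/negbTE; rewrite -leNgt ltW //; near: y; exact: lt_nbhsl.
  have -> : flat (flat_step p) t = 0 by rewrite /flat ifF //; apply/negbTE; rewrite -leNgt ltW.
  by apply: near_eq_is_derive E _; exact: is_derive_cst.
- rewrite -t0 (_ : flat _ 0 = 0) /flat ?ltxx //.
  apply: is_derive_quotient => eps eps0; have [C C0 HC] := flat_quadratic p.
  exists (eps / (C + 1)); first by rewrite divr_gt0 // ltr_wpDl.
  move=> h h0 hr; rewrite ltxx !subr0 addr0 [h *: _]mulr1 -/(flat p h).
  rewrite normrM normfV ler_pdivrMl ?normr_gt0 //; apply: le_trans (HC h) _.
  rewrite -[h ^+ 2]ger0_norm ?sqr_ge0 // normrX expr2 mulrA mulrC ler_wpM2l //.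
  apply: le_trans (_ : (C + 1) * `|h| <= _); first by rewrite ler_wpM2r // lerDl.
  by rewrite mulrC -ler_pdivlMr ?ltr_wpDl // ltW.
Unshelve. all: by end_near. Qed.

Lemma continuous_flat p : continuous (flat p).
Proof.
move=> t; apply/differentiable_continuous/derivable1_diffP.
by have [] := is_derive_flat p t.
Qed.

End FlatFunction.

Section Bump.
Context {R : realType} {n : nat}.
Notation V := 'rV[R]_n.
Notation e i := (@Defs.coord R n i).
Implicit Types (p q : 'I_n -> {poly R}) (x : V).

(** Products of one-dimensional bumps supported in [-1, 1]. Letting the polynomials vary with the
    coordinate makes every partial derivative a difference of two members of the family, which is
    all that smoothness needs. *)
Definition flat_prod p q x : R := \prod_i (flat (p i) (1 + x 0 i) * flat (q i) (1 - x 0 i)).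

Definition step_at p i : 'I_n -> {poly R} := fun j => if j == i then flat_step (p i) else p j.

Lemma is_derive_flat_prod p q x i : is_derive x (e i) (flat_prod p q)
  (flat_prod (step_at p i) q x - flat_prod p (step_at q i) x).
Proof.
pose C := \prod_(j | j != i) (flat (p j) (1 + x 0 j) * flat (q j) (1 - x 0 j)).
have E p' q' (y : V) : (forall j, j != i -> p' j = p j /\ q' j = q j /\ y 0 j = x 0 j) ->
    flat_prod p' q' y = flat (p' i) (1 + y 0 i) * flat (q' i) (1 - y 0 i) * C.
  move=> H; rewrite /flat_prod (bigD1 i) //=; congr (_ * _); apply: eq_bigr => j ji.
  by have [-> [-> ->]] := H j ji.
have D : is_derive (0 : R) (1 : R) (fun t : R => flat_prod p q (t *: e i + x))
    (flat_prod (step_at p i) q x - flat_prod p (step_at q i) x).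
  rewrite (_ : (fun t => _) = (fun t : R => ((flat (p i) \o (fun t => t + (1 + x 0 i))) t
      * (flat (q i) \o (fun t => - t + (1 - x 0 i))) t) * C)); last first.
    apply/funext => t /=; rewrite (E p q (t *: e i + x)); last first.
      by move=> j ji; rewrite !mxE (negbTE ji) andbF mulr0 add0r.
    by rewrite !mxE !eqxx /= mulr1; congr (flat _ _ * flat _ _ * _); ring.
  rewrite (E (step_at p i) q x); last by move=> j ji; rewrite /step_at (negbTE ji).
  rewrite (E p (step_at q i) x); last by move=> j ji; rewrite /step_at (negbTE ji).
  have ? : is_derive ((fun t : R => t + (1 + x 0 i)) 0) (1 : R) (flat (p i)) (flat (flat_step (p i)) (1 + x 0 i)).
    by rewrite /= add0r; exact: is_derive_flat.
  have ? : is_derive ((fun t : R => - t + (1 - x 0 i)) 0) (1 : R) (flat (q i)) (flat (flat_step (q i)) (1 - x 0 i)).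
    by rewrite /= oppr0 add0r; exact: is_derive_flat.
  have D1 : is_derive (0 : R) (1 : R) (fun t : R => t + (1 + x 0 i)) 1.
    by apply: is_derive_eq; rewrite addr0.
  have D2 : is_derive (0 : R) (1 : R) (fun t : R => - t + (1 - x 0 i)) (-1).
    by apply: is_derive_eq; rewrite addr0.
  have D3 : is_derive (0 : R) (1 : R) (flat (p i) \o (fun t => t + (1 + x 0 i))) (flat (flat_step (p i)) (1 + x 0 i) * 1).
    exact: is_derive1_comp.
  have D4 : is_derive (0 : R) (1 : R) (flat (q i) \o (fun t => - t + (1 - x 0 i))) (flat (flat_step (q i)) (1 - x 0 i) * -1).
    exact: is_derive1_comp.
  have D5 := is_deriveM (is_deriveM D3 D4) (is_derive_cst C (0 : R) (1 : R)).
  apply: is_derive_eq; rewrite /GRing.scale /= !add0r oppr0 add0r /step_at !eqxx; ring.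
apply: is_derive_quotient => eps eps0; have [r r0 Hr] := quotient_derive D eps0.
exists r => // t t0 tr; have := Hr t t0 tr.
by rewrite addr0 [t *: 1]mulr1 scale0r add0r.
Qed.

Lemma continuous_flat_prod p q : continuous (flat_prod p q).
Proof.
move=> x; rewrite /flat_prod.
have H (s : seq 'I_n) : {for x, continuous (fun x => \prod_(i <- s) (flat (p i) (1 + x 0 i) * flat (q i) (1 - x 0 i)))}.
  elim: s => [|i s IH].
    rewrite (_ : (fun=> _) = fun=> 1); last by apply/funext => y; rewrite big_nil.
    exact: cont_cst.
  rewrite (_ : (fun=> _) = fun y : V => (flat (p i) (1 + y 0 i) * flat (q i) (1 - y 0 i)) *
    \prod_(i <- s) (flat (p i) (1 + y 0 i) * flat (q i) (1 - y 0 i))); last first.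
    by apply/funext => y; rewrite big_cons.
  have cx : {for x, continuous (fun y : V => y 0 i)} by exact: coord_continuous.
  apply: contM IH; apply: contM.
    apply: (@continuous_comp _ _ _ (fun y : V => 1 + y 0 i) (flat (p i))); last exact: continuous_flat.
    by apply: contD; [exact: cont_cst|].
  apply: (@continuous_comp _ _ _ (fun y : V => 1 - y 0 i) (flat (q i))); last exact: continuous_flat.
  by apply: contB; [exact: cont_cst|].
exact: (H (index_enum 'I_n)).
Qed.

Lemma smooth_flat_prod p q : smooth_on setT (flat_prod p q).
Proof.
move=> k; elim: k p q => [|k IH] p q.
  apply/Ck_along0/(within_openP _ openT) => x _; exact: continuous_flat_prod.
apply/Ck_along_rec; split.
- apply/(within_openP _ openT) => x _; exact: continuous_flat_prod.
- by move=> x _ _ [i _ <-]; have [] := is_derive_flat_prod p q x i.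
- move=> _ [i _ <-].
  rewrite (_ : 'D_(e i) _ = fun x => -1 * flat_prod p (step_at q i) x + flat_prod (step_at p i) q x).
    by apply: Ck_along_linear; exact: IH.
  by apply/funext => x; have [_ ->] := is_derive_flat_prod p q x i; rewrite mulN1r addrC.
Qed.

(** Supported in the closed unit cube of the sup norm and positive inside. It is not normalised;
    where an approximate identity is needed, integrals are divided by its mass. *)
Definition mollifier : V -> R := flat_prod (fun=> 1) (fun=> 1).

Lemma mollifier_ge0 x : 0 <= mollifier x.
Proof.
apply: prodr_ge0 => i _; rewrite /flat !hornerC !mul1r.
by apply: mulr_ge0; case: ifP => // _; exact: expR_ge0.
Qed.

Lemma mollifier_gt0 x : `|x| < 1 -> 0 < mollifier x.
Proof.
move=> x1; apply: prodr_gt0 => i _; have := le_lt_trans (coord_norm_le x i) x1.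
rewrite ltr_norml => /andP[h1 h2].
have p1 : 0 < 1 + x 0 i by lra.
have p2 : 0 < 1 - x 0 i by lra.
by rewrite /flat p1 p2 !hornerC !mul1r mulr_gt0 // expR_gt0.
Qed.

Lemma flat_prod_out p q x : 1 < `|x| -> flat_prod p q x = 0.
Proof.
move=> x1; have [i xi] : exists i, 1 < `|x 0 i|.
  apply: contrapT => /forallNP H; have : `|x| <= 1.
    by apply: row_norm_le => // i; rewrite leNgt; apply/negP; exact: H.
  by rewrite leNgt x1.
rewrite /flat_prod (bigD1 i) //= /flat; move: xi; rewrite ltr_normr => /orP[h|h].
  by rewrite [0 < 1 - _]ltNge [1 - _ <= 0](_ : _ = true) /= ?mulr0 ?mul0r //; apply/idP; lra.
by rewrite [0 < 1 + _]ltNge [1 + _ <= 0](_ : _ = true) /= ?mul0r ?mul0r //; apply/idP; lra.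
Qed.

Lemma smooth_mollifier : smooth_on setT mollifier.
Proof. exact: smooth_flat_prod. Qed.

End Bump.

Section CompactOpen.
Context {R : realType} {V : normedModType R}.

(** Uniform continuity on [K] of the indicator of [O], which is locally constant on [O]: a variation
    below 1 means that [y] has not left [O]. *)
Lemma compact_open_dist (K O : set V) : compact K -> open O -> K `<=` O ->
  exists2 d : R, 0 < d & forall x y, K x -> `|y - x| < d -> O y.
Proof.
move=> cK oO KO.
pose f x : R := \1_O x.
have cf x : K x -> {for x, continuous f}.
  move=> Kx; have near1 : \forall y \near x, 1 = f y.
    have : \forall y \near x, O y by apply: open_nbhs_nbhs; split => //; exact: KO.
    by apply: filterS => y Oy; rewrite /f indicE mem_set.
  have E : f x = 1 by rewrite /f indicE mem_set //; exact: KO.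
  rewrite /prop_for /continuous_at E; apply: cvg_trans (near_eq_cvg near1) _; exact: cvg_cst.
have [d d0 Hd] := compact_unif_cont cK cf ltr01.
exists d => // x y Kx yx; apply: contrapT => Oy.
have := Hd x y Kx yx; rewrite /f !indicE memNset // mem_set ?sub0r ?normrN ?normr1 ?ltxx //.
exact: KO.
Qed.

Lemma compact_bound (K : set V) (c : V -> R) : compact K -> (forall x, K x -> {for x, continuous c}) ->
  exists2 B : R, 0 <= B & forall x, K x -> `|c x| <= B.
Proof.
move=> cK cc.
have /compact_bounded [M [_ HM]] : compact (c @` K).
  by apply: continuous_compact cK; apply: continuous_in_subspaceT => x; rewrite inE; exact: cc.
exists (`|M| + 1); first by rewrite addr_ge0.
move=> x Kx; apply: (HM (`|M| + 1)); last by exists x.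
by rewrite (le_lt_trans (ler_norm M)) // ltrDl.
Qed.

End CompactOpen.

Section Mollify.
Context {R : realType} {n : nat}.
Notation V := 'rV[R]_n.
Notation e i := (@Defs.coord R n i).
Notation I := (@integral_Rn R n).
Implicit Types (f g psi : V -> R) (x y : V).

(** Convolution with the reflected kernel, so that a derivative put on [psi] comes with a minus
    sign. *)
Definition smear psi g x : R := I (fun y => psi (y - x) * g y).

Lemma Cc_window psi g x : Cc psi -> continuous g -> Cc (fun y => psi (y - x) * g y).
Proof.
move=> Cp cg; have := Cc_mul cg (Cc_shift (- x) Cp).
by congr (Cc _); apply/funext => y; rewrite mulrC.
Qed.

Lemma smearE psi g x : Cc psi -> continuous g -> smear psi g x = I (fun y => psi y * g (y + x)).
Proof.
move=> Cp cg; rewrite /smear -[LHS](int_shift x) //; last exact: Cc_window.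
by congr (integral_Rn _); apply/funext => y; rewrite addrK.
Qed.

Lemma is_derive_smear_kernel psi psid g x i : C1on setT psi psid -> Cc psi ->
  (forall i, Cc (psid i)) -> Cc g ->
  is_derive x (e i) (smear psi g) (- smear (psid i) g x).
Proof.
move=> Dp Cp Cpd Cg; apply: is_derive_quotient => eps eps0.
pose N : R := I (fun y => `|g y|).
have N0 : 0 <= N by apply: int_ge0 => //; exact: Cc_norm.
have e1 : 0 < eps / (N + 1) by rewrite divr_gt0 // ltr_wpDl.
have [d d0 Hd] := uniform_quotient Dp Cpd i e1.
exists d => // t t0 td.
have W := fun z => Cc_window z Cp Cg.1.
have Wd := Cc_window x (Cpd i) Cg.1.
rewrite /smear opprK -intB // -intZ; last exact: CcB.
rewrite -intD //; last by apply: CcZ; exact: CcB.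
apply: (le_trans (int_norm (g := fun y => eps / (N + 1) * `|g y|) _ _ _)).
- by apply: CcD => //; apply: CcZ; exact: CcB.
- by apply: CcZ; exact: Cc_norm.
- move=> y; rewrite -mulrBl mulrA -mulrDl normrM; apply: ler_wpM2r => //.
  have := Hd (- t) (y - x); rewrite oppr_eq0 normrN => /(_ t0 td).
  rewrite -normrN invrN mulNr opprD opprK scaleNr.
  by rewrite opprK (_ : - (t *: e i) + (y - x) = y - (t *: e i + x)) // opprD addrCA.
- rewrite intZ; last exact: Cc_norm.
  by rewrite mulrAC ler_pdivrMr ?ltr_wpDl // ler_pM2l // lerDl.
Qed.

(** Here the derivative falls on [g]: second derivatives of a mollified test function are mollified
    second derivatives, hence converge uniformly. The rule [is_derive_smear_kernel] instead gives
    smoothness of every order. *)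
Lemma is_derive_smear psi g gd x i : C1on setT g gd -> Cc psi -> Cc g -> (forall i, Cc (gd i)) ->
  is_derive x (e i) (smear psi g) (smear psi (gd i) x).
Proof.
move=> Dg Cp Cg Cgd; apply: is_derive_quotient => eps eps0.
pose N : R := I (fun y => `|psi y|).
have N0 : 0 <= N by apply: int_ge0 => //; exact: Cc_norm.
have e1 : 0 < eps / (N + 1) by rewrite divr_gt0 // ltr_wpDl.
have [d d0 Hd] := uniform_quotient Dg Cgd i e1.
exists d => // t t0 td.
have W h z : Cc h -> Cc (fun y => psi y * h (y + z)).
  by move=> Ch; apply: Cc_mul; [exact: Cp.1|exact: Cc_shift].
have Cc1 := Cg.1; have Cc2 := (Cgd i).1.
rewrite !smearE //.
rewrite -intB; [|exact: W|exact: W]. rewrite -intZ; last by apply: CcB; exact: W.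
rewrite -intB; [|by apply: CcZ; apply: CcB; exact: W|exact: W].
apply: (le_trans (int_norm (g := fun y => eps / (N + 1) * `|psi y|) _ _ _)).
- by apply: CcB; [apply: CcZ; apply: CcB|]; exact: W.
- by apply: CcZ; exact: Cc_norm.
- move=> y; rewrite -mulrBr mulrCA -mulrBr normrM mulrC; apply: ler_wpM2r => //.
  by have := Hd t (y + x) t0 td; rewrite addrCA.
- rewrite intZ; last exact: Cc_norm.
  by rewrite mulrAC ler_pdivrMr ?ltr_wpDl // ler_pM2l // lerDl.
Qed.

Lemma continuous_smear psi g : Cc psi -> Cc g -> continuous (smear psi g).
Proof.
move=> Cp Cg x; apply/continuous_atP => eps eps0.
pose N : R := I (fun y => `|g y|).
have N0 : 0 <= N by apply: int_ge0 => //; exact: Cc_norm.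
have e1 : 0 < eps / (N + 1) by rewrite divr_gt0 // ltr_wpDl.
have [d d0 Hd] := Cc_unif Cp e1.
exists d => // z zx; have W := fun z => Cc_window z Cp Cg.1.
rewrite /smear -intB //.
apply: (le_lt_trans (int_norm (g := fun y => eps / (N + 1) * `|g y|) _ _ _)).
- exact: CcB.
- by apply: CcZ; exact: Cc_norm.
- move=> y; rewrite -mulrBl normrM; apply: ler_wpM2r => //; apply/ltW/Hd.
  by rewrite opprB addrC addrA subrK distrC.
- rewrite intZ; last exact: Cc_norm.
  by rewrite mulrAC ltr_pdivrMr ?ltr_wpDl // ltr_pM2l // ltrDl.
Qed.

Lemma smooth_C1on psi : smooth_on setT psi -> C1on setT psi (fun i => 'D_(e i) psi).
Proof.
move=> sp; have [_ dp _] := (Ck_along_rec _ _ _ _).1 (sp 1%N).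
split=> x _ i; first by apply/derivableP/dp => //; exists i.
have [_ _ H] := (Ck_along_rec _ _ _ _).1 (sp 1%N).
by have /Ck_along0 /(within_openP _ openT) := H (e i) (ex_intro2 _ _ i Logic.I erefl); exact.
Qed.

Lemma smooth_derive psi i : smooth_on setT psi -> smooth_on setT ('D_(e i) psi).
Proof. by move=> sp k; have [_ _] := (Ck_along_rec _ _ _ _).1 (sp k.+1); apply; exists i. Qed.

Lemma smooth_Cc psi (M : R) : smooth_on setT psi -> (forall x, M < `|x| -> psi x = 0) ->
  Cc psi /\ forall i x, M < `|x| -> 'D_(e i) psi x = 0.
Proof.
move=> sp pM; have Dp := smooth_C1on sp; split.
  by split; [move=> x; exact: C1on_continuous openT Dp Logic.I|exists M].
move=> i x xM; apply: (@is_derive_off _ _ [set y | `|y| <= M] psi x (e i)).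
- exact: compact_cube.
- by move=> y /= /negP; rewrite -ltNge => /pM.
- by move=> /=; apply/negP; rewrite -ltNge.
- exact: Dp.1.
Qed.

Lemma smooth_smear psi g (M : R) : smooth_on setT psi -> (forall x, M < `|x| -> psi x = 0) ->
  Cc g -> smooth_on setT (smear psi g).
Proof.
move=> sp pM Cg k; elim: k psi sp pM => [|k IH] psi sp pM; have [Cp Cpd] := smooth_Cc sp pM.
  by apply/Ck_along0/(within_openP _ openT) => x _; exact: continuous_smear.
have Cpd' i : Cc ('D_(e i) psi) by have [] := smooth_Cc (smooth_derive i sp) (Cpd i).
have D i x := is_derive_smear_kernel x i (smooth_C1on sp) Cp Cpd' Cg.
apply/Ck_along_rec; split.
- by apply/(within_openP _ openT) => x _; exact: continuous_smear.
- by move=> x _ _ [i _ <-]; have [] := D i x.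
- move=> _ [i _ <-]; have H := IH _ (smooth_derive i sp) (Cpd i).
  rewrite (_ : 'D_(e i) _ = fun x => - 2 * smear ('D_(e i) psi) g x + smear ('D_(e i) psi) g x).
    exact: Ck_along_linear.
  by apply/funext => x; have [_ ->] := D i x; ring.
Qed.

Lemma smear_approx psi g x (d : R) (r : R) : Cc psi -> Cc g -> (forall y, 0 <= psi y) -> 0 < I psi ->
  (forall y, r < `|y| -> psi y = 0) -> (forall y, `|y| <= r -> `|g (y + x) - g x| <= d) -> 0 <= d ->
  `|(I psi)^-1 * smear psi g x - g x| <= d.
Proof.
move=> Cp Cg p0 Ip pr gd d0.
have Cpg : Cc (fun y => psi y * g (y + x)) by apply: Cc_mul; [exact: Cp.1|exact: Cc_shift].
have Cpx : Cc (fun y => g x * psi y) by exact: CcZ.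
have -> : (I psi)^-1 * smear psi g x - g x = (I psi)^-1 * I (fun y => psi y * g (y + x) - g x * psi y).
  by rewrite intB // mulrBr intZ // -smearE //; [rewrite [_ * (g x * _)]mulrCA mulVf ?gt_eqF ?mulr1|exact: Cg.1].
rewrite normrM gtr0_norm ?invr_gt0 // ler_pdivrMl //.
apply: (le_trans (int_norm (g := fun y => d * psi y) _ _ _)).
- exact: CcB.
- exact: CcZ.
- move=> y; have [yr|yr] := leP `|y| r; last by rewrite pr // mul0r !mulr0 subrr normr0.
  by rewrite [g x * _]mulrC -mulrBr normrM ger0_norm // mulrC; apply: ler_wpM2r => //; exact: gd.
- by rewrite intZ // mulrC.
Qed.

Definition solves_smooth (O : set V) (c : 'I_n -> 'I_n -> V -> R) : Prop :=
  forall f, test_function O f -> I (fun x => \sum_i \sum_j c i j x * partial2 f i j x) = 0.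

Definition small_mollifier (r : R) x : R := mollifier (r^-1 *: x).

Lemma small_mollifier_out (r : R) x : 0 < r -> r < `|x| -> small_mollifier r x = 0.
Proof.
move=> r0 rx; apply: flat_prod_out; rewrite normrZ normfV gtr0_norm //.
by rewrite mulrC ltr_pdivlMr // mul1r.
Qed.

(** A C^2 test function is mollified at a small radius. Its support stays in a compact neighbourhood
    [K2] of [K] inside [O], on which [c] is bounded, and its second derivatives converge
    uniformly. *)
Lemma solves_of_smooth (O : set V) (c : 'I_n -> 'I_n -> V -> R) : open O ->
  (forall i j x, O x -> {for x, continuous (c i j)}) -> solves_smooth O c -> solves O c.
Proof.
move=> oO cc sc f fd fdd tf.
have [K [cK KO fK fdK fddK]] := test_support tf.
have [d d0 Hd] := compact_open_dist cK oO KO.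
(* With radius d/3 all points of [K2], the closure included, lie within 2d/3 of [K]. *)
pose r0 := d / 3; have r00 : 0 < r0 by rewrite divr_gt0.
pose K2 := closure [set y | exists2 x, K x & `|y - x| <= r0].
have [M0 [_ KM]] := compact_bounded cK.
pose M : R := `|M0| + 1.
have K2near y : K2 y -> exists2 x, K x & `|y - x| < d.
  move=> K2y; have : nbhs y (ball y r0) by exact: nbhsx_ballx.
  move=> /K2y [z [[x Kx zx]]]; rewrite -ball_normE /= => yz; exists x => //.
  rewrite -[y](subrK z) -addrA; apply: (le_lt_trans (ler_normD _ _)); rewrite /r0 in zx yz; lra.
have K2O : K2 `<=` O by move=> y /K2near [x Kx yx]; exact: Hd yx.
have K2M y : K2 y -> `|y| <= M + d.
  move=> /K2near [x Kx yx]; rewrite -[y](subrK x) addrC; apply: (le_trans (ler_normD _ _)).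
  apply: lerD; last exact: ltW.
  by apply: (KM M) => //; rewrite /M (le_lt_trans (ler_norm _)) // ltrDl.
have cK2 : compact K2.
  apply: bounded_closed_compact; last exact: closed_closure.
  exists (M + d); split; first exact: num_real.
  by move=> N MN y K2y; apply: le_trans (K2M y K2y) _; exact: ltW.
have KK2 y x : K x -> `|y - x| <= r0 -> K2 y.
  by move=> Kx yx; apply: subset_closure; exists x.
have [C2f _] := tf; have Dfd i := C2f.2 i.
have Df := C2on_C1on openT C2f.
have Cf : Cc f.
  apply: Cc_vanish; first by move=> x; exact: C1on_continuous openT Df Logic.I.
  by exists K; split.
have Cfd i : Cc (fd i).
  apply: Cc_vanish; first by move=> x; exact: C1on_continuous openT (Dfd i) Logic.I.
  by exists K; split => // x; exact: fdK.
have Cfdd i j : Cc (fdd i j) := Cc_test2 i j tf.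
pose phi := small_mollifier.
have phi0 r x : 0 <= phi r x by exact: mollifier_ge0.
have phis r : smooth_on setT (phi r) by move=> k; apply: Ck_along_dilate; exact: smooth_mollifier.
have phiC r : 0 < r -> Cc (phi r).
  by move=> r1; have [] := smooth_Cc (phis r) (fun x => small_mollifier_out r1).
have phiI r : 0 < r -> 0 < I (phi r).
  move=> r1; apply: (int_gt0 (x0 := 0) (phiC _ r1)) => //.
  by rewrite /phi /small_mollifier scaler0; apply: mollifier_gt0; rewrite normr0.
have supp g r x : 0 < r -> r <= r0 -> (forall x, ~ K x -> g x = 0) -> smear (phi r) g x != 0 -> K2 x.
  move=> r1 rr gK sx; have [y gy] : exists y, phi r (y - x) * g y != 0.
    apply: contrapT => /forallNP H; move/eqP: sx; apply; rewrite /smear -[RHS](@int0 R n).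
    by congr (integral_Rn _); apply/funext => y; apply/eqP/negPn/negP; exact: H.
  have Ky : K y by apply: contrapT => /gK gy0; rewrite gy0 mulr0 eqxx in gy.
  apply: (KK2 _ y) => //; rewrite distrC leNgt; apply/negP => yx.
  have z : phi r (y - x) = 0 by apply: small_mollifier_out => //; exact: le_lt_trans yx.
  by rewrite z mul0r eqxx in gy.
have E1 r i : 0 < r -> 'D_(e i) (smear (phi r) f) = smear (phi r) (fd i).
  by move=> r1; apply/funext => x; have [_ ->] := is_derive_smear x i Df (phiC _ r1) Cf Cfd.
have E2 r i j : 0 < r -> 'D_(e j) (smear (phi r) (fd i)) = smear (phi r) (fdd i j).
  by move=> r1; apply/funext => x; have [_ ->] := is_derive_smear x j (Dfd i) (phiC _ r1) (Cfd i) (Cfdd i).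
have tphi r : 0 < r -> r <= r0 -> test_function O (smear (phi r) f).
  move=> r1 rr; have sub : closure [set x | smear (phi r) f x != 0] `<=` K2.
    have clK2 : closed K2 by exact: closed_closure.
    rewrite [X in _ `<=` X]((closure_id K2).1 clK2).
    apply: closure_subset => x; exact: supp.
  split; first by apply: smooth_smear (fun x => small_mollifier_out r1) Cf; exact: phis.
  - by apply: subclosed_compact sub => //; exact: closed_closure.
  - exact: subset_trans K2O.
have vg g : continuous g -> (forall x, g x != 0 -> K2 x) -> vanish_off O g.
  by move=> cg gK; exists K2; split => // x K2x; apply/eqP/negPn/negP => /gK.
have cS r i j : 0 < r -> continuous (smear (phi r) (fdd i j)).
  by move=> r1; apply: continuous_smear => //; exact: phiC.
have Cs r i j : 0 < r -> r <= r0 -> Cc (fun x => c i j x * smear (phi r) (fdd i j) x).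
  move=> r1 rr; apply: (Cc_cut oO) => //; [exact: cc|exact: cS|].
  by apply: vg; [exact: cS|move=> x; apply: supp => // y; exact: fddK].
have Cc0' i j : Cc (fun x => c i j x * fdd i j x) by apply: (Cc_pairing oO) tf; exact: cc.
pose T i j := I (fun x => c i j x * fdd i j x).
(* The kernel has mass [I (phi r)], by which the mollified pairing is divided before it is compared
   with [T]. *)
pose Tr r i j := (I (phi r))^-1 * I (fun x => c i j x * smear (phi r) (fdd i j) x).
have Tr0 r : 0 < r -> r <= r0 -> \sum_i \sum_j Tr r i j = 0.
  move=> r1 rr; have := sc _ (tphi r r1 rr).
  have -> : (fun x => \sum_i \sum_j c i j x * partial2 (smear (phi r) f) i j x) =
            (fun x => \sum_i \sum_j c i j x * smear (phi r) (fdd i j) x).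
    by apply/funext => x; apply: eq_bigr => i _; apply: eq_bigr => j _; rewrite -E2 // -E1.
  rewrite int_sum; last by move=> i; apply: Cc_sum => j; exact: Cs.
  move=> H; have -> : \sum_i \sum_j Tr r i j =
      (I (phi r))^-1 * \sum_i I (fun x => \sum_j c i j x * smear (phi r) (fdd i j) x).
    rewrite [RHS]mulr_sumr; apply: eq_bigr => i _.
    rewrite int_sum; last by move=> j; exact: Cs.
    by rewrite [RHS]mulr_sumr.
  by rewrite H mulr0.
have TE : I (fun x => \sum_i \sum_j c i j x * fdd i j x) = \sum_i \sum_j T i j.
  rewrite int_sum; last by move=> i; apply: Cc_sum => j; exact: Cc0'.
  by apply: eq_bigr => i _; rewrite int_sum // => j; exact: Cc0'.
rewrite TE; apply/eqP; rewrite -normr_le0; apply/ler_addgt0Pr => /= eps eps0; rewrite add0r.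
have e1 : 0 < eps / (n%:R * n%:R + 1) by rewrite divr_gt0 // ltr_wpDl // mulr_ge0.
have app i j : \forall r \near (0 : R)^'+, `|T i j - Tr r i j| <= eps / (n%:R * n%:R + 1).
  have [B B0 HB] := compact_bound cK2 (fun x Kx => cc i j x (K2O _ Kx)).
  pose N : R := I (cutoff (M + d)).
  have N0 : 0 <= N by apply: int_ge0; [exact: Cc_cutoff|exact: cutoff_ge0].
  (* [B] bounds [c i j] on [K2] and [N] bounds the volume of [K2], so the error is at most
     [B * dl * N]. *)
  pose dl := eps / (n%:R * n%:R + 1) / (B * N + 1).
  have dl0 : 0 < dl by rewrite divr_gt0 // ltr_wpDl // mulr_ge0.
  have [s s0 Hs] := Cc_unif (Cfdd i j) dl0.
  near=> r.
  have r1 : 0 < r by near: r; exact: nbhs_right_gt.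
  have rr : r <= r0 by near: r; exact: nbhs_right_le.
  have rs : r < s by near: r; exact: nbhs_right_lt.
  rewrite /T /Tr -intZ; last exact: Cs.
  rewrite -intB //; last by apply: CcZ; exact: Cs.
  apply: (le_trans (int_norm (g := fun x => B * dl * cutoff (M + d) x) _ _ _)).
  - by apply: CcB => //; apply: CcZ; exact: Cs.
  - by apply: CcZ; exact: Cc_cutoff.
  - move=> x; rewrite mulrCA -mulrBr.
    have [K2x|K2x] := pselect (K2 x).
      rewrite cutoff1 ?mulr1; last exact: K2M.
      rewrite normrM distrC; apply: ler_pM => //; first exact: HB.
      apply: (smear_approx (phiC _ r1) (Cfdd i j) (phi0 r) (phiI _ r1) (fun y => small_mollifier_out r1)) (ltW dl0).
      move=> y yr; apply/ltW/Hs; rewrite addrK; exact: le_lt_trans rs.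
    have -> : smear (phi r) (fdd i j) x = 0.
      by apply/eqP/negPn/negP => /(supp (fdd i j) r x r1 rr (fun y => @fddK y i j)).
    have -> : fdd i j x = 0.
      by apply: fddK => Kx; apply: K2x; apply: (KK2 _ x) => //; rewrite subrr normr0 ltW.
    by rewrite mulr0 subrr mulr0 normr0 mulr_ge0 ?cutoff_ge0 // mulr_ge0 // ltW.
  - rewrite intZ; last exact: Cc_cutoff.
    rewrite -/N mulrAC /dl mulrA ler_pdivrMr ?ltr_wpDl ?mulr_ge0 // mulrC ler_pM2l // lerDl //.
have : \forall r \near (0 : R)^'+, forall i j, `|T i j - Tr r i j| <= eps / (n%:R * n%:R + 1).
  by apply: filter_forall => i; apply: filter_forall => j; exact: app.
move=> Happ.
have [r [Hr [r1 rr]]] : exists r, (forall i j, `|T i j - Tr r i j| <= eps / (n%:R * n%:R + 1)) /\ (0 < r /\ r <= r0).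
  apply: (@filter_ex _ (0 : R)^'+); apply: filterI Happ _.
  by apply: filterI; [exact: nbhs_right_gt|exact: nbhs_right_le].
have -> : \sum_i \sum_j T i j = \sum_i \sum_j (T i j - Tr r i j).
  under [RHS]eq_bigr do rewrite sumrB.
  by rewrite sumrB Tr0 // subr0.
apply: (le_trans (ler_norm_sum _ _ _)).
apply: (@le_trans _ _ (\sum_(i < n) \sum_(j < n) eps / (n%:R * n%:R + 1))).
  apply: ler_sum => i _; apply: (le_trans (ler_norm_sum _ _ _)); apply: ler_sum => j _; exact: Hr.
rewrite !sumr_const !card_ord -mulrnA -[_ *+ _]mulr_natr natrM mulrAC.
by rewrite ler_pdivrMr ?ltr_wpDl ?mulr_ge0 // ler_pM2l // lerDl.
Unshelve. all: by end_near. Qed.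

End Mollify.

(** * Energy estimate and Liouville theorem *)

Section Differences.
Context {R : realType} {n : nat}.
Notation V := 'rV[R]_n.
Notation I := (@integral_Rn R n).
Implicit Types (f g : V -> R) (x y h : V) (O : set V).

Definition delta h f x : R := f (x + h) - f x.

Lemma C1on_shift O f fd h : C1on O f fd ->
  C1on [set x | O (x + h)] (fun x => f (x + h)) (fun i x => fd i (x + h)).
Proof.
move=> /(C1on_affine 1 h).
have -> : [set x : V | O (1 *: x + h)] = [set x | O (x + h)].
  by apply/funext => x; rewrite /= scale1r.
have -> : (fun x => f (1 *: x + h)) = (fun x => f (x + h)) by apply/funext => x; rewrite scale1r.
congr (C1on _ _ _); apply/funext => i; apply/funext => x; by rewrite scale1r mul1r.
Qed.

Lemma C2on_shift O f fd fdd h : C2on O f fd fdd ->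
  C2on [set x | O (x + h)] (fun x => f (x + h)) (fun i x => fd i (x + h)) (fun i j x => fdd i j (x + h)).
Proof.
move=> [df cf]; split; last by move=> i; exact: C1on_shift.
move=> x /= Ox i; have := @is_derive_affine R n f x (Defs.coord i) 1 (fd i (x + h)) h.
rewrite scale1r mul1r => /(_ (df _ Ox i)).
by congr (is_derive _ _ _ _); apply/funext => y; rewrite scale1r.
Qed.

Lemma C2on_delta f fd fdd h : C2on setT f fd fdd ->
  C2on setT (delta h f) (fun i => delta h (fd i)) (fun i j => delta h (fdd i j)).
Proof.
move=> Cf; have := C2onD (-1) Cf (C2on_shift h Cf).
congr (C2on _ _ _ _).
- by apply/funext => x; rewrite /delta mulN1r addrC.
- by apply/funext => i; apply/funext => x; rewrite /delta mulN1r addrC.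
- by apply/funext => i; apply/funext => j; apply/funext => x; rewrite /delta mulN1r addrC.
Qed.

Lemma C1on_delta f fd h : C1on setT f fd -> C1on setT (delta h f) (fun i => delta h (fd i)).
Proof.
move=> Cf; have := C1onD (-1) Cf (C1on_shift h Cf).
congr (C1on _ _ _); first by apply/funext => x; rewrite /delta mulN1r addrC.
by apply/funext => i; apply/funext => x; rewrite /delta mulN1r addrC.
Qed.

Lemma vanish_off_shift O f h : vanish_off O f -> vanish_off [set x | O (x + h)] (fun x => f (x + h)).
Proof.
move=> [K [cK KO fK]]; exists ((fun y => y - h) @` K); split.
- apply: continuous_compact cK; apply: continuous_subspaceT => x.
  by apply: (@continuousB _ _ _ id (fun=> h)); [exact: cvg_id|exact: (@cst_continuous _ _ h x)].
- by move=> _ [y Ky <-] /=; rewrite subrK; exact: KO.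
- by move=> x Kx; apply: fK => Kxh; apply: Kx; exists (x + h) => //; rewrite addrK.
Qed.

Lemma test_shift O f fd fdd h : test O f fd fdd ->
  test [set x | O (x + h)] (fun x => f (x + h)) (fun i x => fd i (x + h)) (fun i j x => fdd i j (x + h)).
Proof. by move=> [Cf vf]; split; [exact: (C2on_shift h Cf)|exact: vanish_off_shift]. Qed.

Lemma solves_shift O (c : 'I_n -> 'I_n -> V -> R) h : open O -> (forall i j x, O x -> {for x, continuous (c i j)}) ->
  solves O c -> solves [set x | O (x + h)] (fun i j x => c i j (x + h)).
Proof.
move=> oO cc sc f fd fdd tf.
have := test_shift (- h) tf.
have -> : [set x | [set x | O (x + h)] (x - h)] = O by apply/funext => x /=; rewrite subrK.
move=> tf'; rewrite -[RHS](sc _ _ _ tf').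
rewrite -[RHS](int_shift h); last first.
  by apply: Cc_sum => i; apply: Cc_sum => j; apply: (Cc_pairing oO) tf'; exact: cc.
congr (integral_Rn _); apply/funext => x; apply: eq_bigr => i _; apply: eq_bigr => j _.
by rewrite addrK.
Qed.

Lemma solves_linear O (c d : 'I_n -> 'I_n -> V -> R) (k : R) : open O ->
  (forall i j x, O x -> {for x, continuous (c i j)}) ->
  (forall i j x, O x -> {for x, continuous (d i j)}) ->
  solves O c -> solves O d -> solves O (fun i j x => k * c i j x + d i j x).
Proof.
move=> oO cc cd sc sd f fd fdd tf.
have Hc := sc _ _ _ tf; have Hd := sd _ _ _ tf.
have C1 : Cc (fun x => \sum_i \sum_j c i j x * fdd i j x).
  by apply: Cc_sum => i; apply: Cc_sum => j; apply: (Cc_pairing oO) tf; exact: cc.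
have C2 : Cc (fun x => \sum_i \sum_j d i j x * fdd i j x).
  by apply: Cc_sum => i; apply: Cc_sum => j; apply: (Cc_pairing oO) tf; exact: cd.
rewrite (_ : (fun x => _) = (fun x => k * (\sum_i \sum_j c i j x * fdd i j x) + \sum_i \sum_j d i j x * fdd i j x)).
  by rewrite intD ?intZ ?Hc ?Hd ?mulr0 ?addr0 //; exact: CcZ.
apply/funext => x; rewrite mulr_sumr -big_split; apply: eq_bigr => i _ /=.
by rewrite mulr_sumr -big_split; apply: eq_bigr => j _ /=; rewrite mulrDl mulrA.
Qed.

End Differences.

Section Algebra.
Context {R : realType}.

Lemma amgm (x y e : R) : 0 < e -> `|x * y| <= e * x ^+ 2 + (4 * e)^-1 * y ^+ 2.
Proof.
move=> e0; have e4 : 0 < 4 * e by rewrite mulr_gt0.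
have H (z : R) : z * y <= e * z ^+ 2 + (4 * e)^-1 * y ^+ 2.
  have -> : e * z ^+ 2 + (4 * e)^-1 * y ^+ 2 = z * y + (4 * e)^-1 * (2 * e * z - y) ^+ 2.
    by field; rewrite gt_eqF.
  by rewrite lerDl mulr_ge0 ?invr_ge0 ?sqr_ge0 // ltW.
rewrite ler_norml; apply/andP; split; last exact: H.
by have := H (- x); rewrite sqrrN mulNr; lra.
Qed.

Lemma sq_le (x B : R) : `|x| <= B -> x ^+ 2 <= B ^+ 2.
Proof. by move=> xB; rewrite -[x ^+ 2]ger0_norm ?sqr_ge0 // normrX; apply: lerXn2r => //; rewrite nnegrE // (le_trans _ xB). Qed.

End Algebra.

(** * Pointwise inequalities for the Caccioppoli estimate *)

Section Caccioppoli.
Context {R : realType} {n : nat}.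
Notation V := 'rV[R]_n.
Notation I := (@integral_Rn R n).
Context (A : 'I_n -> 'I_n -> 'I_n -> 'I_n -> R) (Lam : R).

(** Only symmetric arrays are tested, as Hessians are symmetric; the array [A] itself need not have
    any symmetry. *)
Definition elliptic (lam : R) : Prop := forall xi : 'I_n -> 'I_n -> R, (forall i j, xi i j = xi j i) ->
  lam * (\sum_i \sum_j xi i j ^+ 2) <= \sum_i \sum_j \sum_k \sum_l A i j k l * xi i j * xi k l.

Definition entire (g : V -> R) gd gdd : Prop :=
  C2on setT g gd gdd /\ solves setT (fun i j x => \sum_k \sum_l A i j k l * gdd k l x).

Lemma continuous_flux (gdd : 'I_n -> 'I_n -> V -> R) i j x :
  (forall k l, {for x, continuous (gdd k l)}) ->
  {for x, continuous (fun x => \sum_k \sum_l A i j k l * gdd k l x)}.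
Proof.
move=> cg; apply: cont_sum => k; apply: cont_sum => l.
by apply: contM; [exact: cont_cst|exact: cg].
Qed.

Lemma entire_delta g gd gdd h : entire g gd gdd ->
  entire (delta h g) (fun i => delta h (gd i)) (fun i j => delta h (gdd i j)).
Proof.
move=> [Cg sg]; split; first exact: C2on_delta.
pose c (f : 'I_n -> 'I_n -> V -> R) i j x := \sum_k \sum_l A i j k l * f k l x.
have cc i j x : setT x -> {for x, continuous (c gdd i j)}.
  by move=> _; apply: continuous_flux => k l; exact: (Cg.2 k).2.
have ss := solves_shift (h := h) openT cc sg.
have cs i j x : setT x -> {for x, continuous (c (fun k l x => gdd k l (x + h)) i j)}.
  by move=> _; apply: continuous_flux => k l; exact: ((C2on_shift h Cg).2 k).2.
have := solves_linear (-1) openT cc cs sg ss.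
congr (solves _ _); apply/funext => i; apply/funext => j; apply/funext => x.
rewrite /c mulN1r addrC -sumrB; apply: eq_bigr => k _; rewrite -sumrB; apply: eq_bigr => l _.
by rewrite /delta mulrBr.
Qed.

(** Young's inequality for the terms in which a derivative falls on the fourth power of the cutoff
    [b], whose radius is the reciprocal of [r]. Each such term retains a factor b^2, so it pairs
    with b^2 g_kl and that part can be absorbed by ellipticity. *)
Lemma pointwise_term (a b bi bj bij gkl gi gj g r B e : R) : 0 < e -> 0 <= B ->
  `|a| <= Lam -> `|b| <= B -> `|bi| <= B -> `|bj| <= B -> `|bij| <= B ->
  `|a * gkl * (4 * b ^+ 3 * r * (bi * gj + bj * gi) + r ^+ 2 * (12 * b ^+ 2 * bi * bj + 4 * b ^+ 3 * bij) * g)|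
  <= 2 * e * (b ^+ 4 * gkl ^+ 2) + (8 * Lam ^+ 2 * B ^+ 2 / e) * (r ^+ 2 * b ^+ 2 * (gi ^+ 2 + gj ^+ 2))
     + (64 * Lam ^+ 2 * B ^+ 4 / e) * (r ^+ 4 * g ^+ 2).
Proof.
move=> e0 B0 aL bB biB bjB bijB.
have L0 : 0 <= Lam by apply: le_trans aL.
have -> : a * gkl * (4 * b ^+ 3 * r * (bi * gj + bj * gi) + r ^+ 2 * (12 * b ^+ 2 * bi * bj + 4 * b ^+ 3 * bij) * g)
  = (b ^+ 2 * gkl) * (4 * a * b * r * (bi * gj + bj * gi))
    + (b ^+ 2 * gkl) * (a * r ^+ 2 * (12 * bi * bj + 4 * b * bij) * g) by ring.
apply: (le_trans (ler_normD _ _)).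
have H1 := amgm (b ^+ 2 * gkl) (4 * a * b * r * (bi * gj + bj * gi)) e0.
have H2 := amgm (b ^+ 2 * gkl) (a * r ^+ 2 * (12 * bi * bj + 4 * b * bij) * g) e0.
apply: (le_trans (lerD H1 H2)).
have a2 : a ^+ 2 <= Lam ^+ 2 := sq_le aL.
have bi2 := sq_le biB; have bj2 := sq_le bjB.
have K1 : (bi * gj + bj * gi) ^+ 2 <= 2 * B ^+ 2 * (gi ^+ 2 + gj ^+ 2).
  have : (bi * gj + bj * gi) ^+ 2 <= 2 * (bi ^+ 2 * gj ^+ 2 + bj ^+ 2 * gi ^+ 2).
    rewrite -subr_ge0 (_ : _ - _ = (bi * gj - bj * gi) ^+ 2) ?sqr_ge0 //; ring.
  move=> /le_trans; apply; rewrite -mulrA ler_pM2l //.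
  by rewrite [gi ^+ 2 + _]addrC mulrDr; apply: lerD; apply: ler_wpM2r => //; exact: sqr_ge0.
have K2 : (12 * bi * bj + 4 * b * bij) ^+ 2 <= (16 * B ^+ 2) ^+ 2.
  apply: sq_le; apply: (le_trans (ler_normD _ _)).
  have -> : 16 * B ^+ 2 = 12 * (B * B) + 4 * (B * B) by ring.
  rewrite -!mulrA normrM [`|4 * _|]normrM (ger0_norm (ler0n _ 12)) (ger0_norm (ler0n _ 4)).
  by rewrite !normrM; apply: lerD; apply: ler_wpM2l => //; apply: ler_pM.
have r2 : 0 <= r ^+ 2 := sqr_ge0 r. have b2 : 0 <= b ^+ 2 := sqr_ge0 b. have g2 : 0 <= g ^+ 2 := sqr_ge0 g.
have J1 : (4 * a * b * r * (bi * gj + bj * gi)) ^+ 2 <= 32 * Lam ^+ 2 * B ^+ 2 * (r ^+ 2 * b ^+ 2 * (gi ^+ 2 + gj ^+ 2)).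
  have -> : (4 * a * b * r * (bi * gj + bj * gi)) ^+ 2 = (16 * (r ^+ 2 * b ^+ 2)) * (a ^+ 2 * (bi * gj + bj * gi) ^+ 2) by ring.
  have -> : 32 * Lam ^+ 2 * B ^+ 2 * (r ^+ 2 * b ^+ 2 * (gi ^+ 2 + gj ^+ 2)) =
     (16 * (r ^+ 2 * b ^+ 2)) * (Lam ^+ 2 * (2 * B ^+ 2 * (gi ^+ 2 + gj ^+ 2))) by ring.
  apply: ler_wpM2l; first by rewrite mulr_ge0 // mulr_ge0.
  by apply: ler_pM => //; exact: sqr_ge0.
have J2 : (a * r ^+ 2 * (12 * bi * bj + 4 * b * bij) * g) ^+ 2 <= 256 * Lam ^+ 2 * B ^+ 4 * (r ^+ 4 * g ^+ 2).
  have -> : (a * r ^+ 2 * (12 * bi * bj + 4 * b * bij) * g) ^+ 2 = (r ^+ 4 * g ^+ 2) * (a ^+ 2 * (12 * bi * bj + 4 * b * bij) ^+ 2) by ring.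
  have -> : 256 * Lam ^+ 2 * B ^+ 4 * (r ^+ 4 * g ^+ 2) = (r ^+ 4 * g ^+ 2) * (Lam ^+ 2 * (16 * B ^+ 2) ^+ 2) by ring.
  apply: ler_wpM2l; first by rewrite mulr_ge0 // (_ : r ^+ 4 = (r ^+ 2) ^+ 2) ?sqr_ge0 // -exprM.
  by apply: ler_pM => //; exact: sqr_ge0.
have e4 : 0 <= (4 * e)^-1 by rewrite invr_ge0 mulr_ge0 // ltW.
have := lerD (ler_wpM2l e4 J1) (ler_wpM2l e4 J2).
have -> : (4 * e)^-1 * (32 * Lam ^+ 2 * B ^+ 2 * (r ^+ 2 * b ^+ 2 * (gi ^+ 2 + gj ^+ 2))) =
  8 * Lam ^+ 2 * B ^+ 2 / e * (r ^+ 2 * b ^+ 2 * (gi ^+ 2 + gj ^+ 2)) by field; rewrite gt_eqF.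
have -> : (4 * e)^-1 * (256 * Lam ^+ 2 * B ^+ 4 * (r ^+ 4 * g ^+ 2)) = 64 * Lam ^+ 2 * B ^+ 4 / e * (r ^+ 4 * g ^+ 2).
  by field; rewrite gt_eqF.
have -> : e * (b ^+ 2 * gkl) ^+ 2 = e * (b ^+ 4 * gkl ^+ 2) by ring.
lra.
Qed.

(** The bracket multiplied by [2 * r ^+ 2] is the i-th derivative of b^2 g g_i and integrates to 0.
    What is left bounds the gradient term by an absorbable multiple of b^4 g_ii^2 and a multiple of
    g^2. *)
Lemma pointwise_gradient (b bi g gi gii r B e : R) : 0 < e -> `|bi| <= B ->
  r ^+ 2 * b ^+ 2 * gi ^+ 2 <=
  2 * r ^+ 2 * (2 * b * (r * bi) * (g * gi) + b ^+ 2 * (gi * gi + g * gii))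
  + 2 * e * (b ^+ 4 * gii ^+ 2) + (4 * B ^+ 2 + (2 * e)^-1) * (r ^+ 4 * g ^+ 2).
Proof.
move=> e0 biB; have bi2 := sq_le biB.
have /ler_normlP [H1 _] := amgm (b ^+ 2 * gii) (r ^+ 2 * g) e0.
have h4 : (0 : R) < 2^-1 by rewrite invr_gt0.
have /ler_normlP [H2 _] := amgm (r * b * gi) (2 * r ^+ 2 * bi * g) h4.
have r4 : 0 <= r ^+ 4 * g ^+ 2.
  by rewrite mulr_ge0 ?sqr_ge0 // (_ : r ^+ 4 = (r ^+ 2) ^+ 2) ?sqr_ge0 // -exprM.
have H3 : bi ^+ 2 * (r ^+ 4 * g ^+ 2) <= B ^+ 2 * (r ^+ 4 * g ^+ 2) by apply: ler_wpM2r.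
have E1 : (4 * e)^-1 * (r ^+ 2 * g) ^+ 2 = (4 * e)^-1 * (r ^+ 4 * g ^+ 2) by ring.
have E2 : (4 * 2^-1)^-1 * (2 * r ^+ 2 * bi * g) ^+ 2 = 2 * (bi ^+ 2 * (r ^+ 4 * g ^+ 2)) by field.
have E3 : (2 * e)^-1 = 2 * (4 * e)^-1 by field; rewrite gt_eqF.
rewrite E1 in H1; rewrite E2 in H2; rewrite E3.
have E4 : e * (b ^+ 2 * gii) ^+ 2 = e * (b ^+ 4 * gii ^+ 2) by ring.
rewrite E4 in H1.
have E5 : 2^-1 * (r * b * gi) ^+ 2 = 2^-1 * (r ^+ 2 * b ^+ 2 * gi ^+ 2) by ring.
rewrite E5 in H2.
have E6 : 2 * r ^+ 2 * (2 * b * (r * bi) * (g * gi) + b ^+ 2 * (gi * gi + g * gii))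
 = 2 * (r * b * gi * (2 * r ^+ 2 * bi * g)) + 2 * (r ^+ 2 * b ^+ 2 * gi ^+ 2) + 2 * (b ^+ 2 * gii * (r ^+ 2 * g)) by ring.
rewrite E6; lra.
Qed.

End Caccioppoli.

Section FiniteSums.
Context {R : realType}.

Lemma mean_square (m : nat) (a : 'I_m -> R) : (0 < m)%N ->
  (m%:R^-1 * \sum_j a j) ^+ 2 <= m%:R^-1 * \sum_j a j ^+ 2.
Proof.
move=> m0; have mr : 0 < m%:R :> R by rewrite ltr0n.
set mu := _ * \sum_j a j.
have E : \sum_j a j = m%:R * mu by rewrite /mu mulVKf // gt_eqF.
have H : 0 <= \sum_j (a j - mu) ^+ 2 by apply: sumr_ge0 => j _; exact: sqr_ge0.
have EE : \sum_j (a j - mu) ^+ 2 = \sum_j a j ^+ 2 - m%:R * mu ^+ 2.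
  under eq_bigr do rewrite sqrrB.
  rewrite big_split sumrB /= sumr_const card_ord -[mu ^+ 2 *+ m]mulr_natl.
  under [X in _ - X + _]eq_bigr do rewrite -mulr_natr -mulrA.
  by rewrite -mulr_suml E; ring.
by rewrite ler_pdivlMl //; move: H; rewrite EE; lra.
Qed.

Lemma sum_cst n (c : R) : \sum_(i < n) c = n%:R * c.
Proof. by rewrite sumr_const card_ord mulr_natl. Qed.

End FiniteSums.

(** The product rule for b^4 g in the form in which nested uses of [C2onM] deliver it; derivatives
    of [b] carry their scaling factor [r]. *)
Lemma cutoff_hessian {R : comNzRingType} (b r bi bj bij g gi gj gij : R) :
  (((r ^+ 2 * bij) * b + (r * bi) * (r * bj) + ((r * bj) * (r * bi) + b * (r ^+ 2 * bij))) * (b * b) +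
     ((r * bi) * b + b * (r * bi)) * ((r * bj) * b + b * (r * bj)) +
     (((r * bj) * b + b * (r * bj)) * ((r * bi) * b + b * (r * bi)) +
      b * b * ((r ^+ 2 * bij) * b + (r * bi) * (r * bj) + ((r * bj) * (r * bi) + b * (r ^+ 2 * bij))))) * g +
    (((r * bi) * b + b * (r * bi)) * (b * b) + b * b * ((r * bi) * b + b * (r * bi))) * gj +
    ((((r * bj) * b + b * (r * bj)) * (b * b) + b * b * ((r * bj) * b + b * (r * bj))) * gi
     + b * b * (b * b) * gij)
  = b ^+ 4 * gij + (4 * b ^+ 3 * r * (bi * gj + bj * gi)
     + r ^+ 2 * (12 * b ^+ 2 * bi * bj + 4 * b ^+ 3 * bij) * g).
Proof. by ring. Qed.

Section EnergyEstimate.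
Context {R : realType} {n : nat}.
Notation V := 'rV[R]_n.
Notation I := (@integral_Rn R n).
Implicit Types (g : V -> R) (x y h : V).

Lemma Cc_bounded g : Cc g -> exists2 B : R, 0 <= B & forall x, `|g x| <= B.
Proof.
move=> [cg [M gM]]; have [B B0 HB] := compact_bound (@compact_cube R n M) (fun x _ => cg x).
by exists B => // x; have [/HB //|/gM ->] := leP `|x| M; rewrite normr0.
Qed.

Lemma Cc_of_C1 g gd (M : R) : C1on setT g gd -> (forall x, M < `|x| -> g x = 0) -> Cc g.
Proof. by move=> Cg gM; split; [move=> x; exact: C1on_continuous openT Cg Logic.I|exists M]. Qed.

Lemma derive_out g gd (M : R) i x : C1on setT g gd -> (forall x, M < `|x| -> g x = 0) ->
  M < `|x| -> gd i x = 0.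
Proof.
move=> Cg gM Mx; apply: (@is_derive_off _ _ [set y | `|y| <= M] g x (Defs.coord i)).
- exact: compact_cube.
- by move=> y /= /negP; rewrite -ltNge => /gM.
- by move=> /=; apply/negP; rewrite -ltNge.
- exact: Cg.1.
Qed.

(** The equation is tested with b^4 g, where [b] is the mollifier dilated to radius [rho]; the power
    of [rho^-1] comes from the scaling of the derivatives of [b]. *)
Lemma caccioppoli (A : 'I_n -> 'I_n -> 'I_n -> 'I_n -> R) (lam Lam : R) :
  0 < lam -> (forall i j k l, `|A i j k l| <= Lam) -> elliptic A lam ->
  exists2 C : R, 0 <= C & forall (rho : R) g gd gdd, 0 < rho -> entire A g gd gdd ->
  I (fun x => mollifier (rho^-1 *: x) ^+ 4 * \sum_i \sum_j gdd i j x ^+ 2)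
   <= C * rho^-1 ^+ 4 * I (fun x => cutoff rho x * g x ^+ 2).
Proof.
move=> lam0 AL Ae.
have sm := @smooth_mollifier R n.
pose m0 : V -> R := mollifier.
pose md i : V -> R := 'D_(Defs.coord i) m0.
pose mdd i j : V -> R := 'D_(Defs.coord j) (md i).
have Cm1 : C1on setT m0 md := smooth_C1on sm.
have Cm2 i : C1on setT (md i) (mdd i) := smooth_C1on (smooth_derive i sm).
have m_out x : 1 < `|x| -> m0 x = 0 by exact: flat_prod_out.
have md_out i x : 1 < `|x| -> md i x = 0 by exact: derive_out Cm1 m_out.
have mdd_out i j x : 1 < `|x| -> mdd i j x = 0 by exact: derive_out (Cm2 i) (md_out i).
have [B0 B00 HB0] := Cc_bounded (Cc_of_C1 Cm1 m_out).
have /choice [B1 HB1] i : exists b : R, 0 <= b /\ forall x, `|md i x| <= b.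
  by have [b b0 Hb] := Cc_bounded (Cc_of_C1 (Cm2 i) (md_out i)); exists b.
have Cmdd i j : Cc (mdd i j).
  have Cm3 := smooth_C1on (smooth_derive j (smooth_derive i sm)).
  exact: Cc_of_C1 Cm3 (mdd_out i j).
have /choice [B2 HB2] (p : 'I_n * 'I_n) : exists b : R, 0 <= b /\ forall x, `|mdd p.1 p.2 x| <= b.
  by have [b b0 Hb] := Cc_bounded (Cmdd p.1 p.2); exists b.
pose B : R := B0 + \sum_i B1 i + \sum_p B2 p.
have S1 : 0 <= \sum_i B1 i by apply: sumr_ge0 => i _; exact: (HB1 i).1.
have S2 : 0 <= \sum_p B2 p by apply: sumr_ge0 => p _; exact: (HB2 p).1.
have B_ge0 : 0 <= B by rewrite /B; lra.
have mB x : `|m0 x| <= B by apply: le_trans (HB0 x) _; rewrite /B; lra.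
have mdB i x : `|md i x| <= B.
  apply: le_trans ((HB1 i).2 x) _; rewrite /B (bigD1 i) //=.
  have : 0 <= \sum_(j | j != i) B1 j by apply: sumr_ge0 => j _; exact: (HB1 j).1.
  by lra.
have mddB i j x : `|mdd i j x| <= B.
  apply: le_trans ((HB2 (i, j)).2 x) _; rewrite /B [\sum_p B2 p](bigD1 (i, j)) //=.
  have : 0 <= \sum_(p | p != (i, j)) B2 p by apply: sumr_ge0 => p _; exact: (HB2 p).1.
  by lra.
pose N : R := n%:R.
have N0 : 0 <= N by exact: ler0n.
(* [e] spends lam/2 of the ellipticity on the error terms and [e'] below spends lam/4 on the
   gradient terms; the remaining lam/4 gives the estimate. [m] is the coefficient of the gradient
   terms after summation over the four indices. *)
pose e := lam / (4 * (N ^+ 2 + 1)).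
have N2 : 0 < N ^+ 2 + 1 by rewrite ltr_wpDl // sqr_ge0.
have e0 : 0 < e by rewrite divr_gt0 // mulr_gt0.
pose a1 := 8 * Lam ^+ 2 * B ^+ 2 / e.
pose a2 := 64 * Lam ^+ 2 * B ^+ 4 / e.
have sq0 (z : R) : 0 <= z ^+ 2 := sqr_ge0 z.
have B40 : 0 <= B ^+ 4 by rewrite exprn_ge0.
have a10 : 0 <= a1 by apply: divr_ge0 (ltW e0); apply: mulr_ge0 => //; apply: mulr_ge0.
have a20 : 0 <= a2 by apply: divr_ge0 (ltW e0); apply: mulr_ge0 => //; apply: mulr_ge0.
pose m := 2 * N ^+ 3 * a1.
have mm0 : 0 <= m by rewrite /m mulr_ge0 // mulr_ge0 // exprn_ge0.
pose e' := lam / (8 * (m + 1)).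
have m1 : 0 < m + 1 by rewrite ltr_wpDl.
have e'0 : 0 < e' by rewrite divr_gt0 // mulr_gt0.
pose C3 := m * (N * (4 * B ^+ 2 + (2 * e')^-1)) + a2 * N ^+ 4.
have C30 : 0 <= C3.
  apply: addr_ge0; last by apply: mulr_ge0 => //; exact: exprn_ge0.
  apply: mulr_ge0 => //; apply: mulr_ge0 => //; apply: addr_ge0; first exact: mulr_ge0.
  by rewrite invr_ge0 mulr_ge0 // ltW.
exists (4 * C3 / lam); first by rewrite divr_ge0 ?mulr_ge0 // ltW.
move=> rho g gd gdd rho0 [Cg sg].
pose r := rho^-1.
have r0 : 0 < r by rewrite invr_gt0.
have Cm : C2on setT m0 md mdd by split; [exact: Cm1.1|exact: Cm2].
have Cb := C2on_affine r 0 Cm.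
pose b x := m0 (r *: x + 0).
pose bd i x := r * md i (r *: x + 0).
pose bdd i j x := r ^+ 2 * mdd i j (r *: x + 0).
have {}Cb : C2on setT b bd bdd by apply: C2on_sub Cb.
have big_out x : rho < `|x| -> 1 < `|r *: x + 0|.
  by move=> xr; rewrite addr0 normrZ gtr0_norm // /r mulrC ltr_pdivlMr // mul1r.
have b_out x : rho < `|x| -> b x = 0 by move=> /big_out; exact: m_out.
have bd_out i x : rho < `|x| -> bd i x = 0 by move=> /big_out; rewrite /bd => /md_out ->; rewrite mulr0.
have bdd_out i j x : rho < `|x| -> bdd i j x = 0 by move=> /big_out; rewrite /bdd => /mdd_out ->; rewrite mulr0.
have Cg1 := C2on_C1on openT Cg; have Cb1 := C2on_C1on openT Cb.
have Cbb := C2onM openT Cb Cb.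
have Ceta := C2onM openT (C2onM openT Cbb Cbb) Cg.
set eta := (X in C2on _ X _ _) in Ceta.
set etad := (X in C2on _ _ X _) in Ceta.
set etadd := (X in C2on _ _ _ X) in Ceta.
have teta : test setT eta etad etadd.
  split => //; exists [set x | `|x| <= rho]; split => //; first exact: compact_cube.
  by move=> x /= /negP; rewrite -ltNge => /b_out bx; rewrite /eta bx !mul0r.
have etaE i j x : etadd i j x = b x ^+ 4 * gdd i j x +
   (4 * b x ^+ 3 * r * (md i (r *: x + 0) * gd j x + md j (r *: x + 0) * gd i x)
    + r ^+ 2 * (12 * b x ^+ 2 * md i (r *: x + 0) * md j (r *: x + 0) + 4 * b x ^+ 3 * mdd i j (r *: x + 0)) * g x).
  exact: cutoff_hessian.
pose P x := \sum_i \sum_j (\sum_k \sum_l A i j k l * gdd k l x) * etadd i j x.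
have IP : I P = 0 := sg _ _ _ teta.
have cgdd i j : continuous (gdd i j) by move=> x; exact: (Cg.2 i).2.
have cflux i j x : setT x -> {for x, continuous (fun x => \sum_k \sum_l A i j k l * gdd k l x)}.
  by move=> _; apply: continuous_flux => k l; exact: cgdd.
have CP : Cc P.
  apply: Cc_sum => i; apply: Cc_sum => j.
  exact: (Cc_pairing (c := fun i j x => \sum_k \sum_l A i j k l * gdd k l x) openT (cflux i j) teta).
(* The i-th derivative of b^2 g g_i, whose integral is 0. *)
pose D i x := (bd i x * b x + b x * bd i x) * (g x * gd i x) + b x * b x * (gd i x * gd i x + g x * gdd i i x).
have CD i : Cc (D i) /\ I (D i) = 0.
  have Ck := C1onM openT (C2on_C1on openT Cbb) (C1onM openT Cg1 (Cg.2 i)).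
  set k := (X in C1on _ X _) in Ck; set kd := (X in C1on _ _ X) in Ck.
  have k_out x : rho < `|x| -> k x = 0 by move=> /b_out bx; rewrite /k bx !mul0r.
  have kd_out j x : rho < `|x| -> kd j x = 0 by exact: derive_out Ck k_out.
  have Ckd j : Cc (kd j) by split; [move=> x; exact: Ck.2|exists rho; exact: kd_out].
  by have := int_derive i Ck (Cc_of_C1 Ck k_out) Ckd; split; [exact: (Ckd i)|].
have ID : I (fun x => \sum_i D i x) = 0.
  rewrite int_sum; last by move=> i; exact: (CD i).1.
  by rewrite big1 // => i _; exact: (CD i).2.
have CDs : Cc (fun x => \sum_i D i x) by apply: Cc_sum => i; exact: (CD i).1.
have cg : continuous g by move=> x; exact: C1on_continuous openT Cg1 Logic.I.
have Cchi : Cc (fun x => cutoff rho x * g x ^+ 2).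
  have := Cc_mul (f := fun x => g x ^+ 2) _ (Cc_cutoff rho).
  rewrite (_ : (fun x => g x ^+ 2 * _) = (fun x => cutoff rho x * g x ^+ 2)); last by apply/funext => x; rewrite mulrC.
  by apply => x; apply: contM; exact: cg.
pose SS x := \sum_i \sum_j gdd i j x ^+ 2.
have CL : Cc (fun x => b x ^+ 4 * SS x).
  split; last by exists rho => x /b_out ->; rewrite expr0n mul0r.
  move=> x; have cb : {for x, continuous b} by exact: C1on_continuous openT Cb1 Logic.I.
  apply: (@contM _ _ (fun y => b y ^+ 4) SS x); last by apply: cont_sum => i; apply: cont_sum => j; apply: contM; exact: cgdd.
  have := contM (contM cb cb) (contM cb cb).
  by rewrite (_ : (fun y => b y * b y * (b y * b y)) = (fun y => b y ^+ 4)) //; apply/funext => y; ring.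
(* Pointwise form of the estimate: [P] and the sum of the [D i] integrate to 0, so integration
   leaves only the two outer terms. *)
have key x : lam / 4 * (b x ^+ 4 * SS x) <= P x + (2 * m * r ^+ 2) * (\sum_i D i x) + (C3 * r ^+ 4) * (cutoff rho x * g x ^+ 2).
  have [xr|xr] := leP `|x| rho; last first.
    rewrite b_out // expr0n mul0r mulr0 {1}/P big1; last first.
      by move=> i _; rewrite big1 // => j _; rewrite etaE b_out // (mdd_out i j) ?big_out // !expr0n /= !(mulr0, mul0r, addr0, add0r).
    rewrite big1; last by move=> i _; rewrite /D bd_out // b_out // !(mulr0, mul0r, addr0, add0r).
    rewrite mulr0 !add0r; apply: mulr_ge0; apply: mulr_ge0 => //; last exact: cutoff_ge0.
    exact: exprn_ge0 (ltW r0).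
  rewrite cutoff1 // mul1r.
  pose bi i := md i (r *: x + 0); pose bij i j := mdd i j (r *: x + 0).
  pose E i j := 4 * b x ^+ 3 * r * (bi i * gd j x + bi j * gd i x) + r ^+ 2 * (12 * b x ^+ 2 * bi i * bi j + 4 * b x ^+ 3 * bij i j) * g x.
  pose Q := \sum_i \sum_j \sum_k \sum_l A i j k l * gdd i j x * gdd k l x.
  have HQ : lam * SS x <= Q.
    by apply: Ae => i j; exact: (C2on_sym (O := setT)) openT Cg Logic.I.
  have PE : P x = b x ^+ 4 * Q + \sum_i \sum_j \sum_k \sum_l A i j k l * gdd k l x * E i j.
    rewrite /P /Q mulr_sumr -big_split; apply: eq_bigr => i _ /=.
    rewrite mulr_sumr -big_split; apply: eq_bigr => j _ /=.
    rewrite mulr_suml mulr_sumr -big_split; apply: eq_bigr => k _ /=.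
    rewrite mulr_suml mulr_sumr -big_split; apply: eq_bigr => l _ /=.
    rewrite etaE -[X in _ * (_ + X)]/(E i j); move: (E i j) (b x) (gdd i j x) (gdd k l x) => X bx y z; ring.
  pose G1 := \sum_i gd i x ^+ 2.
  have HE : `|\sum_i \sum_j \sum_k \sum_l A i j k l * gdd k l x * E i j| <=
     2 * e * N ^+ 2 * (b x ^+ 4 * SS x) + m * (r ^+ 2 * b x ^+ 2 * G1) + a2 * N ^+ 4 * (r ^+ 4 * g x ^+ 2).
    apply: (@le_trans _ _ (\sum_(i < n) \sum_(j < n) \sum_(k < n) \sum_(l < n)
       (2 * e * (b x ^+ 4 * gdd k l x ^+ 2) + a1 * (r ^+ 2 * b x ^+ 2 * (gd i x ^+ 2 + gd j x ^+ 2)) + a2 * (r ^+ 4 * g x ^+ 2)))).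
      apply: (le_trans (ler_norm_sum _ _ _)); apply: ler_sum => i _.
      apply: (le_trans (ler_norm_sum _ _ _)); apply: ler_sum => j _.
      apply: (le_trans (ler_norm_sum _ _ _)); apply: ler_sum => k _.
      apply: (le_trans (ler_norm_sum _ _ _)); apply: ler_sum => l _.
      by apply: pointwise_term => //; [exact: mB|exact: mdB|exact: mdB|exact: mddB].
    under eq_bigr => i _ do under eq_bigr => j _ do under eq_bigr => k _ do rewrite !big_split /= !sum_cst -!mulr_sumr.
    under eq_bigr => i _ do under eq_bigr => j _ do rewrite !big_split /= !sum_cst -!mulr_sumr.
    rewrite -/(SS x).
    under eq_bigr => i _ do rewrite !big_split /= !sum_cst -!mulr_sumr big_split /= sum_cst.
    rewrite !big_split /= !sum_cst -!mulr_sumr big_split /= sum_cst -mulr_sumr -/G1 -/N.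
    by rewrite le_eqVlt; apply/orP; left; apply/eqP; rewrite /m; ring.
  have HG : r ^+ 2 * b x ^+ 2 * G1 <= 2 * r ^+ 2 * (\sum_i D i x) + 2 * e' * (b x ^+ 4 * SS x) + N * (4 * B ^+ 2 + (2 * e')^-1) * (r ^+ 4 * g x ^+ 2).
    apply: (@le_trans _ _ (\sum_i (2 * r ^+ 2 * D i x + 2 * e' * (b x ^+ 4 * gdd i i x ^+ 2) + (4 * B ^+ 2 + (2 * e')^-1) * (r ^+ 4 * g x ^+ 2)))).
      rewrite mulr_sumr; apply: ler_sum => i _.
      have := @pointwise_gradient R (b x) (bi i) (g x) (gd i x) (gdd i i x) r B e' e'0 (mdB i _).
      have -> : 2 * b x * (r * bi i) * (g x * gd i x) + b x ^+ 2 * (gd i x * gd i x + g x * gdd i i x) = D i x.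
        by rewrite /D /bd -/(bi i); ring.
      by [].
    rewrite big_split big_split /= sum_cst -!mulr_sumr -/N -[X in _ <= _ + X]mulrA lerD2r lerD2l; apply: ler_wpM2l; first by rewrite mulr_ge0 // ltW.
    apply: ler_wpM2l; first by rewrite (_ : b x ^+ 4 = (b x ^+ 2) ^+ 2) ?sqr_ge0 // -exprM.
    apply: ler_sum => i _; rewrite (bigD1 i) //= lerDl; exact: sumr_ge0.
  have SS0 : 0 <= b x ^+ 4 * SS x.
    apply: mulr_ge0; first by rewrite (_ : b x ^+ 4 = (b x ^+ 2) ^+ 2) ?sqr_ge0 // -exprM.
    by apply: sumr_ge0 => i _; apply: sumr_ge0.
  have b4Q : b x ^+ 4 * (lam * SS x) <= b x ^+ 4 * Q.
    by apply: ler_wpM2l HQ; rewrite (_ : b x ^+ 4 = (b x ^+ 2) ^+ 2) ?sqr_ge0 // -exprM.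
  have h1 : 2 * e * N ^+ 2 * (b x ^+ 4 * SS x) <= lam / 2 * (b x ^+ 4 * SS x).
    apply: ler_wpM2r => //; rewrite /e mulrA mulrAC ler_pdivrMr ?mulr_gt0 //.
    have -> : lam / 2 * (4 * (N ^+ 2 + 1)) = 2 * lam * N ^+ 2 + 2 * lam by field.
    by rewrite lerDl mulr_ge0 // ltW.
  have h2 : m * (2 * e' * (b x ^+ 4 * SS x)) <= lam / 4 * (b x ^+ 4 * SS x).
    rewrite mulrA; apply: ler_wpM2r => //; rewrite /e' !mulrA ler_pdivrMr ?mulr_gt0 //.
    have -> : lam / 4 * (8 * (m + 1)) = m * 2 * lam + 2 * lam by field.
    by rewrite lerDl mulr_ge0 // ltW.
  have h3 := ler_wpM2l mm0 HG.
  rewrite PE; move: HE => /ler_normlP [HE _].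
  have -> : C3 * r ^+ 4 * g x ^+ 2 = m * (N * (4 * B ^+ 2 + (2 * e')^-1) * (r ^+ 4 * g x ^+ 2)) + a2 * N ^+ 4 * (r ^+ 4 * g x ^+ 2) by rewrite /C3; ring.
  have E3 : 2 * m * r ^+ 2 * \sum_i D i x = m * (2 * r ^+ 2 * \sum_i D i x) by ring.
  rewrite E3; move: h3; rewrite !mulrDr; lra.
have := int_le (CcZ (lam / 4) CL) (CcD (CcD CP (CcZ (2 * m * r ^+ 2) CDs)) (CcZ (C3 * r ^+ 4) Cchi)) key.
rewrite intD; [|by apply: CcD => //; exact: CcZ|exact: CcZ].
rewrite intD //; last exact: CcZ.
rewrite !intZ // IP ID mulr0 !add0r => H.
have -> : (fun x => mollifier (rho^-1 *: x) ^+ 4 * \sum_i \sum_j gdd i j x ^+ 2) = (fun x => b x ^+ 4 * SS x).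
  by apply/funext => x; rewrite /b addr0.
rewrite -(ler_pM2l (_ : 0 < lam / 4)); last by rewrite divr_gt0.
apply: le_trans H _; rewrite le_eqVlt; apply/orP; left; apply/eqP; rewrite -/r; field; rewrite gt_eqF //.
Qed.

End EnergyEstimate.

Section Cutoff.
Context {R : realType} {n : nat}.
Notation V := 'rV[R]_n.
Notation I := (@integral_Rn R n).
Implicit Types (f g : V -> R) (x y h : V).

Lemma cutoff_le (M M' : R) x y : M - `|x| <= M' - `|y| -> cutoff M x <= cutoff M' y.
Proof.
move=> H; have H' : M + 1 - `|x| <= M' + 1 - `|y| by lra.
by apply: le_max2 => //; apply: le_min2.
Qed.

(** Comparison with the dilated cutoff of radius 1 gives polynomial volume growth of degree [n]. *)
Lemma int_cutoff_le (M : R) : 1 <= M -> I (cutoff M) <= M ^+ n * I (cutoff 1).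
Proof.
move=> M1; have M0 : 0 < M by lra.
have Mi : 0 < M^-1 by rewrite invr_gt0.
have E := int_dilate Mi (Cc_cutoff (n := n) 1).
rewrite -E mulrA -exprMn divff ?gt_eqF // expr1n mul1r.
apply: int_le; [exact: Cc_cutoff|exact: Cc_dilate Mi (Cc_cutoff 1)|].
move=> x; have [xM|Mx] := leP `|x| M.
  rewrite [X in _ <= X]cutoff1 ?cutoff_le1 // normrZ gtr0_norm // mulrC ler_pdivrMr // mul1r //.
apply: cutoff_le; rewrite normrZ gtr0_norm // -(ler_pM2l M0) mulrBr mulrBr mulVKf ?gt_eqF // mulr1.
rewrite -subr_ge0 (_ : _ - _ = (M - 1) * (`|x| - M)); last by ring.
by apply: mulr_ge0; lra.
Qed.

Lemma cutoff_sq_Cc (M : R) f : continuous f -> Cc (fun x => cutoff M x * f x ^+ 2).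
Proof.
move=> cf; have cf2 : continuous (fun x => f x ^+ 2) by move=> x; apply: (contM (cf x) (cf x)).
have := Cc_mul cf2 (Cc_cutoff M); congr (Cc _); apply/funext => x; exact: mulrC.
Qed.

(** The difference is written as a mean of rescaled small increments along [h], so that Jensen's
    inequality for finite means and translation invariance suffice. The factor 2 pays for replacing
    the derivative at intermediate points by its value at the nodes. *)
Lemma delta_l2 f fd h (M : R) : C1on setT f fd ->
  I (fun x => cutoff M x * delta h f x ^+ 2) <=
  2 * I (fun x => cutoff (M + `|h|) x * (\sum_i fd i x * h 0 i) ^+ 2).
Proof.
move=> Cf; set p := fun x => \sum_i fd i x * h 0 i; set M' := M + `|h|.
have cp : continuous p by move=> x; apply: cont_sum => i; apply: contM; [exact: Cf.2|exact: cont_cst].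
have cf : continuous f by move=> x; exact: C1on_continuous openT Cf Logic.I.
have Cp : Cc (fun x => cutoff M' x * p x ^+ 2) by exact: cutoff_sq_Cc.
have Ic0 : 0 <= I (cutoff M') by apply: int_ge0; [exact: Cc_cutoff|exact: cutoff_ge0].
apply/ler_addgt0Pr => /= e0 e00.
(* Chosen so that the term 2 e^2, integrated against the cutoff, costs at most [e0]. *)
pose e := Num.min 1 (e0 / (2 * (I (cutoff M') + 1))).
have Ic1 : 0 < I (cutoff M') + 1 by rewrite ltr_wpDl.
have e_gt0 : 0 < e by rewrite lt_min ltr01 divr_gt0 // mulr_gt0.
have e_le : 2 * e ^+ 2 * I (cutoff M') <= e0.
  have e1 : e <= 1 by rewrite ge_min lexx.
  have e2 : e * (2 * (I (cutoff M') + 1)) <= e0 by rewrite -ler_pdivlMr ?mulr_gt0 // ge_min lexx orbT.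
  apply: le_trans e2; rewrite -subr_ge0 (_ : _ - _ = 2 * e * (1 + I (cutoff M') * (1 - e))); last by ring.
  apply: mulr_ge0; first by apply: mulr_ge0 => //; exact: ltW.
  by apply: addr_ge0 => //; apply: mulr_ge0 => //; rewrite subr_ge0.
have [d d0 Hd] := compact_unif_cont (@compact_cube R n (M' + 1)) (fun x _ => cp x) e_gt0.
pose m := (Num.truncn (`|h| / d)).+1.
have mr : 0 < m%:R :> R by rewrite ltr0n.
have hm : m%:R^-1 * `|h| < d.
  rewrite ltr_pdivrMl // -ltr_pdivrMr //; apply: truncnS_gt.
pose xj x j := x + (j%:R / m%:R) *: h.
(* The majorant at one node. Its integral is unchanged by each of the [m] shifts, hence equals the
   integral of its mean over the nodes. *)
pose F x := 2 * (cutoff M' x * p x ^+ 2) + 2 * e ^+ 2 * cutoff M' x.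
have CF : Cc F by apply: CcD; apply: CcZ => //; exact: Cc_cutoff.
have IF : I F <= 2 * I (fun x => cutoff M' x * p x ^+ 2) + e0.
  by rewrite /F intD; [rewrite !intZ // ?lerD2l //; exact: Cc_cutoff|exact: CcZ|apply: CcZ; exact: Cc_cutoff].
apply: le_trans IF.
have shiftF j : I (fun x => F (xj x j)) = I F by exact: int_shift.
have -> : I F = I (fun x => m%:R^-1 * \sum_(j < m) F (xj x j)).
  rewrite intZ; last by apply: Cc_sum => j; exact: Cc_shift.
  rewrite int_sum; last by move=> j; exact: Cc_shift.
  by under eq_bigr do rewrite shiftF; rewrite sum_cst mulKf ?gt_eqF.
apply: int_le.
- apply: cutoff_sq_Cc => x; exact: C1on_continuous openT (C1on_delta h Cf) Logic.I.
- by apply: CcZ; apply: Cc_sum => j; exact: Cc_shift.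
move=> x; have F0 y : 0 <= F y.
  have := cutoff_ge0 M' y => c0.
  by apply: addr_ge0; apply: mulr_ge0 => //; apply: mulr_ge0 => //; exact: sqr_ge0.
have [xM|Mx] := leP `|x| (M + 1); last first.
  by rewrite cutoff_out // mul0r mulr_ge0 ?invr_ge0 ?sumr_ge0.
have step (j : 'I_m) : exists2 q, m%:R * (f (xj x j.+1) - f (xj x j)) = q & cutoff M x * q ^+ 2 <= F (xj x j).
  have D y : is_derive y (m%:R^-1 *: h) f (m%:R^-1 * p y).
    by apply: is_derive_dirZ; exact: C1on_derive openT Cf Logic.I.
  have [s /andP[s0 s1] Hs] := mvt_line (x := xj x j) (fun s _ => D _).
  exists (p (s *: (m%:R^-1 *: h) + xj x j)).
    rewrite [xj x j.+1](_ : _ = m%:R^-1 *: h + xj x j); last first.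
      by rewrite /xj -natr1 mulrDl mul1r scalerDl addrA addrC.
    by rewrite Hs mulVKf // gt_eqF.
  have jm : j%:R / m%:R <= 1 :> R by rewrite ler_pdivrMr // mul1r ler_nat ltnW.
  have j0 : 0 <= j%:R / m%:R :> R by rewrite divr_ge0.
  have xjn : `|xj x j| <= `|x| + `|h|.
    apply: (le_trans (ler_normD _ _)); rewrite lerD2l normrZ ger0_norm //.
    by apply: ler_piMl.
  have near : `|p (s *: (m%:R^-1 *: h) + xj x j) - p (xj x j)| < e.
    apply: Hd => /=; first by rewrite /M'; lra.
    rewrite addrK normrZ (ger0_norm s0) normrZ gtr0_norm ?invr_gt0 //.
    by apply: le_lt_trans hm; apply: ler_piMl => //; rewrite mulr_ge0 // invr_ge0 ltW.
  have -> : F (xj x j) = cutoff M' (xj x j) * (2 * p (xj x j) ^+ 2 + 2 * e ^+ 2) by rewrite /F; ring.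
  apply: ler_pM; [exact: cutoff_ge0|exact: sqr_ge0|by apply: cutoff_le; rewrite /M'; lra|].
  move: near; set a := p _; set b := p _ => near.
  have := sq_le (ltW near); have := sqr_ge0 (a - 2 * b); nra.
pose q (j : 'I_m) := m%:R * (f (xj x j.+1) - f (xj x j)).
have Hq2 j : cutoff M x * q j ^+ 2 <= F (xj x j) by have [_ <-] := step j.
have -> : delta h f x = m%:R^-1 * \sum_(j < m) q j.
  rewrite -mulr_sumr mulKf ?gt_eqF // -(big_mkord xpredT (fun j => f (xj x j.+1) - f (xj x j))).
  by rewrite telescope_sumr // /xj divff ?gt_eqF // scale1r mul0r scale0r addr0.
apply: (@le_trans _ _ (cutoff M x * (m%:R^-1 * \sum_(j < m) q j ^+ 2))).
  by apply: ler_wpM2l; [exact: cutoff_ge0|exact: mean_square].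
rewrite mulrCA; apply: ler_wpM2l; first by rewrite invr_ge0 ltW.
by rewrite mulr_sumr; apply: ler_sum => j _; exact: Hq2.
Qed.

Lemma sum_sq_le (a : 'I_n -> R) : (\sum_i a i) ^+ 2 <= n%:R * \sum_i a i ^+ 2.
Proof.
have [n0|n0] := posnP n; first by rewrite !big1 ?expr0n ?mulr0 // => -[i Hi]; exfalso; rewrite n0 in Hi.
have nr : 0 < n%:R :> R by rewrite ltr0n.
have := @mean_square R n a n0; rewrite exprMn exprVn.
rewrite -(ler_pM2l (_ : 0 < n%:R ^+ 2 :> R)) ?exprn_gt0 //.
by rewrite mulrA divff ?expf_neq0 ?gt_eqF // mul1r expr2 -mulrA mulVKf // gt_eqF.
Qed.

End Cutoff.

(** * Decay of iterated differences of entire solutions *)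

Section Liouville.
Context {R : realType} {n : nat}.
Notation V := 'rV[R]_n.
Notation I := (@integral_Rn R n).
Variables (A : 'I_n -> 'I_n -> 'I_n -> 'I_n -> R) (lam Lam : R).
Hypotheses (lam0 : 0 < lam) (A_le : forall i j k l, `|A i j k l| <= Lam) (A_ell : elliptic A lam).
Implicit Types (f g : V -> R) (x y h : V).

Lemma continuous_mollifier : continuous (@mollifier R n).
Proof. move=> x; exact: C1on_continuous openT (smooth_C1on smooth_mollifier) Logic.I. Qed.

Lemma is_derive_comb m (f : 'I_m -> V -> R) (c d : 'I_m -> R) x v :
  (forall i, is_derive x v (f i) (d i)) ->
  is_derive x v (fun x => \sum_i f i x * c i) (\sum_i d i * c i).
Proof.
move=> Hf; have -> : (fun x => \sum_i f i x * c i) = \sum_i (c i \*: f i).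
  by apply/funext => y; rewrite fct_sumE; apply: eq_bigr => i _; rewrite /= mulrC.
rewrite (eq_bigr (fun i => c i *: d i)); last by move=> i _; rewrite mulrC.
by apply: is_derive_sum => i; exact: is_deriveZ.
Qed.

Lemma C1on_comb O m (f : 'I_m -> V -> R) (fd : 'I_m -> 'I_n -> V -> R) (c : 'I_m -> R) :
  (forall i, C1on O (f i) (fd i)) ->
  C1on O (fun x => \sum_i f i x * c i) (fun j x => \sum_i fd i j x * c i).
Proof.
move=> Cf; split=> x Ox j; first by apply: is_derive_comb => i; exact: (Cf i).1.
by apply: cont_sum => i; apply: contM; [exact: (Cf i).2|exact: cont_cst].
Qed.

Lemma mollifier_lower : exists2 B : R, 0 <= B & forall x, `|x| <= 2^-1 -> 1 <= B * mollifier x ^+ 4.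
Proof.
have cm := continuous_mollifier.
have [B B0 HB] := compact_bound (@compact_cube R n 2^-1) (c := fun x => (mollifier x)^-1)
  (fun x (Kx : `|x| <= 2^-1) => continuousV (lt0r_neq0 (mollifier_gt0 (le_lt_trans Kx (ltac:(lra) : 2^-1 < 1)))) (cm x)).
exists (B ^+ 4); first exact: exprn_ge0.
move=> x Kx; have := HB x Kx.
have m0 : 0 < mollifier x by apply: mollifier_gt0; apply: le_lt_trans Kx _; lra.
rewrite ger0_norm ?invr_ge0 ?(ltW m0) // => H; rewrite -[X in _ <= X]exprMn; apply: exprn_ege1.
by rewrite -ler_pdivrMr // mul1r.
Qed.

(** Two uses of [delta_l2], on the first difference and on the derivative along [h], bound a double
    difference by second derivatives; the Caccioppoli inequality then gains [rho^-1 ^+ 4] at the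
    price of a cube larger by the factor [c]. *)
Lemma delta2_decay h : exists2 K : R, 0 <= K & exists2 c : R, 1 <= c &
  forall (rho : R) g gd gdd, 1 <= rho -> entire A g gd gdd ->
  I (fun x => cutoff rho x * delta h (delta h g) x ^+ 2)
   <= K * rho^-1 ^+ 4 * I (fun x => cutoff (c * rho) x * g x ^+ 2).
Proof.
have [C C0 HC] := caccioppoli lam0 A_le A_ell.
have [B B0 HB] := mollifier_lower.
pose N : R := n%:R; pose K := 4 * (N ^+ 2 * `|h| ^+ 4) * (B * C).
(* For rho >= 1 the cube of radius c rho / 2 contains the one of radius rho + 2 |h| + 1 outside
   which the cutoff vanishes; on it the dilated mollifier is bounded below. *)
pose c := 2 * (2 + 2 * `|h|).
have N0 : 0 <= N by [].
have h0 : 0 <= `|h| by [].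
have N40 : 0 <= N ^+ 2 * `|h| ^+ 4 by apply: mulr_ge0; [exact: sqr_ge0|exact: exprn_ge0].
have K0 : 0 <= K by apply: mulr_ge0; [apply: mulr_ge0|exact: mulr_ge0].
have c1 : 1 <= c by rewrite /c; lra.
exists K => //; exists c => // rho g gd gdd rho1 Eg; have [Cg _] := Eg.
have rho0 : 0 < rho by lra.
pose q x := \sum_i gd i x * h 0 i.
pose qd j x := \sum_i gdd i j x * h 0 i.
have Cq : C1on setT q qd by apply: C1on_comb => i; exact: Cg.2.
have L1 := delta_l2 h rho (C1on_delta h (C2on_C1on openT Cg)).
have E1 x : \sum_i delta h (gd i) x * h 0 i = delta h q x.
  by rewrite /delta /q -sumrB; apply: eq_bigr => i _; rewrite mulrBl.
rewrite [X in _ <= 2 * I X](_ : _ = fun x => cutoff (rho + `|h|) x * delta h q x ^+ 2) in L1; last first.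
  by apply/funext => x; rewrite E1.
have L2 := delta_l2 h (rho + `|h|) Cq.
set rho2 := rho + `|h| + `|h| in L2.
have Rh0 : 0 < c * rho by apply: mulr_gt0; lra.
have L3 := HC (c * rho) g gd gdd Rh0 Eg.
set G := fun x => \sum_i \sum_j gdd i j x ^+ 2.
have cgdd i j : continuous (gdd i j) by move=> x; exact: (Cg.2 i).2.
have cm := continuous_mollifier.
have L4 : I (fun x => cutoff rho2 x * (\sum_j qd j x * h 0 j) ^+ 2) <=
   (N ^+ 2 * `|h| ^+ 4 * B) * I (fun x => mollifier ((c * rho)^-1 *: x) ^+ 4 * G x).
  have CM : Cc (fun x => mollifier ((c * rho)^-1 *: x) ^+ 4 * G x).
    have [cG0 cm4] : continuous G /\ continuous (fun x => mollifier ((c * rho)^-1 *: x) ^+ 4).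
      split=> x; first by apply: cont_sum => i; apply: cont_sum => j; apply: (contM (cgdd i j x) (cgdd i j x)).
      have c1x : {for x, continuous (fun x => mollifier ((c * rho)^-1 *: x))}.
        by apply: (@continuous_comp _ _ _ (fun x => (c * rho)^-1 *: x)); [exact: scaler_continuous|exact: cm].
      have := contM (contM c1x c1x) (contM c1x c1x).
      by rewrite [X in {for x, continuous X}](_ : _ = (fun x => mollifier ((c * rho)^-1 *: x) ^+ 4)) //; apply/funext => y; rewrite !exprS expr0 mulr1 !mulrA.
    split; first by move=> x; apply: (@contM _ _ (fun x => mollifier ((c * rho)^-1 *: x) ^+ 4) G x); [exact: cm4|exact: cG0].
    exists (c * rho) => x xr; rewrite (_ : mollifier _ = 0) ?expr0n ?mul0r //.
    by apply: flat_prod_out; rewrite normrZ gtr0_norm ?invr_gt0 // ltr_pdivlMl // mulr1.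
  rewrite -intZ //; apply: int_le; [|exact: CcZ|].
    apply: cutoff_sq_Cc => x; apply: cont_sum => j; apply: contM; [exact: Cq.2|exact: cont_cst].
  move=> x; have G0 : 0 <= G x by apply: sumr_ge0 => i _; apply: sumr_ge0 => j _; exact: sqr_ge0.
  have m0 : 0 <= mollifier ((c * rho)^-1 *: x) ^+ 4 by apply: exprn_ge0; exact: mollifier_ge0.
  have [xr|rx] := leP `|x| (rho2 + 1); last first.
    by rewrite cutoff_out // mul0r; apply: mulr_ge0; apply: mulr_ge0.
  have HP : (\sum_j qd j x * h 0 j) ^+ 2 <= N ^+ 2 * `|h| ^+ 4 * G x.
    have h2 i : h 0 i ^+ 2 <= `|h| ^+ 2 by apply: sq_le; exact: coord_norm_le.
    apply: (le_trans (sum_sq_le _)); rewrite -/N.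
    have -> : N ^+ 2 * `|h| ^+ 4 * G x = N * \sum_j N * (\sum_i gdd i j x ^+ 2 * `|h| ^+ 2 * `|h| ^+ 2).
      rewrite /G exchange_big /= mulr_sumr mulr_sumr; apply: eq_bigr => j _.
      by rewrite mulrA !mulr_sumr; apply: eq_bigr => i _; ring.
    apply: ler_wpM2l => //; apply: ler_sum => j _; rewrite exprMn.
    apply: (@le_trans _ _ (N * (\sum_i (gdd i j x * h 0 i) ^+ 2) * `|h| ^+ 2)).
      by apply: ler_pM; rewrite ?sqr_ge0 //; exact: sum_sq_le.
    rewrite -mulrA; apply: ler_wpM2l => //; rewrite mulr_suml; apply: ler_sum => i _.
    apply: ler_wpM2r; first exact: sqr_ge0.
    by rewrite exprMn; apply: ler_wpM2l => //; exact: sqr_ge0.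
  have Hb : 1 <= B * mollifier ((c * rho)^-1 *: x) ^+ 4.
    apply: HB; rewrite normrZ gtr0_norm ?invr_gt0 // ler_pdivrMl //.
    apply: (le_trans xr); rewrite /rho2 /c.
    have : 0 <= `|h| * (rho - 1) by apply: mulr_ge0; lra.
    lra.
  apply: (le_trans (ler_wpM2r (sqr_ge0 _) (cutoff_le1 _ _))); rewrite mul1r.
  apply: (le_trans HP).
  have := ler_wpM2l (mulr_ge0 N40 G0) Hb; rewrite mulr1 => /le_trans; apply.
  by rewrite le_eqVlt; apply/orP; left; apply/eqP; ring.
have I0 : 0 <= I (fun x => cutoff (c * rho) x * g x ^+ 2).
  apply: int_ge0; first by apply: cutoff_sq_Cc => x; exact: C1on_continuous openT (C2on_C1on openT Cg) Logic.I.
  by move=> x; apply: mulr_ge0; [exact: cutoff_ge0|exact: sqr_ge0].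
apply: (le_trans L1); apply: (@le_trans _ _ (2 * (2 * ((N ^+ 2 * `|h| ^+ 4 * B) * (C * (c * rho)^-1 ^+ 4 * I (fun x => cutoff (c * rho) x * g x ^+ 2)))))).
  apply: ler_wpM2l => //; apply: (le_trans L2); apply: ler_wpM2l => //; apply: (le_trans L4).
  by apply: ler_wpM2l => //; apply: mulr_ge0.
have -> : 2 * (2 * (N ^+ 2 * `|h| ^+ 4 * B * (C * (c * rho)^-1 ^+ 4 * I (fun x => cutoff (c * rho) x * g x ^+ 2))))
  = K * (c * rho)^-1 ^+ 4 * I (fun x => cutoff (c * rho) x * g x ^+ 2) by rewrite /K; ring.
apply: ler_wpM2r => //; apply: ler_wpM2l => //.
apply: lerXn2r; rewrite ?nnegrE ?invr_ge0 ?(ltW rho0) ?(ltW Rh0) //.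
by rewrite lef_pV2 ?posrE //; apply: ler_peMl => //; exact: ltW.
Qed.

(** Cubic growth makes the weighted integral of g^2 at most of order rho^(n + 6), the n coming from
    the volume, and each double difference gains rho^-4. Using the induction hypothesis at radius c
    rho costs only a constant. *)
Lemma iter_decay h k (g : V -> R) gd gdd (D : R) : entire A g gd gdd ->
  (forall x, `|g x| <= D * (1 + `|x|) ^+ 3) ->
  exists2 C : R, 0 <= C & forall rho : R, 1 <= rho ->
  rho ^+ (4 * k) * I (fun x => cutoff rho x * iter k (delta h \o delta h) g x ^+ 2) <= C * rho ^+ (n + 6).
Proof.
move=> Eg gD; have [K K0 [c c1 HK]] := delta2_decay h.
have Eit m : exists gd' gdd', entire A (iter m (delta h \o delta h) g) gd' gdd'.
  elim: m => [|m [gd' [gdd' IH]]]; first by exists gd, gdd.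
  by eexists; eexists; rewrite /=; apply: entire_delta; apply: entire_delta; exact: IH.
elim: k => [|k [C C0 IH]].
  have I0 : 0 <= I (cutoff 1) by apply: int_ge0; [exact: Cc_cutoff|exact: cutoff_ge0].
  exists ((3 ^+ 3 * D) ^+ 2 * I (cutoff 1)); first by apply: mulr_ge0 => //; exact: sqr_ge0.
  move=> rho rho1; rewrite muln0 expr0 mul1r /=.
  have rho0 : 0 < rho by lra.
  have D0 : 0 <= D by have := gD 0; rewrite normr0 addr0 expr1n mulr1; apply: le_trans.
  apply: (@le_trans _ _ ((3 ^+ 3 * D * rho ^+ 3) ^+ 2 * I (cutoff rho))).
    rewrite -intZ; last exact: Cc_cutoff.
    have cg : continuous g by move=> x; exact: C1on_continuous openT (C2on_C1on openT Eg.1) Logic.I.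
    apply: int_le; [exact: cutoff_sq_Cc|by apply: CcZ; exact: Cc_cutoff|].
    move=> x; have [xr|rx] := leP `|x| (rho + 1); last by rewrite cutoff_out // mul0r mulr0.
    rewrite mulrC; apply: ler_wpM2r; first exact: cutoff_ge0.
    apply: sq_le; apply: (le_trans (gD x)); rewrite [3 ^+ 3 * D]mulrC -mulrA -exprMn; apply: ler_wpM2l => //.
    by apply: lerXn2r; rewrite ?nnegrE ?addr_ge0 //; [apply: mulr_ge0 => //; exact: ltW|lra].
  rewrite [X in _ <= X](_ : _ = (3 ^+ 3 * D * rho ^+ 3) ^+ 2 * (rho ^+ n * I (cutoff 1))); last by rewrite exprD; ring.
  by apply: ler_wpM2l; [exact: sqr_ge0|exact: int_cutoff_le].
exists (K * C * c ^+ (n + 6)); first by apply: mulr_ge0; [exact: mulr_ge0|apply: exprn_ge0; lra].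
move=> rho rho1; have [gd' [gdd' E']] := Eit k.
have rho0 : 0 < rho by lra.
have cr1 : 1 <= c * rho by rewrite -[1]mulr1; apply: ler_pM.
have H1 := HK rho _ _ _ rho1 E'; have H2 := IH _ cr1.
rewrite -[X in X * _](_ : rho ^+ (4 * k) * rho ^+ 4 = _); last by rewrite -exprD mulnS addnC.
have p4 : 0 < rho ^+ 4 by exact: exprn_gt0.
have pk : 0 <= rho ^+ (4 * k) by apply: exprn_ge0; lra.
rewrite -mulrA; apply: (le_trans (ler_wpM2l pk (ler_wpM2l (ltW p4) H1))).
set J := I _ in H2 *.
have J0 : 0 <= J.
  apply: int_ge0; first by apply: cutoff_sq_Cc => x; exact: C1on_continuous openT (C2on_C1on openT E'.1) Logic.I.
  by move=> x; apply: mulr_ge0; [exact: cutoff_ge0|exact: sqr_ge0].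
have -> : rho ^+ (4 * k) * (rho ^+ 4 * (K * rho^-1 ^+ 4 * J)) = K * (rho ^+ (4 * k) * J).
  by field; rewrite gt_eqF.
rewrite -!mulrA; apply: ler_wpM2l => //; rewrite -exprMn; apply: le_trans H2.
apply: ler_wpM2r => //; apply: lerXn2r; rewrite ?nnegrE; [lra|lra|].
by apply: ler_peMl => //; lra.
Qed.

(** After n + 2 double differences the gain 4 (n + 2) exceeds the growth n + 6, so the integral over
    any fixed cube is smaller than every positive number. *)
Lemma iter_zero h (g : V -> R) gd gdd (D : R) : entire A g gd gdd ->
  (forall x, `|g x| <= D * (1 + `|x|) ^+ 3) -> forall x, iter n.+2 (delta h \o delta h) g x = 0.
Proof.
move=> Eg gD x0; have [C C0 HC] := iter_decay h n.+2 Eg gD.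
set G := iter _ _ _ in HC *.
have cG : continuous G.
  suff : exists gd' gdd', entire A G gd' gdd' by move=> [gd' [gdd' [CG _]]] x; exact: C1on_continuous openT (C2on_C1on openT CG) Logic.I.
  rewrite /G; elim: n.+2 => [|m [gd' [gdd' IH]]]; first by exists gd, gdd.
  by eexists; eexists; rewrite /=; apply: entire_delta; apply: entire_delta; exact: IH.
apply/eqP; apply: contrapT => /negP Gx0.
pose r := 1 + `|x0|; have r1 : 1 <= r by rewrite /r lerDl.
have CcG M : Cc (fun x => cutoff M x * G x ^+ 2) by exact: cutoff_sq_Cc.
have J0 : 0 < I (fun x => cutoff r x * G x ^+ 2).
  apply: (@int_gt0 _ _ _ x0) => // [x|]; first by apply: mulr_ge0; [exact: cutoff_ge0|exact: sqr_ge0].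
  rewrite cutoff1 ?mul1r; last by rewrite /r lerDr.
  by rewrite lt_neqAle sqr_ge0 andbT eq_sym expf_neq0.
set J := I _ in J0.
(* At this radius C < rho J, whereas the decay bound forces rho^(3 n + 2) J <= C. *)
pose rho := r + C / J.
have CJ : 0 <= C / J by apply: divr_ge0 => //; exact: ltW.
have rho1 : 1 <= rho by rewrite /rho; lra.
have rho0 : 0 < rho by lra.
have := HC rho rho1; have -> : (4 * n.+2 = (n + 6) + (3 * n + 2))%N by lia.
rewrite exprD -mulrA [X in _ <= X]mulrC ler_pM2l ?exprn_gt0 // => H.
have H2 : J <= I (fun x => cutoff rho x * G x ^+ 2).
  apply: int_le => // x; apply: ler_wpM2r; first exact: sqr_ge0.
  by apply: cutoff_le; rewrite /rho; lra.
have : C < rho * J by rewrite -ltr_pdivrMr // /rho; lra.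
rewrite ltNge => /negP; apply; apply: le_trans H; apply: ler_pM => //; [lra|exact: ltW|].
by rewrite addn2 exprS; apply: ler_peMr; [lra|exact: exprn_ege1].
Qed.

End Liouville.

(** * Polynomial growth, unwinding of differences, Liouville theorem *)

Section Growth.
Context {R : realType} {n : nat}.
Notation V := 'rV[R]_n.
Implicit Types (f g : V -> R) (x y h : V).

Lemma powR_le_affine (t alpha : R) : 0 <= t -> 0 <= alpha -> alpha <= 1 -> t `^ alpha <= 1 + t.
Proof.
move=> t0 a0 a1; apply: (@le_trans _ _ ((1 + t) `^ alpha)).
  by apply: ge0_ler_powR; rewrite ?nnegrE ?lerDr // addr_ge0.
by rewrite -{2}[1 + t](@powRr1 R) ?addr_ge0 //; apply: ler_powR; rewrite // lerDl.
Qed.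

Lemma growth_antiderivative (O : set V) f fd (C : R) m : open O ->
  (forall x s, O x -> 0 <= s <= 1 -> O (s *: x)) -> C1on O f fd ->
  (forall i x, O x -> `|fd i x| <= C * (1 + `|x|) ^+ m) ->
  forall x, O x -> `|f x| <= (`|f 0| + n%:R * C) * (1 + `|x|) ^+ m.+1.
Proof.
move=> oO sO Cf HC x Ox.
have Os s : 0 <= s <= 1 -> O (s *: x + 0) by move=> s01; rewrite addr0; exact: sO.
have [s s01] := mvt_line (x := 0) (v := x) (fun s s01 => C1on_derive x oO Cf (Os s s01)).
have /andP[s0 s1] := s01.
rewrite !addr0 => E.
have X1 : 1 <= 1 + `|x| by rewrite lerDl.
have Xm : 1 <= (1 + `|x|) ^+ m.+1 by exact: exprn_ege1.
have -> : f x = f 0 + (f x - f 0) by ring.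
apply: (le_trans (ler_normD _ _)); rewrite mulrDl; apply: lerD; first exact: ler_peMr.
rewrite E; apply: (le_trans (ler_norm_sum _ _ _)).
rewrite -mulrA -sum_cst; apply: ler_sum => i _; rewrite normrM exprSr mulrA.
have C0 : 0 <= C.
  have O0 : O 0 by rewrite -(scale0r x); apply: sO => //; rewrite lexx ler01.
  have := HC i 0 O0; rewrite normr0 addr0 expr1n mulr1; apply: le_trans; exact: normr_ge0.
apply: ler_pM => //; last by apply: (le_trans (coord_norm_le _ _)); rewrite lerDr.
apply: (le_trans (HC _ _ _)); first exact: sO.
apply: ler_wpM2l => //; apply: lerXn2r; rewrite ?nnegrE ?addr_ge0 //.
by rewrite lerD2l normrZ ger0_norm //; exact: ler_piMl.
Qed.

(* If the second difference vanishes then the first one is constant along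
   multiples of h, and sublinear growth forces it to be 0. *)
Lemma sublinear_descent f h (C alpha : R) : alpha < 1 ->
  (forall x y, `|f x - f y| <= C * `|x - y| `^ alpha) ->
  (forall x, delta h (delta h f) x = 0) -> forall x, delta h f x = 0.
Proof.
move=> a1 fC ff x.
have ffm m : delta h f (x + m%:R *: h) = delta h f x.
  elim: m => [|m IH]; first by rewrite scale0r addr0.
  have := ff (x + m%:R *: h); rewrite {1}/delta IH => /eqP; rewrite subr_eq0 => /eqP <-.
  by rewrite -addrA -natr1 scalerDl scale1r.
have fm m : f (x + m%:R *: h) - f x = m%:R * delta h f x.
  elim: m => [|m IH]; first by rewrite scale0r addr0 subrr mul0r.
  have := ffm m; rewrite {1}/delta -addrA -{2}[h]scale1r -scalerDl natr1.
  rewrite -natr1 mulrDl mul1r -IH => E; rewrite -E; ring.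
have [//|d1] := eqVneq (delta h f x) 0; exfalso.
have d0 : 0 < `|delta h f x| by rewrite normr_gt0.
set d := `|_| in d0; pose P := C * `|h| `^ alpha.
have key m : m%:R * d <= P * m%:R `^ alpha.
  have := fC (x + m%:R *: h) x; rewrite fm normrM normr_nat -/d => H; apply: (le_trans H).
  by rewrite addrAC subrr add0r normrZ normr_nat powRM // mulrCA mulrC.
(* [m] is taken so large that m^(1 - alpha) exceeds P / d, against [key]. *)
pose b := Num.max 0 (P / d) + 1; pose m := (Num.truncn (b `^ (1 - alpha)^-1)).+1.
have b0 : 0 < b by rewrite ltr_wpDl // le_max lexx.
have a0 : 0 < 1 - alpha by lra.
have mb : b `^ (1 - alpha)^-1 <= m%:R by apply: ltW; exact: truncnS_gt.
have m0 : 0 < m%:R :> R by rewrite ltr0n.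
have bm : b <= m%:R `^ (1 - alpha).
  have -> : b = (b `^ (1 - alpha)^-1) `^ (1 - alpha) by rewrite -powRrM mulVf ?gt_eqF // powRr1 // ltW.
  by apply: ge0_ler_powR mb; rewrite ?nnegrE ?powR_ge0 // ltW.
have mE : m%:R = m%:R `^ (1 - alpha) * m%:R `^ alpha :> R.
  by rewrite -powRD ?subrK ?powRr1 // ?ltW // gt_eqF ?implybT.
have := key m; rewrite {1}mE.
rewrite mulrAC ler_pM2r ?powR_gt0 // => H.
have : b * d <= P by apply: le_trans H; rewrite ler_pM2r.
rewrite -ler_pdivlMr // /b; have : P / d <= Num.max 0 (P / d) by rewrite le_max lexx orbT.
lra.
Qed.

Lemma delta_growth f h (C alpha : R) : (forall x y, `|f x - f y| <= C * `|x - y| `^ alpha) ->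
  forall x y, `|delta h f x - delta h f y| <= (2 * C) * `|x - y| `^ alpha.
Proof.
move=> fC x y; rewrite /delta (_ : _ - _ = (f (x + h) - f (y + h)) - (f x - f y)); last by ring.
apply: (le_trans (ler_normB _ _)); rewrite -mulrA mulr_natl mulr2n; apply: lerD => //.
by apply: (le_trans (fC _ _)); rewrite opprD addrACA subrr addr0.
Qed.

(** Iterated differences of [f] keep a sublinear Hoelder bound, the constant doubling at each step,
    so [sublinear_descent] removes one difference at a time. *)
Lemma iterated_descent N f h (C alpha : R) : alpha < 1 ->
  (forall x y, `|f x - f y| <= C * `|x - y| `^ alpha) ->
  (forall x, iter N.+1 (delta h) f x = 0) -> forall x, delta h f x = 0.
Proof.
move=> a1; elim: N => [|N IH] fC H //; apply: IH => //.
have [D HD] : exists D : R, forall x y, `|iter N (delta h) f x - iter N (delta h) f y| <= D * `|x - y| `^ alpha.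
  elim: (N) => [|m [D HD]]; first by exists C.
  by exists (2 * D) => x y; exact: delta_growth.
exact: sublinear_descent HD H.
Qed.

(** Iterated differences of [w] vanish by its cubic growth, hence so do those of its second
    derivatives. The descent is done on the latter because they are the ones with sublinear
    differences. *)
Theorem liouville (A : 'I_n -> 'I_n -> 'I_n -> 'I_n -> R) (lam Lam : R) w wd wdd (C alpha : R) :
  0 < lam -> (forall i j k l, `|A i j k l| <= Lam) -> elliptic A lam -> 0 < alpha -> alpha < 1 ->
  entire A w wd wdd -> (forall i j x y, `|wdd i j x - wdd i j y| <= C * `|x - y| `^ alpha) ->
  forall i j x y, wdd i j x = wdd i j y.
Proof.
move=> lam0 A_le A_ell a0 a1 Ew wC i j x y.
pose D0 := \sum_i \sum_j `|wdd i j 0| + `|C|.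
have G2 i' j' z : `|wdd i' j' z| <= D0 * (1 + `|z|) ^+ 1.
  have z1 : 1 <= 1 + `|z| by rewrite lerDl.
  have -> : wdd i' j' z = wdd i' j' 0 + (wdd i' j' z - wdd i' j' 0) by ring.
  apply: (le_trans (ler_normD _ _)); rewrite expr1 mulrDl; apply: lerD.
    apply: (@le_trans _ _ (\sum_i \sum_j `|wdd i j 0|)).
      rewrite (bigD1 i') //= (bigD1 j') //= -addrA lerDl addr_ge0 ?sumr_ge0 // => k _; exact: sumr_ge0.
    by apply: ler_peMr => //; apply: sumr_ge0 => k _; apply: sumr_ge0.
  apply: (le_trans (wC _ _ _ _)); rewrite subr0; apply: (@le_trans _ _ (`|C| * `|z| `^ alpha)).
    by apply: ler_wpM2r; [exact: powR_ge0|exact: ler_norm].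
  apply: ler_wpM2l => //; apply: powR_le_affine => //; exact: ltW.
have [Cw _] := Ew.
have star (x' : V) (s : R) : setT x' -> 0 <= s <= 1 -> setT (s *: x') by [].
pose D1 i' := `|wd i' 0| + n%:R * D0.
have D10 i' : 0 <= D1 i' by apply: addr_ge0 => //; apply: mulr_ge0 => //; apply: addr_ge0 => //; apply: sumr_ge0 => k _; exact: sumr_ge0.
have HD1 i' z : `|wd i' z| <= D1 i' * (1 + `|z|) ^+ 2.
  exact: (growth_antiderivative openT star (Cw.2 i') (fun j z _ => G2 i' j z)).
have HD z : `|w z| <= (`|w 0| + n%:R * \sum_i D1 i) * (1 + `|z|) ^+ 3.
  apply: (growth_antiderivative openT star (C2on_C1on openT Cw)) => // k z' _.
  apply: (le_trans (HD1 k z')); apply: ler_wpM2r; first by apply: exprn_ge0; apply: addr_ge0.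
  by rewrite (bigD1 k) //= lerDl sumr_ge0.
suff H h z : delta h (wdd i j) z = 0.
  by have := H (x - y) y; rewrite /delta (addrC y) subrK => /eqP; rewrite subr_eq0 => /eqP.
pose T := delta h \o delta h.
have Eit m : entire A (iter m T w) (fun i => iter m T (wd i)) (fun i j => iter m T (wdd i j)).
  by elim: m => [//|m IH] /=; apply: entire_delta; apply: entire_delta.
have w0 := iter_zero lam0 A_le A_ell h Ew HD; rewrite -/T in w0.
have [[dw Cdw] _] := Eit n.+2.
have der0 (f : V -> R) v z' d : (forall x, f x = 0) -> is_derive z' v f d -> d = 0.
  move=> f0; have -> : f = cst 0 by apply/funext => ?; rewrite f0.
  by move=> [_ <-]; rewrite derive_cst.
have wd0 k z' : iter n.+2 T (wd k) z' = 0 by apply: der0 w0 (dw _ _ _).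
have wdd0 k l z' : iter n.+2 T (wdd k l) z' = 0 by apply: der0 (wd0 k) ((Cdw _).1 _ _ _).
(* The n + 2 double differences are 2 (n + 2) simple ones, and [iterated_descent] counts them as
   [N.+1]. *)
apply: (iterated_descent (N := (n.+2).*2.-1)) a1 (wC i j) _ z => z'; rewrite -[RHS](wdd0 i j z').
have -> : (n.+2).*2.-1.+1 = (n.+2).*2 by [].
by move: n.+2 => m; elim: m z' => [//|m IH] z'; rewrite doubleS /= /delta !IH.
Qed.

End Growth.

(** * Schauder estimate by compactness *)

Section Ultralimits.
Context {R : realType}.

(** The ultrafilter refines the filter of tails; the image of a bounded sequence is an ultrafilter
    containing a compact interval, so it converges. *)
Lemma ultralimit : exists2 U : set_system nat, ProperFilter U &
  (forall N, U [set m | (N <= m)%N]) /\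
  (forall (a : nat -> R) (B : R), (\forall m \near U, `|a m| <= B) -> exists l : R, a m @[m --> U] --> l).
Proof.
have [U [UU sU]] := @ultraFilterLemma _ (\oo : set_system nat) _.
have UF : ProperFilter U by exact: ultra_proper.
exists U => //; split; first by move=> N; apply: sU; exact: nbhs_infty_ge.
move=> a B aB.
have UI : UltraFilter (a @ U).
  constructor; first exact: fmap_proper_filter.
  move=> G PG sG; apply/seteqP; split => // A GA.
  have [//|UC] := in_ultra_setVsetC (a @^-1` A) UU.
  have : G (A `&` ~` A) by apply: filterI => //; exact: sG.
  by move=> /filter_ex [x []].
have cK := @segment_compact R (- B) B.
move: cK; rewrite compact_ultra => /(_ (a @ U) UI) [|l [_ al]]; last by exists l.
by apply: filterS aB => m; rewrite /= in_itv /= ler_norml.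
Qed.

Lemma powR_small (c e alpha : R) : 0 < e -> 0 < alpha ->
  exists2 r : R, 0 < r & forall t, 0 <= t -> t <= r -> c * t `^ alpha <= e.
Proof.
move=> e0 a0; pose b := e / (`|c| + 1).
have c0 : 0 < `|c| + 1 by rewrite ltr_wpDl.
have b0 : 0 < b by exact: divr_gt0.
exists (b `^ alpha^-1); first exact: powR_gt0.
move=> t t0 tb; have : t `^ alpha <= b.
  have -> : b = (b `^ alpha^-1) `^ alpha by rewrite -powRrM mulVf ?gt_eqF // powRr1 // ltW.
  by apply: ge0_ler_powR; rewrite ?nnegrE ?powR_ge0 // ltW.
rewrite /b ler_pdivlMr // => H; apply: le_trans H; rewrite mulrC; apply: ler_wpM2l; first exact: powR_ge0.
by rewrite (le_trans (ler_norm c)) // lerDl.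
Qed.

End Ultralimits.

Section Holder.
Context {R : realType} {n : nat}.
Notation V := 'rV[R]_n.
Implicit Types (f g : V -> R) (x y h : V) (alpha C : R).

Definition holder_on (O : set V) alpha C f : Prop :=
  forall x y, O x -> O y -> `|f x - f y| <= C * `|x - y| `^ alpha.

Lemma holder_continuous O alpha C f x : open O -> 0 < alpha -> holder_on O alpha C f -> O x ->
  {for x, continuous f}.
Proof.
move=> oO a0 fC Ox; apply/continuous_atP => e e0.
have e2 : 0 < e / 2 by rewrite divr_gt0.
have [r r0 Hr] := powR_small C e2 a0.
have /nbhs_ballP [s /= s0 Hs] : \forall y \near x, O y by exact: open_nbhs_nbhs.
exists (Num.min r s); first by rewrite lt_min r0.
move=> y; rewrite lt_min => /andP[yr ys]; apply: (@le_lt_trans _ _ (e / 2)); last by lra.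
apply: (le_trans (fC _ _ _ Ox)); last by apply: Hr => //; exact: ltW.
by apply: Hs; rewrite -ball_normE /= distrC.
Qed.

(** Such a quantitative expansion passes to pointwise limits, which is how derivatives of limit
    functions are identified below. *)
Lemma quotient_holder_derive f x v (d C alpha r : R) : 0 < alpha -> 0 < r ->
  (forall t, `|t| <= r -> `|f (t *: v + x) - f x - t * d| <= `|t| * (C * `|t| `^ alpha)) ->
  is_derive x v f d.
Proof.
move=> a0 r0 H; apply: is_derive_quotient => e e0.
have [r' r'0 Hr'] := powR_small C e0 a0.
exists (Num.min r r'); first by rewrite lt_min r0.
move=> t t0; rewrite lt_min => /andP[tr tr'].
have tn : 0 < `|t| by rewrite normr_gt0.
rewrite -(ler_pM2l tn) -normrM mulrBr mulVKf //.
by apply: (le_trans (H _ (ltW tr))); apply: ler_wpM2l => //; apply: Hr' => //; exact: ltW.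
Qed.

(** The part of the Arzela-Ascoli theorem that upgrades pointwise to uniform convergence: near each
    point of [K] the sequence and its limit vary little, and compactness does the rest. *)
Lemma equicontinuous_uniform (U : set_system nat) (K : set V) (f : nat -> V -> R) g (C C' alpha : R) :
  ProperFilter U -> compact K -> 0 < alpha ->
  (\forall m \near U, holder_on K alpha C (f m)) -> holder_on K alpha C' g ->
  (forall x, K x -> f m x @[m --> U] --> g x) ->
  forall e : R, 0 < e -> \forall m \near U, forall x, K x -> `|f m x - g x| <= e.
Proof.
move=> UF cK a0 fC gC fg e e0; have e3 : 0 < e / 3 by rewrite divr_gt0.
have [r r0 Hr] := powR_small C e3 a0; have [s s0 Hs] := powR_small C' e3 a0.
have := (compact_near_coveringP K).1 cK _ U (fun m x => K x -> `|f m x - g x| <= e) _.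
move=> H; suff : \forall m \near U, K `<=` (fun x => K x -> `|f m x - g x| <= e).
  by apply: filterS => m Hm x Kx; exact: Hm.
apply: H => x Kx.
have [P1 P2] : (\forall m \near U, holder_on K alpha C (f m) /\ `|f m x - g x| <= e / 3) /\
   (\forall y \near x, `|x - y| <= Num.min r s).
  split; last by near=> y; near: y; apply: cvgr_dist_le; [exact: cvg_id|rewrite lt_min r0].
  apply: filterI fC _; move/cvgrPdist_le : (fg x Kx) => /(_ _ e3); apply: filterS => m.
  by rewrite distrC.
exists ([set y | `|x - y| <= Num.min r s], [set m | holder_on K alpha C (f m) /\ `|f m x - g x| <= e / 3]) => //.
move=> [y m] /= [xy [fm fmx]] Ky.
move: xy; rewrite le_min => /andP[xr xs].
have h1 := le_trans (fm x y Kx Ky) (Hr _ (normr_ge0 _) xr).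
have h2 := le_trans (gC x y Kx Ky) (Hs _ (normr_ge0 _) xs).
move: h1 h2 fmx; rewrite !ler_norml => /andP[? ?] /andP[? ?] /andP[? ?]; apply/andP; split; lra.
Unshelve. all: by end_near.
Qed.

End Holder.

(** * Almost entire solutions and their limits *)

Section Compactness.
Context {R : realType} {n : nat} (lam Lam C alpha : R).
Notation V := 'rV[R]_n.
Notation I := (@integral_Rn R n).
Notation Q M := [set x : V | `|x| < M].
Implicit Types (f g : V -> R) (x y h : V) (A : 'I_n -> 'I_n -> 'I_n -> 'I_n -> R).

(** What a blow-up produces: [A] is the coefficient array frozen at the centre, [B] the error of
    freezing it together with the inhomogeneous term, [M] the radius on which the rescaled equation
    lives. The three zeros come from subtracting a Taylor polynomial; they turn the Hoelder bound
    into bounds on [w] and its derivatives that do not depend on [M]. *)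
Record almost_entire (M d : R) A w wd wdd (B : 'I_n -> 'I_n -> V -> R) : Prop := AlmostEntire {
  ae_bound : forall i j k l, `|A i j k l| <= Lam;
  ae_elliptic : elliptic A lam;
  ae_C2 : C2on (Q M) w wd wdd;
  ae_holder : forall i j, holder_on (Q M) alpha C (wdd i j);
  ae_zero : w 0 = 0;
  ae_zero1 : forall i, wd i 0 = 0;
  ae_zero2 : forall i j, wdd i j 0 = 0;
  ae_cont : forall i j x, Q M x -> {for x, continuous (B i j)};
  ae_small : forall i j x, Q M x -> `|B i j x| <= d;
  ae_solves : solves (Q M) (fun i j x => \sum_k \sum_l A i j k l * wdd k l x + B i j x) }.

Lemma open_cube (M : R) : open (Q M).
Proof. by have := @ball_open R V 0 M; congr open; apply/seteqP; split=> x; rewrite -ball_normE /= sub0r normrN. Qed.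

Lemma star_cube (M : R) x (s : R) : Q M x -> 0 <= s <= 1 -> Q M (s *: x).
Proof.
move=> /= xM /andP[s0 s1]; rewrite normrZ ger0_norm //; apply: le_lt_trans xM; exact: ler_piMl.
Qed.

Hypotheses (lam0 : 0 < lam) (C0 : 0 <= C) (a0 : 0 < alpha) (a1 : alpha < 1).

Section Bounds.
Variables (M d : R) (A : 'I_n -> 'I_n -> 'I_n -> 'I_n -> R) (w : V -> R) (wd : 'I_n -> V -> R)
  (wdd B : 'I_n -> 'I_n -> V -> R).
Hypothesis (H : almost_entire M d A w wd wdd B).

Lemma ae_bound2 i j x : Q M x -> `|wdd i j x| <= C * (1 + `|x|) ^+ 1.
Proof.
move=> Mx; have M0 : Q M 0 by have := @star_cube M x 0 Mx; rewrite scale0r; apply; rewrite lexx ler01.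
have := ae_holder H i j Mx M0; rewrite (ae_zero2 H) !subr0 expr1 => /le_trans; apply.
by apply: ler_wpM2l => //; apply: powR_le_affine => //; exact: ltW.
Qed.

Lemma ae_bound1 i x : Q M x -> `|wd i x| <= (n%:R * C) * (1 + `|x|) ^+ 2.
Proof.
move=> Mx; have := @growth_antiderivative R n (Q M) (wd i) (wdd i) C 1 (@open_cube M) (@star_cube M)
  ((ae_C2 H).2 i) (fun j x Mx => ae_bound2 i j Mx) x Mx.
by rewrite (ae_zero1 H) normr0 add0r.
Qed.

Lemma ae_bound0 x : Q M x -> `|w x| <= (n%:R * (n%:R * C)) * (1 + `|x|) ^+ 3.
Proof.
move=> Mx; have := @growth_antiderivative R n (Q M) w wd (n%:R * C) 2 (@open_cube M) (@star_cube M)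
  (C2on_C1on (@open_cube M) (ae_C2 H)) (fun j x Mx => ae_bound1 j Mx) x Mx.
by rewrite (ae_zero H) normr0 add0r.
Qed.

Lemma ae_quotient2 i j x (t : R) : `|x| + `|t| < M ->
  `|wd i (t *: Defs.coord j + x) - wd i x - t * wdd i j x| <= `|t| * (C * `|t| `^ alpha).
Proof.
move=> Mt; have e1 : `|Defs.coord j : V| <= 1 by exact: (frame_norm frame_coord).
have seg s : 0 <= s <= 1 -> Q M (s *: (t *: Defs.coord j) + x).
  move=> /andP[s0 s1] /=; apply: le_lt_trans Mt; rewrite addrC; apply: (le_trans (ler_normD _ _)).
  rewrite lerD2l scalerA normrZ normrM (ger0_norm s0) -[X in _ <= X]mulr1; apply: ler_pM => //; first exact: mulr_ge0.
  exact: ler_piMl.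
have [s s01 ->] := mvt_line (x := x) (v := t *: Defs.coord j)
  (fun s s01 => is_derive_dirZ t (C2on_derive2 i j (ae_C2 H) (seg s s01))).
have [s0 s1] := andP s01.
rewrite -mulrBr normrM; apply: ler_wpM2l => //.
apply: (le_trans (ae_holder H i j (seg s s01) _)); first by rewrite /=; apply: le_lt_trans Mt; rewrite lerDl.
apply: ler_wpM2l => //; rewrite addrK; apply: ge0_ler_powR; rewrite ?nnegrE ?normr_ge0 ?(ltW a0) //.
rewrite scalerA normrZ normrM (ger0_norm s0) -[X in _ <= X]mulr1; apply: ler_pM => //; first exact: mulr_ge0.
exact: ler_piMl.
Qed.

(** The increment of [wd] is expanded by [ae_quotient2]; for |t| <= 1 the linear term is also
    bounded by a multiple of |t|^alpha. *)
Lemma ae_quotient1 i x (t : R) : `|x| + `|t| < M -> `|t| <= 1 ->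
  `|w (t *: Defs.coord i + x) - w x - t * wd i x| <= `|t| * ((C * (3 + `|x|)) * `|t| `^ alpha).
Proof.
move=> Mt t1; have e1 : `|Defs.coord i : V| <= 1 by exact: (frame_norm frame_coord).
have seg s : 0 <= s <= 1 -> `|x| + `|s * t| < M.
  by move=> /andP[s0 s1] /=; apply: le_lt_trans Mt; rewrite lerD2l normrM (ger0_norm s0); exact: ler_piMl.
have segQ s : 0 <= s <= 1 -> Q M (s *: (t *: Defs.coord i) + x).
  move=> s01 /=; apply: le_lt_trans (seg s s01); rewrite addrC; apply: (le_trans (ler_normD _ _)).
  by rewrite lerD2l scalerA normrZ; apply: ler_piMr.
have Mx : Q M x by rewrite /=; apply: le_lt_trans Mt; rewrite lerDl.
have [s s01 ->] := mvt_line (x := x) (v := t *: Defs.coord i)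
  (fun s s01 => is_derive_dirZ t ((ae_C2 H).1 _ (segQ s s01) i)).
have [s0 s1] := andP s01.
rewrite -mulrBr normrM; apply: ler_wpM2l => //.
have st1 : `|s * t| <= `|t| by rewrite normrM (ger0_norm s0) ler_piMl.
have := ae_quotient2 i i (seg s s01); rewrite -scalerA => Hq.
have -> : wd i (s *: (t *: Defs.coord i) + x) - wd i x =
   (wd i (s *: (t *: Defs.coord i) + x) - wd i x - s * t * wdd i i x) + s * t * wdd i i x by ring.
have ta : `|t| <= `|t| `^ alpha.
  have [->|tn] := eqVneq t 0; first by rewrite normr0 powR_ge0.
  rewrite -{1}[`|t|](@powRr1 R) //; apply: ger_powR; [|exact: ltW].
  by rewrite normr_gt0 tn t1.
apply: (le_trans (ler_normD _ _)).
have -> : C * (3 + `|x|) * `|t| `^ alpha = C * `|t| `^ alpha * 2 + `|t| `^ alpha * (C * (1 + `|x|) ^+ 1) by ring.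
apply: lerD.
  apply: (le_trans Hq); apply: (@le_trans _ _ (1 * (C * `|t| `^ alpha))).
    apply: ler_pM => //; first by apply: mulr_ge0 => //; exact: powR_ge0.
      exact: le_trans st1 t1.
    apply: ler_wpM2l => //; apply: ge0_ler_powR; rewrite ?nnegrE // ltW //.
  by rewrite mul1r ler_peMr //; [apply: mulr_ge0 => //; exact: powR_ge0|lra].
rewrite normrM; apply: ler_pM => //; last exact: ae_bound2.
exact: le_trans st1 ta.
Qed.

End Bounds.

Lemma cvg_bigsum (U : set_system nat) (T : finType) (f : T -> nat -> R) (l : T -> R) : Filter U ->
  (forall i, f i m @[m --> U] --> l i) -> \sum_i f i m @[m --> U] --> \sum_i l i.
Proof. by move=> UF fl; apply: cvg_big => //; exact: add_continuous. Qed.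

Lemma cvg_mulc (U : set_system nat) (t : R) (a : nat -> R) (l : R) : Filter U ->
  a m @[m --> U] --> l -> t * a m @[m --> U] --> t * l.
Proof. by move=> UF al; apply: cvgM => //; exact: cvg_cst. Qed.

Lemma holder_flux (O : set V) A wdd i j : (forall i j k l, `|A i j k l| <= Lam) ->
  (forall i j, holder_on O alpha C (wdd i j)) ->
  holder_on O alpha (n%:R ^+ 2 * Lam * C) (fun x => \sum_k \sum_l A i j k l * wdd k l x).
Proof.
move=> AL wC x y Ox Oy.
have -> : \sum_k \sum_l A i j k l * wdd k l x - \sum_k \sum_l A i j k l * wdd k l y =
   \sum_k \sum_l A i j k l * (wdd k l x - wdd k l y).
  by rewrite -sumrB; apply: eq_bigr => k _; rewrite -sumrB; apply: eq_bigr => l _; rewrite mulrBr.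
apply: (le_trans (ler_norm_sum _ _ _)).
apply: (@le_trans _ _ (\sum_(k < n) \sum_(l < n) (Lam * (C * `|x - y| `^ alpha)))).
  apply: ler_sum => k _; apply: (le_trans (ler_norm_sum _ _ _)); apply: ler_sum => l _.
  by rewrite normrM; apply: ler_pM => //; exact: wC.
rewrite !sum_cst; rewrite le_eqVlt; apply/orP; left; apply/eqP; ring.
Qed.

(* Were this false, a sequence of counterexamples on growing cubes would
   converge, along an ultrafilter, to an entire solution contradicting
   [liouville]. *)
Theorem compact_liouville (e : R) : 0 < e -> exists M d : R, [/\ 1 < M, 0 < d &
  forall A w wd wdd B, almost_entire M d A w wd wdd B ->
  forall i j z, `|z| <= 1 -> `|wdd i j z| <= e].
Proof.
move=> e0; apply: contrapT => H.
have Hm (m : nat) : exists D : ('I_n -> 'I_n -> 'I_n -> 'I_n -> R) * (V -> R) * ('I_n -> V -> R) *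
    ('I_n -> 'I_n -> V -> R) * ('I_n -> 'I_n -> V -> R),
  almost_entire (m%:R + 2) (m.+1%:R^-1) D.1.1.1.1 D.1.1.1.2 D.1.1.2 D.1.2 D.2 /\
  exists i j z, `|z| <= 1 /\ e < `|D.1.2 i j z|.
  (* The m-th counterexample lives on the cube of radius m + 2 with error at most 1/(m + 1). *)
  apply: contrapT => HN; apply: H; exists (m%:R + 2), m.+1%:R^-1; split.
  - have : 0 <= m%:R :> R by []. lra.
  - by rewrite invr_gt0 ltr0n.
  - move=> A w wd wdd B HD i j z z1; rewrite leNgt; apply/negP => ez; apply: HN.
    by exists (A, w, wd, wdd, B); split => //; exists i, j, z.
have {Hm} /choice [D HD] := Hm.
pose As m := (D m).1.1.1.1; pose ws m := (D m).1.1.1.2; pose wds m := (D m).1.1.2.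
pose wdds m := (D m).1.2; pose Bs m := (D m).2; pose Ms (m : nat) : R := m%:R + 2.
have HE m : almost_entire (Ms m) (m.+1%:R^-1) (As m) (ws m) (wds m) (wdds m) (Bs m) by exact: (HD m).1.
have [U UF [UN Ub]] := @ultralimit R.
have nearM r : \forall m \near U, r < Ms m.
  have := UN (Num.truncn `|r|); apply: filterS => m /= rm.
  have := truncnS_gt `|r|; have := ler_norm r; rewrite /Ms.
  have : (Num.truncn `|r|).+1%:R <= m%:R + 1 :> R by rewrite natr1 ler_nat.
  lra.
have /choice [Al HAl] (p : 'I_n * 'I_n * 'I_n * 'I_n) : exists l : R, As m p.1.1.1 p.1.1.2 p.1.2 p.2 @[m --> U] --> l.
  by apply: (Ub _ Lam); apply: nearW => m; exact: (ae_bound (HE m)).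
pose A i j k l := Al (i, j, k, l).
have cA i j k l : As m i j k l @[m --> U] --> A i j k l by exact: (HAl (i, j, k, l)).
have /choice [w cw] (x : V) : exists l : R, ws m x @[m --> U] --> l.
  by apply: (Ub _ _ _); apply: filterS (nearM `|x|) => m; exact: (ae_bound0 (HE m)).
have /choice [wd' cwd'] (p : 'I_n * V) : exists l : R, wds m p.1 p.2 @[m --> U] --> l.
  by apply: (Ub _ _ _); apply: filterS (nearM `|p.2|) => m; exact: (ae_bound1 (HE m)).
have /choice [wdd' cwdd'] (p : 'I_n * 'I_n * V) : exists l : R, wdds m p.1.1 p.1.2 p.2 @[m --> U] --> l.
  by apply: (Ub _ _ _); apply: filterS (nearM `|p.2|) => m; exact: (ae_bound2 (HE m)).
pose wd i x := wd' (i, x); pose wdd i j x := wdd' (i, j, x).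
have cwd i x : wds m i x @[m --> U] --> wd i x by exact: (cwd' (i, x)).
have cwdd i j x : wdds m i j x @[m --> U] --> wdd i j x by exact: (cwdd' (i, j, x)).
have wddC i j : holder_on setT alpha C (wdd i j).
  move=> x y _ _; apply: (cvgr_to_le (cvg_norm (cvgB (cwdd i j x) (cwdd i j y)))).
  near=> m; apply: (ae_holder (HE m)) => /=; near: m; exact: nearM.
(* The quotient estimates do not depend on [m], so the limits [wd] and [wdd] are indeed the
   derivatives of [w]. *)
have Cw : C2on setT w wd wdd.
  split=> [x _ i|i].
    apply: (@quotient_holder_derive _ _ w x (Defs.coord i) (wd i x) (C * (3 + `|x|)) alpha 1) => // t t1.
    have cc : ws m (t *: Defs.coord i + x) - ws m x - t * wds m i x @[m --> U] --> w (t *: Defs.coord i + x) - w x - t * wd i x.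
      by apply: cvgB; [apply: cvgB; exact: cw|exact: cvg_mulc].
    apply: (cvgr_to_le (cvg_norm cc)).
    near=> m; apply: (ae_quotient1 (HE m)) => //; near: m; exact: nearM.
  split=> x _ j.
    apply: (@quotient_holder_derive _ _ (wd i) x (Defs.coord j) (wdd i j x) C alpha 1) => // t t1.
    have cc : wds m i (t *: Defs.coord j + x) - wds m i x - t * wdds m i j x @[m --> U] --> wd i (t *: Defs.coord j + x) - wd i x - t * wdd i j x.
      by apply: cvgB; [apply: cvgB; exact: cwd|exact: cvg_mulc].
    apply: (cvgr_to_le (cvg_norm cc)).
    near=> m; apply: (ae_quotient2 (HE m)) => //; near: m; exact: nearM.
  exact: holder_continuous openT a0 (wddC i j) _.
have AL i j k l : `|A i j k l| <= Lam.
  apply: (cvgr_to_le (cvg_norm (cA i j k l))); apply: nearW => m; exact: (ae_bound (HE m)).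
have Aell : elliptic A lam.
  move=> xi sxi; apply: (@cvgr_to_ge nat U UF R (fun m => \sum_i \sum_j \sum_k \sum_l As m i j k l * xi i j * xi k l)).
    apply: cvg_bigsum => i; apply: cvg_bigsum => j; apply: cvg_bigsum => k; apply: cvg_bigsum => l.
    by apply: cvgM; [apply: cvgM|]; [exact: cA|exact: cvg_cst|exact: cvg_cst].
  by apply: nearW => m; exact: (ae_elliptic (HE m)).
pose c i j x := \sum_k \sum_l A i j k l * wdd k l x.
pose cs m i j x := \sum_k \sum_l As m i j k l * wdds m k l x.
have ccs i j x : cs m i j x @[m --> U] --> c i j x.
  by apply: cvg_bigsum => k; apply: cvg_bigsum => l; apply: cvgM; [exact: cA|exact: cwdd].
have uniform i j r (e' : R) : 0 < e' -> \forall m \near U, forall x, `|x| <= r -> `|cs m i j x - c i j x| <= e'.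
  apply: (equicontinuous_uniform (K := [set x | `|x| <= r]) _ (@compact_cube R n r) a0) => //.
  - near=> m; apply: holder_flux; first exact: (ae_bound (HE m)).
    move=> k l x y /= xr yr; apply: (ae_holder (HE m)) => /=.
      by apply: le_lt_trans xr _; near: m; exact: nearM.
    by apply: le_lt_trans yr _; near: m; exact: nearM.
  - by apply: holder_flux => // k l x y _ _; exact: wddC.
(* A fixed test function is eventually admissible, as the cubes exhaust the space; the fluxes
   converge uniformly on its support and the errors [Bs m] tend to 0. *)
have Esol : solves setT c.
  move=> f fd fdd tf; apply/eqP; rewrite -normr_le0; apply/ler_addgt0Pr => /= e1 e10; rewrite add0r.
  have [K [cK _ fK fdK fddK]] := test_support tf.
  have [r0 _ r0P] : exists2 r : R, 0 <= r & forall x, K x -> `|x| <= r.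
    have [M [_ KM]] := compact_bounded cK; exists (`|M| + 1); first exact: addr_ge0.
    by move=> x Kx; apply: KM Kx; rewrite ltr_pwDr // ler_norm.
  have Cfdd i j := Cc_test2 i j tf.
  have CN : Cc (fun x => \sum_i \sum_j `|fdd i j x|) by apply: Cc_sum => i; apply: Cc_sum => j; exact: Cc_norm.
  pose J := I (fun x => \sum_i \sum_j `|fdd i j x|).
  have J0 : 0 <= J by apply: int_ge0 => // x; apply: sumr_ge0 => i _; apply: sumr_ge0.
  pose e2 := e1 / (2 * (J + 1)).
  have J1 : 0 < J + 1 by rewrite ltr_wpDl.
  have e20 : 0 < e2 by rewrite divr_gt0 // mulr_gt0.
  have [m [m1 [m2 m3]]] : exists m, r0 < Ms m /\ m.+1%:R^-1 <= e2 /\ forall i j x, `|x| <= r0 -> `|cs m i j x - c i j x| <= e2.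
    apply: (@filter_ex _ U); near=> m; split; first by near: m; exact: nearM.
    split; last first.
      near: m; apply: filter_forall => i; apply: filter_forall => j; exact: uniform.
    rewrite -[e2]invrK lef_pV2 ?posrE ?invr_gt0 //; apply: (@le_trans _ _ (Ms m - 1)).
      by apply: ltW; rewrite ltrBrDr; near: m; exact: nearM.
    by rewrite /Ms -natr1; lra.
  have tfm : test (Q (Ms m)) f fd fdd.
    split; first exact: tf.1; exists K; split => //; move=> x Kx /=; apply: le_lt_trans m1; exact: r0P.
  have Hs := ae_solves (HE m) tfm.
  have ccm i j x : Q (Ms m) x -> {for x, continuous (fun x => cs m i j x + Bs m i j x)}.
    move=> Qx; apply: contD; last exact: (ae_cont (HE m)).
    by apply: continuous_flux => k l; exact: ((ae_C2 (HE m)).2 k).2.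
  have Cm : Cc (fun x => \sum_i \sum_j (cs m i j x + Bs m i j x) * fdd i j x).
    apply: Cc_sum => i; apply: Cc_sum => j.
    exact: (Cc_pairing (c := fun i j x => cs m i j x + Bs m i j x) (@open_cube (Ms m)) (ccm i j) tfm).
  have Cl : Cc (fun x => \sum_i \sum_j c i j x * fdd i j x).
    apply: Cc_sum => i; apply: Cc_sum => j; apply: (Cc_pairing openT _ tf) => x _.
    by apply: continuous_flux => k l; exact: (Cw.2 k).2.
  have -> : I (fun x => \sum_i \sum_j c i j x * fdd i j x) =
     I (fun x => (\sum_i \sum_j c i j x * fdd i j x) - \sum_i \sum_j (cs m i j x + Bs m i j x) * fdd i j x).
    by rewrite intB // Hs subr0.
  apply: (@le_trans _ _ ((2 * e2) * J)); last first.
    rewrite (_ : 2 * e2 * J = e1 * (J / (J + 1))); last by rewrite /e2; field; rewrite gt_eqF.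
    by apply: ler_piMr; [exact: ltW|rewrite ler_pdivrMr // mul1r lerDl].
  rewrite /J -intZ //; apply: int_norm; [exact: CcB|exact: CcZ|].
  move=> x; rewrite -sumrB mulr_sumr; apply: (le_trans (ler_norm_sum _ _ _)); apply: ler_sum => i _.
  rewrite -sumrB mulr_sumr; apply: (le_trans (ler_norm_sum _ _ _)); apply: ler_sum => j _.
  have [Kx|Kx] := pselect (K x); last by rewrite fddK // !mulr0 subr0 normr0 mulr0.
  rewrite -mulrBl normrM; apply: ler_wpM2r => //.
  have h1 := m3 i j x (r0P x Kx).
  have h2 : `|Bs m i j x| <= e2.
    by apply: le_trans m2; apply: (ae_small (HE m)) => /=; apply: le_lt_trans m1; exact: r0P.
  by move: h1 h2; rewrite !ler_norml => /andP[? ?] /andP[? ?]; apply/andP; split; lra.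
have w0 i j z : wdd i j z = 0.
  rewrite (liouville lam0 AL Aell a0 a1 (conj Cw Esol) (fun i j x y => wddC i j x y Logic.I Logic.I) i j z 0).
  apply/eqP; rewrite -normr_le0; apply: (cvgr_to_le (cvg_norm (cwdd i j 0))).
  by apply: nearW => m; rewrite (ae_zero2 (HE m)) normr0.
(* The point that violates the bound varies with [m], so convergence to 0 must be uniform on the
   unit cube. *)
have small : \forall m \near U, forall i j z, `|z| <= 1 -> `|wdds m i j z| <= e.
  apply: filter_forall => i; apply: filter_forall => j.
  have := @equicontinuous_uniform R n U [set x | `|x| <= 1] (fun m => wdds m i j) (fun=> 0) C 0 alpha UF (@compact_cube R n 1) a0.
  move=> E; have {E} := E _ _ _ e e0; rewrite /= => E.
  have : \forall m \near U, forall x, `|x| <= 1 -> `|wdds m i j x - 0| <= e.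
    apply: E.
    - near=> m => x y /= x1 y1; apply: (ae_holder (HE m)) => /=.
        by apply: le_lt_trans x1 _; near: m; exact: nearM.
      by apply: le_lt_trans y1 _; near: m; exact: nearM.
    - by move=> x y _ _; rewrite subrr normr0 mul0r.
    - by move=> x _; rewrite -(w0 i j x); exact: cwdd.
  by apply: filterS => m Hm z z1; have := Hm z z1; rewrite subr0.
have [m Hsm] := filter_ex small.
have [_ [i [j [z [z1]]]]] := HD m; rewrite ltNge => /negP; apply; exact: Hsm.
Unshelve. all: by end_near.
Qed.

End Compactness.

Lemma powR_mono {R : realType} (a x y : R) : 0 < a -> 0 <= x -> x <= y -> x `^ a <= y `^ a.
Proof.
move=> a0 x0 xy; have y0 := le_trans x0 xy.
by apply: ge0_ler_powR xy; rewrite ?nnegrE // ltW.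
Qed.

(** * Affine changes of variable, constant fluxes, quadratic polynomials *)

Section Affine.
Context {R : realType} {n : nat}.
Notation V := 'rV[R]_n.
Notation I := (@integral_Rn R n).
Implicit Types (f g : V -> R) (x y h : V).

(** The integral of a derivative of a compactly supported function is 0. This permits subtracting
    from a flux its value at one point. *)
Lemma solves_cst (O : set V) (c : 'I_n -> 'I_n -> R) : solves O (fun i j _ => c i j).
Proof.
move=> f fd fdd tf; have Cf i j := Cc_test2 i j tf.
have tT : test setT f fd fdd by exact: test_sub tf.
have Cf1 i : Cc (fd i).
  apply: Cc_vanish; first by move=> x; exact: C1on_continuous openT (tT.1.2 i) Logic.I.
  by have [K [? ? _ H _]] := test_support tT; exists K; split => // x Kx; exact: H.
rewrite int_sum; last by move=> i; apply: Cc_sum => j; exact: CcZ.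
rewrite big1 // => i _; rewrite int_sum; last by move=> j; exact: CcZ.
rewrite big1 // => j _; rewrite intZ //.
by rewrite (int_derive j (tT.1.2 i) (Cf1 i)) ?mulr0.
Qed.

Lemma vanish_off_affine (O : set V) f (k : R) a : 0 < k -> vanish_off [set x | O (k *: x + a)] f ->
  vanish_off O (fun y => f (k^-1 *: y + - (k^-1 *: a))).
Proof.
move=> k0 [K [cK KO fK]]; exists ((fun x => k *: x + a) @` K); split.
- apply: continuous_compact cK; apply: continuous_subspaceT => x.
  by apply: (@continuousD _ _ _ (fun x => k *: x) (fun=> a)); [exact: scaler_continuous|exact: (@cst_continuous _ _ a x)].
- by move=> _ [y Ky <-] /=; exact: KO.
- move=> x Kx; apply: fK => Kxh; apply: Kx; eexists; first exact: Kxh.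
  by rewrite scalerDr scalerN !scalerA divff ?gt_eqF // !scale1r subrK.
Qed.

Lemma solves_affine O (c : 'I_n -> 'I_n -> V -> R) (k : R) a : 0 < k -> open O ->
  (forall i j x, O x -> {for x, continuous (c i j)}) ->
  solves O c -> solves [set x | O (k *: x + a)] (fun i j x => c i j (k *: x + a)).
Proof.
move=> k0 oO cc sc f fd fdd tf.
have kn : k != 0 by rewrite gt_eqF.
have tf' : test O (fun y => f (k^-1 *: y + - (k^-1 *: a))) (fun i y => k^-1 * fd i (k^-1 *: y + - (k^-1 *: a)))
    (fun i j y => k^-1 ^+ 2 * fdd i j (k^-1 *: y + - (k^-1 *: a))).
  split; last exact: vanish_off_affine tf.2.
  by apply: C2on_sub (C2on_affine k^-1 (- (k^-1 *: a)) tf.1).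
have := sc _ _ _ tf'; set F := fun x => _ => IF0.
have CF : Cc F.
  by apply: Cc_sum => i; apply: Cc_sum => j; apply: (Cc_pairing oO _ tf') => x; exact: cc.
have CF' := Cc_dilate k0 (Cc_shift a CF).
have H : I (fun x => F (k *: x + a)) = 0.
  have /eqP := int_dilate k0 (Cc_shift a CF); rewrite int_shift // /F IF0.
  by rewrite mulf_eq0 expf_eq0 (negPf kn) andbF => /eqP.
have -> : (fun x => \sum_i \sum_j c i j (k *: x + a) * fdd i j x) = (fun x => k ^+ 2 * F (k *: x + a)).
  apply/funext => x; rewrite /F mulr_sumr; apply: eq_bigr => i _; rewrite mulr_sumr; apply: eq_bigr => j _.
  rewrite scalerDr scalerA mulVf // scale1r addrK.
  by field.
by rewrite intZ // H mulr0.
Qed.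

Lemma is_derive_coord x i j : is_derive x (Defs.coord j : V) (fun z : V => z 0 i) ((i == j)%:R : R).
Proof.
have -> : ((i == j)%:R : R) = (Defs.coord j : V) 0 i by rewrite mxE eqxx.
apply: (@quotient_holder_derive _ _ _ _ _ _ 0 1 1) => // t _.
by rewrite !mxE addrK subrr normr0 !mul0r mulr0.
Qed.

Lemma C1on_coord i : C1on setT (fun z : V => z 0 i) (fun j _ => (i == j)%:R).
Proof. by split=> x _ j; [exact: is_derive_coord|exact: cont_cst]. Qed.

Lemma C1on_affine_form (c0 : R) (c : 'I_n -> R) :
  C1on setT (fun z : V => c0 + \sum_j z 0 j * c j) (fun j _ => c j).
Proof.
have Cc0 : C1on setT (fun _ : V => c0) (fun (_ : 'I_n) _ => 0).
  by split=> x _ j; [exact: is_derive_cst|exact: cont_cst].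
have := C1onD 1 Cc0 (C1on_comb c C1on_coord).
congr (C1on _ _ _); first by apply/funext => z; rewrite mul1r.
apply/funext => j; apply/funext => z; rewrite mulr0 add0r (bigD1 j) //= eqxx mul1r big1 ?addr0 // => i /negPf ->.
by rewrite mul0r.
Qed.

(** The inner [0 +] keeps the linear factor in the shape of [C1on_affine_form]. *)
Lemma C2on_quadratic (c0 : R) (b : 'I_n -> R) (H : 'I_n -> 'I_n -> R) : (forall i j, H i j = H j i) ->
  C2on setT (fun z : V => c0 + \sum_i z 0 i * b i + 2^-1 * \sum_i z 0 i * (0 + \sum_j z 0 j * H i j))
    (fun i z => b i + \sum_j z 0 j * H i j) (fun i j _ => H i j).
Proof.
move=> sH; split; last by move=> i; exact: C1on_affine_form.
pose q (z : V) := \sum_i (z 0 i * (0 + \sum_j z 0 j * H i j)) * 1.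
have Cq : C1on setT q (fun j z => \sum_i ((i == j)%:R * (0 + \sum_j z 0 j * H i j) + z 0 i * H i j) * 1).
  by apply: C1on_comb => i; exact: (C1onM openT (C1on_coord i) (C1on_affine_form 0 (H i))).
have := (C1onD 2^-1 Cq (C1on_affine_form c0 b)).1.
move=> D x _ i; have := D x Logic.I i.
have -> : (fun z => 2^-1 * q z + (c0 + \sum_j z 0 j * b j)) = (fun z : V => c0 + \sum_i z 0 i * b i + 2^-1 * \sum_i z 0 i * (0 + \sum_j z 0 j * H i j)).
  by apply/funext => z; rewrite addrC; congr (_ + _ * _); apply: eq_bigr => k _; rewrite mulr1.
congr (is_derive _ _ _ _).
have -> : \sum_i0 ((i0 == i)%:R * (0 + \sum_j x 0 j * H i0 j) + x 0 i0 * H i0 i) * 1 = (\sum_j x 0 j * H i j) + \sum_j x 0 j * H i j.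
  under eq_bigr do rewrite mulr1 add0r.
  rewrite big_split /=; congr (_ + _); last by apply: eq_bigr => k _; rewrite sH.
  rewrite (bigD1 i) //= eqxx mul1r [X in _ + X]big1; last by move=> k /negPf ->; rewrite mul0r.
  by rewrite addr0.
by field.
Qed.

End Affine.

(** * Interior estimate on the unit cube *)

Section Schauder.
Context {R : realType} {n : nat} (lam Lam alpha : R).
Notation V := 'rV[R]_n.
Notation I := (@integral_Rn R n).
Notation Q := [set x : V | `|x| < 1].
Implicit Types (f g v : V -> R) (x y h : V) (A : 'I_n -> 'I_n -> 'I_n -> 'I_n -> V -> R).

Record coefficients (O : set V) A : Prop := Coefficients {
  coef_bound : forall i j k l x, O x -> `|A i j k l x| <= Lam;
  coef_holder : forall i j k l, holder_on O alpha Lam (A i j k l);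
  coef_elliptic : forall x, O x -> elliptic (fun i j k l => A i j k l x) lam }.

(** One constant [K] bounds both the size of [v] and the oscillation of the flux [G], so that the
    data scale together when the equation is multiplied by a number. Only the oscillation of [G]
    counts, since constant fluxes solve the equation. *)
Record solution (O : set V) A (K : R) v vd vdd (G : 'I_n -> 'I_n -> V -> R) : Prop := Solution {
  sol_C2 : C2on O v vd vdd;
  sol_bound : forall x, O x -> `|v x| <= K;
  sol_holder : forall i j, holder_on O alpha K (G i j);
  sol_eq : solves O (fun i j x => \sum_k \sum_l A i j k l x * vdd k l x + G i j x) }.

(* Interior Hoelder bound weighted by the distance t to the boundary. *)
Definition weighted (L : R) (vdd : 'I_n -> 'I_n -> V -> R) : Prop := forall i j x y t,
  0 < t -> `|x| + t <= 1 -> `|y| + t <= 1 ->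
  t ^+ 2 * t `^ alpha * `|vdd i j x - vdd i j y| <= L * `|x - y| `^ alpha.

Hypotheses (lam0 : 0 < lam) (Lam0 : 0 <= Lam) (a0 : 0 < alpha) (a1 : alpha < 1).

(** A second difference of [v] with step tau t is at most 4 K and equals (tau t)^2 times a second
    derivative at a nearby point; the weighted Hoelder bound carries this over to [x]. A small
    [tau], and then a small [K], make the bound small. *)
Lemma interpolation (K tau : R) v vd vdd i j x t : C2on Q v vd vdd -> (forall x, Q x -> `|v x| <= K) ->
  weighted 1 vdd -> 0 < t -> `|x| + t <= 1 -> 0 < tau -> tau <= 4^-1 ->
  t ^+ 2 * `|vdd i j x| <= 4 * K / tau ^+ 2 + 4 * (4 * tau) `^ alpha.
Proof.
move=> Cv vK W t0 xt tau0 tau4; pose k := tau * t.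
have k0 : 0 < k by exact: mulr_gt0.
have k4 : k <= t / 4 by rewrite /k mulrC; apply: ler_wpM2l; [exact: ltW|].
have e1 p : `|Defs.coord p : V| <= 1 by exact: (frame_norm frame_coord).
have pt (a b : R) : 0 <= a <= 1 -> 0 <= b <= 1 ->
    `|(a * k) *: (Defs.coord i : V) + (b * k) *: Defs.coord j| <= 2 * k.
  have nz (c : R) p : 0 <= c <= 1 -> `|(c * k) *: (Defs.coord p : V)| <= k.
    move=> /andP[c0 c1]; have ck : 0 <= c * k by apply: mulr_ge0 => //; exact: ltW.
    rewrite normrZ ger0_norm // -[X in _ <= X]mulr1; apply: ler_pM => //.
    by apply: ler_piMl => //; exact: ltW.
  move=> a01 b01; apply: (le_trans (ler_normD _ _)).
  by have := nz a i a01; have := nz b j b01; lra.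
have ptQ (a b : R) : 0 <= a <= 1 -> 0 <= b <= 1 ->
    `|(a * k) *: (Defs.coord i : V) + (b * k) *: Defs.coord j + x| + t / 2 <= 1.
  move=> a01 b01; have := pt a b a01 b01; have := ler_normD ((a * k) *: (Defs.coord i : V) + (b * k) *: Defs.coord j) x; lra.
have inQ (y : V) : `|y| + t / 2 <= 1 -> Q y by move=> /=; lra.
have [|s [u [s01 u01 E]]] := @second_difference R V v (vd i) (vdd i j) x (Defs.coord i) (Defs.coord j) k.
  move=> s u s01 u01; have Qs := inQ _ (ptQ s u s01 u01).
  by split; [exact: Cv.1|exact: C2on_derive2 Cv Qs].
set xi := (s * k) *: Defs.coord i + (u * k) *: Defs.coord j + x in E.
have Qxi := ptQ s u s01 u01.
have I1 : (0 : R) <= 1 <= (1 : R) by rewrite lexx ler01.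
have I0 : (0 : R) <= 0 <= (1 : R) by rewrite lexx ler01.
have b1 := vK _ (inQ _ (ptQ 1 1 I1 I1)); have b2 := vK _ (inQ _ (ptQ 1 0 I1 I0)).
have b3 := vK _ (inQ _ (ptQ 0 1 I0 I1)); have b4 := vK _ (inQ _ (ptQ 0 0 I0 I0)).
rewrite !mul1r !mul0r !scale0r ?addr0 ?add0r in b1 b2 b3 b4.
have H1 : k ^+ 2 * `|vdd i j xi| <= 4 * K.
  rewrite -[k ^+ 2]gtr0_norm ?exprn_gt0 // -normrM -E.
  move: b1 b2 b3 b4; rewrite !ler_norml => /andP[? ?] /andP[? ?] /andP[? ?] /andP[? ?].
  by apply/andP; split; lra.
have t20 : 0 < t / 2 by rewrite divr_gt0.
have xt2 : `|x| + t / 2 <= 1 by lra.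
have H2 := W i j xi x (t / 2) t20 Qxi xt2.
(* The displacement is at most 2 tau t, which is below (4 tau)(t/2) or equal to it; t/2 is the
   distance to the boundary still available. *)
have H3 : `|xi - x| `^ alpha <= (4 * tau) `^ alpha * (t / 2) `^ alpha.
  rewrite -powRM; [|by apply: mulr_ge0 => //; exact: ltW|exact: ltW].
  apply: powR_mono => //; rewrite /xi addrK; apply: (le_trans (pt s u s01 u01)); rewrite /k; lra.
have p0 : 0 < (t / 2) `^ alpha by exact: powR_gt0.
have H4 : t ^+ 2 * `|vdd i j xi - vdd i j x| <= 4 * (4 * tau) `^ alpha.
  have := le_trans H2 (ler_wpM2l ler01 H3).
  rewrite mul1r -mulrA mulrCA -mulrA [X in _ <= X]mulrC ler_pM2l // => H.
  have -> : t ^+ 2 = 4 * (t / 2) ^+ 2 by field.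
  by rewrite -mulrA; apply: ler_wpM2l => //; rewrite expr2 -mulrA.
have H5 : t ^+ 2 * `|vdd i j xi| <= 4 * K / tau ^+ 2.
  by rewrite ler_pdivlMr ?exprn_gt0 // mulrAC -exprMn mulrC (mulrC t) -/k mulrC.
have : `|vdd i j x| <= `|vdd i j xi| + `|vdd i j xi - vdd i j x|.
  by have := ler_normB (vdd i j xi) (vdd i j xi - vdd i j x); rewrite opprB addrC subrK.
have t2 : 0 <= t ^+ 2 by exact: sqr_ge0.
move=> /(ler_wpM2l t2); rewrite mulrDr; lra.
Qed.

Lemma powR2_le2 (t : R) : 0 <= t -> t `^ alpha <= 2 * (t / 2) `^ alpha.
Proof.
move=> t0; have -> : t = 2 * (t / 2) by field.
rewrite powRM ?divr_ge0 //; have -> : 2 * (t / 2) / 2 = t / 2 by field.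
apply: ler_wpM2r; first exact: powR_ge0.
by rewrite -{2}[2](@powRr1 R) //; apply: ler_powR; [lra|exact: ltW].
Qed.

(* Blow-up at a pair of points violating the bound, which by [interpolation] are
   close compared with their distance to the boundary; subtracting the second order Taylor polynomial gives an almost entire
   solution, whose second derivatives are small by [compact_liouville]. *)
Lemma improvement : exists2 eps : R, 0 < eps & forall A v vd vdd G,
  coefficients Q A -> solution Q A eps v vd vdd G -> weighted 1 vdd -> weighted 2^-1 vdd.
Proof.
have h0 : (0 : R) < 2^-1 by rewrite invr_gt0.
(* The constant 8 is the Hoelder bound of the rescaled second derivatives: the weighted bound is
   used at distance t/2, which costs 4 from the square and at most 2 from the power alpha. *)
have [M [d [M1 d0 HL]]] := @compact_liouville R n lam Lam 8 alpha lam0 (ltac:(lra) : 0 <= 8) a0 a1 2^-1 h0.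
pose N : R := n%:R; pose P := M `^ alpha.
have N0 : 0 <= N by [].
have M0 : 0 < M by lra.
have P0 : 0 < P by exact: powR_gt0.
(* [S] gathers what [kap] must beat: [4 * P] so that the cube of radius M r about [x] stays at
   distance t/2 from the boundary, the other terms so that the error [B] is at most [d]. *)
pose S := 4 * P + 4 * (N ^+ 2 * Lam * P) + P + 1.
have NLP : 0 <= N ^+ 2 * Lam * P.
  by apply: mulr_ge0; [apply: mulr_ge0 => //; exact: sqr_ge0|exact: ltW].
have S0 : 0 < S by rewrite /S; lra.
pose d' := Num.min d ((2^-1) `^ alpha).
have d'0 : 0 < d' by rewrite lt_min d0 powR_gt0.
pose kap := d' / S.
have kap0 : 0 < kap by exact: divr_gt0.
have kS : kap * S = d' by rewrite /kap divfK // gt_eqF.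
have kS1 : 4 * P * kap <= (2^-1) `^ alpha.
  have : d' <= (2^-1) `^ alpha by rewrite ge_min lexx orbT.
  have q1 : 0 <= kap * (S - 4 * P) by apply: mulr_ge0; [exact: ltW|rewrite /S; lra].
  by move: q1; rewrite mulrBr kS; lra.
have kS2 : kap * (4 * (N ^+ 2 * Lam * P) + P) <= d.
  have : d' <= d by rewrite ge_min lexx.
  have q1 : 0 <= kap * (S - (4 * (N ^+ 2 * Lam * P) + P)) by apply: mulr_ge0; [exact: ltW|rewrite /S; lra].
  by move: q1; rewrite mulrBr kS; lra.
have [rr rr0 Hrr] := powR_small 4 (divr_gt0 kap0 (ltac:(lra) : (0 : R) < 2)) a0.
(* [tau], and then [eps], are chosen so that [interpolation] bounds t^2 times the second derivatives
   by [kap]. *)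
pose tau := Num.min 4^-1 (rr / 4).
have tau0 : 0 < tau by rewrite lt_min invr_gt0 divr_gt0 // andbT.
have tau4 : tau <= 4^-1 by rewrite ge_min lexx.
have tauS : 4 * (4 * tau) `^ alpha <= kap / 2.
  apply: Hrr; first by lra.
  have : tau <= rr / 4 by rewrite ge_min lexx orbT.
  lra.
pose eps := Num.min kap (kap * tau ^+ 2 / 8).
have eps0 : 0 < eps by rewrite lt_min kap0 divr_gt0 // mulr_gt0 // exprn_gt0.
have epsk : eps <= kap by rewrite ge_min lexx.
have epst : 4 * eps / tau ^+ 2 <= kap / 2.
  have t2 : 0 < tau ^+ 2 by exact: exprn_gt0.
  rewrite ler_pdivrMr //; have : eps <= kap * tau ^+ 2 / 8 by rewrite ge_min lexx orbT.
  lra.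
exists eps => // A v vd vdd G HA HS W i j x y t t0 xt yt.
have interp k l z t' : 0 < t' -> `|z| + t' <= 1 -> t' ^+ 2 * `|vdd k l z| <= kap.
  move=> t'0 zt; have := interpolation k l (sol_C2 HS) (sol_bound HS) W t'0 zt tau0 tau4; lra.
rewrite leNgt; apply/negP => Hlt.
pose r := `|x - y|.
have tp : 0 < t `^ alpha by exact: powR_gt0.
have t20 : 0 < t ^+ 2 by exact: exprn_gt0.
have r0 : 0 < r.
  rewrite lt_neqAle normr_ge0 andbT eq_sym; apply/eqP => r0.
  move: r0 Hlt => /eqP; rewrite normr_eq0 subr_eq0 => /eqP ->.
  by rewrite !subrr !normr0 mulr0 powR0 ?mulr0 ?ltxx // gt_eqF.
have rp : 0 < r `^ alpha by exact: powR_gt0.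
(* Both second derivatives have size at most kap / t^2, so the bound can fail only for points that
   are close together compared with [t]. *)
have rt : r `^ alpha <= 4 * kap * t `^ alpha.
  have h1 := interp i j x t t0 xt; have h2 := interp i j y t t0 yt.
  have h3 : t ^+ 2 * `|vdd i j x - vdd i j y| <= 2 * kap.
    have := ler_wpM2l (ltW t20) (ler_normB (vdd i j x) (vdd i j y)); rewrite mulrDr; lra.
  have := ler_wpM2l (ltW tp) h3; move: Hlt; rewrite -/r mulrCA mulrA; lra.
have Mr : M * r <= t / 2.
  rewrite leNgt; apply/negP => H.
  have : (t / 2) `^ alpha < (M * r) `^ alpha.
    by apply: gt0_ltr_powR => //; rewrite ?nnegrE ?divr_ge0 ?mulr_ge0 // ltW.
  rewrite (powRM _ (ltW t0)) ?invr_ge0 // (powRM _ (ltW M0) (ltW r0)) -/P.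
  have := ler_wpM2l (ltW P0) rt; have := ler_wpM2r (ltW tp) kS1; lra.
(* With this normalisation the violating pair, rescaled to distance 1, has second derivatives that
   differ by more than 1/2. *)
pose sg := t ^+ 2 * t `^ alpha / r `^ alpha.
have sg0 : 0 < sg by rewrite divr_gt0 // mulr_gt0.
pose s := sg / r ^+ 2.
have sr : s * r ^+ 2 = sg by rewrite /s divfK // expf_neq0 // gt_eqF.
have inQ z : `|z| < M -> `|r *: z + x| + t / 2 <= 1.
  move=> zM; have := ler_normD (r *: z) x; rewrite normrZ gtr0_norm //.
  have := ler_wpM2l (ltW r0) (ltW zM); lra.
have inQ' z : `|z| < M -> Q (r *: z + x) by move=> /inQ /=; lra.
have Qx : Q x by rewrite /=; lra.
(* Error of freezing the coefficients, plus the inhomogeneous term less its value at [x]; that value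
   contributes only a constant flux. *)
pose B k l z := \sum_p \sum_q (A k l p q (r *: z + x) - A k l p q x) * (sg * vdd p q (r *: z + x))
   + sg * (G k l (r *: z + x) - G k l x).
have oQ : open Q by exact: open_cube.
have symx k l : vdd k l x = vdd l k x by exact: C2on_sym oQ (sol_C2 HS) Qx.
(* Minus the second order Taylor polynomial at the origin of the rescaled function z -> s v(r z +
   x), where s r^2 = sg. *)
have Cpoly := @C2on_quadratic R n (- s * v x) (fun k => - s * r * vd k x) (fun k l => - sg * vdd k l x) (fun k l => congr1 _ (symx k l)).
have Cpoly' := C2on_sub (O' := [set z : V | `|z| < M]) (fun _ _ => Logic.I) Cpoly.
have Cv' := C2on_affine r x (sol_C2 HS).
have {}Cv' := C2on_sub (O' := [set z : V | `|z| < M]) inQ' Cv'.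
have Cw := C2onD s Cv' Cpoly'.
set w := (X in C2on _ X _ _) in Cw; set wd := (X in C2on _ _ X _) in Cw; set wdd := (X in C2on _ _ _ X) in Cw.
have wddE k l z : wdd k l z = sg * (vdd k l (r *: z + x) - vdd k l x) by rewrite /wdd -sr; ring.
have t20' : 0 < t / 2 by rewrite divr_gt0.
have sgr : sg * r `^ alpha = t ^+ 2 * t `^ alpha by rewrite /sg divfK // gt_eqF.
have t_1 : t <= 1 by apply: le_trans xt; rewrite lerDr.
have t_le1 : t `^ alpha <= 1.
  by have := powR_mono a0 (ltW t0) t_1; rewrite powR1.
have t2_le1 : t ^+ 2 <= 1 by apply: exprn_ile1 => //; exact: ltW.
have affine_dist (z z' : V) : `|(r *: z + x) - (r *: z' + x)| `^ alpha = r `^ alpha * `|z - z'| `^ alpha.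
  by rewrite opprD addrACA subrr addr0 -scalerBr normrZ gtr0_norm // powRM // ltW.
have affine_dist0 (z : V) : `|z| < M -> `|(r *: z + x) - x| `^ alpha <= r `^ alpha * P.
  move=> zM; rewrite addrK normrZ gtr0_norm // powRM // ?(ltW r0) //.
  by apply: ler_wpM2l; [exact: ltW|apply: powR_mono => //; exact: ltW].
have cA k l p q (z : V) : `|z| < M -> {for z, continuous (fun z : V => A k l p q (r *: z + x))}.
  by move=> zM; apply: cont_affine; apply: (holder_continuous oQ a0 (coef_holder HA k l p q)); exact: inQ'.
have cG k l (z : V) : `|z| < M -> {for z, continuous (fun z : V => G k l (r *: z + x))}.
  by move=> zM; apply: cont_affine; apply: (holder_continuous oQ a0 (sol_holder HS k l)); exact: inQ'.
have cv k l (z : V) : `|z| < M -> {for z, continuous (fun z : V => vdd k l (r *: z + x))}.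
  by move=> zM; apply: cont_affine; apply: ((sol_C2 HS).2 k).2; exact: inQ'.
pose flux k l z := \sum_p \sum_q A k l p q z * vdd p q z + G k l z.
have z0 (c : 'I_n -> R) : \sum_k (0 : V) 0 k * c k = 0 by rewrite big1 // => k _; rewrite mxE mul0r.
have AE : almost_entire lam Lam 8 alpha M d (fun k l p q => A k l p q x) w wd wdd B.
  split.
  - by move=> k l p q; exact: coef_bound HA _ _ _ _ _ Qx.
  - exact: coef_elliptic HA _ Qx.
  - exact: Cw.
  - move=> k l z z' zM z'M.
    rewrite !wddE (_ : _ - _ = sg * (vdd k l (r *: z + x) - vdd k l (r *: z' + x))); last by ring.
    rewrite normrM gtr0_norm // -(ler_pM2l rp) mulrA (mulrC (r `^ alpha)) sgr.
    have := W k l _ _ _ t20' (inQ _ zM) (inQ _ z'M); rewrite affine_dist mul1r => HW.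
    have tt := powR2_le2 (ltW t0).
    set X := `|vdd k l _ - _| in HW *; set Y := `|z - z'| `^ alpha in HW *.
    have X0 : 0 <= t ^+ 2 * X by apply: mulr_ge0; [exact: ltW|exact: normr_ge0].
    have := ler_wpM2r X0 tt; have -> : t ^+ 2 = 4 * (t / 2) ^+ 2 by field.
    move: HW; clear; nra.
  - rewrite /w scaler0 add0r !z0; ring.
  - move=> k; rewrite /wd scaler0 add0r z0; ring.
  - by move=> k l; rewrite wddE scaler0 add0r subrr mulr0.
  - move=> k l z zM; apply: contD.
      apply: cont_sum => p; apply: cont_sum => q; apply: contM.
        by apply: contB; [exact: cA|exact: cont_cst].
      by apply: contM; [exact: cont_cst|exact: cv].
    by apply: contM; [exact: cont_cst|apply: contB; [exact: cG|exact: cont_cst]].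
  - move=> k l z zM; have Qz := inQ' z zM.
    apply: (@le_trans _ _ (kap * (4 * (N ^+ 2 * Lam * P) + P))) => //.
    rewrite mulrDr; apply: (le_trans (ler_normD _ _)); apply: lerD.
      apply: (@le_trans _ _ (\sum_(p < n) \sum_(q < n) (4 * Lam * P * kap))); last first.
        by rewrite !sum_cst -/N le_eqVlt; apply/orP; left; apply/eqP; ring.
      apply: (le_trans (ler_norm_sum _ _ _)); apply: ler_sum => p _.
      apply: (le_trans (ler_norm_sum _ _ _)); apply: ler_sum => q _.
      have h1 := le_trans (coef_holder HA k l p q Qz Qx) (ler_wpM2l Lam0 (affine_dist0 z zM)).
      have h2 := interp p q _ _ t20' (inQ z zM).
      rewrite normrM normrM (gtr0_norm sg0).
      have sv0 : 0 <= sg * `|vdd p q (r *: z + x)| by apply: mulr_ge0 => //; exact: ltW.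
      apply: (le_trans (ler_wpM2r sv0 h1)).
      rewrite [X in X <= _](_ : _ = Lam * P * (sg * r `^ alpha * `|vdd p q (r *: z + x)|)); last by ring.
      rewrite sgr [X in _ <= X](_ : _ = Lam * P * (4 * kap)); last by ring.
      apply: ler_wpM2l; first by apply: mulr_ge0 => //; exact: ltW.
      have h3 : t ^+ 2 * `|vdd p q (r *: z + x)| <= 4 * kap by move: h2; clear; rewrite expr_div_n; lra.
      have h4 : 0 <= t ^+ 2 * `|vdd p q (r *: z + x)| by apply: mulr_ge0 => //; exact: ltW.
      by rewrite mulrAC; apply: (le_trans _ h3); exact: ler_piMr.
    have h1 := sol_holder HS k l Qz Qx; have h2 := affine_dist0 z zM.
    rewrite normrM (gtr0_norm sg0).
    apply: (@le_trans _ _ (sg * (eps * (r `^ alpha * P)))).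
      apply: ler_wpM2l; first exact: ltW.
      by apply: (le_trans h1); apply: ler_wpM2l => //; exact: ltW.
    rewrite [X in X <= _](_ : _ = eps * P * (sg * r `^ alpha)); last by ring.
    rewrite sgr; apply: (@le_trans _ _ (eps * P * 1)).
      apply: ler_wpM2l; first by apply: mulr_ge0; exact: ltW.
      by rewrite -[1]mulr1; apply: ler_pM => //; exact: ltW.
    by rewrite mulr1; apply: ler_wpM2r => //; exact: ltW.
  - have cflux k l z : Q z -> {for z, continuous (flux k l)}.
      move=> Qz; apply: contD; last exact: holder_continuous oQ a0 (sol_holder HS k l) Qz.
      apply: cont_sum => p; apply: cont_sum => q; apply: contM; last exact: ((sol_C2 HS).2 p).2.
      exact: holder_continuous oQ a0 (coef_holder HA k l p q) Qz.
    have S1 := solves_affine (a := x) r0 oQ cflux (sol_eq HS).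
    have {}S1 := solves_sub inQ' S1.
    have S2 := @solves_cst R n [set z : V | `|z| < M] (fun k l => - sg * flux k l x).
    have c1 k l (z : V) : `|z| < M -> {for z, continuous (fun z : V => flux k l (r *: z + x))}.
      by move=> zM; apply: cont_affine; exact: cflux (inQ' z zM).
    have c2 k l (z : V) : `|z| < M -> {for z, continuous (fun _ : V => - sg * flux k l x)}.
      by move=> _; exact: cont_cst.
    have := solves_linear sg (@open_cube R n M) c1 c2 S1 S2.
    congr (solves _ _).
    apply/funext => k; apply/funext => l; apply/funext => z.
    have E : \sum_p \sum_q A k l p q x * wdd p q z + \sum_p \sum_q (A k l p q (r *: z + x) - A k l p q x) * (sg * vdd p q (r *: z + x)) =
       sg * (\sum_p \sum_q A k l p q (r *: z + x) * vdd p q (r *: z + x)) - sg * \sum_p \sum_q A k l p q x * vdd p q x.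
      rewrite -big_split !mulr_sumr -sumrB; apply: eq_bigr => p _ /=; rewrite !mulr_sumr -sumrB -big_split; apply: eq_bigr => q _ /=.
      by rewrite wddE; ring.
    rewrite /B addrA E /flux; ring.
have zeta1 : `|r^-1 *: (y - x)| <= 1.
  by rewrite normrZ gtr0_norm ?invr_gt0 // distrC -/r mulVf // gt_eqF.
have := HL _ _ _ _ _ AE i j _ zeta1.
rewrite wddE scalerA divff ?gt_eqF // scale1r subrK normrM gtr0_norm // distrC.
move=> Hle; move: Hlt; rewrite ltNge => /negP; apply.
by rewrite -/r -sgr mulrAC; apply: ler_wpM2r => //; exact: ltW.
Qed.

End Schauder.

(** * Estimate with linear dependence on the data *)

Section ScaledSchauder.
Context {R : realType} {n : nat} (lam Lam alpha : R).
Notation V := 'rV[R]_n.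
Notation Q := [set x : V | `|x| < 1].
Notation coefficients := (@coefficients R n lam Lam alpha).
Notation solution := (@solution R n alpha).
Notation weighted := (@weighted R n alpha).
Hypotheses (lam0 : 0 < lam) (Lam0 : 0 <= Lam) (a0 : 0 < alpha) (a1 : alpha < 1).

Lemma C2on_scale (O : set V) (k : R) f fd fdd : C2on O f fd fdd ->
  C2on O (fun x => k * f x) (fun i x => k * fd i x) (fun i j x => k * fdd i j x).
Proof.
move=> Cf; have C0 : C2on O (fun _ : V => 0 : R) (fun (_ : 'I_n) _ => 0) (fun (_ _ : 'I_n) _ => 0).
  by split=> [x _ i|i]; [exact: is_derive_cst|split=> x _ j; [exact: is_derive_cst|exact: cont_cst]].
have := C2onD k Cf C0; congr (C2on _ _ _ _).
- by apply/funext => x; rewrite addr0.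
- by apply/funext => i; apply/funext => x; rewrite addr0.
- by apply/funext => i; apply/funext => j; apply/funext => x; rewrite addr0.
Qed.

Lemma solves_scale (O : set V) (k : R) (c : 'I_n -> 'I_n -> V -> R) : open O ->
  (forall i j x, O x -> {for x, continuous (c i j)}) -> solves O c -> solves O (fun i j x => k * c i j x).
Proof.
move=> oO cc sc; have := solves_linear k oO cc (fun i j x _ => @cont_cst _ _ 0 x) sc (@solves_cst R n O (fun _ _ => 0)).
by congr (solves _ _); apply/funext => i; apply/funext => j; apply/funext => x; rewrite addr0.
Qed.

Lemma continuous_fluxA (A : 'I_n -> 'I_n -> 'I_n -> 'I_n -> V -> R) (vdd G : 'I_n -> 'I_n -> V -> R) i j x :
  (forall i j k l, {for x, continuous (A i j k l)}) -> (forall i j, {for x, continuous (vdd i j)}) ->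
  (forall i j, {for x, continuous (G i j)}) ->
  {for x, continuous (fun x => \sum_k \sum_l A i j k l x * vdd k l x + G i j x)}.
Proof.
move=> cA cv cG; apply: contD => //; apply: cont_sum => k; apply: cont_sum => l; exact: contM.
Qed.

(** [H] enters only through finiteness: it starts the weighted bound at some level 2^N s0, and
    [improvement], applied to [v] divided by the level, halves the level until K / eps is
    reached. *)
Theorem schauder : exists2 C : R, 0 <= C & forall A K v vd vdd G H,
  coefficients Q A -> 0 < K -> solution Q A K v vd vdd G -> (forall i j, holder_on Q alpha H (vdd i j)) ->
  forall i j x y, `|x| <= 2^-1 -> `|y| <= 2^-1 -> `|vdd i j x - vdd i j y| <= C * K * `|x - y| `^ alpha.
Proof.
have [eps eps0 Himp] := @improvement R n lam Lam alpha lam0 Lam0 a0 a1.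
have oQ : open Q by exact: open_cube.
have scaled A K v vd vdd G s : coefficients Q A -> 0 < s -> K <= eps * s -> solution Q A K v vd vdd G ->
    weighted s vdd -> weighted (s / 2) vdd.
  move=> HA s0 Ks HS W i j x y t t0 xt yt; have s1 : 0 < s^-1 by rewrite invr_gt0.
  have HS' : solution Q A eps (fun x => s^-1 * v x) (fun i x => s^-1 * vd i x) (fun i j x => s^-1 * vdd i j x) (fun i j x => s^-1 * G i j x).
    have Ks' : s^-1 * K <= eps by rewrite ler_pdivrMl // mulrC.
    split; first exact: C2on_scale (sol_C2 HS).
    - move=> z Qz; rewrite normrM gtr0_norm //; apply: le_trans Ks'.
      by apply: ler_wpM2l; [exact: ltW|exact: sol_bound HS z Qz].
    - move=> k l z z' Qz Qz'; rewrite -mulrBr normrM gtr0_norm //.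
      apply: (le_trans (ler_wpM2l (ltW s1) (sol_holder HS k l Qz Qz'))); rewrite mulrA.
      by apply: ler_wpM2r => //; exact: powR_ge0.
    - have cf k l z : Q z -> {for z, continuous (fun x => \sum_p \sum_q A k l p q x * vdd p q x + G k l x)}.
        move=> Qz; apply: continuous_fluxA => *.
        + exact: holder_continuous oQ a0 (coef_holder HA _ _ _ _) Qz.
        + exact: ((sol_C2 HS).2 _).2.
        + exact: holder_continuous oQ a0 (sol_holder HS _ _) Qz.
      have := solves_scale s^-1 oQ cf (sol_eq HS); congr (solves _ _).
      apply/funext => k; apply/funext => l; apply/funext => z; rewrite mulrDr mulr_sumr; congr (_ + _).
      by apply: eq_bigr => p _; rewrite mulr_sumr; apply: eq_bigr => q _; rewrite mulrCA.
  have W' : weighted 1 (fun i j x => s^-1 * vdd i j x).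
    move=> k l z z' t' t'0 zt zt'; rewrite -mulrBr normrM (gtr0_norm s1) mulrCA.
    by rewrite ler_pdivrMl // mul1r; exact: W.
  have := Himp _ _ _ _ _ HA HS' W' i j x y t t0 xt yt.
  by rewrite -mulrBr normrM (gtr0_norm s1) mulrCA ler_pdivrMl // mulrA.
exists (8 / eps); first by rewrite divr_ge0 // ltW.
move=> A K v vd vdd G H HA K0 HS HH i j x y x2 y2.
pose s0 := K / eps; have s00 : 0 < s0 by exact: divr_gt0.
have W0 : exists N : nat, weighted (2 ^+ N * s0) vdd.
  pose N := Num.truncn (`|H| / s0); exists N.
  have HN : `|H| <= 2 ^+ N * s0.
    rewrite -ler_pdivrMr //; apply: (le_trans (ltW (truncnS_gt _))).
    rewrite -natrX ler_nat; exact: ltn_expl.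
  move=> k l z z' t t0 zt z't; have t1 : t <= 1 by have := normr_ge0 z; lra.
  have Qz : Q z by rewrite /=; lra.
  have Qz' : Q z' by rewrite /=; lra.
  have h := HH k l z z' Qz Qz'.
  have hH : H * `|z - z'| `^ alpha <= 2 ^+ N * s0 * `|z - z'| `^ alpha.
    by apply: ler_wpM2r; [exact: powR_ge0|exact: le_trans (ler_norm H) HN].
  apply: le_trans hH; apply: le_trans h; apply: ler_piMl => //.
  have ta : t `^ alpha <= 1 by have := powR_mono a0 (ltW t0) t1; rewrite powR1.
  rewrite -[1]mulr1; apply: ler_pM => //; first by rewrite sqr_ge0.
    exact: powR_ge0.
  by apply: exprn_ile1 => //; exact: ltW.
have {W0} W : weighted s0 vdd.
  have [N] := W0; elim: N => [|N IH W]; first by rewrite mul1r.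
  apply: IH; have -> : 2 ^+ N * s0 = (2 ^+ N.+1 * s0) / 2 by rewrite exprS; field.
  apply: scaled HA _ _ HS W; first by rewrite mulr_gt0 // exprn_gt0.
  rewrite mulrCA [eps * s0](_ : _ = K); last by rewrite /s0; field; rewrite gt_eqF.
  apply: ler_peMl; first exact: ltW.
  by apply: exprn_ege1; lra.
have h0 : (0 : R) < 2^-1 by rewrite invr_gt0.
have := W i j x y 2^-1 h0 _ _; rewrite -/s0 => HW.
have {HW} := HW _ _; move=> HW.
have {HW} : 2^-1 ^+ 2 * 2^-1 `^ alpha * `|vdd i j x - vdd i j y| <= s0 * `|x - y| `^ alpha by apply: HW; lra.
(* At t = 1/2 the weight t^2 t^alpha is at least 1/8, whence the factor 8 in the constant. *)
have p2 : 2^-1 <= 2^-1 `^ alpha :> R.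
  by rewrite -{1}[2^-1](@powRr1 R) ?invr_ge0 //; apply: ger_powR; [rewrite invr_gt0 /=; apply/andP; split => //; lra|exact: ltW].
have X0 := normr_ge0 (vdd i j x - vdd i j y).
have -> : 8 / eps * K * `|x - y| `^ alpha = 8 * (s0 * `|x - y| `^ alpha) by rewrite /s0; ring.
move: X0; set X := `|_ - _| => X0 HW.
have := ler_wpM2r X0 p2; have -> : X = 8 * (2^-1 ^+ 2 * (2^-1 * X)) by field.
move: HW; rewrite -mulrA; lra.
Qed.

End ScaledSchauder.

(** * Cubes with arbitrary centre and radius *)

Section Cubes.
Context {R : realType} {n : nat}.
Notation V := 'rV[R]_n.
Implicit Types (f g : V -> R) (x y : V) (r alpha C : R) (O : set V).

Definition cube x r : set V := [set y | `|y - x| < r].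

Lemma cube_open x r : open (cube x r).
Proof. by have := @ball_open R V x r; congr open; apply/seteqP; split=> y; rewrite -ball_normE /= distrC. Qed.

Lemma cube_center x r : 0 < r -> cube x r x.
Proof. by rewrite /cube /= subrr normr0. Qed.

Lemma cube_le x r s : r <= s -> cube x r `<=` cube x s.
Proof. by move=> rs y /= yr; exact: lt_le_trans yr rs. Qed.

Lemma cube_convex x r y z (s : R) : cube x r y -> cube x r z -> 0 <= s <= 1 -> cube x r (s *: (y - z) + z).
Proof.
rewrite /cube /= => yr zr /andP[s0 s1].
have -> : s *: (y - z) + z - x = s *: (y - x) + (1 - s) *: (z - x).
  rewrite scalerBl scale1r !scalerBr; apply/rowP => i; rewrite !mxE; ring.
apply: (le_lt_trans (ler_normD _ _)); rewrite !normrZ !ger0_norm ?subr_ge0 //.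
have [->|sn] := eqVneq s 0; first by rewrite mul0r subr0 mul1r add0r.
have sp : 0 < s by rewrite lt_neqAle eq_sym sn.
have h1 : s * `|y - x| < s * r by rewrite ltr_pM2l.
have h2 : (1 - s) * `|z - x| <= (1 - s) * r by apply: ler_wpM2l; [rewrite subr_ge0|exact: ltW].
have -> : r = s * r + (1 - s) * r by ring.
exact: ltr_leD.
Qed.

Lemma closed_cube_compact x r : compact [set y : V | `|y - x| <= r].
Proof.
have -> : [set y : V | `|y - x| <= r] = (fun y => y + x) @` [set y : V | `|y| <= r].
  apply/seteqP; split=> [y /= yr|_ [y /= yr <-]]; last by rewrite addrK.
  by exists (y - x) => //; rewrite subrK.
apply: continuous_compact (@compact_cube R n r); apply: continuous_subspaceT => y.
by apply: (@continuousD _ _ _ id (fun=> x)); [exact: cvg_id|exact: (@cst_continuous _ _ x y)].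
Qed.

Lemma open_cube_in O x : open O -> O x -> exists2 r : R, 0 < r & cube x r `<=` O.
Proof.
move=> oO Ox; have /nbhs_ballP [r /= r0 Hr] : nbhs x O by exact: open_nbhs_nbhs.
by exists r => // y yr; apply: Hr; rewrite -ball_normE /= distrC.
Qed.

Lemma mvt_cube x r f fd y z : C1on (cube x r) f fd -> cube x r y -> cube x r z ->
  exists2 xi : V, cube x r xi & f y - f z = \sum_i fd i xi * (y - z) 0 i.
Proof.
move=> Cf yr zr.
have seg s : 0 <= s <= 1 -> cube x r (s *: (y - z) + z) by exact: cube_convex.
have [s s01 E] := mvt_line (x := z) (v := y - z) (fun s s01 => C1on_derive (y - z) (@cube_open x r) Cf (seg s s01)).
by exists (s *: (y - z) + z); [exact: seg|rewrite -E subrK].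
Qed.

Lemma lipschitz_cube x r f fd (B : R) y z : C1on (cube x r) f fd ->
  (forall i y, cube x r y -> `|fd i y| <= B) -> cube x r y -> cube x r z ->
  `|f y - f z| <= n%:R * B * `|y - z|.
Proof.
move=> Cf fB yr zr; have [xi xir ->] := mvt_cube Cf yr zr.
apply: (le_trans (ler_norm_sum _ _ _)); rewrite -mulrA -sum_cst; apply: ler_sum => i _.
by rewrite normrM; apply: ler_pM => //; [exact: fB|exact: coord_norm_le].
Qed.

Lemma holder_on_sub O O' alpha C f : O' `<=` O -> holder_on O alpha C f -> holder_on O' alpha C f.
Proof. by move=> OO fC x y /OO Ox /OO Oy; exact: fC. Qed.

Lemma holder_on_le O alpha C C' f : C <= C' -> holder_on O alpha C f -> holder_on O alpha C' f.
Proof. by move=> CC fC x y Ox Oy; apply: (le_trans (fC x y Ox Oy)); apply: ler_wpM2r => //; exact: powR_ge0. Qed.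

(** Radius at most 1/2 keeps distances below 1, where a Lipschitz bound is stronger than a Hoelder
    bound. *)
Lemma lipschitz_holder x r f fd (B alpha : R) : 0 < alpha -> alpha <= 1 -> r <= 2^-1 -> 0 <= B -> C1on (cube x r) f fd ->
  (forall i y, cube x r y -> `|fd i y| <= B) -> holder_on (cube x r) alpha (n%:R * B) f.
Proof.
move=> a0 a1 r1 B0 Cf fB y z yr zr; apply: (le_trans (lipschitz_cube Cf fB yr zr)).
apply: ler_wpM2l; first exact: mulr_ge0.
have [->|yz] := eqVneq y z; first by rewrite subrr normr0 powR_ge0.
have yz0 : 0 < `|y - z| by rewrite normr_gt0 subr_eq0.
rewrite -{1}[`|y - z|](@powRr1 R) //; apply: ger_powR => //; rewrite yz0 /=.
have := ler_normB (y - x) (z - x); rewrite opprB addrA subrK; move: yr zr; rewrite /cube /=; lra.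
Qed.

End Cubes.

Section SchauderAt.
Context {R : realType} {n : nat} (lam Lam alpha : R).
Notation V := 'rV[R]_n.
Hypotheses (lam0 : 0 < lam) (Lam0 : 0 <= Lam) (a0 : 0 < alpha) (a1 : alpha < 1).

(** Dilation by [r <= 1] does not increase the constants of the coefficients and data, so the
    estimate on the unit cube applies. The resulting constant depends on [r] but not on the
    centre. *)
Theorem schauder_at (r : R) : 0 < r -> r <= 1 -> exists2 C : R, 0 <= C &
  forall (x0 : V) A K v vd vdd G H,
  coefficients lam Lam alpha (cube x0 r) A -> 0 < K -> solution alpha (cube x0 r) A K v vd vdd G ->
  (forall i j, holder_on (cube x0 r) alpha H (vdd i j)) ->
  forall i j, holder_on (cube x0 (r / 2)) alpha (C * K) (vdd i j).
Proof.
move=> r0 r1; have [C C0 HC] := @schauder R n lam Lam alpha lam0 Lam0 a0 a1.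
have rp : 0 < r `^ alpha by exact: powR_gt0.
have rp1 : r `^ alpha <= 1 by have := powR_mono a0 (ltW r0) r1; rewrite powR1.
have r2p : 0 < r ^+ 2 by exact: exprn_gt0.
exists (C / (r ^+ 2 * r `^ alpha)); first by rewrite divr_ge0 // ltW // mulr_gt0.
move=> x0 A K v vd vdd G H HA K0 HS HH i j x y xr yr.
pose a z : V := r *: z + x0.
have aQ z : `|z| < 1 -> cube x0 r (a z).
  by move=> z1; rewrite /cube /a /= addrK normrZ gtr0_norm // gtr_pMr.
have adist z z' : `|a z - a z'| `^ alpha = r `^ alpha * `|z - z'| `^ alpha.
  by rewrite /a opprD addrACA subrr addr0 -scalerBr normrZ gtr0_norm // powRM // ltW.
have adist1 z z' : `|a z - a z'| `^ alpha <= `|z - z'| `^ alpha.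
  by rewrite adist; apply: ler_piMl => //; exact: powR_ge0.
have Kr : r ^+ 2 * K <= K.
  by apply: ler_piMl; [exact: ltW|apply: exprn_ile1 => //; exact: ltW].
have HA' : coefficients lam Lam alpha [set z : V | `|z| < 1] (fun i j k l z => A i j k l (a z)).
  split.
  - by move=> k l p q z z1; apply: (coef_bound HA); exact: aQ.
  - move=> k l p q z z' z1 z1'; apply: (le_trans (coef_holder HA k l p q (aQ z z1) (aQ z' z1'))).
    exact: ler_wpM2l.
  - by move=> z z1; apply: (coef_elliptic HA); exact: aQ.
have HS' : solution alpha [set z : V | `|z| < 1] (fun i j k l z => A i j k l (a z)) K
    (fun z => v (a z)) (fun i z => r * vd i (a z)) (fun i j z => r ^+ 2 * vdd i j (a z)) (fun i j z => r ^+ 2 * G i j (a z)).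
  have oQ := @cube_open R n x0 r.
  split.
  - by apply: C2on_sub (C2on_affine r x0 (sol_C2 HS)) => z; exact: aQ.
  - by move=> z z1; apply: (sol_bound HS); exact: aQ.
  - move=> k l z z' z1 z1'; rewrite -mulrBr normrM gtr0_norm //.
    apply: (le_trans (ler_wpM2l (ltW r2p) (sol_holder HS k l (aQ z z1) (aQ z' z1')))).
    by rewrite mulrA; apply: ler_pM => //; rewrite ?powR_ge0 ?mulr_ge0 // ltW.
  - pose c k l z := \sum_p \sum_q A k l p q z * vdd p q z + G k l z.
    have cc k l z : cube x0 r z -> {for z, continuous (c k l)}.
      move=> Qz; apply: continuous_fluxA => *.
      + exact: holder_continuous oQ a0 (coef_holder HA _ _ _ _) Qz.
      + exact: ((sol_C2 HS).2 _).2.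
      + exact: holder_continuous oQ a0 (sol_holder HS _ _) Qz.
    have S1 := solves_sub (O := [set z : V | `|z| < 1]) aQ (solves_affine (a := x0) r0 oQ cc (sol_eq HS)).
    have cc' k l (z : V) : [set z : V | `|z| < 1] z -> {for z, continuous (fun z : V => c k l (r *: z + x0))}.
      by move=> z1; apply: cont_affine; apply: cc; exact: aQ.
    have := solves_scale (r ^+ 2) (@open_cube R n 1) cc' S1; congr (solves _ _).
    apply/funext => k; apply/funext => l; apply/funext => z; rewrite /c mulrDr mulr_sumr; congr (_ + _).
    by apply: eq_bigr => p _; rewrite mulr_sumr; apply: eq_bigr => q _; rewrite mulrCA.
have HH' k l : holder_on [set z : V | `|z| < 1] alpha (r ^+ 2 * `|H|) (fun z => r ^+ 2 * vdd k l (a z)).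
  move=> z z' z1 z1'; rewrite -mulrBr normrM gtr0_norm // -mulrA; apply: ler_wpM2l; first exact: ltW.
  apply: (le_trans (HH k l _ _ (aQ z z1) (aQ z' z1'))).
  by apply: (le_trans (ler_wpM2r (powR_ge0 _ _) (ler_norm H))); apply: ler_wpM2l.
pose b z : V := r^-1 *: (z - x0).
have ab z : a (b z) = z by rewrite /a /b scalerA divff ?gt_eqF // scale1r subrK.
have bQ z : cube x0 (r / 2) z -> `|b z| <= 2^-1.
  by rewrite /cube /b /= => zr; rewrite normrZ gtr0_norm ?invr_gt0 // ler_pdivrMl //; exact: ltW.
clearbody b a.
have h : `|r ^+ 2 * vdd i j (a (b x)) - r ^+ 2 * vdd i j (a (b y))| <= C * K * `|b x - b y| `^ alpha.
  exact: HC _ _ _ _ _ _ _ HA' K0 HS' HH' i j (b x) (b y) (bQ x xr) (bQ y yr).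
have e : `|r ^+ 2 * vdd i j x - r ^+ 2 * vdd i j y| = r ^+ 2 * `|vdd i j x - vdd i j y|.
  by rewrite -mulrBr normrM gtr0_norm.
clear HC HA' HS' HH'; rewrite (ab x) (ab y) e in h.
have -> : `|x - y| `^ alpha = r `^ alpha * `|b x - b y| `^ alpha by rewrite -adist !ab.
rewrite -(ler_pM2l r2p); apply: (le_trans h); rewrite le_eqVlt; apply/orP; left; apply/eqP.
by field; rewrite !gt_eqF.
Qed.

End SchauderAt.

(** * Regularity of linear equations *)

Section DifferenceQuotients.
Context {R : realType} {n : nat} (lam Lam alpha : R).
Notation V := 'rV[R]_n.
Notation e i := (@Defs.coord R n i).
Implicit Types (f g : V -> R) (x y : V) (r C t : R) (O : set V).

Definition dquot k t f x : R := t^-1 * delta (t *: e k) f x.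

Lemma dquotE k t f x : dquot k t f x = t^-1 * (f (t *: e k + x) - f x).
Proof. by rewrite /dquot /delta [x + _]addrC. Qed.

Lemma family_bound (T : finType) (P : V -> Prop) (f : T -> V -> R) :
  (forall p, exists2 B : R, 0 <= B & forall y, P y -> `|f p y| <= B) ->
  exists2 B : R, 0 <= B & forall p y, P y -> `|f p y| <= B.
Proof.
move=> H; have /choice [b Hb] p : exists B : R, 0 <= B /\ forall y, P y -> `|f p y| <= B.
  by have [B ? ?] := H p; exists B.
exists (\sum_p b p); first by apply: sumr_ge0 => p _; exact: (Hb p).1.
move=> p y Py; apply: (le_trans ((Hb p).2 y Py)); rewrite (bigD1 p) //= lerDl.
by apply: sumr_ge0 => q _; exact: (Hb q).1.
Qed.

Lemma dquot_mvt O f fd k x t : open O -> C1on O f fd ->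
  (forall s, 0 <= s <= 1 -> O (x + (s * t) *: e k)) -> t != 0 ->
  exists2 s : R, 0 <= s <= 1 & dquot k t f x = fd k (x + (s * t) *: e k).
Proof.
move=> oO Cf Os t0.
have seg s : 0 <= s <= 1 -> O (s *: (t *: e k) + x) by move=> s01; rewrite scalerA addrC; exact: Os.
have [s s01 E] := mvt_line (x := x) (v := t *: e k) (fun s s01 => is_derive_dirZ t (Cf.1 _ (seg s s01) k)).
by exists s => //; rewrite dquotE E mulKf // scalerA addrC.
Qed.

Lemma dquot_C2on O O' v vd vdd k t : C2on O v vd vdd ->
  (forall x, O' x -> O x /\ O (x + t *: e k)) ->
  C2on O' (dquot k t v) (fun i => dquot k t (vd i)) (fun i j => dquot k t (vdd i j)).
Proof.
move=> Cv OO; have C1 := C2on_sub (O' := O') (fun x Ox => (OO x Ox).1) Cv.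
have C2 := C2on_sub (O' := O') (fun x Ox => (OO x Ox).2) (C2on_shift (t *: e k) Cv).
have := C2on_scale t^-1 (C2onD (-1) C1 C2); rewrite /dquot /delta.
congr (C2on _ _ _ _).
- by apply/funext => x; rewrite mulN1r addrC.
- by apply/funext => i; apply/funext => x; rewrite mulN1r addrC.
- by apply/funext => i; apply/funext => j; apply/funext => x; rewrite mulN1r addrC.
Qed.

Lemma dquot_limit O f fd k x (tm : nat -> R) (U : set_system nat) : ProperFilter U -> C1on O f fd -> O x ->
  (forall m, tm m != 0) -> tm m @[m --> U] --> 0 -> dquot k (tm m) f x @[m --> U] --> fd k x.
Proof.
move=> UF [df _] Ox tm0 ctm; apply/cvgrPdist_le => eps eps0.
have [r r0 Hr] := quotient_derive (df x Ox k) eps0.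
move/cvgrPdist_lt : ctm => /(_ _ r0); apply: filterS => m; rewrite sub0r normrN => tr.
by rewrite distrC dquotE; exact: Hr.
Qed.

Hypotheses (lam0 : 0 < lam) (Lam0 : 0 <= Lam) (a0 : 0 < alpha) (a1 : alpha < 1).

(** The Schauder estimate bounds the difference quotients of [vdd] in C^alpha uniformly in [t].
    Their ultralimits are the second derivatives of [vd k], so the third derivatives of [v] are
    constructed and not assumed. *)
Lemma difference_quotients O v vd vdd k x0 r (H K : R) : open O -> C2on O v vd vdd -> 0 < r -> r <= 1 ->
  (forall y, `|y - x0| <= 2 * r -> O y) ->
  (forall i j, holder_on [set y | `|y - x0| <= 2 * r] alpha H (vdd i j)) ->
  (forall t, t != 0 -> `|t| < r -> exists A (G : 'I_n -> 'I_n -> V -> R), [/\ coefficients lam Lam alpha (cube x0 r) A,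
     forall i j, holder_on (cube x0 r) alpha K (G i j)
     & solves (cube x0 r) (fun i j x => \sum_p \sum_q A i j p q x * dquot k t (vdd p q) x + G i j x)]) ->
  exists (g : 'I_n -> 'I_n -> V -> R) C, C2on (cube x0 (r / 2)) (vd k) (vdd k) g /\ forall i j, holder_on (cube x0 (r / 2)) alpha C (g i j).
Proof.
move=> oO Cv r0 r1 KO HH HE.
have Cv1 := C2on_C1on oO Cv.
have cK := @closed_cube_compact R n x0 (2 * r).
have e1 p : `|e p| <= 1 by exact: (frame_norm frame_coord).
have [B1 B10 HB1] : exists2 B : R, 0 <= B & forall i y, `|y - x0| <= 2 * r -> `|vd i y| <= B.
  apply: family_bound => i; apply: compact_bound cK _ => y /= /KO Oy; exact: Cv1.2.
have [B2 B20 HB2] : exists2 B : R, 0 <= B & forall i j y, `|y - x0| <= 2 * r -> `|vdd i j y| <= B.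
  have [|B B0 HB] := @family_bound _ (fun y => `|y - x0| <= 2 * r) (fun p : 'I_n * 'I_n => vdd p.1 p.2).
    by move=> p; apply: compact_bound cK _ => y /= /KO Oy; exact: (Cv.2 p.1).2.
  by exists B => // i j; exact: HB (i, j).
have move_in t y : `|t| < r -> cube x0 r y -> `|y + t *: e k - x0| <= 2 * r.
  move=> tr; rewrite /cube /= => yr; rewrite addrAC.
  apply: (le_trans (ler_normD _ _)); rewrite normrZ.
  have : `|t| * `|e k| <= `|t| by apply: ler_piMr.
  lra.
have move_s t y s : `|t| < r -> cube x0 r y -> 0 <= s <= 1 -> `|y + (s * t) *: e k - x0| <= 2 * r.
  move=> tr yr /andP[s0 s1]; apply: move_in => //; apply: le_lt_trans tr.
  by rewrite normrM (ger0_norm s0) ler_piMl.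
have cube_in y : cube x0 r y -> `|y - x0| <= 2 * r by rewrite /cube /=; lra.
have half_in y : cube x0 (r / 2) y -> cube x0 r y by apply: cube_le; lra.
have dq0 t y : t != 0 -> `|t| < r -> cube x0 r y -> `|dquot k t v y| <= B1.
  move=> tn tr yr; have [s s01 ->] := dquot_mvt oO Cv1 (fun s s01 => KO _ (move_s t y s tr yr s01)) tn.
  by apply: HB1; exact: move_s.
have dq1 i t y : t != 0 -> `|t| < r -> cube x0 r y -> `|dquot k t (vd i) y| <= B2.
  move=> tn tr yr; have [s s01 ->] := dquot_mvt oO (Cv.2 i) (fun s s01 => KO _ (move_s t y s tr yr s01)) tn.
  by apply: HB2; exact: move_s.
have Cdq t : `|t| < r -> C2on (cube x0 r) (dquot k t v) (fun i => dquot k t (vd i)) (fun i j => dquot k t (vdd i j)).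
  by move=> tr; apply: dquot_C2on Cv _ => y yr; split; apply: KO; [exact: cube_in|exact: move_in].
have [C C0 HC] := @schauder_at R n lam Lam alpha lam0 Lam0 a0 a1 r r0 r1.
pose K' := `|K| + B1 + 1; have K'0 : 0 < K' by rewrite /K' ltr_wpDl // addr_ge0.
(* The a priori Hoelder constant 2 |H| / |t| blows up as t tends to 0, but the bound obtained does
   not see it. *)
have dq2 t i j : t != 0 -> `|t| < r -> holder_on (cube x0 (r / 2)) alpha (C * K') (dquot k t (vdd i j)).
  move=> tn tr; have [A [G [HA HG HS]]] := HE t tn tr.
  apply: (HC x0 A K' (dquot k t v) (fun i => dquot k t (vd i)) (fun i j => dquot k t (vdd i j)) G (`|t^-1| * (2 * `|H|))) => //.
    split => //; first exact: Cdq.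
    - by move=> y yr; apply: (le_trans (dq0 t y tn tr yr)); rewrite /K'; have := normr_ge0 K; lra.
    - by move=> p q; apply: holder_on_le (HG p q); rewrite /K'; have := ler_norm K; lra.
  move=> p q x y xr yr; rewrite /dquot -mulrBr normrM -mulrA; apply: ler_wpM2l => //.
  rewrite /delta (_ : _ - _ = (vdd p q (x + t *: e k) - vdd p q (y + t *: e k)) - (vdd p q x - vdd p q y)); last by ring.
  apply: (le_trans (ler_normB _ _)).
  have h1 := HH p q _ _ (move_in t x tr xr) (move_in t y tr yr).
  have h2 := HH p q _ _ (cube_in x xr) (cube_in y yr).
  rewrite opprD addrACA subrr addr0 in h1.
  have h3 := ler_wpM2r (powR_ge0 `|x - y| alpha) (ler_norm H); lra.
(* Sup bound: by the mean value theorem over a segment of length at most r/4 the quotient of [vdd]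
   is at most 8 B2 / r at some point, and the Hoelder bound spreads this over the cube. *)
pose B3 := 8 * B2 / r + C * K'.
have dq2b t i j y : t != 0 -> `|t| < r -> cube x0 (r / 2) y -> `|dquot k t (vdd i j) y| <= B3.
  move=> tn tr yr.
  have r4 : r / 4 != 0 by rewrite gt_eqF // divr_gt0.
  have seg s : 0 <= s <= 1 -> cube x0 (r / 2) (x0 + (s * (r / 4)) *: e j).
    move=> /andP[s0 s1]; rewrite /cube /= addrAC subrr add0r normrZ ger0_norm; last by rewrite mulr_ge0 // divr_ge0 // ltW.
    have : s * (r / 4) * `|e j| <= 1 * (r / 4) * 1 by apply: ler_pM => //; [rewrite mulr_ge0 // divr_ge0 // ltW|apply: ler_wpM2r => //; rewrite divr_ge0 // ltW].
    lra.
  have [s s01 E] := dquot_mvt (k := j) (x := x0) (@cube_open R n x0 r) ((Cdq t tr).2 i) (fun s s01 => half_in _ (seg s s01)) r4.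
  have xr := seg s s01; set xi := x0 + _ in E xr.
  have bxi : `|dquot k t (vdd i j) xi| <= 8 * B2 / r.
    rewrite -E {1}/dquot normrM.
    have x0r : cube x0 r (x0 + (r / 4) *: e j).
      by have := seg 1; rewrite mul1r lexx ler01 => /(_ isT) /half_in.
    have h1 := dq1 i t _ tn tr x0r; have h2 := dq1 i t x0 tn tr (cube_center x0 r0).
    have h3 : `|delta ((r / 4) *: e j) (dquot k t (vd i)) x0| <= 2 * B2.
      by rewrite {1}/delta; apply: (le_trans (ler_normB _ _)); lra.
    have -> : `|(r / 4)^-1| = 4 / r by rewrite gtr0_norm ?invr_gt0 ?divr_gt0 // invf_div.
    have := ler_wpM2l (ltW (divr_gt0 (ltac:(lra) : (0 : R) < 4) r0)) h3.
    move=> h4; apply: (le_trans h4); rewrite le_eqVlt; apply/orP; left; apply/eqP; field.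
    by rewrite gt_eqF.
  have := dq2 t i j tn tr y xi yr xr.
  have hp : `|y - xi| `^ alpha <= 1.
    have d1 : `|y - xi| <= 1.
      have := ler_normB (y - x0) (xi - x0); rewrite opprB addrA subrK; move: yr xr; rewrite /cube /=; lra.
    by have := powR_mono a0 (normr_ge0 _) d1; rewrite powR1.
  have CK : 0 <= C * K' by apply: mulr_ge0 => //; exact: ltW.
  move=> h; have h5 := le_trans h (ler_wpM2l CK hp).
  have := ler_normB (dquot k t (vdd i j) xi) (dquot k t (vdd i j) xi - dquot k t (vdd i j) y).
  rewrite opprB addrC subrK distrC; rewrite /B3; lra.
pose tm (m : nat) : R := r / (m%:R + 2).
have tm_gt0 m : 0 < tm m by rewrite divr_gt0 // ltr_wpDl.
have tmn m : tm m != 0 by rewrite gt_eqF.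
have tmr m : `|tm m| < r.
  rewrite gtr0_norm // /tm ltr_pdivrMr ?ltr_wpDl // ltr_pMr //; have : 0 <= m%:R :> R by []. lra.
have [U UF [UN Ub]] := @ultralimit R.
have ctm : tm m @[m --> U] --> 0.
  apply/cvgrPdist_le => eps eps0; have := UN (Num.truncn (r / eps)); apply: filterS => m /= hm.
  rewrite sub0r normrN gtr0_norm // /tm ler_pdivrMr ?ltr_wpDl // mulrC -ler_pdivrMr //.
  apply: (le_trans (ltW (truncnS_gt _))); rewrite -natr1; have : (Num.truncn (r / eps))%:R <= m%:R :> R by rewrite ler_nat.
  lra.
have /choice [g' Hg'] (p : 'I_n * 'I_n * V) : exists l : R, cube x0 (r / 2) p.2 -> dquot k (tm m) (vdd p.1.1 p.1.2) p.2 @[m --> U] --> l.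
  have [pr|pr] := pselect (cube x0 (r / 2) p.2); last by exists 0.
  have [|l Hl] := Ub (fun m => dquot k (tm m) (vdd p.1.1 p.1.2) p.2) B3; last by exists l.
  by apply: nearW => m; exact: dq2b.
pose g i j x := g' (i, j, x).
have cg i j x : cube x0 (r / 2) x -> dquot k (tm m) (vdd i j) x @[m --> U] --> g i j x by exact: (Hg' (i, j, x)).
have gC i j : holder_on (cube x0 (r / 2)) alpha (C * K') (g i j).
  move=> x y xr yr; apply: (cvgr_to_le (cvg_norm (cvgB (cg i j x xr) (cg i j y yr)))).
  by apply: nearW => m; exact: dq2.
exists g, (C * K'); split => //; split.
  by move=> x xr i; apply: C2on_derive2 Cv _; apply: KO; apply: cube_in; exact: half_in.
move=> i; split=> x xr j; last exact: holder_continuous (@cube_open R n x0 (r / 2)) a0 (gC i j) xr.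
have d0 : 0 < r / 2 - `|x - x0| by rewrite subr_gt0.
pose d := (r / 2 - `|x - x0|) / 2.
have dp : 0 < d by rewrite divr_gt0.
apply: (@quotient_holder_derive _ _ (vdd k i) x (e j) (g i j x) (C * K') alpha d) => // t td.
have tin s : `|s| <= `|t| -> cube x0 (r / 2) (s *: e j + x).
  move=> st; rewrite /cube /= -addrA; apply: (le_lt_trans (ler_normD _ _)); rewrite normrZ.
  have : `|s| * `|e j| <= `|s| by apply: ler_piMr.
  move: td; rewrite /d; lra.
(* Quotients of [vd i] converge to [vdd i k]; symmetry identifies this with [vdd k i], the function
   to be differentiated. *)
have symk y : cube x0 (r / 2) y -> vdd k i y = vdd i k y.
  by move=> yr; apply: C2on_sym oO Cv _; apply: KO; apply: cube_in; exact: half_in.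
have tx := tin t (lexx _).
have Oin y : cube x0 (r / 2) y -> O y by move=> yr; apply: KO; apply: cube_in; exact: half_in.
rewrite !symk //.
have cc : dquot k (tm m) (vd i) (t *: e j + x) - dquot k (tm m) (vd i) x - t * dquot k (tm m) (vdd i j) x @[m --> U] -->
    vdd i k (t *: e j + x) - vdd i k x - t * g i j x.
  apply: cvgB; last by apply: cvg_mulc; exact: cg.
  by apply: cvgB; apply: (dquot_limit UF (Cv.2 i) _ tmn ctm); exact: Oin.
apply: (cvgr_to_le (cvg_norm cc)); apply: nearW => m.
have seg s : 0 <= s <= 1 -> cube x0 (r / 2) (s *: (t *: e j) + x).
  by move=> /andP[s0 s1]; rewrite scalerA; apply: tin; rewrite normrM (ger0_norm s0) ler_piMl.
have [s s01 ->] := mvt_line (x := x) (v := t *: e j)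
  (fun s s01 => is_derive_dirZ t (C2on_derive2 i j (Cdq (tm m) (tmr m)) (half_in _ (seg s s01)))).
rewrite -mulrBr normrM; apply: ler_wpM2l => //.
apply: (le_trans (dq2 _ i j (tmn m) (tmr m) _ _ (seg s s01) xr)).
apply: ler_wpM2l; first by apply: mulr_ge0 => //; exact: ltW.
have [s0 s1] := andP s01.
rewrite addrK scalerA; apply: powR_mono => //; rewrite normrZ normrM (ger0_norm s0).
have : s * `|t| * `|e j| <= 1 * `|t| * 1 by apply: ler_pM => //; [exact: mulr_ge0|exact: ler_wpM2r].
lra.
Qed.

End DifferenceQuotients.

(** * Differentiating an equation; functions of a matrix field *)

Section Regularity.
Context {R : realType} {n : nat}.
Notation V := 'rV[R]_n.
Notation I := (@integral_Rn R n).
Notation e i := (@Defs.coord R n i).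

Lemma common_radius (T : finType) (P : T -> R -> Prop) :
  (forall p, exists2 d : R, 0 < d & forall t, `|t| < d -> P p t) ->
  exists2 d : R, 0 < d & forall p t, `|t| < d -> P p t.
Proof.
move=> H; have : \forall t \near (0 : R), forall p, P p t.
  apply: (@filter_forall R T (fun p t => P p t) (nbhs (0 : R)) _) => p; have [d d0 Hd] := H p; apply/nbhs_ballP; exists d => // t.
  by rewrite -ball_normE /= sub0r normrN => /Hd.
move=> /nbhs_ballP [d /= d0 Hd]; exists d => // p t td; apply: Hd.
by rewrite -ball_normE /= sub0r normrN.
Qed.

(** Being a solution is closed under uniform approximation of the flux on compact sets. The
    approximants need only solve near the compact set, since shifted fluxes are not controlled on
    all of [O]. *)
Lemma solves_approx (O : set V) (c : 'I_n -> 'I_n -> V -> R) : open O ->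
  (forall i j x, O x -> {for x, continuous (c i j)}) ->
  (forall (K : set V) (eps : R), compact K -> K `<=` O -> 0 < eps -> exists O' c', [/\ open O', K `<=` O',
     forall i j x, O' x -> {for x, continuous (c' i j)}, solves O' c' &
     forall i j x, K x -> `|c' i j x - c i j x| <= eps]) -> solves O c.
Proof.
move=> oO cc H f fd fdd tf; apply/eqP; rewrite -normr_le0; apply/ler_addgt0Pr => /= e1 e10; rewrite add0r.
have [K [cK KO fK fdK fddK]] := test_support tf.
have CN : Cc (fun x => \sum_i \sum_j `|fdd i j x|).
  by apply: Cc_sum => i; apply: Cc_sum => j; apply: Cc_norm; exact: Cc_test2 tf.
set J := I (fun x => \sum_i \sum_j `|fdd i j x|).
have J0 : 0 <= J by apply: int_ge0 => // x; apply: sumr_ge0 => i _; apply: sumr_ge0.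
have J1 : 0 < J + 1 by rewrite ltr_wpDl.
have [W [c' [oW KW cc' sc' Hc]]] := H K (e1 / (J + 1)) cK KO (divr_gt0 e10 J1).
have tf' : test W f fd fdd by split; [exact: tf.1|exists K].
have C1 : Cc (fun x => \sum_i \sum_j c i j x * fdd i j x).
  by apply: Cc_sum => i; apply: Cc_sum => j; exact: Cc_pairing oO (cc i j) tf.
have C2 : Cc (fun x => \sum_i \sum_j c' i j x * fdd i j x).
  by apply: Cc_sum => i; apply: Cc_sum => j; exact: Cc_pairing oW (cc' i j) tf'.
have -> : I (fun x => \sum_i \sum_j c i j x * fdd i j x) =
   I (fun x => (\sum_i \sum_j c i j x * fdd i j x) - \sum_i \sum_j c' i j x * fdd i j x).
  by rewrite intB // (sc' _ _ _ tf') subr0.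
apply: (@le_trans _ _ ((e1 / (J + 1)) * J)); last first.
  by rewrite mulrAC ler_pdivrMr //; apply: ler_wpM2l; [exact: ltW|rewrite lerDl].
rewrite /J -intZ //; apply: int_norm; [exact: CcB|exact: CcZ|].
move=> x; rewrite -sumrB mulr_sumr; apply: (le_trans (ler_norm_sum _ _ _)); apply: ler_sum => i _.
rewrite -sumrB mulr_sumr; apply: (le_trans (ler_norm_sum _ _ _)); apply: ler_sum => j _.
have [Kx|Kx] := pselect (K x); last by rewrite fddK // !mulr0 subr0 normr0 mulr0.
by rewrite -mulrBl normrM distrC; apply: ler_wpM2r => //; exact: Hc.
Qed.

Lemma open_shift (O : set V) h : open O -> open [set x | O (x + h)].
Proof.
move=> oO; rewrite openE => x /= Ox.
have cs : {for x, continuous (fun y : V => y + h)}.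
  by apply: (@continuousD _ _ _ id (fun=> h)); [exact: cvg_id|exact: (@cst_continuous _ _ h x)].
by apply: (cs O); exact: open_nbhs_nbhs.
Qed.

Lemma cont_shift (f : V -> R) h x : {for x + h, continuous f} -> {for x, continuous (fun y : V => f (y + h))}.
Proof.
move=> cf; have := @cont_affine _ _ f 1 h x; rewrite scale1r => /(_ cf).
by have -> : (fun y : V => f (1 *: y + h)) = (fun y => f (y + h)) by apply/funext => y; rewrite scale1r.
Qed.

Lemma solves_dquot (O : set V) c k (t : R) : open O -> (forall i j x, O x -> {for x, continuous (c i j)}) ->
  solves O c -> solves (O `&` [set x | O (x + t *: e k)]) (fun i j => dquot k t (c i j)).
Proof.
move=> oO cc sc; have oI : open (O `&` [set x | O (x + t *: e k)]) by apply: openI => //; exact: open_shift.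
have c1 i j x : (O `&` [set x | O (x + t *: e k)]) x -> {for x, continuous (c i j)} by move=> [Ox _]; exact: cc.
have c2 i j x : (O `&` [set x | O (x + t *: e k)]) x -> {for x, continuous (fun x : V => c i j (x + t *: e k))}.
  by move=> [_ Ox]; apply: cont_shift; exact: cc.
have cq i j x : (O `&` [set x | O (x + t *: e k)]) x -> {for x, continuous (fun x : V => -1 * c i j x + c i j (x + t *: e k))}.
  by move=> Ox; apply: contD; [apply: contM; [exact: cont_cst|exact: c1]|exact: c2].
have S1 := solves_sub (@subIsetl _ O [set x | O (x + t *: e k)]) sc.
have S2 := solves_sub (@subIsetr _ O [set x | O (x + t *: e k)]) (solves_shift (h := t *: e k) oO cc sc).
have := solves_scale t^-1 oI cq (solves_linear (-1) oI c1 c2 S1 S2); congr (solves _ _).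
by apply/funext => i; apply/funext => j; apply/funext => x; rewrite /dquot /delta mulN1r addrC.
Qed.

(** Difference quotients of the flux solve the equation and converge to its derivative uniformly on
    compact sets. *)
Lemma solves_derivative (O : set V) c cd k : open O -> (forall i j, C1on O (c i j) (cd i j)) ->
  solves O c -> solves O (fun i j => cd i j k).
Proof.
move=> oO Cc1 sc; have cc i j x : O x -> {for x, continuous (c i j)} by exact: C1on_continuous oO (Cc1 i j).
apply: solves_approx => // [i j x Ox|K eps cK KO eps0]; first exact: (Cc1 i j).2.
have [d0 d00 Hd0] := compact_open_dist cK oO KO.
have e1 : `|e k| <= 1 by exact: (frame_norm frame_coord).
have segO x t s : K x -> `|t| < d0 -> 0 <= s <= 1 -> `|x + (s * t) *: e k - x| <= `|t|.
  move=> Kx td /andP[s0 s1]; rewrite addrAC subrr add0r normrZ normrM (ger0_norm s0).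
  have : s * `|t| * `|e k| <= 1 * `|t| * 1 by apply: ler_pM => //; [exact: mulr_ge0|exact: ler_wpM2r].
  by rewrite mul1r mulr1.
have [d dp Hd] : exists2 d : R, 0 < d & forall (p : 'I_n * 'I_n) t, `|t| < d ->
    t != 0 -> forall x, K x -> `|dquot k t (c p.1 p.2) x - cd p.1 p.2 k x| <= eps.
  apply: common_radius => -[i j] /=.
  have [d dp Hd] := compact_unif_cont cK (fun x Kx => (Cc1 i j).2 x (KO x Kx) k) eps0.
  exists (Num.min d d0); first by rewrite lt_min dp.
  move=> t; rewrite lt_min => /andP[td td0] tn x Kx.
  have [s s01 ->] := dquot_mvt oO (Cc1 i j) (fun s s01 => Hd0 x _ Kx (le_lt_trans (segO x t s Kx td0 s01) td0)) tn.
  by apply: ltW; apply: Hd => //; apply: le_lt_trans td; exact: segO.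
pose t := Num.min d d0 / 2.
have m0 : 0 < Num.min d d0 by rewrite lt_min dp.
have t0 : 0 < t by rewrite divr_gt0.
have tmin : `|t| < Num.min d d0 by rewrite gtr0_norm // /t; lra.
have [td td0] : `|t| < d /\ `|t| < d0 by move: tmin; rewrite lt_min => /andP.
exists (O `&` [set x | O (x + t *: e k)]), (fun i j => dquot k t (c i j)).
split.
- by apply: openI => //; exact: open_shift.
- move=> x Kx; split; first exact: KO.
  apply: (Hd0 x _ Kx); apply: le_lt_trans (td0); have := segO x t 1 Kx td0; rewrite mul1r; apply.
  by rewrite lexx ler01.
- move=> i j x [Ox Oxh]; apply: contM; first exact: cont_cst.
  by apply: contB; [apply: cont_shift; exact: cc|exact: cc].
- exact: solves_dquot.
- by move=> i j x Kx; apply: (Hd (i, j)) => //; rewrite gt_eqF.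
Qed.

Section Chain.
Variables (g : 'M[R]_n -> R) (gd : 'I_n * 'I_n -> 'M[R]_n -> R).
Hypotheses (dg : forall Y p, is_derive Y (delta_mx p.1 p.2) g (gd p Y)) (cg : forall p, continuous (gd p)).

Definition mx_of (M : 'I_n -> 'I_n -> V -> R) x : 'M[R]_n := \matrix_(i, j) M i j x.

Lemma chain_rule (M : 'I_n -> 'I_n -> V -> R) (Md : 'I_n -> 'I_n -> R) x v :
  (forall i j, is_derive x v (M i j) (Md i j)) ->
  is_derive x v (fun x => g (mx_of M x)) (\sum_p gd p (mx_of M x) * Md p.1 p.2).
Proof.
move=> dM; pose c (t : R) := mx_of M (t *: v + x).
have E0 : 0 *: v + x = x by rewrite scale0r add0r.
have dij i j : is_derive (0 : R) (1 : R) (fun t => c t i j) (Md i j).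
  have -> : (fun t => c t i j) = (fun t => M i j (t *: v + x)) by apply/funext => t; rewrite mxE.
  by apply: is_derive_line; rewrite E0.
have dc : is_derive (0 : R) (1 : R) c (\matrix_(i, j) Md i j).
  have D : derivable c (0 : R) 1 by apply/derivable_mxP => i j; case: (dij i j).
  split => //; rewrite derive_mx //; apply/matrixP => i j; rewrite !mxE.
  by case: (dij i j).
have dG : is_derive (0 : R) (1 : R) (g \o c) (\sum_p gd p (c 0) * (\matrix_(i, j) Md i j) p.1 p.2).
  apply: (frame_curve (@frame_delta R n n) (f1 := gd)) => //; last by move=> p; exact: cg.
  by near=> Y => p; exact: dg.
rewrite /c E0 in dG; apply: is_derive_quotient => eps eps0.
have [r r0 Hr] := quotient_derive dG eps0; exists r => // t tn tr.
have := Hr t tn tr; rewrite /= addr0 [_%:A]mulr1 E0.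
by under eq_bigr do rewrite mxE.
Unshelve. all: by end_near.
Qed.

Lemma mx_norm_le (Y : 'M[R]_n) (r : R) : 0 <= r -> (forall i j, `|Y i j| <= r) -> `|Y| <= r.
Proof.
move=> r0 Yr; rewrite /Num.Def.normr /= mx_normrE; apply/bigmax_leP; split => // -[a b] _ /=.
Qed.

Lemma locally_lipschitz (Y0 : 'M[R]_n) : exists r L : R, [/\ 0 < r, 0 <= L &
  forall Y Z, `|Y - Y0| < r -> `|Z - Y0| < r -> `|g Y - g Z| <= L * `|Y - Z|].
Proof.
have : \forall Y \near Y0, forall p, `|gd p Y| <= `|gd p Y0| + 1.
  apply: (@filter_forall _ _ (fun p Y => `|gd p Y| <= `|gd p Y0| + 1) (nbhs Y0) _) => p; have := @cg p Y0; move=> /cvgrPdist_le /(_ 1 ltr01); apply: filterS => Y h.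
  have := ler_normB (gd p Y0) (gd p Y0 - gd p Y); rewrite opprB addrC subrK; lra.
move=> /nbhs_ballP [r /= r0 Hr].
exists r, (\sum_p (`|gd p Y0| + 1)); split => //; first by apply: sumr_ge0 => p _; apply: addr_ge0.
move=> Y Z Yr Zr.
have seg s : 0 <= s <= 1 -> is_derive (s *: (Y - Z) + Z) (Y - Z) g (\sum_p gd p (s *: (Y - Z) + Z) * (Y - Z) p.1 p.2).
  move=> _; apply: (frame_is_derive (@frame_delta R n n) (f1 := gd)) => //; last by move=> p; exact: cg.
  by near=> W => p; exact: dg.
have [s /andP[s0 s1]] := mvt_line seg; rewrite subrK => ->.
have inb : `|s *: (Y - Z) + Z - Y0| < r.
  have -> : s *: (Y - Z) + Z - Y0 = s *: (Y - Y0) + (1 - s) *: (Z - Y0).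
    rewrite scalerBl scale1r !scalerBr; apply/matrixP => i j; rewrite !mxE; ring.
  apply: (le_lt_trans (ler_normD _ _)); rewrite !normrZ !ger0_norm ?subr_ge0 //.
  have [->|sn] := eqVneq s 0; first by rewrite mul0r subr0 mul1r add0r.
  have sp : 0 < s by rewrite lt_neqAle eq_sym sn.
  have h1 : s * `|Y - Y0| < s * r by rewrite ltr_pM2l.
  have h2 : (1 - s) * `|Z - Y0| <= (1 - s) * r by apply: ler_wpM2l; [rewrite subr_ge0|exact: ltW].
  by rewrite [X in _ < X](_ : r = s * r + (1 - s) * r); [exact: ltr_leD|ring].
apply: (le_trans (ler_norm_sum _ _ _)); rewrite mulr_suml; apply: ler_sum => p _.
rewrite normrM; apply: ler_pM => //; last exact: (frame_le (@frame_delta R n n)).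
by apply: Hr; rewrite -ball_normE /= distrC.
Unshelve. all: by end_near.
Qed.

End Chain.

End Regularity.

(** * Local Hoelder classes *)

Section HolderClasses.
Context {R : realType} {n : nat} (alpha : R) (O : set 'rV[R]_n).
Notation V := 'rV[R]_n.
Notation e i := (@Defs.coord R n i).
Implicit Types (f g : V -> R) (x y : V).
Hypotheses (a0 : 0 < alpha) (a1 : alpha < 1) (oO : open O).

Definition holder_at f x := exists r C : R, 0 < r /\ holder_on (cube x r) alpha C f.

(** The local class C^(m,alpha). Radius and constant may vary with the point, so that products and
    compositions need no global bounds. *)
Fixpoint holder_class (m : nat) f : Prop := match m with
  | 0 => forall x, O x -> holder_at f x
  | m'.+1 => exists fd, C1on O f fd /\ forall i, holder_class m' (fd i)
  end.

Lemma holder_family (T : finType) (f : T -> V -> R) x (d : R) : 0 < d -> (forall p, holder_at (f p) x) ->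
  exists r C : R, [/\ 0 < r, r <= d, 0 <= C & forall p, holder_on (cube x r) alpha C (f p)].
Proof.
move=> d0 H; have /choice [c Hc] p : exists C : R, exists2 r : R, 0 < r & holder_on (cube x r) alpha C (f p).
  by have [r [C [r0 HC]]] := H p; exists C, r.
pose C := \sum_p `|c p|.
have [s s0 Hs] : exists2 s : R, 0 < s & forall p (t : R), `|t| < s -> holder_on (cube x `|t|) alpha C (f p).
  apply: common_radius => p; have [r r0 HC] := Hc p; exists r => // t tr.
  apply: holder_on_sub (cube_le (ltW tr)) _; apply: holder_on_le HC; apply: (le_trans (ler_norm _)).
  by rewrite /C (bigD1 p) //= lerDl sumr_ge0.
pose t := Num.min d (s / 2).
have t0 : 0 < t by rewrite lt_min d0 divr_gt0.
exists t, C; split => //; [by rewrite ge_min lexx|exact: sumr_ge0|].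
move=> p; rewrite -[t]gtr0_norm //; apply: Hs; rewrite gtr0_norm //.
have : t <= s / 2 by rewrite ge_min lexx orbT.
lra.
Qed.

Lemma holder_at2 f g x (d : R) : 0 < d -> holder_at f x -> holder_at g x ->
  exists r C : R, [/\ 0 < r, r <= d, 0 <= C, holder_on (cube x r) alpha C f & holder_on (cube x r) alpha C g].
Proof.
move=> d0 H1 H2; have [|r [C [r0 rd C0 HC]]] := holder_family (f := fun b : bool => if b then f else g) (x := x) d0.
  by case.
by exists r, C; split => //; [exact: (HC true)|exact: (HC false)].
Qed.

Lemma holder_at_cont f x : holder_at f x -> {for x, continuous f}.
Proof. by move=> [r [C [r0 HC]]]; exact: holder_continuous (@cube_open R n x r) a0 HC (cube_center x r0). Qed.

Lemma holder_bound f x (r C : R) y : r <= 1 -> 0 <= C -> holder_on (cube x r) alpha C f -> cube x r y ->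
  `|f y| <= `|f x| + C.
Proof.
move=> r1 C0 HC yr; have xr : cube x r x by apply: cube_center; apply: le_lt_trans yr; exact: normr_ge0.
have h := HC y x yr xr; have y1 : `|y - x| <= 1 by apply: (le_trans (ltW yr)).
have := powR_mono a0 (normr_ge0 _) y1; rewrite powR1 => p1.
have := ler_normD (f x) (f y - f x); rewrite addrC subrK => h2.
have := ler_wpM2l C0 p1; lra.
Qed.

Lemma holder_at_lin (k : R) f g x : holder_at f x -> holder_at g x -> holder_at (fun x => k * f x + g x) x.
Proof.
move=> Hf Hg; have [r [C [r0 _ C0 HC1 HC2]]] := holder_at2 ltr01 Hf Hg.
exists r, (`|k| * C + C); split => // y z yr zr.
have -> : k * f y + g y - (k * f z + g z) = k * (f y - f z) + (g y - g z) by ring.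
apply: (le_trans (ler_normD _ _)); rewrite normrM mulrDl; apply: lerD; last exact: HC2.
by rewrite -mulrA; apply: ler_wpM2l => //; exact: HC1.
Qed.

Lemma holder_at_mul f g x : holder_at f x -> holder_at g x -> holder_at (fun x => f x * g x) x.
Proof.
move=> Hf Hg; have [r [C [r0 r1 C0 HC1 HC2]]] := holder_at2 ltr01 Hf Hg.
exists r, ((`|f x| + C) * C + C * (`|g x| + C)); split => // y z yr zr.
have -> : f y * g y - f z * g z = f y * (g y - g z) + (f y - f z) * g z by ring.
apply: (le_trans (ler_normD _ _)); rewrite !normrM mulrDl; apply: lerD.
  rewrite -mulrA; apply: ler_pM => //; [exact: holder_bound HC1 yr|exact: HC2].
by rewrite mulrAC; apply: ler_pM => //; [exact: HC1|exact: holder_bound HC2 zr].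
Qed.

Lemma holder_at_C1 f fd x : C1on O f fd -> O x -> holder_at f x.
Proof.
move=> Cf Ox; have : \forall y \near x, O y /\ forall i, `|fd i y| <= `|fd i x| + 1.
  apply: filterI; first exact: open_nbhs_nbhs.
  apply: (@filter_forall _ _ (fun i y => `|fd i y| <= `|fd i x| + 1) (nbhs x) _) => i; have := Cf.2 x Ox i.
  move=> /cvgrPdist_le /(_ 1 ltr01); apply: filterS => y h.
  have := ler_normB (fd i x) (fd i x - fd i y); rewrite opprB addrC subrK; lra.
move=> /nbhs_ballP [r /= r0 Hr].
pose s := Num.min r 2^-1; pose B := \sum_i (`|fd i x| + 1).
have s0 : 0 < s by rewrite lt_min r0 invr_gt0 /=; lra.
have sr : s <= r by rewrite ge_min lexx.
have s2 : s <= 2^-1 by rewrite ge_min lexx orbT.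
have B0 : 0 <= B by apply: sumr_ge0 => i _; exact: addr_ge0.
have Hs y : cube x s y -> O y /\ forall i, `|fd i y| <= `|fd i x| + 1.
  by move=> /(cube_le sr) ys; apply: Hr; rewrite -ball_normE /= distrC.
exists s, (n%:R * B); split => //.
apply: (lipschitz_holder a0 (ltW a1) s2 B0 (fd := fd)).
  by apply: C1on_sub Cf => y /Hs [].
move=> i y /Hs [_ /(_ i) h]; apply: (le_trans h); rewrite /B (bigD1 i) //= lerDl.
by apply: sumr_ge0 => j _; exact: addr_ge0.
Qed.

Lemma holder_class_le m f : holder_class m.+1 f -> holder_class m f.
Proof.
elim: m f => [|m IH] f [fd [Cf Hfd]]; first by move=> x Ox; exact: holder_at_C1 Cf Ox.
by exists fd; split => // i; apply: IH; exact: Hfd.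
Qed.

Lemma holder_class0 m f : holder_class m f -> forall x, O x -> holder_at f x.
Proof. by elim: m f => [//|m IH] f /holder_class_le; exact: IH. Qed.

Lemma holder_class_cst m (c : R) : holder_class m (fun _ => c).
Proof.
elim: m c => [|m IH] c /=.
  by move=> x _; exists 1, 0; split => // y z _ _; rewrite subrr normr0 mul0r.
exists (fun _ _ => 0); split; last by [].
by split=> [x _ i|x _ i]; [exact: is_derive_cst|exact: cont_cst].
Qed.

Lemma holder_class_lin m (k : R) f g : holder_class m f -> holder_class m g ->
  holder_class m (fun x => k * f x + g x).
Proof.
elim: m f g => [|m IH] f g /=.
  by move=> Hf Hg x Ox; apply: holder_at_lin; [exact: Hf|exact: Hg].
move=> [fd [Cf Hf]] [gd [Cg Hg]]; exists (fun i x => k * fd i x + gd i x); split; first exact: C1onD.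
by move=> i; exact: IH.
Qed.

Lemma holder_classD m f g : holder_class m f -> holder_class m g -> holder_class m (fun x => f x + g x).
Proof.
by move=> Hf Hg; have := holder_class_lin 1 Hf Hg; congr holder_class; apply/funext => x; rewrite mul1r.
Qed.

Lemma holder_classM m f g : holder_class m f -> holder_class m g -> holder_class m (fun x => f x * g x).
Proof.
elim: m f g => [|m IH] f g.
  by move=> Hf Hg x Ox; apply: holder_at_mul; [exact: Hf|exact: Hg].
move=> Hf Hg; have [fd [Cf Hfd]] := Hf; have [gd [Cg Hgd]] := Hg.
exists (fun i x => fd i x * g x + f x * gd i x); split; first exact: C1onM.
move=> i; apply: holder_classD; apply: IH; [exact: Hfd|exact: holder_class_le|exact: holder_class_le|exact: Hgd].
Qed.

Lemma holder_class_sum m (T : finType) (f : T -> V -> R) : (forall p, holder_class m (f p)) ->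
  holder_class m (fun x => \sum_p f p x).
Proof.
move=> Cf; have -> : (fun x => \sum_p f p x) = \sum_p f p by apply/funext => x; rewrite fct_sumE.
elim/big_ind: _ => [|f1 g1|p _]; [exact: holder_class_cst|exact: holder_classD|exact: Cf].
Qed.

(* [g vs] is the iterated partial derivative of [g [::]] along the matrix units
   indexed by [vs], the head of [vs] being the last derivative taken. *)
Record smooth_family (g : seq ('I_n * 'I_n) -> 'M[R]_n -> R) : Prop := SmoothFamily {
  family_derive : forall vs Y p, is_derive Y (delta_mx p.1 p.2) (g vs) (g (p :: vs) Y);
  family_cont : forall vs, continuous (g vs) }.

Lemma mx_of_holder (M : 'I_n -> 'I_n -> V -> R) (r C : R) x : 0 <= C ->
  (forall p : 'I_n * 'I_n, holder_on (cube x r) alpha C (M p.1 p.2)) ->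
  forall y z, cube x r y -> cube x r z -> `|mx_of M y - mx_of M z| <= C * `|y - z| `^ alpha.
Proof.
move=> C0 HM y z yr zr; apply: mx_norm_le; first by apply: mulr_ge0 => //; exact: powR_ge0.
by move=> i j; rewrite !mxE; exact: (HM (i, j)).
Qed.

(** Differentiating [g vs] composed with [M] brings in [g (p :: vs)], so the induction on the order
    runs over all [vs] at once. *)
Lemma holder_class_comp (g : seq ('I_n * 'I_n) -> 'M[R]_n -> R) (M : 'I_n -> 'I_n -> V -> R) m vs : smooth_family g ->
  (forall i j, holder_class m (M i j)) -> holder_class m (fun x => g vs (mx_of M x)).
Proof.
move=> sg; elim: m vs M => [|m IH] vs M HM.
  move=> x Ox; have [rho [L [rho0 L0 HL]]] := locally_lipschitz (family_derive sg vs) (fun p => family_cont sg (vs := p :: vs)) (mx_of M x).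
  have [r [C [r0 r1 C0 HC]]] := holder_family ltr01 (f := fun p : 'I_n * 'I_n => M p.1 p.2) (fun p => HM p.1 p.2 x Ox).
  have HH := mx_of_holder C0 HC.
  have [s s0 Hs] := powR_small C (divr_gt0 rho0 (ltac:(lra) : (0 : R) < 2)) a0.
  pose t := Num.min r s; have t0 : 0 < t by rewrite lt_min r0.
  have tr : t <= r by rewrite ge_min lexx.
  have ts : t <= s by rewrite ge_min lexx orbT.
  have inb y : cube x t y -> `|mx_of M y - mx_of M x| < rho.
    move=> yt; have h := HH y x (cube_le tr yt) (cube_center x r0).
    have := Hs _ (normr_ge0 (y - x)) (le_trans (ltW yt) ts); lra.
  exists t, (L * C); split => // y z yt zt.
  apply: (le_trans (HL _ _ (inb y yt) (inb z zt))); rewrite -mulrA; apply: ler_wpM2l => //.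
  by apply: HH; exact: cube_le tr _ _.
have /choice [Md HMd] (p : 'I_n * 'I_n) := HM p.1 p.2.
exists (fun k x => \sum_p g (p :: vs) (mx_of M x) * Md p k x); split; last first.
  move=> k; apply: holder_class_sum => p; apply: holder_classM; last exact: (HMd p).2.
  by apply: IH => i j; exact: holder_class_le.
split=> x Ox k.
  have D := chain_rule (family_derive sg vs) (fun p => family_cont sg (vs := p :: vs))
    (M := M) (Md := fun i j => Md (i, j) k x) (fun i j => (HMd (i, j)).1.1 x Ox k).
  by rewrite (eq_bigr (fun p => g (p :: vs) (mx_of M x) * Md (p.1, p.2) k x)) // => -[].
apply: cont_sum => p; apply: contM; last exact: (HMd p).1.2.
have H0 := IH (p :: vs) M (fun i j => holder_class_le (HM i j)).
exact: holder_at_cont (holder_class0 H0 Ox).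
Qed.

End HolderClasses.

Section HolderEstimates.
Context {R : realType} {n : nat} (alpha : R).
Notation V := 'rV[R]_n.
Notation e i := (@Defs.coord R n i).
Implicit Types (f g : V -> R) (x y : V) (O : set V) (C r : R).

Lemma holder_on_mul O C B1 B2 f g : 0 <= C -> 0 <= B1 -> (forall x, O x -> `|f x| <= B1) -> (forall x, O x -> `|g x| <= B2) ->
  holder_on O alpha C f -> holder_on O alpha C g -> holder_on O alpha (B1 * C + C * B2) (fun x => f x * g x).
Proof.
move=> C0 B10 fB gB Hf Hg x y Ox Oy.
have -> : f x * g x - f y * g y = f x * (g x - g y) + (f x - f y) * g y by ring.
apply: (le_trans (ler_normD _ _)); rewrite !normrM mulrDl; apply: lerD.
  by rewrite -mulrA; apply: ler_pM => //; [exact: fB|exact: Hg].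
by rewrite mulrAC; apply: ler_pM => //; [exact: Hf|exact: gB].
Qed.

Lemma holder_on_sum O C m (f : 'I_m -> V -> R) : (forall p, holder_on O alpha C (f p)) ->
  holder_on O alpha (m%:R * C) (fun x => \sum_p f p x).
Proof.
move=> H x y Ox Oy; rewrite -sumrB; apply: (le_trans (ler_norm_sum _ _ _)).
by rewrite -mulrA -sum_cst; apply: ler_sum => p _; exact: H.
Qed.

Lemma holder_onD O C D f g : holder_on O alpha C f -> holder_on O alpha D g ->
  holder_on O alpha (C + D) (fun x => f x + g x).
Proof.
move=> Hf Hg x y Ox Oy; rewrite (_ : _ - _ = (f x - f y) + (g x - g y)); last by ring.
by apply: (le_trans (ler_normD _ _)); rewrite mulrDl; apply: lerD; [exact: Hf|exact: Hg].
Qed.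

Lemma shift_in_cube x0 r k (t s : R) x : `|t| < r -> cube x0 r x -> 0 <= s <= 1 ->
  cube x0 (2 * r) (x + (s * t) *: e k).
Proof.
rewrite /cube /= => tr xr /andP[s0 s1]; rewrite addrAC; apply: (le_lt_trans (ler_normD _ _)).
have e1 : `|e k| <= 1 by exact: (frame_norm frame_coord).
rewrite normrZ normrM (ger0_norm s0).
have : s * `|t| * `|e k| <= 1 * `|t| * 1 by apply: ler_pM => //; [exact: mulr_ge0|exact: ler_wpM2r].
lra.
Qed.

Lemma shift_in_cube1 x0 r k (t : R) x : `|t| < r -> cube x0 r x -> cube x0 (2 * r) (x + t *: e k).
Proof. by move=> tr xr; have := @shift_in_cube x0 r k t 1 x tr xr; rewrite mul1r lexx ler01; apply. Qed.

Lemma dquot_bound x0 r k (t B : R) f fd : C1on (cube x0 (2 * r)) f fd ->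
  (forall x, cube x0 (2 * r) x -> `|fd k x| <= B) -> t != 0 -> `|t| < r ->
  forall x, cube x0 r x -> `|dquot k t f x| <= B.
Proof.
move=> Cf fB t0 tr x xr.
have [s s01 ->] := dquot_mvt (@cube_open R n x0 (2 * r)) Cf (fun s s01 => shift_in_cube k tr xr s01) t0.
by apply: fB; exact: shift_in_cube.
Qed.

(** The mean value theorem is applied to f(z) - f(z + (y - x)), so that one parameter serves both
    quotients and the two intermediate points stay at the distance of [x] and [y]. *)
Lemma dquot_holder x0 r k (t C : R) f fd : C1on (cube x0 (2 * r)) f fd ->
  holder_on (cube x0 (2 * r)) alpha C (fd k) -> t != 0 -> `|t| < r ->
  holder_on (cube x0 r) alpha C (dquot k t f).
Proof.
move=> Cf fC t0 tr x y xr yr.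
pose W := cube x0 (2 * r) `&` [set z | cube x0 (2 * r) (z + (y - x))].
have oW : open W by apply: openI; [exact: cube_open|apply: open_shift; exact: cube_open].
pose phi z := -1 * f (z + (y - x)) + f z.
have Cphi : C1on W phi (fun i z => -1 * fd i (z + (y - x)) + fd i z).
  by apply: C1onD; [apply: C1on_sub (C1on_shift (y - x) Cf) => z []|apply: C1on_sub Cf => z []].
have seg s : 0 <= s <= 1 -> W (x + (s * t) *: e k).
  move=> s01; split; first exact: shift_in_cube.
  rewrite /= addrAC (addrC x) subrK; exact: shift_in_cube.
have [s s01 E] := dquot_mvt (k := k) oW Cphi seg t0.
have -> : dquot k t f x - dquot k t f y = dquot k t phi x.
  rewrite /dquot /delta /phi -mulrBr; congr (_ * _).
  have -> : x + t *: e k + (y - x) = y + t *: e k by rewrite addrAC (addrC x) subrK.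
  have -> : x + (y - x) = y by rewrite addrC subrK.
  ring.
rewrite E mulN1r addrC.
have [W1 W2] := seg s s01.
have -> : `|x - y| = `|(x + (s * t) *: e k) - (x + (s * t) *: e k + (y - x))|.
  by rewrite opprD addrA subrr add0r opprB.
exact: fC.
Qed.

End HolderEstimates.

(** * Bootstrap for linear equations *)

Section LinearEquation.
Context {R : realType} {n : nat} (alpha lam : R) (O : set 'rV[R]_n).
Notation V := 'rV[R]_n.
Notation e i := (@Defs.coord R n i).
Notation holder_at := (@holder_at R n alpha).
Notation holder_class := (@holder_class R n alpha O).
Implicit Types (f g : V -> R) (x y : V).
Hypotheses (a0 : 0 < alpha) (a1 : alpha < 1) (oO : open O) (lam0 : 0 < lam).

Definition has_third (vd : 'I_n -> V -> R) (vdd : 'I_n -> 'I_n -> V -> R) k x0 := exists (r C : R) (g : 'I_n -> 'I_n -> V -> R),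
  [/\ 0 < r, C2on (cube x0 r) (vd k) (vdd k) g & forall i j, holder_on (cube x0 r) alpha C (g i j)].

(** The local third derivatives coincide with ['D] of [vdd k i], so they glue without any choice. *)
Lemma third_global v vd vdd k : C2on O v vd vdd -> (forall x, O x -> has_third vd vdd k x) ->
  C2on O (vd k) (vdd k) (fun i j => 'D_(e j) (vdd k i)) /\
  forall i j x, O x -> holder_at ('D_(e j) (vdd k i)) x.
Proof.
move=> Cv H.
have loc x : O x -> exists r C (g : 'I_n -> 'I_n -> V -> R), [/\ 0 < r, forall i j y, cube x r y -> is_derive y (e j) (vdd k i) (g i j y)
     & forall i j, holder_on (cube x r) alpha C (g i j)].
  by move=> /H [r [C [g [r0 [_ C2] HC]]]]; exists r, C, g; split => // i j y yr; exact: (C2 i).1.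
have Hat i j x : O x -> holder_at ('D_(e j) (vdd k i)) x.
  move=> Ox; have [r [C [g [r0 dg HC]]]] := loc x Ox; exists r, C; split => // y z yr zr.
  have [_ ->] := dg i j y yr; have [_ ->] := dg i j z zr; exact: HC.
split => //; split=> [x Ox i|i]; first exact: C2on_derive2 Cv Ox.
split=> x Ox j; last exact: (holder_at_cont a0 (Hat i j x Ox)).
have [r [C [g [r0 dg HC]]]] := loc x Ox; have [D E] := dg i j x (cube_center x r0).
by split.
Qed.

(** Discrete product rule: the quotient of the flux has leading coefficients evaluated at the
    shifted point, while quotients of [A] times [vdd] and quotients of [B] form an inhomogeneous
    term that is Hoelder uniformly in [t]. *)
Lemma linear_step v vd vdd (A : 'I_n -> 'I_n -> 'I_n -> 'I_n -> V -> R) Ad (B : 'I_n -> 'I_n -> V -> R) Bd k x0 :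
  C2on O v vd vdd -> (forall i j x, O x -> holder_at (vdd i j) x) ->
  (forall i j p q, C1on O (A i j p q) (Ad i j p q)) -> (forall i j p q l x, O x -> holder_at (Ad i j p q l) x) ->
  (forall i j, C1on O (B i j) (Bd i j)) -> (forall i j l x, O x -> holder_at (Bd i j l) x) ->
  (forall x, O x -> elliptic (fun i j p q => A i j p q x) lam) ->
  solves O (fun i j x => \sum_p \sum_q A i j p q x * vdd p q x + B i j x) ->
  O x0 -> has_third vd vdd k x0.
Proof.
move=> Cv Hv CA HAd CB HBd Ael Sol Ox0.
have [d d0 dO] := open_cube_in oO Ox0.
have HA i j p q : holder_at (A i j p q) x0 by exact: (holder_at_C1 a0 a1 oO (CA i j p q) Ox0).
have HB i j : holder_at (B i j) x0 by exact: (holder_at_C1 a0 a1 oO (CB i j) Ox0).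
(* All functions involved are indexed by one finite type, so that a single radius and a single bound
   serve them all. *)
pose T := ('I_n * 'I_n + ('I_n * 'I_n * 'I_n * 'I_n) + ('I_n * 'I_n * 'I_n * 'I_n * 'I_n) + ('I_n * 'I_n * 'I_n))%type.
pose F (p : T) : V -> R := match p with
  | inl (inl (inl (i, j))) => vdd i j
  | inl (inl (inr (i, j, p, q))) => A i j p q
  | inl (inr (i, j, p, q, l)) => Ad i j p q l
  | inr (i, j, l) => Bd i j l end.
have HF p : holder_at (F p) x0.
  case: p => [[[[i j]|[[[i j] p] q]]|[[[[i j] p] q] l]]|[[i j] l]] /=; [exact: Hv|exact: HA|exact: HAd|exact: HBd].
have m0 : 0 < Num.min d 1 by rewrite lt_min d0 ltr01.
have [rho [C [rho0 rhod C0 HC]]] := holder_family m0 HF.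
have rho1 : rho <= 1 by apply: (le_trans rhod); rewrite ge_min lexx orbT.
have {rhod} rhod : rho <= d by apply: (le_trans rhod); rewrite ge_min lexx.
have [Bd0 Bd00 HBB] : exists2 M : R, 0 <= M & forall p y, cube x0 rho y -> `|F p y| <= M.
  apply: family_bound => p; exists (`|F p x0| + C); first exact: addr_ge0.
  by move=> y yr; exact: (holder_bound a0 rho1 C0 (HC p) yr).
pose r := rho / 4; pose Lam := Bd0 + C.
have r0 : 0 < r by rewrite divr_gt0.
have r1 : r <= 1 by rewrite /r; lra.
have Lam0 : 0 <= Lam by exact: addr_ge0.
have r2rho : 2 * r <= rho by rewrite /r; lra.
have sub2 : cube x0 (2 * r) `<=` cube x0 rho by exact: cube_le.
have sub1 : cube x0 r `<=` cube x0 rho by apply: cube_le; rewrite /r; lra.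
have rhoO : cube x0 rho `<=` O by apply: subset_trans dO; exact: cube_le.
have clos (y : V) : `|y - x0| <= 2 * r -> cube x0 rho y.
  by rewrite /cube /= => h; apply: (le_lt_trans h); rewrite /r; lra.
have HCs p : holder_on (cube x0 r) alpha C (F p) by exact: holder_on_sub sub1 (HC p).
pose K := n%:R * (n%:R * (Bd0 * C + C * Bd0)) + C.
have oQ := @cube_open R n x0 r.
have res := difference_quotients lam0 Lam0 a0 a1 (k := k) (H := C) (K := K) oO Cv r0 r1.
have [||t tn tr|g [C' [Cg HG]]] := res x0.
- by move=> y /clos /rhoO.
- by move=> i j; exact: holder_on_sub clos (HC (inl (inl (inl (i, j))))).
- have sh x : cube x0 r x -> cube x0 rho (x + t *: e k) by move=> xr; apply: sub2; exact: shift_in_cube1.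
  exists (fun i j p q x => A i j p q (x + t *: e k)),
    (fun i j x => \sum_p \sum_q dquot k t (A i j p q) x * vdd p q x + dquot k t (B i j) x); split.
  + split.
    * move=> i j p q x xr; apply: (le_trans (HBB (inl (inl (inr (i, j, p, q)))) _ (sh x xr))).
      by rewrite /Lam lerDl.
    * move=> i j p q x y xr yr.
      have := HC (inl (inl (inr (i, j, p, q)))) _ _ (sh x xr) (sh y yr).
      rewrite opprD addrACA subrr addr0 => /le_trans; apply; apply: ler_wpM2r; first exact: powR_ge0.
      by rewrite /Lam lerDr.
    * by move=> x xr; apply: Ael; apply: rhoO; exact: sh.
  + move=> i j; apply: holder_onD; last first.
      apply: (dquot_holder (C1on_sub (subset_trans sub2 rhoO) (CB i j)) _ tn tr).
      exact: holder_on_sub sub2 (HC (inr (i, j, k))).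
    apply: holder_on_sum => p; apply: holder_on_sum => q; apply: holder_on_mul => //.
    * apply: (dquot_bound (C1on_sub (subset_trans sub2 rhoO) (CA i j p q)) _ tn tr).
      by move=> x xr; exact: (HBB (inl (inr (i, j, p, q, k))) _ (sub2 _ xr)).
    * by move=> x xr; exact: (HBB (inl (inl (inl (p, q)))) _ (sub1 _ xr)).
    * apply: (dquot_holder (C1on_sub (subset_trans sub2 rhoO) (CA i j p q)) _ tn tr).
      exact: holder_on_sub sub2 (HC (inl (inr (i, j, p, q, k)))).
    * exact: (HCs (inl (inl (inl (p, q))))).
  + pose c i j x := \sum_p \sum_q A i j p q x * vdd p q x + B i j x.
    have cc i j x : O x -> {for x, continuous (c i j)}.
      move=> Ox; apply: continuous_fluxA => *.
      * exact: C1on_continuous oO (CA _ _ _ _) Ox.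
      * exact: (Cv.2 _).2.
      * exact: C1on_continuous oO (CB _ _) Ox.
    have inO x : cube x0 r x -> (O `&` [set x | O (x + t *: e k)]) x.
      by move=> xr; split; apply: rhoO; [exact: sub1|exact: sh].
    have := solves_sub inO (solves_dquot (k := k) (t := t) oO cc Sol); congr (solves _ _).
    apply/funext => i; apply/funext => j; apply/funext => x; rewrite /c /dquot /delta.
    have E : \sum_p \sum_q A i j p q (x + t *: e k) * vdd p q (x + t *: e k) - \sum_p \sum_q A i j p q x * vdd p q x
      = \sum_p \sum_q A i j p q (x + t *: e k) * (vdd p q (x + t *: e k) - vdd p q x) +
        \sum_p \sum_q (A i j p q (x + t *: e k) - A i j p q x) * vdd p q x.
      rewrite -sumrB -big_split; apply: eq_bigr => p _ /=; rewrite -sumrB -big_split; apply: eq_bigr => q _ /=; ring.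
    rewrite [X in _ * X](_ : _ = (\sum_p \sum_q A i j p q (x + t *: e k) * vdd p q (x + t *: e k) - \sum_p \sum_q A i j p q x * vdd p q x)
      + (B i j (x + t *: e k) - B i j x)); last by ring.
    rewrite E !mulrDr -addrA; congr (_ + (_ + _)); rewrite mulr_sumr; apply: eq_bigr => p _; rewrite mulr_sumr; apply: eq_bigr => q _.
      by rewrite mulrCA.
    by rewrite mulrA.
by exists (r / 2), C', g; split => //; exact: divr_gt0.
Qed.

End LinearEquation.

Section LinearRegularity.
Context {R : realType} {n : nat} (alpha lam : R) (O : set 'rV[R]_n).
Notation V := 'rV[R]_n.
Notation e i := (@Defs.coord R n i).
Notation holder_at := (@holder_at R n alpha).
Notation holder_class := (@holder_class R n alpha O).
Implicit Types (f g : V -> R) (x y : V).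
Hypotheses (a0 : 0 < alpha) (a1 : alpha < 1) (oO : open O) (lam0 : 0 < lam).

Lemma C1on_sum (W : set V) (T : finType) (f : T -> V -> R) (fd : T -> 'I_n -> V -> R) :
  (forall p, C1on W (f p) (fd p)) -> C1on W (fun x => \sum_p f p x) (fun j x => \sum_p fd p j x).
Proof.
move=> Cf; split=> x Wx j; last by apply: cont_sum => p; exact: (Cf p).2.
have H (s : seq T) : is_derive x (e j) (fun x => \sum_(p <- s) f p x) (\sum_(p <- s) fd p j x).
  elim: s => [|p s IH].
    have -> : (fun x => \sum_(p <- [::]) f p x) = cst 0 by apply/funext => y; rewrite big_nil.
    by rewrite big_nil; exact: is_derive_cst.
  have -> : (fun x => \sum_(p <- p :: s) f p x) = (fun x => f p x + \sum_(p <- s) f p x) by apply/funext => y; rewrite big_cons.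
  by rewrite big_cons; apply: is_deriveD => //; exact: (Cf p).1.
exact: H.
Qed.

Lemma solves_ext (W : set V) (c c' : 'I_n -> 'I_n -> V -> R) : (forall i j x, W x -> c i j x = c' i j x) ->
  solves W c -> solves W c'.
Proof.
move=> cE sc f fd fdd tf; rewrite -[RHS](sc _ _ _ tf); congr (integral_Rn _); apply/funext => x.
have [K [_ KW _ _ fK]] := test_support tf.
apply: eq_bigr => i _; apply: eq_bigr => j _.
by have [Kx|Kx] := pselect (K x); [rewrite cE //; exact: KW|rewrite fK // !mulr0].
Qed.

Lemma derive_congr (W : set V) f g (v : V) x : open W -> (forall y, W y -> f y = g y) -> W x -> 'D_v f x = 'D_v g x.
Proof.
move=> oW fg Wx; apply: near_eq_derive.
have : \forall y \near x, W y by exact: open_nbhs_nbhs.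
by apply: filterS => y Wy; rewrite fg.
Qed.

(** Each derivative of [v] solves an equation with the same leading coefficients. Its inhomogeneous
    term contains [vdd] times derivatives of [A], so the induction hypothesis is used twice: for
    [v], to control that term, and then for [vd k]. *)
Lemma linear_regularity m v vd vdd (A : 'I_n -> 'I_n -> 'I_n -> 'I_n -> V -> R) (B : 'I_n -> 'I_n -> V -> R) :
  C2on O v vd vdd -> (forall i j x, O x -> holder_at (vdd i j) x) ->
  (forall i j p q, holder_class m.+1 (A i j p q)) -> (forall i j, holder_class m.+1 (B i j)) ->
  (forall x, O x -> elliptic (fun i j p q => A i j p q x) lam) ->
  solves O (fun i j x => \sum_p \sum_q A i j p q x * vdd p q x + B i j x) ->
  forall k i, holder_class m.+1 (vdd k i).
Proof.
elim: m v vd vdd A B => [|m IH] v vd vdd A B Cv Hv HA HB Ael Sol.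
  have /choice [Ad' HAd] (p : 'I_n * 'I_n * 'I_n * 'I_n) := HA p.1.1.1 p.1.1.2 p.1.2 p.2.
  have /choice [Bd' HBd] (p : 'I_n * 'I_n) := HB p.1 p.2.
  have CA i j p q : C1on O (A i j p q) (Ad' (i, j, p, q)) by exact: (HAd (i, j, p, q)).1.
  have CB i j : C1on O (B i j) (Bd' (i, j)) by exact: (HBd (i, j)).1.
  move=> k i; have [|C3 H3] := third_global (alpha := alpha) (k := k) a0 Cv.
    move=> x Ox; apply: (linear_step a0 a1 oO lam0 k Cv Hv CA _ CB _ Ael Sol Ox).
    - by move=> i' j p q; exact: (HAd (i', j, p, q)).2.
    - by move=> i' j; exact: (HBd (i', j)).2.
  by exists (fun j => 'D_(e j) (vdd k i)); split; [exact: C3.2|move=> j x Ox; exact: H3].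
have Hvdd : forall k i, holder_class m.+1 (vdd k i).
  by apply: (IH v vd vdd A B) => // *; apply: (holder_class_le a0 a1 oO).
have /choice [Ad' HAd] (p : 'I_n * 'I_n * 'I_n * 'I_n) := HA p.1.1.1 p.1.1.2 p.1.2 p.2.
have /choice [Bd' HBd] (p : 'I_n * 'I_n) := HB p.1 p.2.
pose Ad i j p q := Ad' (i, j, p, q); pose Bd i j := Bd' (i, j).
have CA i j p q : C1on O (A i j p q) (Ad i j p q) by exact: (HAd (i, j, p, q)).1.
have CAd i j p q l : holder_class m.+1 (Ad i j p q l) by exact: (HAd (i, j, p, q)).2.
have CB i j : C1on O (B i j) (Bd i j) by exact: (HBd (i, j)).1.
have CBd i j l : holder_class m.+1 (Bd i j l) by exact: (HBd (i, j)).2.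
have T k : C2on O (vd k) (vdd k) (fun i j => 'D_(e j) (vdd k i)) /\ forall i j x, O x -> holder_at ('D_(e j) (vdd k i)) x.
  apply: (third_global a0 Cv) => x Ox; apply: (linear_step a0 a1 oO lam0 k Cv Hv CA _ CB _ Ael Sol Ox).
  - by move=> i j p q l; exact: (holder_class0 a0 a1 oO (CAd i j p q l)).
  - by move=> i j l; exact: (holder_class0 a0 a1 oO (CBd i j l)).
move=> k i.
have [C3 H3] := T k.
pose cd i j l x := \sum_p \sum_q (Ad i j p q l x * vdd p q x + A i j p q x * 'D_(e l) (vdd p q) x) + Bd i j l x.
have Cflux i' j : C1on O (fun x => \sum_p \sum_q A i' j p q x * vdd p q x + B i' j x) (cd i' j).
  have C1 : C1on O (fun x => \sum_p \sum_q A i' j p q x * vdd p q x)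
     (fun l x => \sum_p \sum_q (Ad i' j p q l x * vdd p q x + A i' j p q x * 'D_(e l) (vdd p q) x)).
    by apply: C1on_sum => p; apply: C1on_sum => q; apply: C1onM => //; exact: ((T p).1.2 q).
  have := C1onD 1 C1 (CB i' j); congr (C1on _ _ _); first by apply/funext => x; rewrite mul1r.
  by apply/funext => l; apply/funext => x; rewrite mul1r.
have Sol' := solves_derivative k oO Cflux Sol.
pose B' i j x := \sum_p \sum_q Ad i j p q k x * vdd p q x + Bd i j k x.
(* Commuting third derivatives turns the k-th derivative of [vdd] into second derivatives of
   [vd k]. *)
have third_sym p q x : O x -> 'D_(e k) (vdd p q) x = 'D_(e q) (vdd k p) x.
  move=> Ox; rewrite (C2on_sym (fdd := fun i j => 'D_(e j) (vdd p i)) q k oO (T p).1 Ox).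
  by apply: (derive_congr (e q) oO _ Ox) => y Oy; exact: C2on_sym oO Cv Oy.
have Sol2 : solves O (fun i j x => \sum_p \sum_q A i j p q x * 'D_(e q) (vdd k p) x + B' i j x).
  apply: solves_ext Sol' => i' j x Ox; rewrite /cd /B' addrA; congr (_ + _).
  rewrite -big_split; apply: eq_bigr => p _ /=; rewrite -big_split; apply: eq_bigr => q _ /=.
  by rewrite third_sym // addrC.
exists (fun j => 'D_(e j) (vdd k i)); split; first exact: C3.2.
apply: (IH (vd k) (vdd k) (fun i j => 'D_(e j) (vdd k i)) A B' C3 H3 _ _ Ael Sol2).
- by move=> *; apply: (holder_class_le a0 a1 oO).
- move=> i' j; apply: holder_classD => //; apply: holder_class_sum => p; apply: holder_class_sum => q.
  exact: (holder_classM a0 a1 oO (CAd _ _ _ _ _) (Hvdd _ _)).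
Qed.

End LinearRegularity.

(** * The nonlinear equation *)

Section Mean.
Context {R : realType}.
Implicit Types (phi psi : R -> R) (s B C : R).

Definition bounded01 phi B := forall s, 0 <= s <= 1 -> `|phi s| <= B.

(* The averages of the second derivatives of F along a segment are taken by a
   finitely additive mean (Riemann sums along an ultrafilter), which applies to
   every bounded function and so needs no integrability argument. *)
Record mean_value (L : (R -> R) -> R) : Prop := MeanValue {
  mean_lin : forall (k : R) phi psi B B', bounded01 phi B -> bounded01 psi B' ->
    L (fun s => k * phi s + psi s) = k * L phi + L psi;
  mean_ge : forall phi B C, bounded01 phi B -> (forall s, 0 <= s <= 1 -> C <= phi s) -> C <= L phi;
  mean_ftc : forall phi psi C, (forall s, 0 <= s <= 1 -> is_derive s (1 : R) phi (psi s)) ->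
    (forall s t, 0 <= s <= 1 -> 0 <= t <= 1 -> `|psi s - psi t| <= C * `|s - t|) -> L psi = phi 1 - phi 0 }.

(** Left Riemann sums of a bounded function converge along the ultrafilter; unbounded functions get
    the value 0. The Lipschitz condition in [mean_ftc] compares each increment of [phi], which is a
    mean value of [psi], with the corresponding term of the sum. *)
Lemma mean_exists : exists L, mean_value L.
Proof.
have [U UF [UN Ub]] := @ultralimit R.
pose avg phi (m : nat) : R := m.+1%:R^-1 * \sum_(j < m.+1) phi (j%:R / m.+1%:R).
have node (m : nat) (j : 'I_m.+1) : 0 <= (j%:R / m.+1%:R : R) <= 1.
  by rewrite divr_ge0 //= ler_pdivrMr ?ltr0n // mul1r ler_nat ltnW.
have avg_ge phi C m : (forall s, 0 <= s <= 1 -> C <= phi s) -> C <= avg phi m.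
  move=> H; rewrite /avg ler_pdivlMl ?ltr0n // -sum_cst; apply: ler_sum => j _; exact: H.
have avg_lin k phi psi m : avg (fun s => k * phi s + psi s) m = k * avg phi m + avg psi m.
  by rewrite /avg big_split /= -mulr_sumr; ring.
have avg_bound phi B m : bounded01 phi B -> `|avg phi m| <= B.
  move=> H; rewrite ler_norml; apply/andP; split.
    by apply: avg_ge => s /H; rewrite ler_norml => /andP[].
  have h : - B <= avg (fun s => -1 * phi s + 0) m by apply: avg_ge => s /H; rewrite ler_norml => /andP[_]; lra.
  by move: h; rewrite avg_lin [avg (fun=> 0) m]/avg big1 // mulr0; lra.
have /choice [L HL] phi : exists l : R, forall B, bounded01 phi B -> avg phi m @[m --> U] --> l.
  have [[B HB]|HB] := pselect (exists B, bounded01 phi B); last by exists 0 => B HB'; exfalso; apply: HB; exists B.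
  have [|l Hl] := Ub (avg phi) B; last by exists l.
  by apply: nearW => m; exact: avg_bound.
exists L; split.
- move=> k phi psi B B' Hphi Hpsi.
  have Hs : bounded01 (fun s => k * phi s + psi s) (`|k| * B + B').
    move=> s s01; apply: (le_trans (ler_normD _ _)); rewrite normrM; apply: lerD; last exact: Hpsi.
    by apply: ler_wpM2l => //; exact: Hphi.
  have c1 := HL _ _ Hs.
  have c2 : avg (fun s => k * phi s + psi s) m @[m --> U] --> k * L phi + L psi.
    rewrite [X in X @ U](_ : _ = (fun m => k * avg phi m + avg psi m)); last by apply/funext => m; rewrite avg_lin.
    by apply: cvgD; [apply: cvg_mulc; exact: HL Hphi|exact: HL Hpsi].
  exact: cvg_unique c1 c2.
- by move=> phi B C Hphi HC; apply: (cvgr_to_ge (HL _ _ Hphi)); apply: nearW => m; exact: avg_ge.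
- move=> phi psi C dphi HC.
  have C0 : 0 <= C.
    have := HC 1 0; rewrite lexx ler01 lexx subr0 normr1 mulr1 => /(_ isT isT); apply: le_trans; exact: normr_ge0.
  have Hpsi : bounded01 psi (`|psi 0| + C).
    move=> s /andP[s0 s1]; have := HC s 0; rewrite s0 s1 lexx ler01 subr0 => /(_ isT isT) h.
    have h2 := ler_normD (psi 0) (psi s - psi 0); rewrite addrC subrK in h2.
    have : C * `|s| <= C * 1 by apply: ler_wpM2l => //; rewrite ger0_norm.
    lra.
  apply: cvg_unique (HL _ _ Hpsi) _ => //.
  (* Once m + 1 >= C / eps, the error on each of the m + 1 intervals is at most eps / (m + 1). *)
  apply/cvgrPdist_le => eps eps0; have := UN (Num.truncn (C / eps)); apply: filterS => m /= hm.
  have mr : 0 < m.+1%:R :> R by rewrite ltr0n.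
  have -> : phi 1 - phi 0 = \sum_(j < m.+1) (phi (j.+1%:R / m.+1%:R) - phi (j%:R / m.+1%:R)).
    rewrite -(big_mkord xpredT (fun j => phi (j.+1%:R / m.+1%:R) - phi (j%:R / m.+1%:R))) telescope_sumr //.
    by rewrite divff ?gt_eqF // mul0r.
  rewrite /avg mulr_sumr -sumrB; apply: (le_trans (ler_norm_sum _ _ _)).
  apply: (@le_trans _ _ (\sum_(j < m.+1) (m.+1%:R^-1 * eps))); last by rewrite sum_cst mulVKf // gt_eqF.
  apply: ler_sum => j _; have /andP[j0 j1] := node m j.
  have step (s : R) : 0 <= s <= 1 -> 0 <= (s + j%:R) / m.+1%:R <= 1.
    move=> /andP[s0 s1]; rewrite divr_ge0 ?addr_ge0 //= ler_pdivrMr // mul1r.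
    have : j%:R + 1 <= m.+1%:R :> R by rewrite natr1 ler_nat.
    lra.
  have d s : 0 <= s <= 1 -> is_derive (s *: (m.+1%:R^-1 : R) + j%:R / m.+1%:R) (m.+1%:R^-1 : R) phi (m.+1%:R^-1 * psi ((s + j%:R) / m.+1%:R)).
    move=> s01; rewrite -[X in is_derive _ X](mulr1 (m.+1%:R^-1)); apply: is_derive_dirZ.
    rewrite /GRing.scale /= -mulrDl; apply: dphi; exact: step.
  have [s s01 E] := mvt_line d.
  have -> : phi (j.+1%:R / m.+1%:R) - phi (j%:R / m.+1%:R) = m.+1%:R^-1 * psi ((s + j%:R) / m.+1%:R).
    have -> : j.+1%:R / m.+1%:R = m.+1%:R^-1 + j%:R / m.+1%:R :> R by rewrite -[X in X / _]natr1 mulrDl mul1r addrC.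
    exact: E.
  rewrite -mulrBr normrM gtr0_norm ?invr_gt0 //; apply: ler_wpM2l; first by rewrite invr_ge0 ltW.
  apply: (le_trans (HC _ _ (step s s01) (node m j))).
  rewrite mulrDl addrK normrM normfV (gtr0_norm mr) mulrA ler_pdivrMr //.
  have [s0 s1] := andP s01.
  apply: (@le_trans _ _ C); first by rewrite -[X in _ <= X]mulr1; apply: ler_wpM2l => //; rewrite ger0_norm.
  rewrite mulrC -ler_pdivrMr //; apply: (le_trans (ltW (truncnS_gt _))).
  by rewrite ler_nat ltnS.
Qed.

Section MeanTheory.
Variables (L : (R -> R) -> R) (HL : mean_value L).

Lemma bounded01_lin k phi psi B B' : bounded01 phi B -> bounded01 psi B' ->
  bounded01 (fun s => k * phi s + psi s) (`|k| * B + B').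
Proof.
move=> Hphi Hpsi s s01; apply: (le_trans (ler_normD _ _)); rewrite normrM; apply: lerD; last exact: Hpsi.
by apply: ler_wpM2l => //; exact: Hphi.
Qed.

Lemma bounded01_0 : bounded01 (fun=> 0) 0.
Proof. by move=> s _; rewrite normr0. Qed.

Lemma mean0 : L (fun=> 0) = 0.
Proof.
have := mean_lin HL 1 bounded01_0 bounded01_0.
rewrite (_ : (fun s : R => 1 * 0 + 0) = (fun=> 0)); last by apply/funext => s; rewrite mulr0 addr0.
by lra.
Qed.

Lemma mean_bound phi B : bounded01 phi B -> `|L phi| <= B.
Proof.
move=> H; rewrite ler_norml; apply/andP; split.
  by apply: (mean_ge HL H) => s /H; rewrite ler_norml => /andP[].
have h : - B <= L (fun s => -1 * phi s + 0).
  by apply: (mean_ge HL (bounded01_lin (-1) H bounded01_0)) => s /H; rewrite ler_norml => /andP[_]; lra.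
by move: h; rewrite (mean_lin HL (-1) H bounded01_0) mean0; lra.
Qed.

Lemma mean_dist phi psi B B' C : bounded01 phi B -> bounded01 psi B' ->
  (forall s, 0 <= s <= 1 -> `|phi s - psi s| <= C) -> `|L phi - L psi| <= C.
Proof.
move=> H1 H2 H; have -> : L phi - L psi = L (fun s => -1 * psi s + phi s) by rewrite (mean_lin HL _ H2 H1); ring.
by apply: mean_bound => s s01; rewrite mulN1r addrC; exact: H.
Qed.

Lemma mean_sum (T : finType) (a : T -> R -> R) (c : T -> R) B : (forall p, bounded01 (a p) B) ->
  L (fun s => \sum_p a p s * c p) = \sum_p L (a p) * c p.
Proof.
move=> H; have S (r : seq T) : L (fun s => \sum_(p <- r) a p s * c p) = \sum_(p <- r) L (a p) * c p /\
    exists B', bounded01 (fun s => \sum_(p <- r) a p s * c p) B'.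
  elim: r => [|p r [IH [B' HB']]].
    rewrite big_nil (_ : (fun s => _) = (fun=> 0)); last by apply/funext => s; rewrite big_nil.
    by split; [exact: mean0|exists 0; exact: bounded01_0].
  have E : (fun s => \sum_(p <- p :: r) a p s * c p) = (fun s => c p * a p s + \sum_(p <- r) a p s * c p).
    by apply/funext => s; rewrite big_cons mulrC.
  split; last by rewrite E; eexists; exact: bounded01_lin (H p) HB'.
  by rewrite E (mean_lin HL _ (H p) HB') IH big_cons mulrC.
exact: (S _).1.
Qed.

End MeanTheory.

End Mean.

(** * Difference quotients of the nonlinear equation *)

Section NonlinearEquation.
Context {R : realType} {n : nat} (alpha lam : R) (O : set 'rV[R]_n).
Notation V := 'rV[R]_n.
Notation e i := (@Defs.coord R n i).
Notation holder_at := (@holder_at R n alpha).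
Notation holder_class := (@holder_class R n alpha O).
Implicit Types (f : V -> R) (x y : V).
Hypotheses (a0 : 0 < alpha) (a1 : alpha < 1) (oO : open O) (lam0 : 0 < lam).
Variable g : seq ('I_n * 'I_n) -> 'M[R]_n -> R.
Hypothesis sg : smooth_family g.

Lemma sum4 (F : 'I_n -> 'I_n -> 'I_n -> 'I_n -> R) :
  \sum_i \sum_j \sum_p \sum_q F i j p q = \sum_(t : ('I_n * 'I_n) * ('I_n * 'I_n)) F t.1.1 t.1.2 t.2.1 t.2.2.
Proof.
under eq_bigr do under eq_bigr do rewrite pair_bigA.
by rewrite pair_bigA pair_bigA.
Qed.

Lemma norm_segment (W : normedModType R) (Y Z : W) (r s : R) : `|Y| <= r -> `|Z| <= r -> 0 <= s <= 1 ->
  `|s *: Y + (1 - s) *: Z| <= r.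
Proof.
move=> Yr Zr /andP[s0 s1]; apply: (le_trans (ler_normD _ _)); rewrite !normrZ !ger0_norm ?subr_ge0 //.
have h1 : s * `|Y| <= s * r by exact: ler_wpM2l.
have h2 : (1 - s) * `|Z| <= (1 - s) * r by apply: ler_wpM2l => //; rewrite subr_ge0.
lra.
Qed.

Lemma family_lipschitz (Y0 : 'M[R]_n) : exists rho Lip B : R, [/\ 0 < rho, 0 <= Lip, 0 <= B &
  forall p q : 'I_n * 'I_n, `|g [:: p; q] Y0| <= B /\
    forall Y Z, `|Y - Y0| < rho -> `|Z - Y0| < rho -> `|g [:: p; q] Y - g [:: p; q] Z| <= Lip * `|Y - Z|].
Proof.
pose T := (('I_n * 'I_n) * ('I_n * 'I_n))%type.
have /choice [l Hl] (p : T) : exists L : R, 0 <= L /\ exists2 r : R, 0 < r &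
    forall Y Z, `|Y - Y0| < r -> `|Z - Y0| < r -> `|g [:: p.1; p.2] Y - g [:: p.1; p.2] Z| <= L * `|Y - Z|.
  have [r [L [r0 L0 HL]]] := locally_lipschitz (family_derive sg [:: p.1; p.2]) (fun q => family_cont sg (vs := q :: [:: p.1; p.2])) Y0.
  by exists L; split => //; exists r.
have [rho rho0 Hrho] : exists2 d : R, 0 < d & forall (p : T) (t : R), `|t| < d ->
    forall Y Z, `|Y - Y0| < `|t| -> `|Z - Y0| < `|t| -> `|g [:: p.1; p.2] Y - g [:: p.1; p.2] Z| <= l p * `|Y - Z|.
  apply: common_radius => p; have [_ [r r0 Hr]] := Hl p; exists r => // t tr Y Z Yt Zt.
  by apply: Hr; [apply: lt_trans tr|apply: lt_trans tr].
exists (rho / 2), (\sum_p l p), (\sum_(p : T) `|g [:: p.1; p.2] Y0|); split.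
- by rewrite divr_gt0.
- by apply: sumr_ge0 => p _; exact: (Hl p).1.
- exact: sumr_ge0.
move=> p q; split; first by rewrite (bigD1 (p, q)) //= lerDl sumr_ge0.
have r2 : `|rho / 2| = rho / 2 by rewrite gtr0_norm // divr_gt0.
move=> Y Z Yr Zr; apply: (le_trans (Hrho (p, q) (rho / 2) _ Y Z _ _)); rewrite ?r2 //; first by lra.
apply: ler_wpM2r => //; rewrite (bigD1 (p, q)) //= lerDl.
by apply: sumr_ge0 => t _; exact: (Hl t).1.
Qed.

(** The Hoelder bound of the averaged coefficients is uniform in [t]: corresponding points of two
    segments differ by a convex combination of the differences of their end points, and [g] is
    locally Lipschitz. *)
Lemma nonlinear_step u ud udd k x0 : C2on O u ud udd -> (forall i j x, O x -> holder_at (udd i j) x) ->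
  solves O (fun i j x => g [:: (i, j)] (mx_of udd x)) ->
  (forall x, O x -> elliptic (fun i j p q => g [:: (p, q); (i, j)] (mx_of udd x)) lam) ->
  O x0 -> has_third alpha ud udd k x0.
Proof.
move=> Cu Hu Sol Ell Ox0.
have [L HL] := @mean_exists R.
pose Y0 := mx_of udd x0.
have [rho [Lip [B [rho0 Lip0 B0 Hg]]]] := family_lipschitz Y0.
have [d d0 dO] := open_cube_in oO Ox0.
have m0 : 0 < Num.min d 1 by rewrite lt_min d0 ltr01.
have [rr [C [rr0 rrd C0 HC]]] := holder_family m0 (f := fun p : 'I_n * 'I_n => udd p.1 p.2) (fun p => Hu p.1 p.2 x0 Ox0).
have HM := mx_of_holder C0 HC.
pose N : R := n%:R ^+ 2.
have N0 : 0 <= N by exact: sqr_ge0.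
have NL : 0 < N * Lip + 1 by rewrite ltr_wpDl // mulr_ge0.
(* Within [eta] of [Y0] the quadratic form changes by at most lam/2, which leaves ellipticity lam/2;
   the bound [rho / 2] stays where the Lipschitz estimate holds. *)
pose eta := Num.min (rho / 2) (lam / (2 * (N * Lip + 1))).
have eta0 : 0 < eta by rewrite lt_min divr_gt0 //= divr_gt0 // mulr_gt0.
have eta_rho : eta < rho by have : eta <= rho / 2 by [rewrite ge_min lexx]; lra.
have eta_lam : N * Lip * eta <= lam / 2.
  have h : eta * (2 * (N * Lip + 1)) <= lam by rewrite -ler_pdivlMr ?mulr_gt0 // ge_min lexx orbT.
  by lra.
have [s0 s00 Hs0] := powR_small C eta0 a0.
pose r := Num.min rr s0 / 4.
have m1 : 0 < Num.min rr s0 by rewrite lt_min rr0.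
have r0 : 0 < r by rewrite divr_gt0.
have r4 : 4 * r <= rr /\ 4 * r <= s0.
  have : Num.min rr s0 <= rr by rewrite ge_min lexx.
  have : Num.min rr s0 <= s0 by rewrite ge_min lexx orbT.
  by rewrite /r; split; lra.
have [r4r r4s] := r4.
have rr1 : rr <= 1 by apply: (le_trans rrd); rewrite ge_min lexx orbT.
have rrO : cube x0 rr `<=` O.
  by apply: subset_trans dO; apply: cube_le; apply: (le_trans rrd); rewrite ge_min lexx.
have r1 : r <= 1 by lra.
have clos (y : V) : `|y - x0| <= 2 * r -> cube x0 rr y by rewrite /cube /= => h; lra.
have sub1 (y : V) : cube x0 r y -> cube x0 rr y by rewrite /cube /= => h; lra.
have near0 y : cube x0 (2 * r) y -> `|mx_of udd y - Y0| <= eta.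
  move=> yr; have yrr : cube x0 rr y by move: yr; rewrite /cube /=; lra.
  apply: (le_trans (HM y x0 yrr (cube_center x0 rr0))); apply: Hs0 => //.
  by move: yr; rewrite /cube /=; lra.
have lam20 : 0 < lam / 2 by rewrite divr_gt0.
have Lam0 : 0 <= B + Lip * rho + Lip * C.
  by rewrite !addr_ge0 // mulr_ge0 // ltW.
have [||t tn tr|h [C' [Ch HG]]] := difference_quotients (k := k) (x0 := x0) (H := C) (K := 0) lam20 Lam0 a0 a1 oO Cu r0 r1.
- by move=> y /clos /rrO.
- by move=> i j; exact: holder_on_sub clos (HC (i, j)).
- pose dM x : 'M[R]_n := mx_of udd (x + t *: e k) - mx_of udd x.
  pose Ms x s : 'M[R]_n := s *: dM x + mx_of udd x.
  have sh x : cube x0 r x -> cube x0 rr (x + t *: e k).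
    by move=> xr; have := shift_in_cube1 k tr xr; rewrite /cube /=; lra.
  have near1 x s : cube x0 r x -> 0 <= s <= 1 -> `|Ms x s - Y0| <= eta.
    move=> xr s01; have -> : Ms x s - Y0 = s *: (mx_of udd (x + t *: e k) - Y0) + (1 - s) *: (mx_of udd x - Y0).
      by rewrite /Ms /dM; apply/matrixP => i j; rewrite !mxE; ring.
    apply: norm_segment => //; apply: near0; first exact: shift_in_cube1.
    by move: xr; rewrite /cube /=; lra.
  have in_rho x s : cube x0 r x -> 0 <= s <= 1 -> `|Ms x s - Y0| < rho.
    by move=> xr s01; apply: le_lt_trans (near1 x s xr s01) eta_rho.
  have Y0rho : `|Y0 - Y0| < rho by rewrite subrr normr0.
  have bnd p q x : cube x0 r x -> bounded01 (fun s => g [:: p; q] (Ms x s)) (B + Lip * rho).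
    move=> xr s s01; have [gB gL] := Hg p q.
    have h := gL _ _ (in_rho x s xr s01) Y0rho.
    have h2 := ler_wpM2l Lip0 (ltW (in_rho x s xr s01)).
    have := ler_normD (g [:: p; q] Y0) (g [:: p; q] (Ms x s) - g [:: p; q] Y0); rewrite addrC subrK; lra.
  exists (fun i j p q x => L (fun s => g [:: (p, q); (i, j)] (Ms x s))), (fun _ _ _ => 0); split.
  + split.
    * move=> i j p q x xr; apply: (le_trans (mean_bound HL (bnd (p, q) (i, j) x xr))).
      by rewrite lerDl mulr_ge0.
    * move=> i j p q x y xr yr; apply: (@le_trans _ _ (Lip * (C * `|x - y| `^ alpha))).
        apply: (mean_dist HL (bnd _ _ x xr) (bnd _ _ y yr)) => s s01.
        apply: (le_trans ((Hg _ _).2 _ _ (in_rho x s xr s01) (in_rho y s yr s01))); apply: ler_wpM2l => //.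
        have -> : Ms x s - Ms y s = s *: (mx_of udd (x + t *: e k) - mx_of udd (y + t *: e k)) + (1 - s) *: (mx_of udd x - mx_of udd y).
          by rewrite /Ms /dM; apply/matrixP => i' j'; rewrite !mxE; ring.
        apply: norm_segment => //; last by apply: HM; exact: sub1.
        have := HM _ _ (sh x xr) (sh y yr); by rewrite opprD addrACA subrr addr0.
      rewrite mulrA; apply: ler_wpM2r; first exact: powR_ge0.
      by rewrite lerDr addr_ge0 // mulr_ge0 // ltW.
    * move=> x xr xi sxi; rewrite sum4.
      pose a (w : ('I_n * 'I_n) * ('I_n * 'I_n)) (s : R) := g [:: w.2; w.1] (Ms x s).
      pose c (w : ('I_n * 'I_n) * ('I_n * 'I_n)) := xi w.1.1 w.1.2 * xi w.2.1 w.2.2.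
      have ba w : bounded01 (a w) (B + Lip * rho) by exact: bnd.
      rewrite (eq_bigr (fun w => L (a w) * c w)); last by move=> [[i j] [p q]] _; rewrite mulrA.
      rewrite -(mean_sum HL c ba).
      have bs : bounded01 (fun s => \sum_w a w s * c w) (\sum_w (B + Lip * rho) * `|c w|).
        move=> s s01; apply: (le_trans (ler_norm_sum _ _ _)); apply: ler_sum => w _.
        by rewrite normrM; apply: ler_wpM2r => //; exact: ba.
      apply: (mean_ge HL bs) => s s01.
      (* Ellipticity is known at Hessians of [u] only, and a segment between two of them need not
         consist of Hessians; it is therefore transferred from [Y0] by continuity. *)
      have E0 : lam * (\sum_i \sum_j xi i j ^+ 2) <= \sum_w g [:: w.2; w.1] Y0 * c w.
        have := Ell x0 Ox0 xi sxi; rewrite sum4 => /le_trans; apply.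
        rewrite le_eqVlt; apply/orP; left; apply/eqP; apply: eq_bigr => -[[i j] [p q]] _.
        by rewrite /c mulrA.
      have E1 : `|\sum_w (a w s - g [:: w.2; w.1] Y0) * c w| <= \sum_w (Lip * eta) * `|c w|.
        apply: (le_trans (ler_norm_sum _ _ _)); apply: ler_sum => w _; rewrite normrM.
        apply: ler_wpM2r => //; apply: (le_trans ((Hg _ _).2 _ _ (in_rho x s xr s01) Y0rho)).
        by apply: ler_wpM2l => //; exact: near1.
      have E2 : \sum_w `|c w| <= N * (\sum_i \sum_j xi i j ^+ 2).
        have -> : \sum_w `|c w| = (\sum_i \sum_j `|xi i j|) ^+ 2.
          rewrite (eq_bigr (fun w : ('I_n * 'I_n) * ('I_n * 'I_n) => `|xi w.1.1 w.1.2| * `|xi w.2.1 w.2.2|)); last by move=> w _; rewrite normrM.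
          rewrite -(sum4 (fun i j p q => `|xi i j| * `|xi p q|)) expr2 mulr_suml; apply: eq_bigr => i _.
          by rewrite mulr_suml; apply: eq_bigr => j _; rewrite mulr_sumr; apply: eq_bigr => p _; rewrite mulr_sumr.
        apply: (le_trans (sum_sq_le _)); rewrite /N expr2 -mulrA; apply: ler_wpM2l => //.
        rewrite mulr_sumr; apply: ler_sum => i _; apply: (le_trans (sum_sq_le _)); apply: ler_wpM2l => //.
        by apply: ler_sum => j _; rewrite -normrX ger0_norm ?sqr_ge0.
      have E3 : \sum_w a w s * c w = \sum_w g [:: w.2; w.1] Y0 * c w + \sum_w (a w s - g [:: w.2; w.1] Y0) * c w.
        by rewrite -big_split; apply: eq_bigr => w _ /=; ring.
      rewrite E3; move: E1; rewrite -mulr_sumr => /ler_normlP [E1 _].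
      set X := \sum_i \sum_j xi i j ^+ 2 in E0 E2 *.
      have X0 : 0 <= X by apply: sumr_ge0 => i _; apply: sumr_ge0 => j _; exact: sqr_ge0.
      have Le : 0 <= Lip * eta by apply: mulr_ge0 => //; exact: ltW.
      have E4 := ler_wpM2l Le E2; have E5 := ler_wpM2r X0 eta_lam.
      have E6 : Lip * eta * (N * X) = N * Lip * eta * X by ring.
      rewrite E6 in E4; lra.
  + by move=> i j x y _ _; rewrite subrr normr0 mul0r.
  + have cc i j x : O x -> {for x, continuous (fun x => g [:: (i, j)] (mx_of udd x))}.
      move=> Ox; have H0 : holder_class 0 (fun x => g [:: (i, j)] (mx_of udd x)).
        by apply: (holder_class_comp a0 a1 oO) => //= i' j' y Oy; exact: Hu.
      exact: (holder_at_cont a0 (H0 x Ox)).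
    have inO x : cube x0 r x -> (O `&` [set x | O (x + t *: e k)]) x.
      by move=> xr; split; apply: rrO; [exact: sub1|exact: sh].
    apply: solves_ext (solves_sub inO (solves_dquot (k := k) (t := t) oO cc Sol)) => i j x xr.
    rewrite addr0 /dquot [X in _ * X]/delta.
    pose psi s := \sum_p g [:: p; (i, j)] (Ms x s) * dM x p.1 p.2.
    have Hftc : L psi = g [:: (i, j)] (Ms x 1) - g [:: (i, j)] (Ms x 0).
      apply: (mean_ftc HL (phi := fun s => g [:: (i, j)] (Ms x s)) (C := \sum_p Lip * `|dM x| * `|dM x p.1 p.2|)).
        move=> s s01; apply: is_derive_line.
        apply: (frame_is_derive (@frame_delta R n n) (f1 := fun p => g [:: p; (i, j)])).
          by near=> W => p; exact: family_derive.
        by move=> p; exact: family_cont.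
      move=> s s' s01 s01'; rewrite /psi -sumrB mulr_suml; apply: (le_trans (ler_norm_sum _ _ _)); apply: ler_sum => p _.
      rewrite -mulrBl normrM [X in _ <= X]mulrAC; apply: ler_wpM2r => //.
      apply: (le_trans ((Hg _ _).2 _ _ (in_rho x s xr s01) (in_rho x s' xr s01'))).
      rewrite -mulrA; apply: ler_wpM2l => //.
      have -> : Ms x s - Ms x s' = (s - s') *: dM x by rewrite /Ms opprD addrACA subrr addr0 scalerBl.
      by rewrite normrZ mulrC.
    have -> : g [:: (i, j)] (mx_of udd (x + t *: e k)) - g [:: (i, j)] (mx_of udd x) = L psi.
      by rewrite Hftc /Ms scale1r scale0r add0r /dM subrK.
    rewrite (mean_sum HL _ (fun p => bnd p (i, j) x xr)) mulr_sumr pair_bigA; apply: eq_bigr => -[p q] _ /=.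
    by rewrite /dM !mxE /delta mulrCA.
by exists (r / 2), C', h; split => //; exact: divr_gt0.
Unshelve. all: by end_near.
Qed.

End NonlinearEquation.

Section NonlinearRegularity.
Context {R : realType} {n : nat} (alpha lam : R) (O : set 'rV[R]_n).
Notation V := 'rV[R]_n.
Notation e i := (@Defs.coord R n i).
Notation holder_at := (@holder_at R n alpha).
Notation holder_class := (@holder_class R n alpha O).
Implicit Types (f : V -> R) (x y : V).
Hypotheses (a0 : 0 < alpha) (a1 : alpha < 1) (oO : open O) (lam0 : 0 < lam).
Variable g : seq ('I_n * 'I_n) -> 'M[R]_n -> R.
Hypothesis sg : smooth_family g.

(** Once third derivatives exist, each [ud k] solves a linear equation whose coefficients are as
    regular as [udd]. Linear regularity makes the second derivatives of [ud k] equally regular,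
    which is one order more for [udd]. *)
Lemma nonlinear_regularity u ud udd : C2on O u ud udd -> (forall i j x, O x -> holder_at (udd i j) x) ->
  solves O (fun i j x => g [:: (i, j)] (mx_of udd x)) ->
  (forall x, O x -> elliptic (fun i j p q => g [:: (p, q); (i, j)] (mx_of udd x)) lam) ->
  forall m k i, holder_class m.+1 (udd k i).
Proof.
move=> Cu Hu Sol Ell.
have T k : C2on O (ud k) (udd k) (fun i j => 'D_(e j) (udd k i)) /\ forall i j x, O x -> holder_at ('D_(e j) (udd k i)) x.
  by apply: (third_global a0 Cu) => x Ox; exact: (nonlinear_step a0 a1 oO lam0 sg k Cu Hu Sol Ell Ox).
pose cd i j l x := \sum_p g [:: p; (i, j)] (mx_of udd x) * 'D_(e l) (udd p.1 p.2) x.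
have Cflux i j : C1on O (fun x => g [:: (i, j)] (mx_of udd x)) (cd i j).
  split=> x Ox l.
    have dudd p q : is_derive x (e l) (udd p q) ('D_(e l) (udd p q) x) by exact: ((T p).1.2 q).1.
    exact: (chain_rule (family_derive sg [:: (i, j)]) (fun p => family_cont sg (vs := [:: p; (i, j)])) dudd).
  apply: cont_sum => p; apply: contM; last exact: ((T p.1).1.2 p.2).2.
  have H0 : holder_class 0 (fun x => g [:: p; (i, j)] (mx_of udd x)) by apply: (holder_class_comp a0 a1 oO).
  exact: (holder_at_cont a0 (H0 x Ox)).
have third_sym k p q x : O x -> 'D_(e k) (udd p q) x = 'D_(e q) (udd k p) x.
  move=> Ox; rewrite (C2on_sym (fdd := fun i j => 'D_(e j) (udd p i)) q k oO (T p).1 Ox).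
  by apply: (derive_congr (e q) oO _ Ox) => y Oy; exact: C2on_sym oO Cu Oy.
(* The trailing 0 is the inhomogeneous term in the form that [linear_regularity] expects. *)
have Sol' k : solves O (fun i j x => \sum_p \sum_q g [:: (p, q); (i, j)] (mx_of udd x) * 'D_(e q) (udd k p) x + 0).
  have := solves_derivative k oO Cflux Sol; apply: solves_ext => i j x Ox.
  rewrite addr0 /cd pair_bigA; apply: eq_bigr => -[p q] _ /=; by rewrite third_sym.
elim=> [|m IH] k i; exists (fun j => 'D_(e j) (udd k i)); split; try exact: (T k).1.2.
  by move=> j x Ox; exact: (T k).2.
apply: (linear_regularity a0 a1 oO lam0 (A := fun i j p q x => g [:: (p, q); (i, j)] (mx_of udd x)) (B := fun _ _ _ => 0) (T k).1 (T k).2 _ _ Ell (Sol' k)).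
  by move=> *; apply: (holder_class_comp a0 a1 oO).
by move=> *; exact: holder_class_cst.
Qed.

End NonlinearRegularity.

(** * Functions of symmetric matrices *)

Section SymmetricFunctions.
Context {R : realType}.

(** A directional derivative sees only one line. This trades the direction [delta_mx] before
    symmetrization for [symm_unit] after it. *)
Lemma line_derivable (W : normedModType R) (f g : W -> R) (x y v w : W) :
  (forall h : R, f (h *: v + x) = g (h *: w + y)) -> derivable g y w ->
  is_derive x v f ('D_w g y).
Proof.
move=> fg dg; have f0 : f x = g y by have := fg 0; rewrite !scale0r !add0r.
have E : (fun h : R => h^-1 *: ((f \o shift x) (h *: v) - f x)) = (fun h : R => h^-1 *: ((g \o shift y) (h *: w) - g y)).
  by apply/funext => h; rewrite /= fg f0.
by split; rewrite ?/derivable ?/derive E.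
Qed.

Lemma derive_line_congr (W : normedModType R) (f g : W -> R) (x v : W) :
  (forall h : R, f (h *: v + x) = g (h *: v + x)) -> 'D_v f x = 'D_v g x.
Proof.
move=> fg; have f0 : f x = g x by have := fg 0; rewrite !scale0r !add0r.
have E : (fun h : R => h^-1 *: ((f \o shift x) (h *: v) - f x)) = (fun h : R => h^-1 *: ((g \o shift x) (h *: v) - g x)).
  by apply/funext => h; rewrite /= fg f0.
by rewrite /derive E.
Qed.

Lemma nonexpansive_continuous (W W' : normedModType R) (f : W -> W') :
  (forall x y, `|f x - f y| <= `|x - y|) -> continuous f.
Proof.
move=> f1 x; apply/cvgrPdist_le => eps eps0; near=> y; apply: (le_trans (f1 _ _)).
by near: y; exact: cvgr_dist_le.
Unshelve. all: by end_near.
Qed.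

Lemma continuous_within_comp (W W' : normedModType R) (A : set W') (f : W' -> R) (h : W -> W') (k : R) :
  {within A, continuous f} -> continuous h -> (forall x, A (h x)) -> continuous (fun x => k * f (h x)).
Proof.
move=> /subspace_continuousP cf ch Ah x.
have c : {for x, continuous (fun x => f (h x))}.
  apply: cvg_comp (cf _ (Ah x)) => B hB; have := ch x _ hB.
  by rewrite /nbhs /=; apply: (@filterS _ (nbhs x)) => z; apply; exact: Ah.
exact: (contM (@cont_cst _ _ k x) c).
Qed.

Context {n : nat} (F : 'M[R]_n -> R) (s : R).
Hypothesis sF : smooth_symm F.
Implicit Types (M Y xi : 'M[R]_n).

Definition symmetrize M : 'M[R]_n := 2^-1 *: (M + M^T).

(* Composing with the symmetrization extends F from symmetric matrices to all
   matrices; the sign s treats the convex and the concave case together. *)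
Definition symm_family (vs : seq ('I_n * 'I_n)) M : R :=
  s * iter_derive F [seq symm_unit p.1 p.2 | p <- vs] (symmetrize M).

Lemma symm_symmetrize M : symm (symmetrize M).
Proof. by rewrite /symm /symmetrize /= linearZ linearD /= trmxK addrC. Qed.

Lemma symmetrize_id M : symm M -> symmetrize M = M.
Proof. by rewrite /symm /symmetrize => ->; apply/matrixP => i j; rewrite !mxE; lra. Qed.

Lemma symm_symm_unit i j : symm (symm_unit i j : 'M[R]_n).
Proof. by rewrite /symm /symm_unit /= linearZ linearD /= !trmx_delta addrC. Qed.

Lemma symmetrize_line (h : R) M i j :
  symmetrize (h *: delta_mx i j + M) = h *: symm_unit i j + symmetrize M.
Proof.
apply/matrixP => a b; rewrite /symmetrize /symm_unit !mxE [(b == i) && _]andbC; ring.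
Qed.

Lemma symmetrize_continuous : continuous symmetrize.
Proof.
apply: nonexpansive_continuous => M Y; apply: mx_norm_le; first exact: normr_ge0.
move=> i j.
have h1 := frame_le (@frame_delta R n n) (i, j) (M - Y); have h2 := frame_le (@frame_delta R n n) (j, i) (M - Y).
rewrite /= !mxE in h1 h2; rewrite !mxE.
have -> : 2^-1 * (M i j + M j i) - 2^-1 * (Y i j + Y j i) = 2^-1 * (M i j - Y i j) + 2^-1 * (M j i - Y j i) by ring.
apply: (le_trans (ler_normD _ _)); rewrite !normrM gtr0_norm //; lra.
Qed.

Lemma symm_family_smooth : smooth_family symm_family.
Proof.
split=> [vs Y p|vs Y].
  rewrite /symm_family /=.
  have Evs v : v \in [seq symm_unit q.1 q.2 | q <- vs] -> symm (v : 'M[R]_n).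
    by move=> /mapP [q _ ->]; exact: symm_symm_unit.
  have [||_ H] := sF (k := (size vs).+1) (vs := [seq symm_unit q.1 q.2 | q <- vs]); rewrite ?size_map //.
  rewrite size_map in H; have dG := H (ltnSn _) _ _ (symm_symmetrize Y) (symm_symm_unit p.1 p.2).
  have := line_derivable (f := fun M => iter_derive F [seq symm_unit q.1 q.2 | q <- vs] (symmetrize M)) (x := Y) (v := delta_mx p.1 p.2) (fun h => congr1 _ (symmetrize_line h Y p.1 p.2)) dG.
  by move=> D; exact: is_deriveZ.
have Evs v : v \in [seq symm_unit q.1 q.2 | q <- vs] -> symm (v : 'M[R]_n).
  by move=> /mapP [q _ ->]; exact: symm_symm_unit.
have [||cG _] := sF (k := size vs) (vs := [seq symm_unit q.1 q.2 | q <- vs]); rewrite ?size_map //.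
exact: (continuous_within_comp (k := s) cG symmetrize_continuous symm_symmetrize).
Qed.

Lemma symm_familyE vs M : symm M ->
  symm_family vs M = s * iter_derive F [seq symm_unit p.1 p.2 | p <- vs] M.
Proof. by move=> sM; rewrite /symm_family symmetrize_id. Qed.

Lemma symm_family_is_derive vs M xi :
  is_derive M xi (symm_family vs) (\sum_p symm_family (p :: vs) M * xi p.1 p.2).
Proof.
apply: (frame_is_derive (@frame_delta R n n) (f1 := fun p => symm_family (p :: vs))).
  by near=> Y => p; exact: (family_derive symm_family_smooth).
by move=> p; exact: (family_cont symm_family_smooth).
Unshelve. all: by end_near.
Qed.

(** Lines through a symmetric matrix in a symmetric direction consist of symmetric matrices, where
    the extension agrees with [s * F]; differentiation in the space of all matrices then gives the
    coordinates. *)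
Lemma second_derivative_symm M xi : symm M -> symm xi ->
  'D_xi ('D_xi (fun N => s * F N)) M =
  \sum_i \sum_j \sum_p \sum_q symm_family [:: (p, q); (i, j)] M * xi i j * xi p q.
Proof.
move=> sM sxi; have sline (N : 'M[R]_n) (h : R) : symm N -> symm (h *: xi + N).
  by move=> sN; rewrite /symm /= linearD linearZ /= sxi sN.
pose H N := \sum_p symm_family [:: p] N * xi p.1 p.2.
have E1 N : symm N -> 'D_xi (fun N => s * F N) N = H N.
  move=> sN; have [_ DN] := symm_family_is_derive [::] N xi; rewrite -[RHS]DN; apply: derive_line_congr => h.
  by rewrite symm_familyE //; exact: sline.
have -> : 'D_xi ('D_xi (fun N => s * F N)) M = 'D_xi H M.
  by apply: derive_line_congr => h; rewrite E1 //; exact: sline.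
have dH : is_derive M xi H (\sum_p (\sum_q symm_family [:: q; p] M * xi q.1 q.2) * xi p.1 p.2).
  have -> : H = \sum_p (fun N => symm_family [:: p] N * xi p.1 p.2) by apply/funext => N; rewrite fct_sumE.
  have K p : is_derive M xi (fun N => symm_family [:: p] N * xi p.1 p.2) ((\sum_q symm_family [:: q; p] M * xi q.1 q.2) * xi p.1 p.2).
    have -> : (fun N => symm_family [:: p] N * xi p.1 p.2) = xi p.1 p.2 *: symm_family [:: p].
      by apply/funext => N; rewrite mulrC.
    rewrite mulrC; exact: is_deriveZ (symm_family_is_derive [:: p] M xi).
  elim/big_rec2: _ => [|p d f _ df]; first exact: is_derive_cst.
  exact: is_deriveD.
have [_ ->] := dH; rewrite [RHS]sum4 [LHS](eq_bigr (fun p => \sum_q symm_family [:: q; p] M * xi p.1 p.2 * xi q.1 q.2)).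
  by rewrite pair_bigA; apply: eq_bigr => -[[i j] [p q]].
by move=> p _; rewrite mulr_suml; apply: eq_bigr => q _; rewrite mulrAC.
Qed.

End SymmetricFunctions.

(** * Critical points in the unit ball *)

Section UnitBall.
Context {R : realType} {n : nat}.
Notation V := 'rV[R]_n.
Notation e i := (@Defs.coord R n i).
Implicit Types (u f : V -> R) (x y : V).

Lemma enorm_continuous : continuous (@enorm R n).
Proof.
move=> x; apply: (@continuous_comp _ _ _ (fun x : V => \sum_i x 0 i ^+ 2) (@Num.sqrt R)); last exact: sqrt_continuous.
apply: cont_sum => i; exact: (contM (C1on_continuous openT (@C1on_coord R n i) Logic.I) (C1on_continuous openT (@C1on_coord R n i) Logic.I)).
Qed.

Lemma open_eball (r : R) : open (@eball R n r).
Proof.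
have -> : @eball R n r = @enorm R n @^-1` [set y | y < r] by [].
by apply: open_comp; [move=> x _; exact: enorm_continuous|exact: open_lt].
Qed.

Lemma enorm_le x : enorm x <= n%:R * `|x|.
Proof.
have h : \sum_i x 0 i ^+ 2 <= n%:R * `|x| ^+ 2.
  have -> : n%:R * `|x| ^+ 2 = \sum_(i < n) `|x| ^+ 2 by rewrite sumr_const card_ord mulr_natl.
  by apply: ler_sum => i _; rewrite -real_normK ?num_real // lerXn2r ?nnegrE // coord_norm_le.
rewrite -[leRHS]ger0_norm ?mulr_ge0 // -sqrtr_sqr; apply: ler_wsqrtr; apply: (le_trans h).
rewrite exprMn; apply: ler_wpM2r; first exact: sqr_ge0.
by case: (n) => [|m]; rewrite ?expr0n // ler_eXnr // ler1n.
Qed.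

Lemma Ck_along_subset (W : normedModType R) (E A B : set W) k (f : W -> R) : B `<=` A -> Ck_along E A k f -> Ck_along E B k f.
Proof.
move=> BA H vs svs Evs; have [cf df] := H vs svs Evs; split; first exact: continuous_subspaceW cf.
by move=> sk x v Bx Ev; apply: df => //; exact: BA.
Qed.

Lemma holder_class_Ck alpha (O : set V) k f : open O -> holder_class alpha O k.+1 f -> Ck_on O k f.
Proof.
move=> oO; elim: k f => [|k IH] f [fd [Cf Hf]].
  by apply/Ck_along0/(within_openP _ oO) => x Ox; exact: C1on_continuous oO Cf Ox.
apply/Ck_along_rec; split.
- by apply/(within_openP _ oO) => x Ox; exact: C1on_continuous oO Cf Ox.
- by move=> x _ Ox [i _ <-]; have [] := Cf.1 x Ox i.
- move=> _ [i _ <-]; apply: (Ck_along_ext (f := fd i) oO); last exact: IH.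
  by move=> x Ox; have [_ ->] := Cf.1 x Ox i.
Qed.

Lemma Ck_on_C1on (O : set V) k f : open O -> Ck_on O k.+1 f -> C1on O f (fun i => 'D_(e i) f).
Proof.
move=> oO /Ck_along_rec [_ df Hf]; split=> x Ox i; first by apply/derivableP/df => //; exists i.
have E : range (@Defs.coord R n) (e i) by exists i.
have [c _] := Hf _ E [::] isT (fun v => ltac:(by [])).
by move/(within_openP _ oO) : c; exact.
Qed.

Lemma Ck_on_C2on (O : set V) f : open O -> Ck_on O 2 f -> C2on O f (fun i => 'D_(e i) f) (partial2 f).
Proof.
move=> oO Cf; split; first exact: (Ck_on_C1on oO Cf).1.
have [_ _ H] := (Ck_along_rec _ _ _ _).1 Cf.
by move=> i; apply: (Ck_on_C1on (k := 0) oO); apply: H; exists i.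
Qed.

Lemma test_of_test_function (O : set V) f : test_function O f -> test O f (fun i => 'D_(e i) f) (partial2 f).
Proof.
move=> [sf cf fO]; split; first exact: (Ck_on_C2on openT (sf 2)).
exists (closure [set x | f x != 0]); split=> // x nx; apply/eqP/negPn/negP => fx; apply: nx.
exact: subset_closure.
Qed.

(** The Euclidean norm is at most [n] times the sup norm, which converts the constant when passing
    from balls to cubes. *)
Lemma C2holder_holder_at alpha u : 0 < alpha -> C2holder_unit_ball alpha u ->
  forall i j x, eball 1 x -> holder_at alpha (partial2 u i j) x.
Proof.
move=> a0 [_ H] i j x x1; have [r [r1 xr]] : exists r : R, r < 1 /\ eball r x.
  by exists ((enorm x + 1) / 2); move: x1; rewrite /eball /=; split; lra.
have [C HC] := H r r1; have [s s0 sO] := open_cube_in (@open_eball r) xr.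
exists s, (`|C| * n%:R `^ alpha); split=> // y z /sO yr /sO zr; apply: (le_trans (HC i j y z yr zr)).
apply: (@le_trans _ _ (`|C| * enorm (y - z) `^ alpha)).
  by apply: ler_wpM2r; [exact: powR_ge0|exact: ler_norm].
rewrite -mulrA -powRM //; apply: ler_wpM2l => //.
apply: ge0_ler_powR; rewrite ?nnegrE; [exact: ltW|exact: sqrtr_ge0|exact: mulr_ge0|exact: enorm_le].
Qed.

Variables (alpha lam : R) (F : 'M[R]_n -> R) (u : V -> R).
Hypotheses (a0 : 0 < alpha) (a1 : alpha < 1) (lam0 : 0 < lam).
Hypotheses (sF : smooth_symm F) (uH : C2holder_unit_ball alpha u) (uc : critical_point F u).

Let O : set V := eball 1.
Let oO : open O := @open_eball 1.
Let Cu : C2on O u (fun i => 'D_(e i) u) (partial2 u) := Ck_on_C2on oO uH.1.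

Lemma symm_hess x : O x -> symm (hess u x).
Proof. by move=> Ox; apply/matrixP => i j; rewrite !mxE; exact: C2on_sym oO Cu Ox. Qed.

(** Inside the ball the Hessian is symmetric, where the extension is [F]; outside it the indicator
    kills one integrand and the support of the test function the other. Multiplying by [s] preserves
    the homogeneous equation. *)
Lemma critical_solves (s : R) : solves O (fun i j x => symm_family F s [:: (i, j)] (mx_of (partial2 u) x)).
Proof.
have c1 i j x : O x -> {for x, continuous (fun x => symm_family F 1 [:: (i, j)] (mx_of (partial2 u) x))}.
  move=> Ox; apply: (holder_at_cont a0).
  have := holder_class_comp a0 a1 oO (M := partial2 u) (m := 0) [:: (i, j)] (symm_family_smooth 1 sF); apply => // i' j' y Oy.
  exact: C2holder_holder_at.
have S1 : solves O (fun i j x => symm_family F 1 [:: (i, j)] (mx_of (partial2 u) x)).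
  apply: solves_of_smooth => // f tf; rewrite -[RHS](uc tf); congr (integral_Rn _); apply/funext => x.
  rewrite indicE; have [Ox|Ox] := pselect (O x).
    rewrite mem_set // mul1r; apply: eq_bigr => i _; apply: eq_bigr => j _.
    by rewrite symm_familyE ?mul1r //; exact: symm_hess.
  rewrite memNset // mul0r; have [K [_ KO _ _ fK]] := test_support (test_of_test_function tf).
  by apply: big1 => i _; apply: big1 => j _; rewrite fK ?mulr0 // => /KO.
have := solves_scale s oO c1 S1; apply: solves_ext => i j x Ox.
by rewrite /symm_family mul1r.
Qed.

Lemma convex_smooth (s : R) :
  (forall x xi, O x -> symm xi -> lam * frob2 xi <= 'D_xi ('D_xi (fun N => s * F N)) (hess u x)) ->
  forall k, Ck_on O k u.
Proof.
move=> conv k; apply: (@holder_class_Ck alpha) => //.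
have Ell x : O x -> elliptic (fun i j p q => symm_family F s [:: (p, q); (i, j)] (mx_of (partial2 u) x)) lam.
  move=> Ox xi sxi; have sX : symm (\matrix_(i, j) xi i j : 'M[R]_n) by apply/matrixP => i j; rewrite !mxE.
  have := conv x _ Ox sX; rewrite (second_derivative_symm s sF (symm_hess Ox) sX) /frob2 => h.
  apply: (le_trans _ (le_trans h _)).
    by rewrite le_eqVlt; apply/orP; left; apply/eqP; congr (_ * _); apply: eq_bigr => i _; apply: eq_bigr => j _; rewrite mxE.
  rewrite le_eqVlt; apply/orP; left; apply/eqP; apply: eq_bigr => i _; apply: eq_bigr => j _.
  by apply: eq_bigr => p _; apply: eq_bigr => q _; rewrite !mxE.
have reg := nonlinear_regularity a0 a1 oO lam0 (symm_family_smooth s sF) Cu (C2holder_holder_at a0 uH) (critical_solves s) Ell.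
(* The order k + 3 is two for the derivatives of [u] and k + 1 from [reg]; two orders are then given
   up to reach the k + 1 that [holder_class_Ck] expects. *)
have h3 : holder_class alpha O k.+3 u.
  exists (fun i => 'D_(e i) u); split; first exact: (Ck_on_C1on oO uH.1).
  by move=> i; exists (partial2 u i); split; [exact: Cu.2|move=> j; exact: reg].
by do 2 apply: (holder_class_le a0 a1 oO).
Qed.

End UnitBall.

Theorem corollary5p1 (R : realType) (n : nat) (hn : (0 < n)%N)
  (alpha : R) (alpha_gt0 : 0 < alpha) (alpha_lt1 : alpha < 1)
  (F : 'M[R]_n -> R) (F_smooth : smooth_symm F)
  (a : 'I_n -> 'I_n -> 'I_n -> 'I_n -> 'M[R]_n -> R)
  (dF_eq : forall (M : 'M[R]_n) (i j : 'I_n), symm M ->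
     dsymm F i j M = \sum_p \sum_q a p q i j M * M p q)
  (u : 'rV[R]_n -> R) (u_C2alpha : C2holder_unit_ball alpha u)
  (u_critical : critical_point F u)
  (U : set 'M[R]_n) (U_def : U = hess u @` eball 1)
  (a_elliptic : exists2 Lambda : R, 0 < Lambda &
     forall M xi : 'M[R]_n, U M -> symm xi ->
       Lambda * frob2 xi <=
         \sum_i \sum_j \sum_k \sum_l a i j k l M * xi i j * xi k l)
  (F_convex : uniformly_convex U F \/ uniformly_concave U F) :
  forall r : R, r < 1 -> smooth_on (eball r) u.
Proof.
(* Regularity is obtained on the whole open unit ball and then restricted. *)
move=> r r1 k; apply: (@Ck_along_subset _ _ _ (eball 1)).
  by move=> x; rewrite /eball /= => /lt_trans; apply.
have Uhess x : eball 1 x -> U (hess u x) by move=> x1; rewrite U_def; exists x.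
case: F_convex => -[lam lam0 conv].
  have E : (fun N => 1 * F N) = F by apply/funext => N; rewrite mul1r.
  apply: (convex_smooth (s := 1) alpha_gt0 alpha_lt1 lam0 F_smooth u_C2alpha u_critical) => x xi x1 sxi.
  by rewrite E; apply: conv => //; exact: Uhess.
(* In the concave case the sign [s = - 1] keeps the weak equation and makes it elliptic. *)
have E : (fun N => - 1 * F N) = \- F by apply/funext => N; rewrite mulN1r.
apply: (convex_smooth (s := - 1) alpha_gt0 alpha_lt1 lam0 F_smooth u_C2alpha u_critical) => x xi x1 sxi.
by rewrite E; apply: conv => //; exact: Uhess.
Qed.
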